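(* Every inner function $u$ that is invertible in the Douglas algebra $E$ is a finite product of interpolating Blaschke products of type $G$.
   Context: Let $D$ be the open unit disk, $T$ the unit circle, $H^\infty$ the Banach algebra of bounded analytic functions on $D$, regarded via radial limits as a closed subalgebra of $L^\infty=L^\infty(T)$. An inner function is an $h\in H^\infty$ with $|h|=1$ a.e. on $T$. For a (finite or infinite, possibly empty) sequence $\{z_n\}$ in $D$ with $\sum_n(1-|z_n|)<\infty$, the Blaschke product with roots $\{z_n\}$ is $b(z)=\prod_n\frac{\bar z_n}{|z_n|}\frac{z_n-z}{1-\bar z_n z}$ (the factor being $z$ if $z_n=0$); Blaschke products are considered up to multiplication by unimodular constants. Put $\delta(b)=\inf_k\prod_{n\ne k}\left|\frac{z_k-z_n}{1-\bar z_n z_k}\right|$; $b$ and $\{z_n\}$ are called interpolating if $\delta(b)>0$. $M(H^\infty)$ is the maximal ideal space of $H^\infty$; elements of $H^\infty$ are viewed as continuous functions on it via the Gelfand transform, and $D$ is identified with a subset of $M(H^\infty)$ via point evaluations. For $x,y\in M(H^\infty)$ let $\rho(x,y)=\sup\{|f(y)|: f\in H^\infty,\ \|f\|_\infty\le 1,\ f(x)=0\}$ and let $P(x)=\{m\in M(H^\infty):\rho(m,x)<1\}$ be the Gleason part containing $x$. Put $G=\bigcup\{P(x): x\in M(H^\infty),\ P(x)\ne\{x\}\}$. For $f\in H^\infty$ and $0<c\le1$ put $\{|f|<c\}=\{x\in M(H^\infty):|f(x)|<c\}$. A Blaschke product $b$ is of type $G$ if it is interpolating and $\{|b|<1\}\subset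 G$. A Douglas algebra is a closed subalgebra of $L^\infty$ containing $H^\infty$. Let $\Omega$ be the family of all interpolating Blaschke products of type $G$. $E$ is the Douglas algebra generated by $H^\infty$ together with the complex conjugates of the elements of $\Omega$. *)

(* Defs.v *)
(* The complex numbers are R[i] for R : realType; their topology and
   normed-module structure are those of R[i]^o. *)
From HB Require Import structures.
From mathcomp Require Import all_boot all_order all_algebra complex.
From mathcomp Require Import all_classical all_reals all_analysis.

Set Implicit Arguments.
Unset Strict Implicit.
Unset Printing Implicit Defensive.

Import Order.TTheory GRing.Theory Num.Theory.
Import numFieldNormedType.Exports.
Import Normc.

Local Open Scope classical_set_scope.
Local Open Scope ring_scope.
Local Open Scope complex_scope.

HB.instance Definition _ (T : pointedType) (K : comNzRingType) :=
  GRing.Lmodule_isLalgebra.Build K (T -> K^o)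
    (fun a f g => funext (fun t => mulrA a (f t) (g t))).

Definition disc (R : realType) := {z : R[i] | normc z < 1}.
HB.instance Definition _ (R : realType) := SubChoice.on (disc R).

Lemma disc0_subproof (R : realType) : normc (0 : R[i]) < 1.
Proof. by rewrite normc0 ltr01. Qed.
HB.instance Definition _ (R : realType) :=
  isPointed.Build (disc R) (Sub (0 : R[i]) (disc0_subproof R)).

(* Extension by 0 outside of the disk, so that f can be differentiated. *)
Definition ext (R : realType) (f : disc R -> R[i]) (z : R[i]) : R[i] :=
  if insub z is Some w then f w else 0.

(* Complex differentiability: the scalars of R[i]^o are the complex numbers. *)
Definition analytic (R : realType) (f : disc R -> R[i]) :=
  forall z : disc R, derivable (ext f : R[i]^o -> R[i]^o) (val z) 1.

Definition bounded_disc (R : realType) (f : disc R -> R[i]) :=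
  exists M : R, forall z, normc (f z) <= M.

Definition Hinf_pred (R : realType) : {pred disc R -> R[i]} :=
  [pred f | `[< analytic f /\ bounded_disc f >]].
Arguments Hinf_pred : clear implicits.

Section Hinf_subalgebra.
Variable R : realType.
Implicit Types f g : disc R -> R[i].

Lemma normc_lt1 (z : R[i]) : (normc z < 1) = (`|z| < 1).
Proof. by rewrite -[`|z|]/((normc z)%:C) -[1 in RHS]/((1 : R)%:C) ltcR. Qed.

Lemma near_disc (z : disc R) : \forall w \near (val z : R[i]^o), normc w < 1.
Proof.
have /= z1 := valP z; rewrite normc_lt1 in z1.
apply/nbhs_ballP; exists (1 - `|val z|) => /=; first by rewrite subr_gt0.
move=> w; rewrite /ball /= => zw; rewrite normc_lt1.
rewrite -(subKr (val z) w) (le_lt_trans (ler_normB _ _))//.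
by rewrite addrC -ltrBrDr.
Qed.

Lemma ext_val f (z : disc R) : ext f (val z) = f z.
Proof. by rewrite /ext valK. Qed.

Lemma extD f g : ext (f + g) = ext f + ext g.
Proof.
apply/funext => z; rewrite -[RHS]/(ext f z + ext g z) /ext.
by case: insub => //; rewrite addr0.
Qed.

Lemma extM f g : ext (f * g) = ext f * ext g.
Proof.
apply/funext => z; rewrite -[RHS]/(ext f z * ext g z) /ext.
by case: insub => //; rewrite mulr0.
Qed.

Lemma analytic_cst (a : R[i]) : analytic (cst a : disc R -> R[i]).
Proof.
move=> z; apply: (@near_eq_derivable _ _ _ (cst a : R[i]^o -> R[i]^o)).
  by near=> w; rewrite /ext insubT//; near: w; exact: near_disc.
exact: derivable_cst.
Unshelve. all: by end_near. Qed.

Lemma analyticD f g : analytic f -> analytic g -> analytic (f + g).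
Proof. by move=> af ag z; rewrite extD; exact: derivableD. Qed.

Lemma analyticM f g : analytic f -> analytic g -> analytic (f * g).
Proof. by move=> af ag z; rewrite extM; exact: derivableM. Qed.

Lemma bounded_cst (a : R[i]) : bounded_disc (cst a : disc R -> R[i]).
Proof. by exists (normc a). Qed.

Lemma bounded_discD f g :
  bounded_disc f -> bounded_disc g -> bounded_disc (f + g).
Proof.
move=> [M fM] [N gN]; exists (M + N) => z.
by rewrite (le_trans (le_normcD _ _))// lerD.
Qed.

Lemma bounded_discM f g :
  bounded_disc f -> bounded_disc g -> bounded_disc (f * g).
Proof.
move=> [M fM] [N gN]; exists (M * N) => z.
by rewrite normcM ler_pM//; [case: (f z)|case: (g z)] => *; exact: sqrtr_ge0.
Qed.

Lemma Hinf_subalg_closed : GRing.subalg_closed (Hinf_pred R).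
Proof.
split.
- by apply/asboolP; split; [exact: analytic_cst|exact: bounded_cst].
- move=> a f g /asboolP[af bf] /asboolP[ag bg].
  have -> : a *: f = cst a * f by [].
  apply/asboolP; split.
    exact (analyticD (analyticM (@analytic_cst a) af) ag).
  exact (bounded_discD (bounded_discM (@bounded_cst a) bf) bg).
- move=> f g /asboolP[af bf] /asboolP[ag bg].
  by apply/asboolP; split; [exact: analyticM|exact: bounded_discM].
Qed.

HB.instance Definition _ :=
  GRing.isSubalgClosed.Build _ _ (Hinf_pred R) Hinf_subalg_closed.
End Hinf_subalgebra.

Record Hinf (R : realType) :=
  MkHinf { hfun :> disc R -> R[i] ; _ : hfun \in Hinf_pred R }.
HB.instance Definition _ (R : realType) := [isSub of Hinf R for @hfun R].
HB.instance Definition _ (R : realType) := [Choice of Hinf R by <:].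
HB.instance Definition _ (R : realType) :=
  [SubChoice_isSubLalgebra of Hinf R by <:].
HB.instance Definition _ (R : realType) :=
  [SubNzRing_isSubComNzRing of Hinf R by <:].

Section maximal_ideal_space.
Variable R : realType.

Definition Hnorm (f : Hinf R) : R := sup (range (fun z => normc (f z))).

(* Maximal ideals, identified with the unital multiplicative linear
   functionals of which they are the kernels. *)
Definition spectrum := {lrmorphism Hinf R -> R[i] | *%R}.

Definition rho (x y : spectrum) : \bar R :=
  ereal_sup [set (normc (y f))%:E | f in [set f | Hnorm f <= 1 /\ x f = 0]].

Definition gleason_part (x : spectrum) : set spectrum :=
  [set m | (rho m x < 1)%E].

Definition nontrivial_parts : set spectrum :=
  \bigcup_(x in [set x | gleason_part x <> [set x]]) gleason_part x.

Definition sublevel (f : Hinf R) (c : R) : set spectrum :=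
  [set x | normc (x f) < c].

End maximal_ideal_space.

Section Blaschke_products.
Variable R : realType.
Implicit Types (a z : disc R) (zs : nat -> option (disc R)).

(* A finite, infinite or empty sequence in the disk is given as a function
   zs : nat -> option (disc R): the indices n with zs n = None carry no term. *)

Definition bfactor a z : R[i] :=
  if val a == 0 then val z
  else conjc (val a) / `|val a| * ((val a - val z) / (1 - conjc (val a) * val z)).

Definition blaschke_condition zs :=
  cvgn (series (fun n => oapp (fun a => 1 - normc (val a)) 0 (zs n))).

(* The constant c reflects that Blaschke products are considered up to
   unimodular constants. *)
Definition blaschke_with_roots zs (b : Hinf R) :=
  blaschke_condition zs /\
  exists2 c : R[i], normc c = 1 &
    forall z, (c * \prod_(n < N) oapp (bfactor^~ z) 1 (zs n) : R[i]^o)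
                @[N --> \oo] --> (b z : R[i]^o).

Definition pseudohyp a z : R :=
  normc ((val a - val z) / (1 - conjc (val z) * val a)).

(* The infimum over k is taken in \bar R, so that it is positive, and not 0,
   for the empty sequence. *)
Definition delta zs : \bar R :=
  ereal_inf [set d | exists k a, zs k = Some a /\
    d = (limn (fun N => \prod_(n < N | n != k :> nat)
                          oapp (pseudohyp a) 1 (zs n)))%:E].

Definition interpolating (b : Hinf R) :=
  exists2 zs, blaschke_with_roots zs b & (0 < delta zs)%E.

Definition typeG (b : Hinf R) :=
  interpolating b /\ sublevel b 1 `<=` @nontrivial_parts R.

End Blaschke_products.

Section Douglas_algebras.
Variable R : realType.

(* L^oo of the unit circle: functions of the angle t, with respect to Lebesgue
   measure on [0, 2 pi[. Elements are functions rather than classes modulo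
   equality almost everywhere; a subset of Linf that is closed for the seminorm
   Linf_norm is saturated for that equality. *)
Definition arc_measure : {measure set (measurableTypeR R) -> \bar R} :=
  mrestr (@lebesgue_measure R)
    (measurable_itv `[0, 2 * pi[ : measurable (`[0, 2 * pi[ : set R)).

Definition Linf_norm (f : R -> R[i]) : \bar R :=
  Lnorm arc_measure +oo%E (fun t => (normc (f t))%:E).

Definition Linf : set (R -> R[i]) :=
  [set f : R -> R[i] |
    [/\ measurable_fun setT (fun t : measurableTypeR R => complex.Re (f t)),
        measurable_fun setT (fun t : measurableTypeR R => complex.Im (f t))
      & (Linf_norm f < +oo)%E]].

Definition Linf_closed (A : set (R -> R[i])) :=
  forall f, Linf f ->
    (forall e : R, 0 < e -> exists2 g, A g & (Linf_norm (f - g)%R <= e%:E)%E) ->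
    A f.

Definition closed_subalgebra (A : set (R -> R[i])) :=
  [/\ A `<=` Linf, GRing.subalg_closed [pred f | f \in A] & Linf_closed A].

(* Radial limits; they exist for almost every t, and where the limit does not
   exist lim returns a fixed default value. *)
Definition boundary (f : Hinf R) (t : R) : R[i] :=
  lim ((ext f (r%:C * (cos t +i* sin t)) : R[i]^o) @[r --> (1 : R)^'-]).

Definition douglas (A : set (R -> R[i])) :=
  closed_subalgebra A /\ range boundary `<=` A.

Definition conj_boundary (f : Hinf R) (t : R) : R[i] := conjc (boundary f t).

Definition E_algebra : set (R -> R[i]) :=
  smallest douglas [set conj_boundary b | b in @typeG R].

Definition inner (u : Hinf R) :=
  {ae arc_measure, forall t, normc (boundary u t) = 1}.

Definition invertible_in (A : set (R -> R[i])) (f : R -> R[i]) :=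
  A f /\ exists2 g, A g & {ae arc_measure, forall t, f t * g t = 1}.

End Douglas_algebras.

(* Main.v *)
(* If u is invertible in E, then for every e > 0 there are h in H^oo and a finite product b of type G
   products with |b - u h| <= e on D: the functions of L^oo approximable by quotients h / b form a
   Douglas algebra.  The set {|b| <= 1/2} contains no hyperbolic discs of arbitrarily large radius:
   otherwise a limit of evaluations along such discs, chosen so that every f in H^oo becomes
   asymptotically constant on discs of fixed radius, is a character x with |x(b)| < 1 whose Gleason
   part is trivial.  Indeed such an x has the property that every f in its kernel with ||f|| <= 1 is a
   product of two such functions, as one sees from f = B F, B a Blaschke product and F zero-free, by
   taking a square root of F or by splitting the zeros of B in two halves (Hoffman).  Hence |u| >= eta
   somewhere in every hyperbolic disc of some fixed radius.  Then the zero-free factor of u is bounded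
   below, has unimodular boundary values together with its inverse, and so is constant, while
   sum_n (1 - rho(z, z_n)^2) is bounded uniformly in z, so that the zeros split into finitely many
   separated, hence interpolating, sequences.  Finally |b_i(x)| < 1 for a factor b_i of u forces
   |u(x)| < 1, hence |b(x)| < 1 for one of the type G products above, and x lies in G. *)
Require Import Defs.
From HB Require Import structures.
From mathcomp Require Import all_boot all_order all_algebra complex.
From mathcomp Require Import all_classical all_reals all_analysis.
From mathcomp Require Import measurable_realfun ess_sup_inf.
From mathcomp Require Import ring lra.
Set Implicit Arguments.
Unset Strict Implicit.
Unset Printing Implicit Defensive.
Import Order.TTheory GRing.Theory Num.Theory.
Import numFieldNormedType.Exports.
Import Normc.
Local Open Scope classical_set_scope.
Local Open Scope ring_scope.
Local Open Scope complex_scope.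

(** * Complex moduli and limits along filters *)

(** Invertibility in E concerns functions on the circle, type G concerns characters; the disc is
    where the two meet. Estimates pass from the circle to the disc by the Poisson representation,
    and from the disc to an arbitrary character by |x(f)| <= ||f||. The limit character x must be
    taken along discs on which functions become constant, because x(B) = 0 alone does not make the
    zeros of B accumulate: a single zero close to each evaluation point would do. Once B is almost
    constant on discs of fixed radius, it is small also at nearby points away from all zeros, which
    is impossible while the sums of 1 - rho^2 over the zeros stay bounded. The two halves of the
    zeros must both remain unbounded along an ultrafilter that is not known explicitly. Therefore
    the zeros are coloured independently of the evaluation point, with an error bounded uniformly
    over the disc. Square roots of zero-free functions serve twice: once in the factorization at x,
    and, iterated, to bring the modulus of the zero-free factor close to 1 at one point of every
    disc of fixed hyperbolic radius, from where Harnack's inequality spreads the lower bound. *)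

Section normc_theory.
Variable R : realType.
Local Notation C := R[i].
Implicit Types (z w : C) (x y : R).

Lemma normc_ge0 z : 0 <= normc z.
Proof. by case: z => *; exact: sqrtr_ge0. Qed.

Lemma normc_eq0 z : (normc z == 0) = (z == 0).
Proof. by apply/eqP/eqP => [/eq0_normc ->//|->]; rewrite normc0. Qed.

Lemma normc_gt0 z : (0 < normc z) = (z != 0).
Proof. by rewrite lt_def normc_eq0 normc_ge0 andbT. Qed.

Lemma normcB z w : normc (z - w) = normc (w - z).
Proof. by rewrite -normcN opprB. Qed.

Lemma normc_sqr z : normc z ^+ 2 = complex.Re z ^+ 2 + complex.Im z ^+ 2.
Proof. by case: z => a b; rewrite /= sqr_sqrtr// addr_ge0// sqr_ge0. Qed.

Lemma normc_conj z : normc (conjc z) = normc z.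
Proof. by case: z => a b; rewrite /= sqrrN. Qed.

Lemma normcR x : normc x%:C = `|x|.
Proof. by rewrite /= expr0n/= addr0 sqrtr_sqr. Qed.

Lemma mulcJ z : z * conjc z = (normc z ^+ 2)%:C.
Proof. by rewrite normc_sqr; case: z => a b; apply/eqP; rewrite eq_complex /=; apply/andP; split; apply/eqP; ring. Qed.

Lemma normcX z n : normc (z ^+ n) = normc z ^+ n.
Proof. by elim: n => [|n IH]; rewrite ?expr0 ?normc1// !exprS normcM IH. Qed.

Lemma normc_div z w : normc (z / w) = normc z / normc w.
Proof. by rewrite normcM normcV. Qed.

Lemma normc_prod (I : Type) (r : seq I) (P : pred I) (F : I -> C) :
  normc (\prod_(i <- r | P i) F i) = \prod_(i <- r | P i) normc (F i).
Proof.
by elim/big_rec2: _ => [|i y1 y2 _ <-]; rewrite ?normc1 ?normcM.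
Qed.

Lemma ler_Re_normc z : `|complex.Re z| <= normc z.
Proof. by rewrite -sqrtr_sqr; case: z => a b /=; rewrite ler_sqrt ?lerDl ?addr_ge0 ?sqr_ge0. Qed.

Lemma ler_Im_normc z : `|complex.Im z| <= normc z.
Proof. by rewrite -sqrtr_sqr; case: z => a b /=; rewrite ler_sqrt ?lerDr ?addr_ge0 ?sqr_ge0. Qed.

Lemma Re_le_normc z : complex.Re z <= normc z.
Proof. by rewrite (le_trans (ler_norm _))// ler_Re_normc. Qed.

Lemma normc_le_ReIm z : normc z <= `|complex.Re z| + `|complex.Im z|.
Proof.
rewrite -(ler_pXn2r (n := 2)) ?nnegrE ?normc_ge0 ?addr_ge0//.
by rewrite normc_sqr sqrrD !real_normK ?num_real// -addrA lerD2l lerDr mulrn_wge0 ?mulr_ge0.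
Qed.

Lemma cReM z w : complex.Re (z * w) = complex.Re z * complex.Re w - complex.Im z * complex.Im w.
Proof. by case: z; case: w. Qed.

Lemma cImM z w : complex.Im (z * w) = complex.Re z * complex.Im w + complex.Im z * complex.Re w.
Proof. by case: z => a b; case: w => c d. Qed.

Lemma ReD z w : complex.Re (z + w) = complex.Re z + complex.Re w.
Proof. by case: z; case: w. Qed.
Lemma ImD z w : complex.Im (z + w) = complex.Im z + complex.Im w.
Proof. by case: z; case: w. Qed.
Lemma ReN z : complex.Re (- z) = - complex.Re z. Proof. by case: z. Qed.
Lemma ImN z : complex.Im (- z) = - complex.Im z. Proof. by case: z. Qed.
Lemma ReB z w : complex.Re (z - w) = complex.Re z - complex.Re w.
Proof. by rewrite ReD ReN. Qed.
Lemma ImB z w : complex.Im (z - w) = complex.Im z - complex.Im w.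
Proof. by rewrite ImD ImN. Qed.

Lemma complex_ext z w : complex.Re z = complex.Re w -> complex.Im z = complex.Im w -> z = w.
Proof. by case: z => a b; case: w => c d /= -> ->. Qed.

Lemma ler_normcB z w : normc z - normc w <= normc (z - w).
Proof. by rewrite lerBlDr -{1}(subrK w z) le_normcD. Qed.

Lemma ler_normc_dist z w : `|normc z - normc w| <= normc (z - w).
Proof. by rewrite ler_norml ler_normcB andbT lerNl opprB normcB ler_normcB. Qed.

Lemma normc_triangle z w v : normc (z - w) <= normc (z - v) + normc (v - w).
Proof. by rewrite -{1}(subrK v z) -addrA le_normcD. Qed.

Lemma phase z : exists2 c : C, normc c = 1 & c * z = (normc z)%:C.
Proof.
have [->|z0] := eqVneq z 0.
  by exists 1; rewrite ?normc1 // mulr0 normc0.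
have nz : normc z != 0 by rewrite normc_eq0.
exists (conjc z / (normc z)%:C).
  by rewrite normc_div normc_conj normcR ger0_norm ?normc_ge0// divff.
have nzC : (normc z)%:C != 0 :> C by rewrite -(rmorph0 (real_complex R)) (inj_eq (@complexI R)).
by rewrite mulrAC [conjc z * z]mulrC mulcJ rmorphXn/= expr2 mulfK.
Qed.
End normc_theory.

Section ctends.
Variable R : realType.
Local Notation C := R[i].

(** Convergence with real moduli and real tolerances, because the norm of [C^o] takes complex
    values. [ctends_cvg] is the bridge to the topology of [C^o]. *)
Definition ctends (T : Type) (F : set_system T) (f : T -> C) (l : C) :=
  forall e : R, 0 < e -> \forall x \near F, normc (f x - l) < e.

Definition cnear (z : C) : set_system C :=
  [set P : set C | exists2 e : R, 0 < e & forall w, normc (w - z) < e -> P w].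

Global Instance cnear_filter z : ProperFilter (cnear z).
Proof.
split.
  by case=> e e0 /(_ z); rewrite subrr normc0; apply.
split.
- by exists 1.
- move=> P Q [e e0 eP] [d d0 dQ]; exists (Num.min e d); first by rewrite lt_min e0.
  by move=> w; rewrite lt_min => /andP[we wd]; split; [exact: eP|exact: dQ].
- by move=> P Q PQ [e e0 eP]; exists e => // w /eP /PQ.
Qed.

Lemma cnear_nbhs (z : C) : cnear z = nbhs (z : C^o).
Proof.
apply/funext => P; apply/propext; split.
  move=> [e e0 eP]; apply/nbhs_ballP; exists e%:C => /=; first by rewrite ltcR.
  move=> w; rewrite /ball /= => zw; apply: eP.
  by rewrite normcB -ltcR.
move=> /nbhs_ballP[e /= e0 eP].
have er : e = (complex.Re e)%:C by rewrite RRe_real// gtr0_real.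
rewrite er ltcR in e0; exists (complex.Re e) => // w we; apply: eP.
by rewrite /ball /= er -[`|_|]/((normc _)%:C) ltcR normcB.
Qed.

Section filter.
Variables (T : Type) (F : set_system T).
Context {FF : Filter F}.
Implicit Types (f g : T -> C) (l : C).

Lemma ctends_cvg f l :
  ctends F f l <-> ((f x : C^o) @[x --> F] --> (l : C^o)).
Proof.
split.
  move=> h; apply/cvgrPdist_lt => e e0.
  have er : e = (complex.Re e)%:C by rewrite RRe_real// gtr0_real.
  rewrite er ltcR in e0; have := h _ e0; apply: filterS => x xe.
  by rewrite distrC er -[`|_|]/((normc _)%:C) ltcR.
move=> /cvgrPdist_lt h e e0.
have := h (e%:C); rewrite ltcR => /(_ e0); apply: filterS => x.
by rewrite distrC -[`|_|]/((normc _)%:C) ltcR.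
Qed.

Lemma ctends_cst l : ctends F (cst l) l.
Proof. by move=> e e0; apply: filterE => x; rewrite subrr normc0. Qed.

Lemma ctends_ext f g l : (\forall x \near F, f x = g x) -> ctends F f l -> ctends F g l.
Proof. by move=> fg fl e /fl; apply: filterS2 fg => x ->. Qed.

Lemma ctendsD f g l m :
  ctends F f l -> ctends F g m -> ctends F (fun x => f x + g x) (l + m).
Proof.
move=> fl gm e e0; have e2 : 0 < e / 2 by rewrite divr_gt0.
apply: filterS2 (fl _ e2) (gm _ e2) => x h k.
rewrite opprD addrACA (le_lt_trans (le_normcD _ _))//.
by rewrite (splitr e) ltrD.
Qed.

Lemma ctendsN f l : ctends F f l -> ctends F (fun x => - f x) (- l).
Proof.
by move=> fl e /fl; apply: filterS => x; rewrite -normcN !opprD !opprK.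
Qed.

Lemma ctendsB f g l m :
  ctends F f l -> ctends F g m -> ctends F (fun x => f x - g x) (l - m).
Proof. by move=> fl /ctendsN; exact: ctendsD. Qed.

Lemma ctends_bounded f l : ctends F f l ->
  \forall x \near F, normc (f x) <= normc l + 1.
Proof.
move=> /(_ 1 ltr01); apply: filterS => x h.
rewrite -(subrK l (f x)) (le_trans (le_normcD _ _))// addrC lerD2l; exact: ltW.
Qed.

Lemma ctendsM f g l m :
  ctends F f l -> ctends F g m -> ctends F (fun x => f x * g x) (l * m).
Proof.
move=> fl gm e e0.
have l0 := normc_ge0 l; have m0 := normc_ge0 m.
pose K := normc l + normc m + 1.
have K0 : 0 < K by rewrite /K ltr_wpDl// addr_ge0.
have eK : 0 < e / (2 * K) by rewrite divr_gt0// mulr_gt0.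
apply: filterS3 (fl _ eK) (gm _ eK) (ctends_bounded gm) => x h k b.
have -> : f x * g x - l * m = (f x - l) * g x + l * (g x - m) by ring.
rewrite (le_lt_trans (le_normcD _ _))// !normcM.
have h1 : normc (f x - l) * normc (g x) <= e / (2 * K) * (normc m + 1).
  by apply: ler_pM; rewrite ?normc_ge0// ltW.
have h2 : normc l * normc (g x - m) <= normc l * (e / (2 * K)).
  by apply: ler_wpM2l => //; rewrite ltW.
rewrite (le_lt_trans (lerD h1 h2))//.
have -> : e / (2 * K) * (normc m + 1) + normc l * (e / (2 * K)) = e / (2 * K) * K.
  by rewrite /K; ring.
have -> : e / (2 * K) * K = e / 2 by field; rewrite gt_eqF.
by rewrite gtr_pMr// invf_lt1// ltr1n.
Qed.

Lemma ctendsV f l : l != 0 -> ctends F f l -> ctends F (fun x => (f x)^-1) l^-1.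
Proof.
move=> l0 fl e e0; have nl : 0 < normc l by rewrite normc_gt0.
have h2 : 0 < normc l / 2 by rewrite divr_gt0.
have h3 : 0 < e * (normc l ^+ 2 / 2) by rewrite mulr_gt0// divr_gt0// exprn_gt0.
apply: filterS2 (fl _ h2) (fl _ h3) => x h k.
have fx : normc l / 2 < normc (f x).
  have := ler_normcB l (f x); rewrite normcB; lra.
have fx0 : f x != 0 by rewrite -normc_gt0; lra.
have -> : (f x)^-1 - l^-1 = - (f x - l) / (f x * l) by field; rewrite l0 fx0.
rewrite normc_div normcN normcM ltr_pdivrMr ?mulr_gt0//; last by lra.
apply: (lt_le_trans k); rewrite ler_wpM2l ?(ltW e0)//.
by rewrite expr2 mulrAC ler_wpM2r ?(ltW nl)// ltW.
Qed.

Lemma ctends_div f g l m : m != 0 ->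
  ctends F f l -> ctends F g m -> ctends F (fun x => f x / g x) (l / m).
Proof. by move=> m0 fl gm; apply: ctendsM => //; exact: ctendsV. Qed.

Lemma ctendsX f l n : ctends F f l -> ctends F (fun x => f x ^+ n) (l ^+ n).
Proof.
move=> fl; elim: n => [|n IH].
  rewrite expr0; apply: (@ctends_ext (cst 1)) (ctends_cst _).
  by apply: filterE => x; rewrite expr0.
rewrite exprS; apply: ctends_ext (ctendsM fl IH).
by apply: filterE => x; rewrite exprS.
Qed.

Lemma ctends_conj f l : ctends F f l -> ctends F (fun x => conjc (f x)) (conjc l).
Proof.
by move=> fl e /fl; apply: filterS => x; rewrite -rmorphB normc_conj.
Qed.

Lemma ctends_norm f l : ctends F f l -> normc (f x) @[x --> F] --> normc l.
Proof.
move=> fl; apply/cvgrPdist_lt => e /fl; apply: filterS => x.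
by rewrite distrC; apply: le_lt_trans; exact: ler_normc_dist.
Qed.

Lemma ctends_Re f l : ctends F f l -> complex.Re (f x) @[x --> F] --> complex.Re l.
Proof.
move=> fl; apply/cvgrPdist_lt => e /fl; apply: filterS => x.
by rewrite distrC; apply: le_lt_trans; rewrite -ReB ler_Re_normc.
Qed.

Lemma ctends_Im f l : ctends F f l -> complex.Im (f x) @[x --> F] --> complex.Im l.
Proof.
move=> fl; apply/cvgrPdist_lt => e /fl; apply: filterS => x.
by rewrite distrC; apply: le_lt_trans; rewrite -ImB ler_Im_normc.
Qed.

Lemma ctends_ReIm f l : complex.Re (f x) @[x --> F] --> complex.Re l ->
  complex.Im (f x) @[x --> F] --> complex.Im l -> ctends F f l.
Proof.
move=> fr fi e e0; have e2 : 0 < e / 2 by rewrite divr_gt0.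
move/cvgrPdist_lt/(_ _ e2) : fr => fr; move/cvgrPdist_lt/(_ _ e2) : fi => fi.
apply: filterS2 fr fi => x h k.
rewrite (le_lt_trans (normc_le_ReIm _))// (splitr e) ReB ImB.
by rewrite ltrD// distrC.
Qed.

Lemma ctends_squeeze f l (h : T -> R) : (\forall x \near F, normc (f x - l) <= h x) ->
  h x @[x --> F] --> 0 -> ctends F f l.
Proof.
move=> fh /cvgrPdist_lt h0 e /h0; apply: filterS2 fh => x fx.
rewrite sub0r normrN => hx; rewrite (le_lt_trans fx)//.
by rewrite (le_lt_trans (ler_norm _)).
Qed.

End filter.

Section proper.
Variables (T : Type) (F : set_system T).
Context {FF : ProperFilter F}.
Implicit Types (f g : T -> C) (l : C).

Lemma ctends_unique f l m : ctends F f l -> ctends F f m -> l = m.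
Proof.
move=> fl fm; apply/eqP; rewrite -subr_eq0 -normc_eq0; apply/eqP.
have : forall e : R, 0 < e -> normc (l - m) <= e.
  move=> e e0; have e2 : 0 < e / 2 by rewrite divr_gt0.
  have [x [h k]] := filter_ex (filterI (fl _ e2) (fm _ e2)).
  apply: (le_trans (normc_triangle _ _ (f x))); rewrite normcB (splitr e).
  by rewrite lerD// ltW.
move=> h; apply/eqP; rewrite eq_le normc_ge0 andbT.
rewrite leNgt; apply/negP => p0.
by have := h _ (divr_gt0 p0 (ltr0Sn _ 1)); lra.
Qed.

Lemma ctends_le f l (M : R) : ctends F f l -> (\forall x \near F, normc (f x) <= M) ->
  normc l <= M.
Proof.
move=> /ctends_norm fl fM; have <- := cvg_lim (@Rhausdorff R) fl.
apply: limr_le => //; by apply/cvg_ex; exists (normc l).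
Qed.

Lemma ctends_ge f l (M : R) : ctends F f l -> (\forall x \near F, M <= normc (f x)) ->
  M <= normc l.
Proof.
move=> /ctends_norm fl fM; have <- := cvg_lim (@Rhausdorff R) fl.
apply: limr_ge => //; by apply/cvg_ex; exists (normc l).
Qed.
End proper.

Definition ccont (f : C -> C) z := ctends (cnear z) f (f z).
Definition rcont (g : R -> C) t := ctends (nbhs t) g (g t).

Lemma ccont_id z : ccont id z.
Proof. by move=> e e0; exists e. Qed.

Lemma ctends_comp T (F : set_system T) (FF : Filter F) (g : T -> C) f z :
  ctends F g z -> ccont f z -> ctends F (fun t => f (g t)) (f z).
Proof. by move=> gz fz e /fz[d d0 dP]; have := gz _ d0; apply: filterS => x /dP. Qed.

End ctends.

#[global] Arguments normc : simpl never.

(** * Integrals of bounded measurable functions *)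

Section real_integral.
Variable R : realType.
Local Notation mu := (@lebesgue_measure R).
Implicit Types (a b : R) (f g : R -> R).

(** Bounded measurable integrands on a bounded interval: this class is closed under the pointwise
    operations and consists of integrable functions, so that linearity of [rint] requires no
    separate integrability argument. *)
Definition rbm a b f := measurable_fun (`[a, b]%classic : set (measurableTypeR R)) f /\
  exists M : R, forall t, a <= t <= b -> `|f t| <= M.

Definition rint a b f : R := \int[mu]_(t in `[a, b]) f t.

Lemma rbm_integrable a b f : rbm a b f -> mu.-integrable `[a, b] (EFin \o f).
Proof.
move=> [mf [M fM]]; apply: measurable_bounded_integrable => //.
  by rewrite /= lebesgue_measure_itv/=; case: ifP => _; rewrite ?ltry// -EFinD ltry.
exists M; split; first exact: num_real.
by move=> x Mx t /=; rewrite in_itv/= => /fM h; rewrite (le_trans h)// ltW.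
Qed.

Lemma rbm_cont a b f : (forall t, a <= t <= b -> {for t, continuous f}) -> rbm a b f.
Proof.
move=> cf; have cwf : {within `[a, b], continuous f}.
  by apply: continuous_in_subspaceT => t; rewrite inE/= in_itv/= => /cf.
split; first exact: subspace_continuous_measurable_fun.
have [ab|ba] := leP a b; last first.
  by exists 0 => t /andP[at_ tb]; have := le_lt_trans (le_trans at_ tb) ba; rewrite ltxx.
have cwg : {within `[a, b], continuous (fun t => `|f t|)}.
  apply: continuous_in_subspaceT => t; rewrite inE/= in_itv/= => /cf ft.
  by apply: continuous_comp => //; exact: norm_continuous.
have [c _ hc] := EVT_max ab cwg; exists `|f c| => t abt; apply: hc.
by rewrite in_itv.
Qed.

Lemma rbm_cst a b (c : R) : rbm a b (cst c).
Proof. by split; [exact: measurable_cst|exists `|c|]. Qed.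

Lemma rbmD a b f g : rbm a b f -> rbm a b g -> rbm a b (fun t => f t + g t).
Proof.
move=> [mf [M fM]] [mg [N gN]]; split; first exact: measurable_funD.
by exists (M + N) => t abt; rewrite (le_trans (ler_normD _ _))// lerD ?fM ?gN.
Qed.

Lemma rbmN a b f : rbm a b f -> rbm a b (fun t => - f t).
Proof.
move=> [mf [M fM]]; split; first exact: measurable_funN.
by exists M => t abt; rewrite normrN fM.
Qed.

Lemma rbmB a b f g : rbm a b f -> rbm a b g -> rbm a b (fun t => f t - g t).
Proof. by move=> hf /rbmN; exact: rbmD. Qed.

Lemma rbmM a b f g : rbm a b f -> rbm a b g -> rbm a b (fun t => f t * g t).
Proof.
move=> [mf [M fM]] [mg [N gN]]; split; first exact: measurable_funM.
by exists (M * N) => t abt; rewrite normrM ler_pM ?fM ?gN.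
Qed.

Lemma rbm_norm a b f : rbm a b f -> rbm a b (fun t => `|f t|).
Proof.
move=> [mf [M fM]]; split; last by exists M => t /fM; rewrite normr_id.
by apply: measurableT_comp => //; exact: measurable_normr.
Qed.

Lemma rbm_sub a b a' b' f : a <= a' -> b' <= b -> rbm a b f -> rbm a' b' f.
Proof.
move=> aa bb [mf [M fM]]; split.
  apply: measurable_funS mf => //; apply: subset_itv; by rewrite bnd_simp.
exists M => t /andP[h k]; apply: fM; by rewrite (le_trans aa)//= (le_trans k).
Qed.

Lemma rintD a b f g : rbm a b f -> rbm a b g ->
  rint a b (fun t => f t + g t) = rint a b f + rint a b g.
Proof. by move=> hf hg; rewrite /rint RintegralD//; exact: rbm_integrable. Qed.

Lemma rintB a b f g : rbm a b f -> rbm a b g ->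
  rint a b (fun t => f t - g t) = rint a b f - rint a b g.
Proof. by move=> hf hg; rewrite /rint RintegralB//; exact: rbm_integrable. Qed.

Lemma rintZ a b c f : rbm a b f -> rint a b (fun t => c * f t) = c * rint a b f.
Proof. by move=> hf; rewrite /rint RintegralZl//; exact: rbm_integrable. Qed.

Lemma rint_cst a b c : a <= b -> rint a b (cst c) = c * (b - a).
Proof.
move=> ab; rewrite /rint Rintegral_cst//= lebesgue_measure_itv/= lte_fin.
move: ab; rewrite le_eqVlt => /predU1P[->|->]; last by rewrite -EFinD.
by rewrite ltxx subrr.
Qed.

Lemma eq_rint a b f g : (forall t, a <= t <= b -> f t = g t) -> rint a b f = rint a b g.
Proof. by move=> fg; apply: eq_Rintegral => t; rewrite inE/= in_itv/= => /fg. Qed.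

Lemma le_rint a b f g : rbm a b f -> rbm a b g ->
  (forall t, a <= t <= b -> f t <= g t) -> rint a b f <= rint a b g.
Proof.
by move=> hf hg fg; apply: le_Rintegral => //; exact: rbm_integrable.
Qed.

Lemma rint_ge0 a b f : (forall t, a <= t <= b -> 0 <= f t) -> 0 <= rint a b f.
Proof. by move=> f0; apply: Rintegral_ge0 => t /=; rewrite in_itv/=; exact: f0. Qed.

Lemma rint_split a b c f : a <= c -> c <= b -> rbm a b f ->
  rint a b f = rint a c f + rint c b f.
Proof.
move=> ac cb hf; have hi := rbm_integrable hf.
have := @Rintegral_itvB R f (BLeft a) (BRight b) c hi.
rewrite !bnd_simp => /(_ ac cb) => h; rewrite /rint -(@Rintegral_itv_obnd_cbnd _ c (BRight b)).
  by rewrite -h addrC subrK.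
by apply: integrableS hi => //; apply: subset_itv; rewrite bnd_simp.
Qed.

Lemma rint_eq0_ae a b f : rbm a b f -> (forall t, a <= t <= b -> 0 <= f t) ->
  rint a b f = 0 -> {ae mu, forall t, a <= t <= b -> f t = 0}.
Proof.
move=> hf f0 I0; have hi := rbm_integrable hf.
have I0' : (\int[mu]_(t in `[a, b]) `|(f t)%:E| = 0)%E.
  under eq_integral => t.
    rewrite inE/= in_itv/= => /f0 ft; rewrite ger0_norm//; over.
  by rewrite -[LHS]fineK ?integrable_fin_num//; congr (_%:E); exact: I0.
have mf : measurable_fun `[a, b] (EFin \o f) by apply/measurable_EFinP; case: hf.
have /(ae_eq_integral_abs mu (measurable_itv _) mf) := I0'.
by apply: filterS => t h abt; have := h; rewrite /= in_itv/= => /(_ abt) [].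
Qed.

Lemma rint_dct a b (h : nat -> R -> R) f M : (forall n, measurable_fun (`[a, b]%classic : set (measurableTypeR R)) (h n)) ->
  (forall n t, a <= t <= b -> `|h n t| <= M) -> rbm a b f ->
  {ae mu, forall t, a <= t <= b -> h n t @[n --> \oo] --> f t} ->
  rint a b (h n) @[n --> \oo] --> rint a b f.
Proof.
move=> mh hM hf hcv.
have [] := @dominated_convergence _ _ _ mu `[a, b]%classic (measurable_itv _)
  (fun n => EFin \o h n) (EFin \o f) (cst M%:E).
- by move=> n; apply/measurable_EFinP.
- by apply/measurable_EFinP; case: hf.
- apply: (@filterS _ _ (ae_filter_ringOfSetsType mu) _ _ _ hcv) => t ht.
  rewrite /= in_itv/= => /ht.
  by apply: cvg_EFin; apply: nearW.
- exact: rbm_integrable (rbm_cst _ _ _).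
- by apply: aeW => t n /=; rewrite in_itv/= => /hM; rewrite lee_fin.
move=> fi _ hh; apply: fine_cvg; rewrite /rint /Rintegral fineK//; exact: integrable_fin_num.
Qed.
End real_integral.

(** * Integrals of complex valued functions *)

Section complex_integral.
Variable R : realType.
Local Notation C := R[i].
Local Notation mu := (@lebesgue_measure R).
Implicit Types (a b : R) (f g : R -> C).

Definition cbm a b f := rbm a b (fun t => complex.Re (f t)) /\ rbm a b (fun t => complex.Im (f t)).

Definition cint a b f : C :=
  rint a b (fun t => complex.Re (f t)) +i* rint a b (fun t => complex.Im (f t)).

Lemma cbm_cont a b f : (forall t, a <= t <= b -> rcont f t) -> cbm a b f.
Proof.
move=> cf; split; apply: rbm_cont => t /cf h; first exact: ctends_Re.
exact: ctends_Im.
Qed.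

Lemma cbm_bound a b f : cbm a b f -> exists M, forall t, a <= t <= b -> normc (f t) <= M.
Proof.
move=> [[_ [M fM]] [_ [N fN]]]; exists (M + N) => t abt.
by rewrite (le_trans (normc_le_ReIm _))// lerD ?fM ?fN.
Qed.

Lemma cbm_cst a b (c : C) : cbm a b (cst c).
Proof. by split; exact: rbm_cst. Qed.

Lemma eq_rbm a b (h k : R -> R) : h =1 k -> rbm a b h -> rbm a b k.
Proof. by move=> /funext ->. Qed.

Lemma cbmD a b f g : cbm a b f -> cbm a b g -> cbm a b (fun t => f t + g t).
Proof.
move=> [fr fi] [gr gi]; split.
  by apply: (eq_rbm (fun t => esym (ReD _ _))); exact: rbmD.
by apply: (eq_rbm (fun t => esym (ImD _ _))); exact: rbmD.
Qed.

Lemma cbmN a b f : cbm a b f -> cbm a b (fun t => - f t).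
Proof.
move=> [fr fi]; split.
  by apply: (eq_rbm (fun t => esym (ReN _))); exact: rbmN.
by apply: (eq_rbm (fun t => esym (ImN _))); exact: rbmN.
Qed.

Lemma cbmB a b f g : cbm a b f -> cbm a b g -> cbm a b (fun t => f t - g t).
Proof. by move=> hf /cbmN; exact: cbmD. Qed.

Lemma cbmM a b f g : cbm a b f -> cbm a b g -> cbm a b (fun t => f t * g t).
Proof.
move=> [fr fi] [gr gi]; split.
  apply: (@eq_rbm _ _ (fun t => complex.Re (f t) * complex.Re (g t) - complex.Im (f t) * complex.Im (g t))).
    by move=> t; rewrite cReM.
  by apply: rbmB; exact: rbmM.
apply: (@eq_rbm _ _ (fun t => complex.Re (f t) * complex.Im (g t) + complex.Im (f t) * complex.Re (g t))).
  by move=> t; rewrite cImM.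
by apply: rbmD; exact: rbmM.
Qed.

Lemma cbm_conj a b f : cbm a b f -> cbm a b (fun t => conjc (f t)).
Proof.
move=> [fr fi]; split.
  by apply: eq_rbm fr => t; case: (f t).
by apply: eq_rbm (rbmN fi) => t; case: (f t).
Qed.

Lemma cbm_norm2 a b f : cbm a b f -> rbm a b (fun t => normc (f t) ^+ 2).
Proof.
move=> [fr fi]; apply: (@eq_rbm _ _ (fun t => complex.Re (f t) * complex.Re (f t) + complex.Im (f t) * complex.Im (f t))).
  by move=> t; rewrite normc_sqr !expr2.
by apply: rbmD; exact: rbmM.
Qed.

Lemma cbm_norm a b f : cbm a b f -> rbm a b (fun t => normc (f t)).
Proof.
move=> fm; have [M fM] := cbm_bound fm; have [h _] := cbm_norm2 fm; split.
  apply: (@eq_measurable_fun _ _ _ _ _ (@Num.sqrt R \o (fun t => normc (f t) ^+ 2))).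
    by move=> t _ /=; rewrite sqrtr_sqr ger0_norm// normc_ge0.
  apply: measurableT_comp => //; exact: continuous_measurable_fun (@sqrt_continuous R).
by exists M => t /fM; rewrite ger0_norm// normc_ge0.
Qed.

Lemma cbm_sub a b a' b' f : a <= a' -> b' <= b -> cbm a b f -> cbm a' b' f.
Proof. by move=> aa bb [fr fi]; split; [exact: rbm_sub fr|exact: rbm_sub fi]. Qed.

Lemma cintD a b f g : cbm a b f -> cbm a b g ->
  cint a b (fun t => f t + g t) = cint a b f + cint a b g.
Proof.
move=> [fr fi] [gr gi]; rewrite /cint.
rewrite (_ : (fun t => complex.Re (f t + g t)) = (fun t => complex.Re (f t) + complex.Re (g t))).
  rewrite (_ : (fun t => complex.Im (f t + g t)) = (fun t => complex.Im (f t) + complex.Im (g t))).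
    by rewrite !rintD.
  by apply/funext => t; rewrite ImD.
by apply/funext => t; rewrite ReD.
Qed.

Lemma cintZ a b (c : C) f : cbm a b f -> cint a b (fun t => c * f t) = c * cint a b f.
Proof.
move=> [fr fi]; rewrite /cint.
rewrite (_ : (fun t => complex.Re (c * f t)) = (fun t => complex.Re c * complex.Re (f t) - complex.Im c * complex.Im (f t))).
  rewrite (_ : (fun t => complex.Im (c * f t)) = (fun t => complex.Re c * complex.Im (f t) + complex.Im c * complex.Re (f t))).
    have z (k : R) h : rbm a b h -> rbm a b (fun t => k * h t) by apply: rbmM; exact: rbm_cst.
    rewrite rintB ?rintD; try exact: z.
    by rewrite !rintZ//; apply: complex_ext; rewrite ?cReM ?cImM.
  by apply/funext => t; rewrite cImM.
by apply/funext => t; rewrite cReM.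
Qed.

Lemma cintN a b f : cbm a b f -> cint a b (fun t => - f t) = - cint a b f.
Proof.
move=> fm; rewrite -mulN1r -cintZ//; congr cint; apply/funext => t.
by rewrite mulN1r.
Qed.

Lemma cintB a b f g : cbm a b f -> cbm a b g ->
  cint a b (fun t => f t - g t) = cint a b f - cint a b g.
Proof. by move=> fm gm; rewrite cintD ?cintN//; exact: cbmN. Qed.

Lemma cint_cst a b c : a <= b -> cint a b (cst c) = c * (b - a)%:C.
Proof.
by move=> ab; rewrite /cint !rint_cst//; apply: complex_ext; rewrite ?cReM ?cImM /= mulr0 ?subr0 ?add0r.
Qed.

Lemma eq_cint a b f g : (forall t, a <= t <= b -> f t = g t) -> cint a b f = cint a b g.
Proof. by move=> fg; rewrite /cint; congr (_ +i* _); apply: eq_rint => t /fg ->. Qed.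

Lemma cint_split a b c f : a <= c -> c <= b -> cbm a b f ->
  cint a b f = cint a c f + cint c b f.
Proof.
by move=> ac cb [fr fi]; rewrite /cint (rint_split ac cb fr) (rint_split ac cb fi).
Qed.

(** Multiplication by the unimodular [c] that makes the integral real and nonnegative turns its
    modulus into the integral of a real part. *)
Lemma normc_cint_le a b f : cbm a b f -> normc (cint a b f) <= rint a b (fun t => normc (f t)).
Proof.
move=> fm; have [c c1 cE] := phase (cint a b f).
have -> : normc (cint a b f) = complex.Re (cint a b (fun t => c * f t)) by rewrite cintZ// cE.
rewrite /=; apply: le_rint; [|exact: cbm_norm|].
  by have [] := cbmM (cbm_cst a b c) fm.
by move=> t _; rewrite (le_trans (Re_le_normc _))// normcM c1 mul1r.
Qed.

Lemma normc_cint_leM a b f M : a <= b -> cbm a b f ->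
  (forall t, a <= t <= b -> normc (f t) <= M) -> normc (cint a b f) <= M * (b - a).
Proof.
move=> ab fm fM; rewrite (le_trans (normc_cint_le fm))// -rint_cst//.
by apply: le_rint => //; [exact: cbm_norm|exact: rbm_cst].
Qed.

Lemma cint_dct a b (h : nat -> R -> C) f M : (forall n, cbm a b (h n)) ->
  (forall n t, a <= t <= b -> normc (h n t) <= M) -> cbm a b f ->
  {ae mu, forall t, a <= t <= b -> ctends \oo (h^~ t) (f t)} ->
  ctends \oo (fun n => cint a b (h n)) (cint a b f).
Proof.
move=> mh hM [fr fi] hcv; apply: ctends_ReIm => /=.
  apply: (@rint_dct _ _ _ (fun n t => complex.Re (h n t)) _ M) => //.
  - by move=> n; case: (mh n) => -[].
  - by move=> n t /(hM n) /(le_trans (ler_Re_normc _)).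
  - apply: (@filterS _ _ (ae_filter_ringOfSetsType mu) _ _ _ hcv) => t ht /ht; exact: ctends_Re.
apply: (@rint_dct _ _ _ (fun n t => complex.Im (h n t)) _ M) => //.
- by move=> n; case: (mh n) => _ [].
- by move=> n t /(hM n) /(le_trans (ler_Im_normc _)).
- apply: (@filterS _ _ (ae_filter_ringOfSetsType mu) _ _ _ hcv) => t ht /ht; exact: ctends_Im.
Qed.

Lemma cbm_lim a b (h : nat -> R -> C) f M : (forall n, cbm a b (h n)) ->
  (forall n t, a <= t <= b -> normc (h n t) <= M) ->
  (forall t, a <= t <= b -> ctends \oo (h^~ t) (f t)) -> cbm a b f.
Proof.
move=> mh hM hcv.
have fM t : a <= t <= b -> normc (f t) <= M.
  by move=> abt; apply: (ctends_le (hcv _ abt)); apply: nearW => n; exact: hM.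
split; split.
- apply: (@measurable_fun_cvg _ _ _ _ (fun n t => complex.Re (h n t))).
    by move=> n; case: (mh n) => -[].
  by move=> t /=; rewrite in_itv/= => /hcv; exact: ctends_Re.
- by exists M => t /fM /(le_trans (ler_Re_normc _)).
- apply: (@measurable_fun_cvg _ _ _ _ (fun n t => complex.Im (h n t))).
    by move=> n; case: (mh n) => _ [].
  by move=> t /=; rewrite in_itv/= => /hcv; exact: ctends_Im.
- by exists M => t /fM /(le_trans (ler_Im_normc _)).
Qed.
End complex_integral.

(** * Complex differentiability and Goursat's lemma *)

Section complex_derivative.
Variable R : realType.
Local Notation C := R[i].
Implicit Types (f g q : C -> C) (z w : C).

(* Caratheodory's formulation of differentiability. *)
Definition cdiff f z := exists q, ccont q z /\ forall w, f w - f z = q w * (w - z).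

Lemma cdiff_cont f z : cdiff f z -> ccont f z.
Proof.
move=> [q [qz fq]]; apply: (@ctends_ext _ _ (cnear z) _ (fun w => q w * (w - z) + f z)).
  by apply: filterE => w; rewrite -fq subrK.
rewrite -[X in ctends _ _ X]add0r -[X in X + _](mulr0 (q z)) -(subrr z).
apply: ctendsD; last exact: ctends_cst.
by apply: ctendsM => //; apply: ctendsB; [exact: ccont_id|exact: ctends_cst].
Qed.

Lemma cdiffP f z : cdiff f z <-> exists l : C, forall e : R, 0 < e ->
  exists2 d : R, 0 < d & forall w, normc (w - z) < d ->
     normc (f w - f z - l * (w - z)) <= e * normc (w - z).
Proof.
split=> [[q [qz fq]]|[l fl]].
  exists (q z) => e /qz[d d0 dP]; exists d => // w /dP qw.
  by rewrite fq -mulrBl normcM ler_wpM2r ?normc_ge0// ltW.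
exists (fun w => if w == z then l else (f w - f z) / (w - z)); split; last first.
  move=> w; case: eqVneq => [->|wz]; first by rewrite !subrr mulr0.
  by rewrite divfK// subr_eq0.
move=> e e0; have e2 : 0 < e / 2 by rewrite divr_gt0.
have [d d0 dP] := fl _ e2; exists d => // w /dP; rewrite eqxx.
case: eqVneq => [-> _|wz h]; first by rewrite subrr normc0.
have wz0 : w - z != 0 by rewrite subr_eq0.
have nwz : 0 < normc (w - z) by rewrite normc_gt0.
rewrite -(ltr_pM2r nwz) -normcM mulrBl divfK//.
by apply: (le_lt_trans h); rewrite ltr_pM2r//; lra.
Qed.

Lemma cdiff_near f g z : (\forall w \near cnear z, f w = g w) -> cdiff f z -> cdiff g z.
Proof.
move=> [d0 d00 fg] /cdiffP[l fl]; apply/cdiffP; exists l => e /fl[d dd0 dP].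
exists (Num.min d0 d); first by rewrite lt_min d00.
move=> w; rewrite lt_min => /andP[/fg <- /dP]; rewrite (fg z)//.
by rewrite subrr normc0.
Qed.

Lemma cdiff_cst (c : C) z : cdiff (cst c) z.
Proof. by exists (cst 0); split=> [|w]; [exact: ctends_cst|rewrite subrr mul0r]. Qed.

Lemma cdiff_id z : cdiff id z.
Proof. by exists (cst 1); split=> [|w]; [exact: ctends_cst|rewrite mul1r]. Qed.

Lemma cdiffD f g z : cdiff f z -> cdiff g z -> cdiff (fun w => f w + g w) z.
Proof.
move=> [p [pz fp]] [q [qz gq]]; exists (fun w => p w + q w); split.
  exact: ctendsD.
by move=> w; rewrite opprD addrACA fp gq mulrDl.
Qed.

Lemma cdiffN f z : cdiff f z -> cdiff (fun w => - f w) z.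
Proof.
move=> [p [pz fp]]; exists (fun w => - p w); split; first exact: ctendsN.
by move=> w; rewrite -opprD fp mulNr.
Qed.

Lemma cdiffB f g z : cdiff f z -> cdiff g z -> cdiff (fun w => f w - g w) z.
Proof. by move=> fz /cdiffN; exact: cdiffD. Qed.

Lemma cdiffM f g z : cdiff f z -> cdiff g z -> cdiff (fun w => f w * g w) z.
Proof.
move=> fz [q [qz gq]]; have fc := cdiff_cont fz; case: fz => p [pz fp].
exists (fun w => p w * g z + f w * q w); split.
  by apply: ctendsD; apply: ctendsM => //; exact: ctends_cst.
move=> w; rewrite mulrDl -[f w * q w * _]mulrA -gq [p w * g z]mulrC -[g z * p w * _]mulrA -fp; ring.
Qed.

Lemma cdiffV f z : f z != 0 -> cdiff f z -> cdiff (fun w => (f w)^-1) z.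
Proof.
move=> fz0 dfz; have fc := cdiff_cont dfz; case: (dfz) => p [pz fp].
have [d d0 dP] := fc _ (divr_gt0 (etrans (normc_gt0 _) fz0) (ltr0Sn R 1)).
have fw0 w : normc (w - z) < d -> f w != 0.
  move=> /dP h; apply/eqP => fw; move: h; rewrite fw sub0r normcN.
  have := normc_ge0 (f z); have := fz0; rewrite -normc_gt0; lra.
apply: (@cdiff_near (fun w => if f w == 0 then (f z)^-1 - p w * (w - z) / f z else (f w)^-1)).
  by exists d => // w /fw0/negbTE ->.
exists (fun w => - p w / f z * (if f w == 0 then 1 else (f w)^-1)); split.
  rewrite /ccont (negbTE fz0); apply: ctendsM.
    by apply: ctendsM; [exact: ctendsN|exact: ctends_cst].
  apply: ctends_ext (ctendsV fz0 fc); exists d => // w /fw0/negbTE ->//.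
move=> w; rewrite (negbTE fz0); case: eqVneq => [fw|fw]; first by rewrite mulr1; ring.
transitivity (- (p w * (w - z)) / (f z * f w)); last by field; rewrite ?fz0 ?fw.
by rewrite -fp; field; rewrite ?fz0 ?fw.
Qed.

Lemma cdiff_div f g z : g z != 0 -> cdiff f z -> cdiff g z -> cdiff (fun w => f w / g w) z.
Proof. by move=> g0 fz gz; apply: cdiffM => //; exact: cdiffV. Qed.

Lemma cdiff_comp f g z : cdiff g z -> cdiff f (g z) -> cdiff (fun w => f (g w)) z.
Proof.
move=> gz [p [pz fp]]; have gc := cdiff_cont gz; case: gz => q [qz gq].
exists (fun w => p (g w) * q w); split.
  by apply: ctendsM => //; exact: ctends_comp gc pz.
by move=> w; rewrite fp gq mulrA.
Qed.

Lemma cdiffX f z n : cdiff f z -> cdiff (fun w => f w ^+ n) z.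
Proof.
move=> fz; elim: n => [|n IH].
  by apply: (@cdiff_near (cst 1)) (cdiff_cst 1 z); apply: filterE => w; rewrite expr0.
by apply: (cdiff_near _ (cdiffM fz IH)); apply: filterE => w; rewrite exprS.
Qed.

Lemma cdiff_quotient f z w : w != z -> cdiff f w ->
  cdiff (fun v => (f v - f z) / (v - z)) w.
Proof.
move=> wz fw; apply: cdiff_div; first by rewrite subr_eq0.
  by apply: cdiffB => //; exact: cdiff_cst.
by apply: cdiffB; [exact: cdiff_id|exact: cdiff_cst].
Qed.
End complex_derivative.

Section goursat.
Variable R : realType.
Local Notation C := R[i].
Variable g : C -> C.

Lemma rcont_h (x y : R) : ccont g (x +i* y) -> rcont (fun s => g (s +i* y)) x.
Proof.
move=> gc e /gc[d d0 dP]; apply/nbhs_ballP; exists d => //= s xs; apply: dP.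
have -> : s +i* y - (x +i* y) = (s - x)%:C by apply: complex_ext; rewrite /= ?subrr.
by rewrite normcR distrC.
Qed.

Lemma rcont_v (x y : R) : ccont g (x +i* y) -> rcont (fun s => g (x +i* s)) y.
Proof.
move=> gc e /gc[d d0 dP]; apply/nbhs_ballP; exists d => //= s xs; apply: dP.
have -> : x +i* s - (x +i* y) = (0 +i* (s - y)) by apply: complex_ext; rewrite /= ?subrr.
by rewrite /normc expr0n/= add0r sqrtr_sqr distrC.
Qed.

(** The counterclockwise contour integral of [g] over the boundary of the rectangle. *)
Definition rect_int (x1 x2 y1 y2 : R) : C :=
  cint x1 x2 (fun s => g (s +i* y1) - g (s +i* y2)) +
  'i * cint y1 y2 (fun s => g (x2 +i* s) - g (x1 +i* s)).

Definition rect_cont (x1 x2 y1 y2 : R) :=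
  forall x y, x1 <= x <= x2 -> y1 <= y <= y2 -> ccont g (x +i* y).

Lemma cbm_h x1 x2 y1 y2 y : rect_cont x1 x2 y1 y2 -> y1 <= y <= y2 ->
  cbm x1 x2 (fun s => g (s +i* y)).
Proof. by move=> gc yy; apply: cbm_cont => t tx; apply: rcont_h; exact: gc. Qed.

Lemma cbm_v x1 x2 y1 y2 x : rect_cont x1 x2 y1 y2 -> x1 <= x <= x2 ->
  cbm y1 y2 (fun s => g (x +i* s)).
Proof. by move=> gc yy; apply: cbm_cont => t tx; apply: rcont_v; exact: gc. Qed.

Lemma rect_split_x x1 x2 y1 y2 m : x1 <= m -> m <= x2 -> y1 <= y2 -> rect_cont x1 x2 y1 y2 ->
  rect_int x1 x2 y1 y2 = rect_int x1 m y1 y2 + rect_int m x2 y1 y2.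
Proof.
move=> xm mx yy gc; rewrite /rect_int (cint_split xm mx); last first.
  by apply: cbmB; apply: (cbm_h gc); rewrite lexx yy.
have v x : x1 <= x <= x2 -> cbm y1 y2 (fun s => g (x +i* s)) by exact: cbm_v.
have h y a b : y1 <= y <= y2 -> x1 <= a -> b <= x2 -> cbm a b (fun s => g (s +i* y)).
  by move=> /(cbm_h gc) hb xa bx; exact: cbm_sub hb.
rewrite !cintB; first by ring.
all: first [apply: v | apply: h]; rewrite ?lexx ?yy ?xm ?mx ?(le_trans xm mx)//.
Qed.

Lemma rect_split_y x1 x2 y1 y2 m : y1 <= m -> m <= y2 -> x1 <= x2 -> rect_cont x1 x2 y1 y2 ->
  rect_int x1 x2 y1 y2 = rect_int x1 x2 y1 m + rect_int x1 x2 m y2.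
Proof.
move=> ym my xx gc; rewrite /rect_int (cint_split ym my); last first.
  by apply: cbmB; apply: (cbm_v gc); rewrite lexx xx.
have h y : y1 <= y <= y2 -> cbm x1 x2 (fun s => g (s +i* y)) by exact: cbm_h.
rewrite mulrDr addrACA; congr (_ + _).
rewrite !cintB; first by ring.
all: apply: h; rewrite ?lexx ?ym ?my ?(le_trans ym my)//.
Qed.

(** The contour integral of the affine function [g p + L * (w - p)] vanishes: its differences [a]
    and [b] between opposite sides satisfy [a * l + 'i * b * m = 0]. Only the error [e] on each of
    the four sides is left. *)
Lemma rect_int_small x y (l m : R) (p : C) (L : C) (e : R) : 0 <= l -> 0 <= m -> 0 <= e ->
  rect_cont x (x + l) y (y + m) ->
  (forall s t, x <= s <= x + l -> y <= t <= y + m ->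
     normc (g (s +i* t) - g p - L * (s +i* t - p)) <= e) ->
  normc (rect_int x (x + l) y (y + m)) <= 2 * e * (l + m).
Proof.
move=> l0 m0 e0 gc ge.
have xl : x <= x + l by rewrite lerDl.
have ym : y <= y + m by rewrite lerDl.
have yy : y <= y <= y + m by rewrite lexx.
have yy' : y <= y + m <= y + m by rewrite lexx ym.
have xx : x <= x <= x + l by rewrite lexx.
have xx' : x <= x + l <= x + l by rewrite lexx xl.
pose u s := g (s +i* y) - g (s +i* (y + m)); pose v s := g ((x + l) +i* s) - g (x +i* s).
have um : cbm x (x + l) u by apply: cbmB; exact: (cbm_h gc).
have vm : cbm y (y + m) v by apply: cbmB; exact: (cbm_v gc).
pose a : C := - (L * (0 +i* m)); pose b : C := L * l%:C.
have ua s : x <= s <= x + l -> normc (u s - a) <= 2 * e.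
  move=> xs; have h1 := ge _ _ xs yy; have h2 := ge _ _ xs yy'.
  have -> : u s - a = (g (s +i* y) - g p - L * (s +i* y - p)) - (g (s +i* (y + m)) - g p - L * (s +i* (y + m) - p)).
    rewrite /u /a (_ : 0 +i* m = (s +i* (y + m)) - (s +i* y)); first by ring.
    by apply: complex_ext; rewrite /= ?subrr// addrAC subrr add0r.
  rewrite (le_trans (le_normcD _ _))// normcN; lra.
have vb s : y <= s <= y + m -> normc (v s - b) <= 2 * e.
  move=> ys; have h1 := ge _ _ xx ys; have h2 := ge _ _ xx' ys.
  have -> : v s - b = (g ((x + l) +i* s) - g p - L * ((x + l) +i* s - p)) - (g (x +i* s) - g p - L * (x +i* s - p)).
    rewrite /v /b (_ : l%:C = ((x + l) +i* s) - (x +i* s)); first by ring.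
    by apply: complex_ext; rewrite /= ?subrr// addrAC subrr add0r.
  rewrite (le_trans (le_normcD _ _))// normcN; lra.
have -> : rect_int x (x + l) y (y + m) = cint x (x + l) (fun s => u s - a) + 'i * cint y (y + m) (fun s => v s - b).
  rewrite /rect_int -/u -/v (cintB um (cbm_cst _ _ a)) (cintB vm (cbm_cst _ _ b)).
  rewrite !cint_cst// [x + l]addrC [y + m]addrC !addrK /a /b.
  have -> : (0 +i* m : C) = 'i * m%:C by apply: complex_ext; rewrite ?cReM ?cImM /=; ring.
  ring.
rewrite (le_trans (le_normcD _ _))// mulrDr lerD//.
  have := normc_cint_leM xl (cbmB um (cbm_cst _ _ a)) ua.
  by rewrite [x + l]addrC addrK.
rewrite normcM [normc 'i](_ : _ = 1) ?mul1r; last by rewrite /normc expr0n expr1n add0r sqrtr1.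
have := normc_cint_leM ym (cbmB vm (cbm_cst _ _ b)) vb.
by rewrite [y + m]addrC addrK.
Qed.

Lemma rect_goursat x0 y0 (l m : R) : 0 <= l -> 0 <= m ->
  (forall x y, x0 <= x <= x0 + l -> y0 <= y <= y0 + m -> cdiff g (x +i* y)) ->
  rect_int x0 (x0 + l) y0 (y0 + m) = 0.
Proof.
move=> l0 m0 gd; apply: contrapT => /eqP; rewrite -normc_gt0; set c := normc _ => c0.
pose h n : R := 2 ^- n.
have h0 n : 0 < h n by rewrite invr_gt0 exprn_gt0.
have hS n : h n = h n.+1 + h n.+1 by rewrite /h exprS invfM; field; rewrite expf_neq0.
have hS2 n : h n ^+ 2 = 4 * h n.+1 ^+ 2 by rewrite hS; ring.
(* A subrectangle of relative size [h n] whose contour integral is at least its share by area of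
   [c]; quartering preserves this for one of the four parts. *)
pose bad (p : R * R) n := [/\ x0 <= p.1, p.1 + l * h n <= x0 + l, y0 <= p.2, p.2 + m * h n <= y0 + m &
   c * h n ^+ 2 <= normc (rect_int p.1 (p.1 + l * h n) p.2 (p.2 + m * h n))].
pose nx n (p q : R * R) := [/\ bad q n.+1, p.1 <= q.1, q.1 <= p.1 + l * h n.+1, p.2 <= q.2 & q.2 <= p.2 + m * h n.+1].
have step p n : bad p n -> exists q, nx n p q.
  move=> [px pxl py pym pc]; case: p px pxl py pym pc => x y /= px pxl py pym pc.
  have gc : rect_cont x (x + l * h n) y (y + m * h n).
    move=> s t /andP[a1 a2] /andP[a3 a4]; apply: cdiff_cont; apply: gd; apply/andP; split.
    - exact: le_trans a1.
    - exact: le_trans pxl.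
    - exact: le_trans a3.
    - exact: le_trans pym.
  have lh k : 0 <= l * h k by rewrite mulr_ge0// ltW.
  have mh k : 0 <= m * h k by rewrite mulr_ge0// ltW.
  have lS : l * h n = l * h n.+1 + l * h n.+1 by rewrite -mulrDr -hS.
  have mS : m * h n = m * h n.+1 + m * h n.+1 by rewrite -mulrDr -hS.
  have := lh n.+1; have := mh n.+1; rewrite lS mS in pxl pym gc pc; rewrite /nx /bad /=.
  move: (l * h n.+1) (m * h n.+1) pxl pym gc pc => l' m' pxl pym gc pc m'0 l'0.
  have sx : x <= x + l' by lra.
  have sx2 : x + l' <= x + (l' + l') by lra.
  have sy : y <= y + m' by lra.
  have sy2 : y + m' <= y + (m' + m') by lra.
  have E1 := rect_split_x sx sx2 (le_trans sy sy2) gc.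
  have gc1 : rect_cont x (x + l') y (y + (m' + m')).
    by move=> s t /andP[a1 a2] tt; apply: gc => //; rewrite a1 (le_trans a2).
  have gc2 : rect_cont (x + l') (x + (l' + l')) y (y + (m' + m')).
    by move=> s t /andP[a1 a2] tt; apply: gc => //; rewrite a2 (le_trans sx).
  have E2 := rect_split_y sy sy2 sx gc1.
  have E3 := rect_split_y sy sy2 sx2 gc2.
  rewrite E1 E2 E3 hS2 in pc; rewrite (addrA x) (addrA y) in pc; rewrite addrA in pxl; rewrite addrA in pym.
  have k0 : 0 < c * h n.+1 ^+ 2 by rewrite mulr_gt0// exprn_gt0.
  have [a|a] := leP (c * h n.+1 ^+ 2) (normc (rect_int x (x + l') y (y + m'))).
    by exists (x, y); split => //=; try lra; split => //=; lra.
  have [b|b] := leP (c * h n.+1 ^+ 2) (normc (rect_int x (x + l') (y + m') (y + m' + m'))).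
    by exists (x, y + m'); split => //=; try lra; split => //=; lra.
  have [d|d] := leP (c * h n.+1 ^+ 2) (normc (rect_int (x + l') (x + l' + l') y (y + m'))).
    by exists (x + l', y); split => //=; try lra; split => //=; lra.
  have [f|f] := leP (c * h n.+1 ^+ 2) (normc (rect_int (x + l') (x + l' + l') (y + m') (y + m' + m'))).
    by exists (x + l', y + m'); split => //=; try lra; split => //=; lra.
  have t1 := le_normcD (rect_int x (x + l') y (y + m')) (rect_int x (x + l') (y + m') (y + m' + m')).
  have t2 := le_normcD (rect_int (x + l') (x + l' + l') y (y + m')) (rect_int (x + l') (x + l' + l') (y + m') (y + m' + m')).
  have t3 := le_trans pc (le_normcD _ _).
  lra.
have stepA pn : exists q, bad pn.1 pn.2 -> nx pn.2 pn.1 q.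
  by have [/step[q ?]|nb] := pselect (bad pn.1 pn.2); [exists q|exists (0, 0)].
have [F FP] := choice stepA.
pose fix u n : R * R := if n is n'.+1 then F (u n', n') else (x0, y0).
have ub n : bad (u n) n.
  elim: n => [|n IH]; last by have [] := FP (u n, n) IH.
  by rewrite /bad /= /h expr0 invr1 !mulr1 expr1n mulr1; split.
have un n : nx n (u n) (u n.+1) by exact: (FP (u n, n) (ub n)).
have mono (k l' : R) (v : nat -> R) : (forall n, v n <= v n.+1 /\ v n.+1 <= v n + k * h n.+1) ->
    0 <= k -> exists X, forall n, v n <= X <= v n + k * h n.
  move=> hv k0.
  have inc i j : v i <= v (i + j)%N.
    by elim: j => [|j IH]; rewrite ?addn0 ?addnS// (le_trans IH)//; have [] := hv (i + j)%N.
  have dec i j : v (i + j)%N + k * h (i + j)%N <= v i + k * h i.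
    elim: j => [|j IH]; rewrite ?addn0 ?addnS//; apply: le_trans IH.
    have [_ a] := hv (i + j)%N; rewrite [h (i + j)%N]hS mulrDr; lra.
  have bnd i j : v i <= v j + k * h j.
    have kh n : 0 <= k * h n by rewrite mulr_ge0// ltW.
    have [ij|/ltnW ji] := leqP i j.
      by have := inc i (j - i)%N; rewrite subnKC// => a; have := kh j; lra.
    by have := dec j (i - j)%N; rewrite subnKC// => a; have := kh i; lra.
  exists (sup (range v)) => n; apply/andP; split.
    by apply: ub_le_sup; [exists (v 0%N + k * h 0%N) => _ [i _ <-]|exists n].
  by apply: sup_le_ub; [exists (v 0%N); exists 0%N|move=> _ [i _ <-]].
have [X hX] : exists X, forall n, (u n).1 <= X <= (u n).1 + l * h n.
  by apply: (mono l 0 (fun n => (u n).1)) => // n; have [_ a b _ _] := un n.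
have [Y hY] : exists Y, forall n, (u n).2 <= Y <= (u n).2 + m * h n.
  by apply: (mono m 0 (fun n => (u n).2)) => // n; have [_ _ _ a b] := un n.
have XY : cdiff g (X +i* Y).
  have := hX 0%N; have := hY 0%N; rewrite /= /h expr0 invr1 !mulr1 => a b.
  exact: gd.
move/cdiffP : XY => [L gL].
have lm0 : 0 <= l + m by rewrite addr_ge0.
have lm1 : 0 < (l + m) ^+ 2 + 1 by rewrite ltr_wpDl// sqr_ge0.
(* This makes [2 * e * (l + m) ^+ 2] at most [c / 2], below the lower bound in [bad]; the [+ 1]
   covers a degenerate rectangle. *)
pose e := c / (4 * ((l + m) ^+ 2 + 1)).
have e0 : 0 < e by rewrite divr_gt0// mulr_gt0.
have [d d0 dP] := gL _ e0.
have [n hn] : exists n, (l + m) * h n < d.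
  pose k := Num.truncn ((l + m) / d); exists k.+1.
  have a1 : (l + m) / d < (k.+1)%:R by exact: truncnS_gt.
  have a2 : (k.+1)%:R <= 2 ^+ k.+1 :> R by rewrite -natrX ler_nat ltnW// ltn_expl.
  rewrite /h ltr_pdivrMr ?exprn_gt0// mulrC -ltr_pdivrMr//.
  exact: lt_le_trans a2.
have [b1 b2 b3 b4 b5] := ub n.
have := hX n; have := hY n; move: (u n) b1 b2 b3 b4 b5 => [x y] /= b1 b2 b3 b4 b5 /andP[y1 y2] /andP[x1 x2].
have lh : 0 <= l * h n by rewrite mulr_ge0// ltW.
have mh : 0 <= m * h n by rewrite mulr_ge0// ltW.
have := @rect_int_small x y (l * h n) (m * h n) (X +i* Y) L (e * ((l + m) * h n)) lh mh.
rewrite mulr_ge0 ?(ltW e0)// ?mulr_ge0 ?(ltW (h0 n))// => /(_ isT) H.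
have {H} : normc (rect_int x (x + l * h n) y (y + m * h n)) <= 2 * (e * ((l + m) * h n)) * (l * h n + m * h n).
  apply: H.
    move=> s t /andP[s1 s2] /andP[t1 t2]; apply: cdiff_cont; apply: gd.
      by rewrite (le_trans b1)//= (le_trans s2).
    by rewrite (le_trans b3)//= (le_trans t2).
  move=> s t /andP[s1 s2] /andP[t1 t2].
  have small : normc (s +i* t - (X +i* Y)) <= (l + m) * h n.
    rewrite (le_trans (normc_le_ReIm _))//= mulrDl lerD// ler_norml; apply/andP; split; lra.
  rewrite (le_trans (dP _ _))//; first exact: le_lt_trans hn.
  by rewrite ler_wpM2l// ltW.
rewrite -mulrDl => H; have := le_trans b5 H.
have -> : 2 * (e * ((l + m) * h n)) * ((l + m) * h n) = 2 * (e * (l + m) ^+ 2) * h n ^+ 2 by ring.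
rewrite ler_pM2r ?exprn_gt0// leNgt => /negP; apply.
have : e * (l + m) ^+ 2 <= c / 4.
  rewrite /e mulrAC ler_pdivrMr ?mulr_gt0//.
  have -> : c / 4 * (4 * ((l + m) ^+ 2 + 1)) = c * ((l + m) ^+ 2 + 1) by field.
  by rewrite ler_pM2l// lerDl.
lra.
Qed.
End goursat.

(** * Cauchy and Poisson formulas on circles *)

Section cexp.
Variable R : realType.
Local Notation C := R[i].
Local Notation pi := (@pi R).

Definition cexp (z : C) : C := (expR (complex.Re z))%:C * (cos (complex.Im z) +i* sin (complex.Im z)).

Definition pt (r t : R) : C := r%:C * (cos t +i* sin t).

Lemma ptE r t : pt r t = (r * cos t) +i* (r * sin t).
Proof. by apply: complex_ext; rewrite ?cReM ?cImM /= mul0r ?subr0 ?addr0. Qed.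

Lemma normc_cis (t : R) : normc (cos t +i* sin t : C) = 1.
Proof. by rewrite /normc cos2Dsin2 sqrtr1. Qed.

Lemma normc_pt r t : 0 <= r -> normc (pt r t) = r.
Proof. by move=> r0; rewrite normcM normcR normc_cis mulr1 ger0_norm. Qed.

Lemma cexpD z w : cexp (z + w) = cexp z * cexp w.
Proof.
rewrite /cexp ReD ImD expRD cosD sinD; apply: complex_ext.
  by rewrite !(cReM, cImM) /=; ring.
by rewrite !(cReM, cImM) /=; ring.
Qed.

Lemma real_frechet (f : R -> R) (x l : R) : is_derive x 1 f l -> forall e, 0 < e ->
  exists2 d, 0 < d & forall h, `|h| < d -> `|f (h + x) - f x - l * h| <= e * `|h|.
Proof.
move=> fx e e0; have dfx : derivable f x 1 by exact: ex_derive.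
have fl : 'D_1 f x = l by exact: derive_val.
move: dfx; rewrite /derivable => /cvgrPdist_le.
rewrite -[lim _]/('D_1 f x) fl => /(_ _ e0)/nbhs_ballP[d /= d0 dP]; exists d => // h hd.
have [->|h0] := eqVneq h 0; first by rewrite add0r subrr sub0r mulr0 oppr0 normr0 mulr0.
have hb : ball (0 : R) d h by rewrite /ball /= sub0r normrN.
have := dP h hb h0.
rewrite /GRing.scale /= mulr1 => H.
have nh : 0 < `|h| by rewrite normr_gt0.
rewrite -(ler_pM2r nh) -normrM in H; apply: le_trans H; rewrite -normrN.
by rewrite le_eqVlt; apply/orP; left; apply/eqP; congr `|_|; field.
Qed.

(** The functional equation reduces differentiability to the point 0, where the first-order
    expansions of the real exponential, sine and cosine are multiplied out; the factor 20 in the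
    tolerance absorbs all cross terms. *)
Lemma cdiff_cexp z : cdiff cexp z.
Proof.
have e0 : cdiff cexp 0.
  apply/cdiffP; exists 1 => e0 e00.
  pose e := Num.min e0 1 / 20.
  have e_gt0 : 0 < e by rewrite divr_gt0// lt_min e00 ltr01.
  have ee0 : e <= e0 / 20 by rewrite ler_pM2r ?invr_gt0// ge_min lexx.
  have e1 : e <= 1 / 20 by rewrite ler_pM2r ?invr_gt0// ge_min lexx orbT.
  have [d1 d10 D1] := real_frechet (is_derive_expR 0) e_gt0.
  have [d2 d20 D2] := real_frechet (is_derive_cos 0) e_gt0.
  have [d3 d30 D3] := real_frechet (is_derive_sin 0) e_gt0.
  exists (Num.min (Num.min d1 d2) (Num.min d3 e)).
    by rewrite !lt_min d10 d20 d30 e_gt0.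
  move=> [x y]; rewrite subr0 !lt_min => /andP[/andP[w1 w2] /andP[w3 we]].
  set n := normc (x +i* y) in w1 w2 w3 we *.
  have xn : `|x| <= n by exact: (ler_Re_normc (x +i* y)).
  have yn : `|y| <= n by exact: (ler_Im_normc (x +i* y)).
  have := D1 x (le_lt_trans xn w1); have := D2 y (le_lt_trans yn w2).
  have := D3 y (le_lt_trans yn w3).
  rewrite !addr0 expR0 cos0 sin0 oppr0 !mul0r !subr0 !mul1r ?addr0 => h3 h2 h1.
  have -> : cexp (x +i* y) - cexp 0 - (x +i* y) = (expR x * cos y - 1 - x) +i* (expR x * sin y - y).
    by rewrite /cexp /= expR0 cos0 sin0; apply: complex_ext; rewrite /=; ring.
  apply: (le_trans (normc_le_ReIm _)) => /=.
  have a1 : `|expR x * cos y - 1 - x| <= `|expR x - 1 - x| + `|expR x| * `|cos y - 1|.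
    by rewrite -normrM; apply: le_trans (ler_normD _ _); rewrite le_eqVlt; apply/orP; left; apply/eqP; congr `|_|; ring.
  have a2 : `|expR x * sin y - y| <= `|expR x| * `|sin y - y| + `|y| * `|expR x - 1|.
    by rewrite -!normrM; apply: le_trans (ler_normD _ _); rewrite le_eqVlt; apply/orP; left; apply/eqP; congr `|_|; ring.
  have a3 : `|expR x - 1| <= `|expR x - 1 - x| + `|x|.
    by apply: le_trans (ler_normD _ _); rewrite subrK.
  have a4 : `|expR x| <= `|expR x - 1| + 1.
    by rewrite -[X in _ <= _ + X]normr1; apply: le_trans (ler_normD _ _); rewrite subrK.
  move: (`|expR x * cos y - 1 - x|) (`|expR x * sin y - y|) (`|expR x - 1 - x|) (`|expR x|) (`|expR x - 1|) (`|cos y - 1|) (`|sin y - y|) h1 h2 h3 a1 a2 a3 a4 (normr_ge0 (sin y - y)) (normr_ge0 (cos y - 1)) (normr_ge0 (expR x)) (normr_ge0 (expR x - 1)) => A B E1 E E0 Cc S h1 h2 h3 a1 a2 a3 a4 S0 C0 E00 E10.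
  have n0 : 0 <= n by exact: normc_ge0.
  have en : e * `|x| <= e * n by rewrite ler_pM2l.
  have en' : e * `|y| <= e * n by rewrite ler_pM2l.
  have E1e : E1 <= e * n by apply: le_trans en.
  have Ce : Cc <= e * n by apply: le_trans en'.
  have Se : S <= e * n by apply: le_trans en'.
  have en1 : e * n <= n / 20 by rewrite mulrC ler_wpM2l// -div1r.
  have E02 : E0 <= 2 * n by clear - a3 E1e en1 xn n0; lra.
  have n1 : n <= 1 / 20 by clear - we e1; lra.
  have E2 : E <= 2 by clear - a4 E02 n1; lra.
  have EC : E * Cc <= 2 * (e * n) by apply: ler_pM.
  have ES : E * S <= 2 * (e * n) by apply: ler_pM.
  have yE : `|y| * E0 <= e * (2 * n) by apply: ler_pM => //; clear - yn n0 we E02; lra.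
  have ee : e * n <= e0 / 20 * n by rewrite ler_wpM2r.
  clear - a1 a2 E1e EC ES yE ee n0 e00; have : 0 <= e0 * n by rewrite mulr_ge0// ltW.
  lra.
have -> : cexp = (fun w => cexp z * cexp (w - z)).
  by apply/funext => w; rewrite -cexpD addrC subrK.
apply: cdiffM; first exact: cdiff_cst.
apply: (@cdiff_comp _ cexp (fun w => w - z)).
  by apply: cdiffB; [exact: cdiff_id|exact: cdiff_cst].
by rewrite subrr.
Qed.

Lemma ctends_pt (T : Type) (F : set_system T) (FF : Filter F) (r t : T -> R) (r0 t0 : R) :
  r x @[x --> F] --> r0 -> t x @[x --> F] --> t0 ->
  ctends F (fun x => pt (r x) (t x)) (pt r0 t0).
Proof.
move=> rr tt; apply: ctends_ReIm.
  under eq_fun do rewrite ptE/=; rewrite ptE/=; apply: cvgM => //.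
  by apply: continuous_cvg => //; exact: continuous_cos.
under eq_fun do rewrite ptE/=; rewrite ptE/=; apply: cvgM => //.
by apply: continuous_cvg => //; exact: continuous_sin.
Qed.

Lemma rcont_pt (h : C -> C) r t : ccont h (pt r t) -> rcont (fun s => h (pt r s)) t.
Proof.
by move=> hc; apply: ctends_comp hc; apply: ctends_pt; [exact: cvg_cst|exact: cvg_id].
Qed.

(** A bound uniform in the radius: the dominating constant when circle integrals are compared for
    varying radii. *)
Lemma polar_bounded (h : C -> C) r : (forall w, normc w <= r -> ccont h w) ->
  exists M, forall s t, 0 <= s <= r -> 0 <= t <= 2 * pi -> normc (h (pt s t)) <= M.
Proof.
move=> hc; pose G (p : R * R) : R := normc (h (pt p.1 p.2)).
have : compact (G @` (`[0, r]%classic `*` `[0, 2 * pi]%classic)).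
  apply: continuous_compact; last by apply: compact_setX; exact: segment_compact.
  apply: continuous_in_subspaceT => p; rewrite inE/= => -[/=]; rewrite !in_itv/= => /andP[p0 pr] _.
  apply: ctends_norm; apply: ctends_comp.
    by apply: ctends_pt; [exact: cvg_fst|exact: cvg_snd].
  by apply: hc; rewrite normc_pt.
move=> /compact_bounded[M [_ /(_ (M + 1))]]; rewrite ltrDl ltr01 => /(_ isT) hM.
exists (M + 1) => s t s0 t0; rewrite -[X in X <= _]ger0_norm ?normc_ge0//.
by apply: (hM (G (s, t))); exists (s, t) => //; split; rewrite /= in_itv.
Qed.

Definition circ (h : C -> C) (r : R) : C := cint 0 (2 * pi) (fun t => h (pt r t)).

Let pi2_ge0 : 0 <= 2 * pi. Proof. by rewrite mulr_ge0// pi_ge0. Qed.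

(** The exponential maps the rectangle between [ln r1] and [ln r2] of height [2 * pi] to the
    annulus. In Goursat's lemma the two horizontal sides cancel by periodicity, and the two vertical
    ones are the circle integrals. *)
Lemma circ_const (h : C -> C) r1 r2 : 0 < r1 -> r1 <= r2 ->
  (forall w, r1 <= normc w <= r2 -> cdiff h w) -> circ h r1 = circ h r2.
Proof.
move=> r10 r12 hd; have r20 : 0 < r2 by exact: lt_le_trans r12.
pose g w := h (cexp w); pose l := ln r2 - ln r1.
have l0 : 0 <= l by rewrite subr_ge0 ler_ln.
have lE : ln r1 + l = ln r2 by rewrite /l addrC subrK.
have gE x y : g (x +i* y) = h (pt (expR x) y) by [].
have := @rect_goursat _ g (ln r1) 0 l (2 * pi) l0 pi2_ge0.
have gd x y : ln r1 <= x <= ln r1 + l -> 0 <= y <= 0 + 2 * pi -> cdiff g (x +i* y).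
  move=> /andP[x1 x2] _; apply: cdiff_comp; first exact: cdiff_cexp.
  apply: hd; rewrite /cexp normcM normcR normc_cis mulr1 ger0_norm ?expR_ge0//=.
  rewrite lE in x2; apply/andP; split.
    by rewrite -[r1]lnK ?posrE// ler_expR.
  by rewrite -[r2]lnK ?posrE// ler_expR.
move=> /(_ gd); rewrite /rect_int add0r lE.
rewrite (@eq_cint _ (ln r1) _ _ (cst 0)); last first.
  move=> t _; rewrite !gE (_ : pt _ (2 * pi) = pt (expR t) 0) ?subrr//.
  by rewrite /pt -[2 * pi]add0r mulr_natl cosD2pi sinD2pi.
rewrite cint_cst ?mul0r ?add0r ?ler_ln// => /eqP; rewrite mulf_eq0.
have -> /= : ('i == 0 :> C) = false.
  by rewrite eq_complex /= oner_eq0 andbF.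
have gm x : ln r1 <= x <= ln r2 -> cbm 0 (2 * pi) (fun s => g (x +i* s)).
  move=> /andP[x1 x2]; apply: cbm_cont => t _; apply: rcont_v; apply: cdiff_cont.
  apply: cdiff_comp; first exact: cdiff_cexp.
  apply: hd; rewrite /cexp normcM normcR normc_cis mulr1 ger0_norm ?expR_ge0//=.
  apply/andP; split; first by rewrite -[r1]lnK ?posrE// ler_expR.
  by rewrite -[r2]lnK ?posrE// ler_expR.
have m1 : cbm 0 (2 * pi) (fun s => g (ln r1 +i* s)) by apply: gm; rewrite lexx ler_ln.
have m2 : cbm 0 (2 * pi) (fun s => g (ln r2 +i* s)) by apply: gm; rewrite lexx ler_ln// r12.
rewrite (cintB m2 m1) subr_eq0 => /eqP; rewrite /circ.
have E r : 0 < r -> cint 0 (2 * pi) (fun t => h (pt r t)) = cint 0 (2 * pi) (fun s => g (ln r +i* s)).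
  by move=> r0; apply: eq_cint => t _; rewrite gE lnK.
by rewrite (E _ r10) (E _ r20) => ->.
Qed.

Lemma circ_cont (h : C -> C) r (u : nat -> R) s : (forall w, normc w <= r -> ccont h w) ->
  (forall n, 0 <= u n <= r) -> 0 <= s <= r -> u n @[n --> \oo] --> s ->
  ctends \oo (fun n => circ h (u n)) (circ h s).
Proof.
move=> hc ur sr us; have [M hM] := polar_bounded hc.
have cm v : 0 <= v <= r -> cbm 0 (2 * pi) (fun t => h (pt v t)).
  move=> /andP[v0 vr]; apply: cbm_cont => t _; apply: rcont_pt; apply: hc.
  by rewrite normc_pt.
apply: (@cint_dct _ _ _ (fun n t => h (pt (u n) t)) _ M).
- by move=> n; exact: cm.
- by move=> n t; exact: hM.
- exact: cm.
- apply: aeW => t _; apply: ctends_comp.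
    by apply: ctends_pt => //; exact: cvg_cst.
  by apply: hc; case/andP: sr => s0 sr; rewrite normc_pt.
Qed.

(** At [z] only continuity is assumed, since the difference quotient of [cauchy_formula] enters
    here. The circle integral is constant for radii below and above [normc z]; its continuity in the
    radius joins the two ranges and reaches radius 0. *)
Lemma circ_mean (h : C -> C) (z : C) r : normc z < r ->
  (forall w, normc w <= r -> ccont h w) ->
  (forall w, normc w <= r -> w != z -> cdiff h w) -> circ h r = (2 * pi)%:C * h 0.
Proof.
move=> zr hc hd; set s := normc z in zr; have s0 : 0 <= s by exact: normc_ge0.
have r0 : 0 < r by exact: le_lt_trans zr.
have J0 : circ h 0 = (2 * pi)%:C * h 0.
  rewrite /circ (@eq_cint _ _ _ _ (cst (h 0))); last first.
    by move=> t _; rewrite /pt mul0r.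
  by rewrite cint_cst// subr0 mulrC.
have hinv : (fun n => n.+2%:R^-1 : R) n @[n --> \oo] --> (0 : R).
  by have := @cvg_harmonic R; rewrite -cvg_shiftS.
have Jlim (a b : R) : 0 <= a -> a <= r -> 0 <= b -> b <= r -> a != b ->
    (forall c, 0 < c -> (a < c /\ c <= b) \/ (b <= c /\ c < a) -> circ h c = circ h b) -> circ h a = circ h b.
  move=> a0 ar b0 br ab hcb.
  pose u n : R := a + (b - a) * n.+2%:R^-1.
  have u01 n : 0 < n.+2%:R^-1 :> R /\ n.+2%:R^-1 < 1 :> R.
    by split; rewrite ?invr_gt0 ?ltr0n// invf_lt1 ?ltr0n// ltr1n.
  have ua n : (a < u n /\ u n <= b) \/ (b <= u n /\ u n < a).
    have [k0 k1] := u01 n; rewrite /u; case/lt_total/orP: ab => ab; [left|right].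
      rewrite ltrDl mulr_gt0 ?subr_gt0//; split => //.
      by rewrite -lerBrDl ler_piMr ?subr_ge0 ?ltW.
    split; last by rewrite gtrDl nmulr_rlt0// subr_lt0.
    rewrite -lerBlDl; rewrite -[b - a]opprB mulNr lerN2 ler_piMr ?subr_ge0 ?ltW//.
  have u0 n : 0 < u n.
    case/lt_total/orP: ab => ab; case: (ua n) => -[h1 h2]; first exact: le_lt_trans h1.
    - by have := lt_trans ab (le_lt_trans h1 h2); rewrite ltxx.
    - by have := lt_trans ab (lt_le_trans h1 h2); rewrite ltxx.
    - have [k0 k1] := u01 n; rewrite /u.
      have -> : a + (b - a) / n.+2%:R = a * (1 - n.+2%:R^-1) + b * n.+2%:R^-1 by ring.
      by rewrite ltr_wpDr ?mulr_ge0 ?(ltW k0)// mulr_gt0 ?subr_gt0// (le_lt_trans b0).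
  have ur n : 0 <= u n <= r.
    rewrite ltW//=; case: (ua n) => -[h1 h2]; first exact: le_trans br.
    by rewrite ltW// (lt_le_trans h2).
  have uc : u n @[n --> \oo] --> a.
    rewrite -[X in _ --> X]addr0 -[X in _ --> _ + X](mulr0 (b - a)).
    by apply: cvgD; [exact: cvg_cst|apply: cvgM => //; exact: cvg_cst].
  have a_r : 0 <= a <= r by rewrite a0.
  apply: (ctends_unique (circ_cont hc ur a_r uc)).
  by apply: ctends_ext (ctends_cst _); apply: nearW => n; rewrite hcb.
have Js : circ h r = circ h s.
  apply/esym; apply: Jlim => //; rewrite ?(ltW zr) ?(ltW r0)// ?lt_eqF//.
  move=> c c0 [[sc cr]|[rc cs]]; last by have := lt_trans zr (le_lt_trans rc cs); rewrite ltxx.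
  apply: circ_const => // w /andP[w1 w2]; apply: hd => //.
  by apply/eqP => wz; move: (lt_le_trans sc w1); rewrite wz ltxx.
rewrite Js -J0; have [<-//|sn0] := eqVneq 0 s.
have sp : 0 < s by rewrite lt_def eq_sym sn0.
have Jh c : 0 < c -> c < s -> circ h c = circ h (s / 2).
  move=> c0 cs; have h2 : 0 < s / 2 by rewrite divr_gt0.
  have h2s : s / 2 < s by clear -h2; lra.
  have k (v w : R) : 0 < v -> v <= w -> w < s -> circ h v = circ h w.
    move=> v0 vw ws; apply: circ_const => // x /andP[x1 x2]; apply: hd.
      exact: le_trans (le_trans x2 (ltW ws)) (ltW zr).
    by apply/eqP => xz; move: (le_lt_trans x2 ws); rewrite xz ltxx.
  have [l|l] := leP c (s / 2); first exact: k.
  by apply/esym; apply: k => //; exact: ltW.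
have h2 : 0 < s / 2 by rewrite divr_gt0.
have h2s : s / 2 < s by clear -h2; lra.
transitivity (circ h (s / 2)).
  apply: Jlim; rewrite ?(ltW zr) ?(ltW h2)//; first exact: ltW (lt_trans h2s zr).
    by rewrite gt_eqF.
  move=> c c0 [[h1 h3]|[h1 h3]]; last exact: Jh.
  by have := lt_trans h1 (le_lt_trans h3 h2s); rewrite ltxx.
apply/esym; apply: Jlim; rewrite ?(ltW h2) ?(ltW r0)//; first exact: ltW (lt_trans h2s zr).
  by rewrite lt_eqF.
move=> c c0 [[h1 h3]|[h1 h3]]; first by apply: Jh => //; exact: le_lt_trans h2s.
by have := lt_trans c0 h3; rewrite ltxx.
Qed.
End cexp.

#[global] Arguments pt : simpl never.
#[global] Arguments cexp : simpl never.
#[global] Arguments conjc : simpl never.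

(** * The Cauchy and Poisson kernels *)

Section cauchy.
Variable R : realType.
Local Notation C := R[i].
Local Notation pi := (@pi R).
Implicit Types (f : C -> C) (z w : C) (r : R).

(** The Cauchy kernel in the angle: with zeta = [pt r t] and d zeta = i zeta dt, the form
    [cker r t z] dt is d zeta / (i (zeta - z)). *)
Definition cker r t z : C := pt r t / (pt r t - z).

Lemma ptBgt r t z : 0 <= r -> r - normc z <= normc (pt r t - z).
Proof. by move=> r0; rewrite -{1}(@normc_pt R r t r0) ler_normcB. Qed.

Lemma ptB_neq0 r t z : normc z < r -> pt r t - z != 0.
Proof.
move=> zr; have r0 : 0 <= r by rewrite ltW// (le_lt_trans (normc_ge0 z)).
by rewrite -normc_gt0 (lt_le_trans _ (ptBgt t z r0))// subr_gt0.
Qed.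

Lemma rcont_ptid r t : rcont (fun s => pt r s) t.
Proof. by apply: (@rcont_pt _ id); exact: ccont_id. Qed.

Lemma cbm_pt r : cbm 0 (2 * pi) (fun t => pt r t).
Proof. by apply: cbm_cont => t _; exact: rcont_ptid. Qed.

Lemma cbm_ptV r z : normc z < r -> cbm 0 (2 * pi) (fun t => (pt r t - z)^-1).
Proof.
move=> zr; apply: cbm_cont => t _; apply: ctendsV; first exact: ptB_neq0.
by apply: ctendsB; [exact: rcont_ptid|exact: ctends_cst].
Qed.

Lemma cbm_cker r z : normc z < r -> cbm 0 (2 * pi) (fun t => cker r t z).
Proof. by move=> zr; apply: cbmM; [exact: cbm_pt|exact: cbm_ptV]. Qed.

Lemma cbm_circ f r : 0 <= r -> (forall w, normc w <= r -> cdiff f w) ->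
  cbm 0 (2 * pi) (fun t => f (pt r t)).
Proof.
move=> r0 fd; apply: cbm_cont => t _; apply: rcont_pt; apply: cdiff_cont; apply: fd.
by rewrite normc_pt.
Qed.

Lemma circ_mvp f r : 0 < r -> (forall w, normc w <= r -> cdiff f w) ->
  cint 0 (2 * pi) (fun t => f (pt r t)) = (2 * pi)%:C * f 0.
Proof.
move=> r0 fd; rewrite -[LHS]/(circ f r) (@circ_mean _ f 0)//.
- by rewrite normc0.
- by move=> w wr; apply: cdiff_cont; exact: fd.
- by move=> w wr _; exact: fd.
Qed.

Lemma conj_pt r t : pt r t * conjc (pt r t) = (r ^+ 2)%:C.
Proof. by rewrite mulcJ /pt normcM normcR normc_cis mulr1 real_normK ?num_real. Qed.

(** Since conj(zeta) = r^2 / zeta on the circle, [conjc (cker r t z) - 1] is the restriction of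
    conj(z) w / (r^2 - conj(z) w), which is analytic on the closed disc and vanishes at 0; the mean
    value property applies. With [poissonE] this turns Cauchy's formula into Poisson's. *)
Lemma circ_poisson_conj f r z : normc z < r -> (forall w, normc w <= r -> cdiff f w) ->
  cint 0 (2 * pi) (fun t => f (pt r t) * (conjc (cker r t z) - 1)) = 0.
Proof.
move=> zr fd; have r0 : 0 < r by exact: le_lt_trans (normc_ge0 _) zr.
pose k w := f w * (conjc z * w / ((r ^+ 2)%:C - conjc z * w)).
have nz w : normc w <= r -> (r ^+ 2)%:C - conjc z * w != 0.
  move=> wr; rewrite -normc_gt0; apply: lt_le_trans (ler_normcB _ _).
  rewrite normcR normcM normc_conj ger0_norm ?sqr_ge0// subr_gt0 expr2.
  by apply: le_lt_trans (ler_wpM2l (normc_ge0 _) wr) _; rewrite ltr_pM2r.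
transitivity (cint 0 (2 * pi) (fun t => k (pt r t))); last first.
  rewrite circ_mvp// /k ?mulr0 ?mul0r ?mulr0// => w wr; apply: cdiffM; first exact: fd.
  apply: cdiff_div; first exact: nz.
    by apply: cdiffM; [exact: cdiff_cst|exact: cdiff_id].
  by apply: cdiffB; [exact: cdiff_cst|apply: cdiffM; [exact: cdiff_cst|exact: cdiff_id]].
apply: eq_cint => t _; rewrite /k; congr (_ * _).
have nt := nz (pt r t); rewrite (normc_pt t (ltW r0)) lexx in nt; have {}nt := nt isT.
have nc : conjc (pt r t) - conjc z != 0.
  by rewrite -rmorphB conjc_eq0; exact: ptB_neq0.
rewrite /cker rmorphM /= conjc_inv rmorphB /=; rewrite -(conj_pt r t) in nt *.
have e : pt r t * conjc (pt r t) - conjc z * pt r t = pt r t * (conjc (pt r t) - conjc z) by ring.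
rewrite e in nt *; have np : pt r t != 0 by apply: contraNneq nt => ->; rewrite mul0r.
by field; rewrite np nc.
Qed.

Lemma cint_conj a b (g : R -> C) : cbm a b g -> cint a b (fun t => conjc (g t)) = conjc (cint a b g).
Proof.
move=> [gr gi]; apply: complex_ext => /=.
  by apply: eq_rint => t _; case: (g t).
rewrite -mulN1r -rintZ//; apply: eq_rint => t _; by case: (g t) => x y; rewrite mulN1r.
Qed.

Lemma cint_cker r z : normc z < r -> cint 0 (2 * pi) (fun t => cker r t z) = (2 * pi)%:C.
Proof.
move=> zr; have h := circ_poisson_conj zr (fun w _ => cdiff_cst 1 w).
have pi2 : 0 <= 2 * pi by rewrite mulr_ge0// pi_ge0.
have cm := cbm_cker zr.
have : cint 0 (2 * pi) (fun t => conjc (cker r t z)) - (2 * pi)%:C = 0.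
  rewrite -[RHS]h -[(2 * pi)%:C]mul1r -[X in _ * X%:C]subr0 -cint_cst// -cintB//.
  - by apply: eq_cint => t _; rewrite mul1r.
  - exact: cbm_conj.
  - exact: cbm_cst.
by rewrite cint_conj// => /eqP; rewrite subr_eq0 => /eqP /(congr1 conjc); rewrite conjcK conjc_real.
Qed.

(** Write f(zeta) = f(z) + q(zeta) (zeta - z) with Caratheodory's [q]. The first term gives the
    integral of the kernel, the second the circle integral of [q w * w], which is zero by
    [circ_mean] because this function vanishes at 0. *)
Lemma cauchy_formula f r z : normc z < r -> (forall w, normc w <= r -> cdiff f w) ->
  cint 0 (2 * pi) (fun t => f (pt r t) * cker r t z) = (2 * pi)%:C * f z.
Proof.
move=> zr fd; have r0 : 0 < r by exact: le_lt_trans (normc_ge0 _) zr.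
have [q [qz fq]] := fd z (ltW zr).
have qd w : normc w <= r -> w != z -> cdiff q w.
  move=> wr wz; apply: cdiff_near (cdiff_quotient wz (fd w wr)).
  exists (normc (w - z)); first by rewrite normc_gt0 subr_eq0.
  move=> v vw; rewrite fq mulfK// subr_eq0; apply: contraTneq vw => ->.
  by rewrite normcB ltxx.
have qc w : normc w <= r -> ccont q w.
  by move=> wr; have [->//|wz] := eqVneq w z; apply: cdiff_cont; exact: qd.
have := @circ_mean _ (fun w => q w * w) z r zr.
rewrite mulr0 mulr0 => H.
have {}H : circ (fun w => q w * w) r = 0.
  apply: H => w wr; first by apply: ctendsM; [exact: qc|exact: ccont_id].
  by move=> wz; apply: cdiffM; [exact: qd|exact: cdiff_id].
have cm := cbm_cker zr; have fm := cbm_circ (ltW r0) fd.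
have qm : cbm 0 (2 * pi) (fun t => q (pt r t) * pt r t).
  apply: cbm_cont => t _; apply: (@rcont_pt _ (fun w => q w * w)).
  by apply: ctendsM; [apply: qc; rewrite normc_pt// ltW|exact: ccont_id].
rewrite [RHS]mulrC -(cint_cker zr) -cintZ// -[RHS]addr0 -H -cintD//; last first.
  by apply: cbmM => //; exact: cbm_cst.
apply: eq_cint => t _; have nz := ptB_neq0 t zr.
rewrite -{1}(subrK (f z) (f (pt r t))) fq mulrDl addrC; congr (_ + _).
by rewrite /cker; field.
Qed.

Definition poisson (r t : R) (z : C) : R := (r ^+ 2 - normc z ^+ 2) / normc (pt r t - z) ^+ 2.

Lemma poissonE r t z : normc z < r ->
  (poisson r t z)%:C = cker r t z + (conjc (cker r t z) - 1).
Proof.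
move=> zr; have nz := ptB_neq0 t zr.
have nc : conjc (pt r t) - conjc z != 0 by rewrite -rmorphB conjc_eq0.
have ck : conjc (cker r t z) = conjc (pt r t) / (conjc (pt r t) - conjc z).
  by rewrite /cker rmorphM /= conjc_inv rmorphB.
have -> : (poisson r t z)%:C = ((r ^+ 2)%:C - (normc z ^+ 2)%:C) / (normc (pt r t - z) ^+ 2)%:C.
  by rewrite /poisson rmorphM/= fmorphV rmorphB.
rewrite -(conj_pt r t) -!mulcJ rmorphB /=.
by rewrite ck /cker; field; rewrite nz nc.
Qed.

Lemma poisson_ge0 r t z : normc z < r -> 0 <= poisson r t z.
Proof.
move=> zr; rewrite divr_ge0 ?sqr_ge0// subr_ge0 ler_pXn2r ?nnegrE ?normc_ge0 ?(ltW zr)//.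
by rewrite (le_trans (normc_ge0 z))// ltW.
Qed.

Lemma cbm_poisson r z : normc z < r -> cbm 0 (2 * pi) (fun t => (poisson r t z)%:C).
Proof.
move=> zr; have cm := cbm_cker zr.
rewrite (_ : (fun t => _) = (fun t => cker r t z + (conjc (cker r t z) - 1))).
  by apply: cbmD => //; apply: cbmB; [exact: cbm_conj|exact: cbm_cst].
by apply/funext => t; rewrite poissonE.
Qed.

Lemma poisson_formula f r z : normc z < r -> (forall w, normc w <= r -> cdiff f w) ->
  cint 0 (2 * pi) (fun t => f (pt r t) * (poisson r t z)%:C) = (2 * pi)%:C * f z.
Proof.
move=> zr fd; have r0 : 0 < r by exact: le_lt_trans (normc_ge0 _) zr.
have cm := cbm_cker zr; have fm := cbm_circ (ltW r0) fd.
rewrite -(cauchy_formula zr fd) -[RHS]addr0 -(circ_poisson_conj zr fd) -cintD.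
- by apply: eq_cint => t _; rewrite poissonE// mulrDr.
- exact: cbmM.
- by apply: cbmM => //; apply: cbmB; [exact: cbm_conj|exact: cbm_cst].
Qed.

Definition ctrans (phi : R -> C) r z := cint 0 (2 * pi) (fun t => phi t * cker r t z).

Lemma cdiff_ctrans (phi : R -> C) r z : cbm 0 (2 * pi) phi -> normc z < r ->
  cdiff (ctrans phi r) z.
Proof.
move=> pm zr; have r0 : 0 < r by exact: le_lt_trans (normc_ge0 _) zr.
have pi2 : 0 <= 2 * pi by rewrite mulr_ge0// pi_ge0.
pose k w t : C := phi t * pt r t * (pt r t - z)^-1.
have km : cbm 0 (2 * pi) (k z) by apply: cbmM; [apply: cbmM => //; exact: cbm_pt|exact: cbm_ptV].
pose e := (r - normc z) / 2; have e0 : 0 < e by rewrite divr_gt0// subr_gt0.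
have ze w : normc (w - z) < e -> normc w + e <= r.
  move=> we; have := ler_normcB w z; rewrite /e in we *; lra.
(* Under the integral the difference quotient of the kernel is zeta / ((zeta - z) (zeta - w)).
   Outside the circle the plain quotient makes the identity hold, continuity being required at [z]
   alone. *)
pose Q w := if normc w < r then cint 0 (2 * pi) (fun t => k z t * (pt r t - w)^-1)
  else (ctrans phi r w - ctrans phi r z) / (w - z).
exists Q; split; last first.
  move=> w; rewrite /Q; case: ifPn => [wr|nwr]; last first.
    by rewrite divfK// subr_eq0; apply: contraNneq nwr => ->.
  have cw := cbmM pm (cbm_cker wr); have cz := cbmM pm (cbm_cker zr).
  rewrite mulrC -cintZ; last by apply: cbmM => //; exact: cbm_ptV.
  rewrite -cintB//; apply: eq_cint => t _; rewrite /k /cker.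
  by have n1 := ptB_neq0 t wr; have n2 := ptB_neq0 t zr; field; rewrite n1 n2.
have [M kM] := cbm_bound km.
have M0 : 0 <= M by rewrite (le_trans (normc_ge0 (k z 0)))// kM// lexx pi2.
pose B := M * (e^-1 * e^-1) * (2 * pi).
have B0 : 0 <= B by rewrite !mulr_ge0 ?invr_ge0 ?(ltW e0)// pi_ge0.
apply: (@ctends_squeeze _ _ _ _ _ _ (fun w => normc (w - z) * B)); last first.
  rewrite -[X in _ --> X](mul0r B); apply: cvgM; last exact: cvg_cst.
  apply/cvgrPdist_lt => d d0; exists d => // w; by rewrite sub0r normrN ger0_norm ?normc_ge0.
exists e => // w we; have wr : normc w < r by have := ze _ we; lra.
rewrite /Q wr zr -cintB; last 2 first.
- by apply: cbmM => //; exact: cbm_ptV.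
- by apply: cbmM => //; exact: cbm_ptV.
have -> : cint 0 (2 * pi) (fun t => k z t / (pt r t - w) - k z t / (pt r t - z)) =
   (w - z) * cint 0 (2 * pi) (fun t => k z t * ((pt r t - w)^-1 * (pt r t - z)^-1)).
  rewrite -cintZ; last by apply: cbmM => //; apply: cbmM; exact: cbm_ptV.
  apply: eq_cint => t _; have n1 := ptB_neq0 t wr; have n2 := ptB_neq0 t zr.
  by field; rewrite n1 n2.
rewrite normcM ler_wpM2l ?normc_ge0//.
have inve v t : normc v + e <= r -> normc (pt r t - v)^-1 <= e^-1.
  move=> ve; rewrite normcV lef_pV2 ?posrE//.
    by apply: le_trans (ptBgt t v (ltW r0)); lra.
  rewrite normc_gt0; apply: ptB_neq0; lra.
have cm : cbm 0 (2 * pi) (fun t => k z t * ((pt r t - w)^-1 * (pt r t - z)^-1)).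
  by apply: cbmM => //; apply: cbmM; exact: cbm_ptV.
have := @normc_cint_leM _ _ _ _ (M * (e^-1 * e^-1)) pi2 cm; rewrite subr0; apply.
have zee : normc z + e <= r by rewrite /e; lra.
move=> t /kM kt; rewrite normcM; apply: ler_pM; rewrite ?normc_ge0//.
rewrite normcM; apply: ler_pM; rewrite ?normc_ge0//; apply: inve => //.
exact: ze.
Qed.
End cauchy.

(** * Schwarz's lemma and the Borel-Caratheodory inequality *)

Section disc_functions.
Variable R : realType.
Local Notation C := R[i].
Local Notation pi := (@pi R).
Implicit Types (f g : C -> C) (z w a : C) (r : R).

Definition holo f := forall w, normc w < 1 -> cdiff f w.

Let pi2_gt0 : 0 < 2 * pi. Proof. by rewrite mulr_gt0// pi_gt0. Qed.

Lemma pi2C_neq0 : (2 * pi)%:C != 0 :> C.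
Proof. by rewrite -normc_eq0 normcR normr_eq0 gt_eqF. Qed.

Lemma holo_le f r : r < 1 -> holo f -> forall w, normc w <= r -> cdiff f w.
Proof. by move=> r1 fh w wr; apply: fh; exact: le_lt_trans r1. Qed.

Lemma mid_disc (x : R) : x < 1 -> x < (1 + x) / 2 /\ (1 + x) / 2 < 1.
Proof. by move=> x1; split; lra. Qed.

(** Dominated convergence carries Cauchy's formula on a circle to the limit, which up to the factor
    [2 * pi] is therefore the Cauchy transform of its own values. *)
Lemma holo_lim (F : nat -> C -> C) f M : (forall n, holo (F n)) ->
  (forall n w, normc w < 1 -> normc (F n w) <= M) ->
  (forall w, normc w < 1 -> ctends \oo (F ^~ w) (f w)) -> holo f.
Proof.
move=> Fh FM Ff z z1; have [zr r1] := mid_disc z1; set r := _ / 2 in zr r1.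
have r0 : 0 <= r by rewrite (le_trans (normc_ge0 z))// ltW.
have pt1 t : normc (pt r t) < 1 by rewrite normc_pt.
pose phi t := f (pt r t).
have Fm n : cbm 0 (2 * pi) (fun t => F n (pt r t)) by apply: cbm_circ => //; exact: holo_le.
have pm : cbm 0 (2 * pi) phi.
  by apply: (@cbm_lim _ _ _ (fun n t => F n (pt r t)) _ M) => // [n t _|t _]; [exact: FM|exact: Ff].
suff E w : normc w < r -> ctrans phi r w = (2 * pi)%:C * f w.
  apply: (@cdiff_near _ (fun w => (2 * pi)%:C^-1 * ctrans phi r w)).
    exists (r - normc z); first by rewrite subr_gt0.
    move=> w wz; rewrite E ?mulKf ?pi2C_neq0//; have := ler_normcB w z; lra.
  by apply: cdiffM; [exact: cdiff_cst|exact: cdiff_ctrans].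
move=> wr; have w1 : normc w < 1 by exact: lt_trans r1.
have km := cbm_cker wr; have [K hK] := cbm_bound km.
have pi20 := ltW pi2_gt0.
have M0 : 0 <= M by rewrite (le_trans (normc_ge0 (F 0%N w)))// FM.
apply: (@ctends_unique _ _ \oo _ (fun n => cint 0 (2 * pi) (fun t => F n (pt r t) * cker r t w))).
  rewrite /ctrans; apply: (@cint_dct _ _ _ (fun n t => F n (pt r t) * cker r t w) _ (M * K)).
  - by move=> n; exact: cbmM.
  - by move=> n t tt; rewrite normcM ler_pM ?normc_ge0// ?FM// hK.
  - exact: cbmM.
  - by apply: aeW => t _; apply: ctendsM; [exact: Ff|exact: ctends_cst].
apply: (@ctends_ext _ _ \oo _ (fun n => (2 * pi)%:C * F n w)).
  by apply: nearW => n; rewrite cauchy_formula//; exact: holo_le.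
by apply: ctendsM; [exact: ctends_cst|exact: Ff].
Qed.

Lemma geometric_le (x M K : R) : 0 <= x -> 0 <= M -> (forall n, x ^+ n <= K * M ^+ n) -> x <= M.
Proof.
move=> x0 M0 h; rewrite leNgt; apply/negP => Mx.
have [M00|Mp] := eqVneq M 0.
  by have := h 1%N; rewrite !expr1 M00 mulr0 leNgt -[X in X < x]M00 Mx.
have {}Mp : 0 < M by rewrite lt_def Mp.
pose d := x / M - 1.
have d0 : 0 < d by rewrite subr_gt0 ltr_pdivlMr// mul1r.
have bern n : 1 + n%:R * d <= (x / M) ^+ n.
  elim: n => [|n IH]; first by rewrite mul0r addr0 expr0.
  rewrite exprS -[x / M](subrK 1) -/d -natr1 mulrDl mul1r mulrDl mul1r.
  have nd : 0 <= n%:R * d by rewrite mulr_ge0// ltW.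
  have : d * (1 + n%:R * d) <= d * (x / M) ^+ n by rewrite ler_pM2l.
  rewrite -[x / M](subrK 1) -/d in IH *; have : 0 <= d * (n%:R * d) by rewrite mulr_ge0// ltW.
  clear -IH d0; move: (_ ^+ n) IH => y; lra.
have bK n : 1 + n%:R * d <= K.
  by apply: (le_trans (bern n)); rewrite expr_div_n ler_pdivrMr ?exprn_gt0.
have := bK (Num.truncn (K / d)).+1; have := truncnS_gt (K / d).
rewrite ltr_pdivrMr//; move: (_.+1%:R * d) => y; lra.
Qed.

(** Cauchy's formula for the powers of [f] gives |f(z)|^n <= K M^n, where [K] bounds the kernel and
    is independent of [n]; letting [n] grow removes [K]. *)
Lemma max_circle f r z M : 0 <= M -> normc z < r -> (forall w, normc w <= r -> cdiff f w) ->
  (forall t, normc (f (pt r t)) <= M) -> normc (f z) <= M.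
Proof.
move=> M0 zr fd fM; have r0 : 0 < r by exact: le_lt_trans (normc_ge0 _) zr.
have [K hK] := cbm_bound (cbm_cker zr).
have pi20 := ltW pi2_gt0.
apply: (@geometric_le _ _ K); rewrite ?normc_ge0// => n.
have fdn w : normc w <= r -> cdiff (fun v => f v ^+ n) w by move=> wr; apply: cdiffX; exact: fd.
have := cauchy_formula zr fdn => /(congr1 (@normc _)).
rewrite normcM normcR gtr0_norm// normcX => E.
rewrite -(ler_pM2l pi2_gt0) -E [leRHS]mulrC.
have cm : cbm 0 (2 * pi) (fun t => f (pt r t) ^+ n * cker r t z).
  by apply: cbmM; [apply: (@cbm_circ _ (fun v => f v ^+ n)) => //; exact: ltW|exact: cbm_cker].
have := @normc_cint_leM _ _ _ _ (K * M ^+ n) pi20 cm; rewrite subr0; apply => t tt.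
rewrite normcM mulrC; apply: ler_pM; rewrite ?normc_ge0 ?hK//.
by rewrite normcX lerXn2r ?nnegrE ?normc_ge0.
Qed.

Lemma cker_diff r t w z : normc w < r -> normc z < r ->
  cker r t w - cker r t z = (w - z) * (cker r t w * (pt r t - z)^-1).
Proof.
move=> wr zr; rewrite /cker; have n1 := ptB_neq0 t wr; have n2 := ptB_neq0 t zr.
by field; rewrite n1 n2.
Qed.

(** Near [a] the quotient coincides, up to the factor [2 * pi], with the Cauchy transform of f(zeta)
    / (zeta - a), which is differentiable also at [a]. *)
Lemma holo_div f a : holo f -> normc a < 1 -> f a = 0 ->
  exists2 q, holo q & forall w, f w = q w * (w - a).
Proof.
move=> fh a1 fa0; have [ar r1] := mid_disc a1; set r := _ / 2 in ar r1.
have fd := holo_le r1 fh; have r0 : 0 <= r by rewrite (le_trans (normc_ge0 a))// ltW.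
pose phi t := (2 * pi)%:C^-1 * (f (pt r t) * (pt r t - a)^-1).
have fm := cbm_circ r0 fd.
have pm : cbm 0 (2 * pi) phi.
  by apply: cbmM; [exact: cbm_cst|apply: cbmM => //; exact: cbm_ptV].
pose q w := if w == a then ctrans phi r a else f w / (w - a).
have qE w : normc w < r -> q w = ctrans phi r w.
  move=> wr; rewrite /q; case: eqVneq => [->//|wa].
  have wa0 : w - a != 0 by rewrite subr_eq0.
  apply: (mulIf wa0); rewrite divfK//; apply: (mulfI pi2C_neq0).
  have wm : cbm 0 (2 * pi) (fun t => f (pt r t) * cker r t w) by apply: cbmM => //; exact: cbm_cker.
  have am : cbm 0 (2 * pi) (fun t => f (pt r t) * cker r t a) by apply: cbmM => //; exact: cbm_cker.
  have -> : (2 * pi)%:C * f w = cint 0 (2 * pi) (fun t => f (pt r t) * cker r t w - f (pt r t) * cker r t a).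
    by rewrite (cintB wm am) !cauchy_formula// fa0 mulr0 subr0.
  have -> : (2 * pi)%:C * (ctrans phi r w * (w - a)) = ((2 * pi)%:C * (w - a)) * ctrans phi r w by ring.
  rewrite /ctrans -cintZ; last by apply: cbmM => //; exact: cbm_cker.
  apply: eq_cint => t _; rewrite -mulrBr cker_diff// /phi.
  by move: (cker r t w) ((2 * pi)%:C) pi2C_neq0 => k c p0; have n2 := ptB_neq0 t ar; field; rewrite n2 p0.
exists q; last first.
  move=> w; rewrite /q; case: eqVneq => [->|wa]; first by rewrite fa0 subrr mulr0.
  by rewrite divfK// subr_eq0.
move=> w w1; have [->|wa] := eqVneq w a.
  apply: (cdiff_near _ (cdiff_ctrans pm ar)); exists (r - normc a); first by rewrite subr_gt0.
  by move=> v va; rewrite qE//; have := ler_normcB v a; lra.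
apply: (@cdiff_near _ (fun v => (f v - f a) / (v - a))); last by apply: cdiff_quotient => //; exact: fh.
exists (normc (w - a)); first by rewrite normc_gt0 subr_eq0.
move=> v vw; rewrite /q fa0 subr0; case: eqVneq => // va; move: vw.
by rewrite va normcB ltxx.
Qed.

Definition bf a w : C :=
  if a == 0 then w else conjc a / `|a| * ((a - w) / (1 - conjc a * w)).

(* The pseudohyperbolic distance, and pp = 1 - psh ^ 2. *)
Definition psh a w : R := normc ((a - w) / (1 - conjc a * w)).

Definition pp a w : R := (1 - normc a ^+ 2) * (1 - normc w ^+ 2) / normc (1 - conjc a * w) ^+ 2.

Lemma conjM_neq0 a w : normc a < 1 -> normc w < 1 -> 1 - conjc a * w != 0.
Proof.
move=> a1 w1; rewrite -normc_gt0; apply: lt_le_trans (ler_normcB _ _).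
rewrite normc1 normcM normc_conj subr_gt0.
by apply: le_lt_trans (ler_wpM2l (normc_ge0 a) (ltW w1)) _; rewrite mulr1.
Qed.

Lemma normc_conjM_sym a w : normc (1 - conjc a * w) = normc (1 - conjc w * a).
Proof.
by rewrite -normc_conj rmorphB rmorphM /= conjcK conjc1 mulrC.
Qed.

Lemma psh_sym a w : psh a w = psh w a.
Proof. by rewrite /psh !normc_div normcB normc_conjM_sym. Qed.

Lemma pp_sym a w : pp a w = pp w a.
Proof. by rewrite /pp normc_conjM_sym [_ * (1 - _)]mulrC. Qed.

Lemma norm_identity a w :
  normc (1 - conjc a * w) ^+ 2 - normc (a - w) ^+ 2 = (1 - normc a ^+ 2) * (1 - normc w ^+ 2).
Proof.
rewrite !normc_sqr; case: a => x y; case: w => u v; rewrite !(ReB, ImB, cReM, cImM) /conjc /=; ring.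
Qed.

Lemma psh_pp a w : normc a < 1 -> normc w < 1 -> psh a w ^+ 2 = 1 - pp a w.
Proof.
move=> a1 w1; have n := conjM_neq0 a1 w1; rewrite /psh /pp -norm_identity normc_div.
have n0 : normc (1 - conjc a * w) != 0 by rewrite normc_eq0.
by field.
Qed.

Lemma normc_bf a w : normc (bf a w) = psh a w.
Proof.
rewrite /bf /psh; case: eqVneq => [->|a0].
  by rewrite conjc0 mul0r subr0 divr1 sub0r normcN.
rewrite normcM !normc_div normc_conj -[`|a|]/((normc a)%:C) normcR ger0_norm ?normc_ge0//.
by rewrite divff ?mul1r// normc_eq0.
Qed.

Lemma sqr_lt1 (x : R) : 0 <= x -> x < 1 -> x ^+ 2 < 1.
Proof. by move=> x0 x1; rewrite expr_lt1. Qed.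

Lemma pp_gt0 a w : normc a < 1 -> normc w < 1 -> 0 < pp a w.
Proof.
move=> a1 w1; rewrite divr_gt0//.
  by rewrite mulr_gt0// subr_gt0 sqr_lt1 ?normc_ge0.
by rewrite exprn_gt0// normc_gt0 conjM_neq0.
Qed.

Lemma pp_le1 a w : normc a < 1 -> normc w < 1 -> pp a w <= 1.
Proof. by move=> a1 w1; rewrite -subr_ge0 -psh_pp// sqr_ge0. Qed.

Lemma psh_lt1 a w : normc a < 1 -> normc w < 1 -> psh a w < 1.
Proof.
move=> a1 w1; rewrite -(@expr_lt1 _ 2)// ?normc_ge0// psh_pp//.
by rewrite gtrBl pp_gt0.
Qed.

Lemma psh_ge0 a w : 0 <= psh a w. Proof. exact: normc_ge0. Qed.

Lemma cdiff_bf a w : normc a < 1 -> normc w < 1 -> cdiff (bf a) w.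
Proof.
move=> a1 w1; rewrite /bf; case: eqVneq => a0; first exact: cdiff_id.
apply: cdiffM; first exact: cdiff_cst.
apply: cdiff_div; first exact: conjM_neq0.
  by apply: cdiffB; [exact: cdiff_cst|exact: cdiff_id].
by apply: cdiffB; [exact: cdiff_cst|apply: cdiffM; [exact: cdiff_cst|exact: cdiff_id]].
Qed.

(** Schwarz's lemma with the quotient kept. On the circle of radius [r] the factor [bf a] has
    squared modulus at least 1 - k (1 - r^2), so the maximum principle bounds [g z] by a quantity
    that tends to 1 with [r]. *)
Lemma schwarz_div f a : holo f -> normc a < 1 -> f a = 0 ->
  (forall w, normc w < 1 -> normc (f w) <= 1) ->
  exists g, [/\ holo g, forall w, normc w < 1 -> normc (g w) <= 1 &
    forall w, normc w < 1 -> f w = bf a w * g w].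
Proof.
move=> fh a1 fa0 f1; have [q qh fq] := holo_div fh a1 fa0.
pose c : C := if a == 0 then 1 else - (conjc a / `|a|)^-1.
have c0 : a != 0 -> conjc a / `|a| != 0.
  by move=> a0; rewrite mulf_neq0 ?conjc_eq0// invr_neq0// normr_eq0.
pose g w := c * (q w * (1 - conjc a * w)).
have gE w : normc w < 1 -> f w = bf a w * g w.
  move=> w1; have n := conjM_neq0 a1 w1; rewrite fq /g /c /bf; case: eqVneq => [->|a0].
    by rewrite conjc0 mul0r !subr0 mulr1 mul1r mulrC.
  by have := c0 a0; move: (_ / `|a|) => d d0; field; rewrite d0 n.
have gh : holo g.
  move=> w w1; apply: cdiffM; first exact: cdiff_cst.
  apply: cdiffM; first exact: qh.
  by apply: cdiffB; [exact: cdiff_cst|apply: cdiffM; [exact: cdiff_cst|exact: cdiff_id]].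
exists g; split => // z z1.
pose k := (1 - normc a ^+ 2) / (1 - normc a) ^+ 2.
have k0 : 0 < k by rewrite divr_gt0 ?exprn_gt0 ?subr_gt0// sqr_lt1 ?normc_ge0.
have ppk r w : normc w = r -> r < 1 -> pp a w <= k * (1 - r ^+ 2).
  move=> wr r1; rewrite /pp /k wr mulrAC ler_wpM2r//.
    by rewrite subr_ge0 ltW// sqr_lt1// -wr normc_ge0.
  rewrite ler_wpM2l ?subr_ge0 ?(ltW (sqr_lt1 (normc_ge0 _) a1))//.
  have h : 1 - normc a <= normc (1 - conjc a * w).
    apply: le_trans (ler_normcB _ _); rewrite normc1 normcM normc_conj lerB//.
    by rewrite ler_piMr ?normc_ge0// wr ltW.
  rewrite lef_pV2 ?posrE ?exprn_gt0 ?subr_gt0//; last by rewrite (lt_le_trans _ h)// subr_gt0.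
  by rewrite ler_pXn2r ?nnegrE ?normc_ge0// subr_ge0 ltW.
have key r : normc z < r -> r < 1 -> k * (1 - r ^+ 2) < 1 -> normc (g z) ^+ 2 * (1 - k * (1 - r ^+ 2)) <= 1.
  move=> zr r1 kr; have r0 : 0 < r by exact: le_lt_trans (normc_ge0 _) zr.
  have x0 : 0 < 1 - k * (1 - r ^+ 2) by rewrite subr_gt0.
  set x := _ - _ in x0 *.
  have : normc (g z) <= Num.sqrt x^-1.
    apply: (max_circle _ zr); first exact: sqrtr_ge0.
      exact: holo_le gh.
    move=> t; have w1 : normc (pt r t) < 1 by rewrite normc_pt ?(ltW r0).
    rewrite -[normc _]ger0_norm ?normc_ge0// -sqrtr_sqr ler_wsqrtr//.
    rewrite -[X in _ <= X]mul1r ler_pdivlMr//.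
    have := f1 _ w1; rewrite gE// normcM normc_bf => h.
    have h2 : (psh a (pt r t) * normc (g (pt r t))) ^+ 2 <= 1 by rewrite expr_le1// mulr_ge0 ?normc_ge0.
    apply: le_trans h2; rewrite exprMn mulrC ler_wpM2r ?sqr_ge0// psh_pp// lerB//.
    by apply: ppk => //; rewrite normc_pt// ltW.
  move=> h; have : normc (g z) ^+ 2 <= Num.sqrt x^-1 ^+ 2 by rewrite lerXn2r ?nnegrE ?normc_ge0 ?sqrtr_ge0.
  by rewrite sqr_sqrtr ?invr_ge0 ?(ltW x0)// -[X in _ <= X]mul1r ler_pdivlMr.
rewrite leNgt; apply/negP => g1.
have g2 : 1 < normc (g z) ^+ 2 by rewrite expr_gt1// normc_ge0.
set s := _ ^+ 2 in g2 key.
have s0 : 0 < s := lt_trans ltr01 g2.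
have u0 : 0 < (s - 1) / (2 * k * s).
  apply: divr_gt0; first by rewrite subr_gt0.
  by apply: mulr_gt0; [apply: mulr_gt0|].
set u := _ / _ in u0.
have sz : normc z ^+ 2 < 1 by rewrite sqr_lt1 ?normc_ge0.
(* The radius used is [Num.sqrt (1 - v)]; it exceeds [normc z]. Since [k * u = (1 - s^-1) / 2], the
   estimate [key] for this radius, [s * (1 - k * v) <= 1], is violated when [s > 1]. *)
pose v := Num.min (u / 2) ((1 - normc z ^+ 2) / 2).
have z0 : 0 < 1 - normc z ^+ 2 by rewrite subr_gt0.
have v0 : 0 < v by rewrite lt_min; apply/andP; split; apply: divr_gt0.
have v1 : v < 1 - normc z ^+ 2.
  by rewrite gt_min; apply/orP; right; rewrite ltr_pdivrMr// ltr_pMr// ltr1n.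
have vle1 : v < 1 by apply: lt_le_trans v1 _; rewrite gerBl sqr_ge0.
have vu : v < u by rewrite gt_min; apply/orP; left; rewrite ltr_pdivrMr// ltr_pMr// ltr1n.
have rE : Num.sqrt (1 - v) ^+ 2 = 1 - v by rewrite sqr_sqrtr// subr_ge0 ltW.
have kv : k * v < 1 - s^-1.
  have : k * v < k * u by rewrite ltr_pM2l.
  have -> : k * u = (1 - s^-1) / 2 by rewrite /u; field; rewrite !gt_eqF.
  have : 0 < 1 - s^-1 by rewrite subr_gt0 invf_lt1.
  lra.
have := key (Num.sqrt (1 - v)); rewrite rE opprB addrCA subrr addr0.
move=> H; have {H} : s * (1 - k * v) <= 1.
  apply: H.
  - rewrite -(@ltr_pXn2r _ 2)// ?nnegrE ?normc_ge0 ?sqrtr_ge0// rE ltrBrDl -ltrBrDr.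
    by move: v1; rewrite ltrBrDl addrC -ltrBrDr.
  - by rewrite -(@expr_lt1 _ 2)// ?sqrtr_ge0// rE gtrBl.
  - by apply: (lt_trans kv); rewrite gtrBl invr_gt0.
rewrite mulrC -ler_pdivlMr// mul1r => h; clear -h kv; lra.
Qed.

Lemma schwarz_pick0 f a w : holo f -> normc a < 1 -> f a = 0 ->
  (forall w, normc w < 1 -> normc (f w) <= 1) -> normc w < 1 -> normc (f w) <= psh a w.
Proof.
move=> fh a1 fa0 f1 w1; have [g [_ g1 fE]] := schwarz_div fh a1 fa0 f1.
by rewrite fE// normcM normc_bf ler_piMr ?psh_ge0// g1.
Qed.

(** The Cayley transform (h - h(a)) / (h + conj h(a)) sends the right half-plane to the disc and
    vanishes at [a], so that Schwarz's lemma bounds it by [psh a w]. The positive shift [d] keeps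
    the denominator away from 0 and is removed at the end. *)
Lemma borel_caratheodory f a w : holo f -> (forall w, normc w < 1 -> 0 <= complex.Re (f w)) ->
  normc a < 1 -> normc w < 1 ->
  normc (f w - f a) <= 2 * psh a w / (1 - psh a w) * complex.Re (f a).
Proof.
move=> fh f0 a1 w1; set q := psh a w.
have q1 : q < 1 by exact: psh_lt1.
have q0 : 0 <= q by exact: psh_ge0.
set K := 2 * q / (1 - q).
have K0 : 0 <= K by rewrite divr_ge0 ?mulr_ge0// subr_ge0 ltW.
have main d : 0 < d -> normc (f w - f a) <= K * (complex.Re (f a) + d).
  move=> d0; pose ha := f a + d%:C; pose h v := f v + d%:C.
  have hpos v : normc v < 1 -> 0 < complex.Re (h v).
    by move=> v1; rewrite ReD /= ltr_wpDl// f0.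
  have rha : 0 < complex.Re ha by exact: hpos.
  have den v : normc v < 1 -> h v + conjc ha != 0.
    move=> v1; apply/eqP => /(congr1 (@complex.Re R)); rewrite ReD /=.
    have := hpos v v1; case: (ha) rha => x y /= x0 hv0 E; move: (addr_gt0 hv0 x0).
    by rewrite E ltxx.
  pose k v := (h v - ha) / (h v + conjc ha).
  have hh v : normc v < 1 -> cdiff h v by move=> v1; apply: cdiffD; [exact: fh|exact: cdiff_cst].
  have kh : holo k.
    move=> v v1; apply: cdiff_div; first exact: den.
      by apply: cdiffB; [exact: hh|exact: cdiff_cst].
    by apply: cdiffD; [exact: hh|exact: cdiff_cst].
  have k1 v : normc v < 1 -> normc (k v) <= 1.
    move=> v1; rewrite normc_div ler_pdivrMr ?normc_gt0 ?den// mul1r.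
    rewrite -(@ler_pXn2r _ 2)// ?nnegrE ?normc_ge0// !normc_sqr.
    move: (hpos _ v1) rha; case: (h v) => x y; case: (ha) => x' y' /= p p'.
    rewrite -subr_ge0 (_ : _ - _ = 4 * (x * x')); last by ring.
    by rewrite !mulr_ge0// ltW.
  have ka : k a = 0 by rewrite /k /h -/ha subrr mul0r.
  have := schwarz_pick0 kh a1 ka k1 w1; rewrite -/q normc_div ler_pdivrMr ?normc_gt0 ?den//.
  have -> : h w - ha = f w - f a by rewrite /h /ha; ring.
  have -> : h w + conjc ha = (f w - f a) + (2 * complex.Re ha)%:C.
    rewrite /h /ha; case: (f w) => x y; case: (f a) => x' y'.
    by apply: complex_ext; rewrite /conjc /=; ring.
  move=> H; have := le_trans H (ler_wpM2l q0 (le_normcD _ _)).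
  rewrite normcR ger0_norm ?mulr_ge0 ?(ltW rha)// => {}H.
  have raE : complex.Re ha = complex.Re (f a) + d by rewrite ReD.
  rewrite /K -raE mulrAC ler_pdivlMr ?subr_gt0//.
  move: (normc _) (complex.Re ha) H => x y H; clear -H; lra.
rewrite leNgt; apply/negP => lt.
have K1 : 0 < K + 1 by rewrite ltr_wpDl.
set D := normc (f w - f a) - K * complex.Re (f a).
have D0 : 0 < D by rewrite subr_gt0.
have := main (D / (K + 1)) (divr_gt0 D0 K1); rewrite mulrDr -lerBlDl -/D.
rewrite mulrA ler_pdivlMr// mulrDr mulr1 mulrC gerDl; lra.
Qed.
End disc_functions.

(** * Square roots of zero-free functions *)

Section holomorphic_sqrt.
Variable R : realType.
Local Notation C := R[i].
Local Notation pi := (@pi R).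
Implicit Types (f g F G : C -> C) (z w a : C) (r s : R).

Lemma holo_lip f s : holo f -> s < 1 -> 0 <= s ->
  exists2 K, 0 <= K & forall w z, normc w <= s -> normc z <= s -> normc (f w - f z) <= K * normc (w - z).
Proof.
move=> fh s1 s0; have [sr r1] := mid_disc s1; set r := _ / 2 in sr r1.
have r0 : 0 <= r by exact: le_trans (ltW sr).
have pi2_gt0 : 0 < 2 * pi by rewrite mulr_gt0// pi_gt0.
have fm := cbm_circ r0 (holo_le r1 fh); have [M hM] := cbm_bound fm.
have M0 : 0 <= M by apply: le_trans (hM 0 _); rewrite ?normc_ge0// lexx ltW.
have e0 : 0 < r - s by rewrite subr_gt0.
exists (M * (r * (r - s)^-1 * (r - s)^-1)).
  by apply: mulr_ge0 => //; apply: mulr_ge0; [apply: mulr_ge0|]; rewrite ?invr_ge0 ?(ltW e0).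
move=> w z ws zs; have wr : normc w < r by exact: le_lt_trans sr.
have zr : normc z < r by exact: le_lt_trans sr.
have mw : cbm 0 (2 * pi) (fun t => f (pt r t) * cker r t w) by apply: cbmM => //; exact: cbm_cker.
have mz : cbm 0 (2 * pi) (fun t => f (pt r t) * cker r t z) by apply: cbmM => //; exact: cbm_cker.
have mk : cbm 0 (2 * pi) (fun t => f (pt r t) * (cker r t w * (pt r t - z)^-1)).
  by apply: cbmM => //; apply: cbmM; [exact: cbm_cker|exact: cbm_ptV].
have E : (2 * pi)%:C * (f w - f z) = (w - z) * cint 0 (2 * pi) (fun t => f (pt r t) * (cker r t w * (pt r t - z)^-1)).
  rewrite mulrBr -(cauchy_formula wr (holo_le r1 fh)) -(cauchy_formula zr (holo_le r1 fh)) -(cintB mw mz) -(cintZ _ mk).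
  by apply: eq_cint => t _; rewrite -mulrBr cker_diff// mulrCA.
rewrite -(ler_pM2l pi2_gt0); have := congr1 (@normc _) E.
rewrite !normcM normcR (gtr0_norm pi2_gt0) => ->.
rewrite mulrC mulrA ler_wpM2r ?normc_ge0//.
have inve v t : normc v <= s -> normc (pt r t - v)^-1 <= (r - s)^-1.
  move=> vs; have vr : normc v < r by exact: le_lt_trans sr.
  rewrite normcV lef_pV2 ?posrE// ?normc_gt0 ?ptB_neq0//.
  by apply: le_trans (ptBgt t v r0); rewrite lerB.
have := @normc_cint_leM _ _ _ _ (M * (r * (r - s)^-1 * (r - s)^-1)) (ltW pi2_gt0) mk.
rewrite subr0 [X in _ -> _ <= X]mulrC; apply => t tt.
rewrite normcM; apply: ler_pM; rewrite ?normc_ge0 ?hM//.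
rewrite normcM; apply: ler_pM; rewrite ?normc_ge0 ?inve//.
rewrite /cker normcM; apply: ler_pM; rewrite ?normc_ge0 ?inve//.
by rewrite normc_pt.
Qed.

Definition psqrt w : C := let v := sqrtc w in if complex.Re v < 0 then - v else v.

Lemma psqrt_sqr w : psqrt w ^+ 2 = w.
Proof. by rewrite /psqrt; case: ifP => _; rewrite ?sqrrN sqr_sqrtc. Qed.

Lemma psqrt_Re w : 0 < complex.Re w -> 0 < complex.Re (psqrt w).
Proof.
move=> w0; have h : 0 <= complex.Re (psqrt w).
  by rewrite /psqrt; case: ltP => // h; rewrite ReN oppr_ge0 ltW.
rewrite lt_def h andbT; apply/eqP => e; move: w0.
rewrite -(psqrt_sqr w) expr2 cReM e mul0r sub0r ltNge -oppr_ge0 opprK.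
by rewrite -expr2 sqr_ge0.
Qed.

Lemma ccont_psqrt w : 0 < complex.Re w -> ccont psqrt w.
Proof.
move=> w0 e e0; have s0 := psqrt_Re w0; set s := complex.Re (psqrt w) in s0.
exists (Num.min (complex.Re w) (e * s)); first by rewrite lt_min w0 mulr_gt0.
move=> v; rewrite lt_min => /andP[v1 v2].
have v0 : 0 < complex.Re v.
  have := le_lt_trans (ler_Re_normc _) v1; rewrite ReB ltr_norml => /andP[h _].
  by move: h; rewrite ltrBrDl addrN.
have t0 := psqrt_Re v0.
have ts : s < normc (psqrt v + psqrt w).
  by apply: lt_le_trans (Re_le_normc _); rewrite ReD ltrDr.
have E : normc (psqrt v - psqrt w) * normc (psqrt v + psqrt w) = normc (v - w).
  by rewrite -normcM -subr_sqr !psqrt_sqr.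
rewrite -(ltr_pM2r s0); apply: le_lt_trans v2; rewrite -E.
by rewrite ler_wpM2l ?normc_ge0// ltW.
Qed.

(** Along the segment from 0 to [z] the quotient of the two roots is continuous with values 1 and
    -1; a change of sign would give its real part a zero. *)
Lemma sqrt_unique (F : C -> C) G G' z : F 0 != 0 -> G 0 = G' 0 ->
  (forall t, 0 <= t <= 1 -> [/\ ccont G (t%:C * z), ccont G' (t%:C * z), F (t%:C * z) != 0,
     G (t%:C * z) ^+ 2 = F (t%:C * z) & G' (t%:C * z) ^+ 2 = F (t%:C * z)]) ->
  G z = G' z.
Proof.
move=> F0 GG H.
have nz t : 0 <= t <= 1 -> G' (t%:C * z) != 0.
  by move=> /H[_ _ Ft _ E]; apply: contraNneq Ft => G0; rewrite -E G0 expr0n.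
pose q t := G (t%:C * z) / G' (t%:C * z).
have q2 t : 0 <= t <= 1 -> q t = 1 \/ q t = -1.
  move=> t1; have [_ _ _ E1 E2] := H _ t1; have n := nz _ t1.
  have : q t ^+ 2 = 1 by rewrite expr_div_n E1 -E2 divff// expf_neq0.
  by move/eqP; rewrite sqrf_eq1 => /orP[/eqP|/eqP]; [left|right].
have qc t : 0 <= t <= 1 -> {for t, continuous (fun t => complex.Re (q t))}.
  move=> t1; have [c1 c2 _ _ _] := H _ t1.
  have tc : ctends (nbhs t) (fun s => s%:C * z) (t%:C * z).
    apply: ctendsM; last exact: ctends_cst.
    by apply: ctends_ReIm => /=; [exact: cvg_id|exact: cvg_cst].
  apply: ctends_Re; apply: ctends_div; first exact: nz.
    exact: ctends_comp c1.
  exact: ctends_comp c2.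
have h0 : 0 <= (0 : R) <= 1 by rewrite lexx ler01.
have h1 : 0 <= (1 : R) <= 1 by rewrite lexx ler01.
have q0 : q 0 = 1 by have := nz _ h0; rewrite /q mul0r GG => n; rewrite divff.
have q1 : q 1 = 1.
  have [//|qm] := q2 _ h1.
  have cw : {within `[0, 1], continuous (fun t => complex.Re (q t))}.
    by apply: continuous_in_subspaceT => t; rewrite inE/= in_itv/= => /qc.
  have := @IVT R (fun t => complex.Re (q t)) 0 1 0 ler01 cw.
  rewrite q0 qm ReN /= => H0; have {H0} : exists2 c, c \in `[0, 1] & complex.Re (q c) = 0.
    by apply: H0; rewrite ge_min le_max lerN10 ler01 orbT.
  move=> [c]; rewrite in_itv/= => /q2[] -> /eqP; rewrite ?ReN /= ?oppr_eq0 oner_eq0//.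
have := nz _ h1; move: q1; rewrite /q mul1r => E n.
by rewrite -[LHS](divfK n) E mul1r.
Qed.

Lemma ctends_prod (T I : Type) (FF : set_system T) (Fil : Filter FF) (s : seq I) (h : I -> T -> C) (l : I -> C) :
  (forall i, ctends FF (h i) (l i)) ->
  ctends FF (fun x => \prod_(i <- s) h i x) (\prod_(i <- s) l i).
Proof.
move=> hl; elim: s => [|i s IH].
  by apply: ctends_ext (ctends_cst _); apply: filterE => x; rewrite !big_nil.
rewrite big_cons; apply: ctends_ext (ctendsM (hl i) IH).
by apply: filterE => x; rewrite big_cons.
Qed.

(* The product of the principal roots of F(j w / N) / F((j - 1) w / N) for 1 <= j <= N. *)
Lemma local_sqrt F s (g0 : C) : holo F -> (forall w, normc w < 1 -> F w != 0) -> 0 < s -> s < 1 ->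
  g0 ^+ 2 = F 0 -> exists G, [/\ G 0 = g0, forall w, normc w <= s -> ccont G w &
    forall w, normc w <= s -> G w ^+ 2 = F w].
Proof.
move=> Fh F0 s0 s1 g0E.
have [K K0 FK] := holo_lip Fh s1 (ltW s0).
have Vh : holo (fun w => (F w)^-1) by move=> w w1; apply: cdiffV; [exact: F0|exact: Fh].
have [K' K'0 VK] := holo_lip Vh s1 (ltW s0).
pose B := normc (F 0)^-1 + K' * s.
have VB w : normc w <= s -> normc (F w)^-1 <= B.
  move=> ws; rewrite -[(F w)^-1](subrK (F 0)^-1) (le_trans (le_normcD _ _))// addrC lerD2l.
  have z0 : normc (0 : C) <= s by rewrite normc0 ltW.
  by rewrite (le_trans (VK _ _ ws z0))// subr0 ler_wpM2l.
(* With the Lipschitz constant [K] of [F] and the bound [B] of its inverse, each quotient of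
   consecutive values differs from 1 by less than 1, hence lies in the right half-plane, where
   [psqrt] is continuous. *)
pose N := (Num.truncn (K * B)).+1.
have NN : K * B < N%:R by exact: truncnS_gt.
have N0 : 0 < N%:R :> R by rewrite ltr0n.
pose x (j : nat) w : C := (j%:R / N%:R)%:C * w.
have xs j w : (j <= N)%N -> normc w <= s -> normc (x j w) <= s.
  move=> jN ws; rewrite normcM normcR ger0_norm ?divr_ge0// (le_trans _ ws)//.
  by rewrite ler_piMl ?normc_ge0// ler_pdivrMr// mul1r ler_nat.
have s_1 w : normc w <= s -> normc w < 1 by move=> ws; exact: le_lt_trans s1.
pose rt j w := F (x j.+1 w) / F (x j w).
have rtRe j w : (j < N)%N -> normc w <= s -> 0 < complex.Re (rt j w).
  move=> jN ws; have w1 := xs _ _ jN ws; have w2 := xs _ _ (ltnW jN) ws.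
  have E : rt j w - 1 = (F (x j.+1 w) - F (x j w)) * (F (x j w))^-1.
    by rewrite /rt mulrBl divff// F0// s_1.
  have : normc (rt j w - 1) < 1.
    rewrite E normcM.
    have d : normc (x j.+1 w - x j w) <= N%:R^-1.
      rewrite /x -mulrBl -rmorphB /= -mulrBl -natrB ?leqnSn// subSnn mul1r.
      rewrite normcM normcR ger0_norm ?invr_ge0 ?(ltW N0)// ler_piMr ?invr_ge0 ?(ltW N0)//.
      exact: le_trans ws (ltW s1).
    have d1 : normc (F (x j.+1 w) - F (x j w)) <= K * N%:R^-1.
      by rewrite (le_trans (FK _ _ w1 w2))// ler_wpM2l.
    apply: le_lt_trans (ler_pM (normc_ge0 _) (normc_ge0 _) d1 (VB _ w2)) _.
    by rewrite mulrAC ltr_pdivrMr// mul1r.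
  move=> h; have := le_lt_trans (ler_Re_normc _) h; rewrite ReB ltr_norml => /andP[h1 _].
  by move: h1; rewrite /= ltrBrDl addrN.
have rtc j w : (j < N)%N -> normc w <= s -> ccont (rt j) w.
  move=> jN ws; have w1 := xs _ _ jN ws; have w2 := xs _ _ (ltnW jN) ws.
  have cx i : cdiff (x i) w by apply: cdiffM; [exact: cdiff_cst|exact: cdiff_id].
  apply: cdiff_cont; apply: cdiff_div; first exact: F0 (s_1 _ w2).
    by apply: (@cdiff_comp _ F); [exact: cx|apply: Fh; exact: s_1].
  by apply: (@cdiff_comp _ F); [exact: cx|apply: Fh; exact: s_1].
exists (fun w => g0 * \prod_(j < N) psqrt (rt j w)); split.
- rewrite big1 ?mulr1// => j _; rewrite /rt /x !mulr0 divff; last by apply: F0; rewrite normc0.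
  by rewrite /psqrt sqrtc1 /= ltNge ler01.
- move=> w ws; apply: ctendsM; first exact: ctends_cst.
  apply: ctends_prod => j; apply: (ctends_comp _ (rtc _ _ (ltn_ord j) ws) (ccont_psqrt _)).
  exact: rtRe.
- move=> w ws; rewrite exprMn g0E -prodrXl (eq_bigr (fun j : 'I_N => rt j w)); last by move=> j _; rewrite psqrt_sqr.
  have T n : (n <= N)%N -> F 0 * \prod_(j < n) rt j w = F (x n w).
    elim: n => [|n IH] nN; first by rewrite big_ord0 mulr1 /x !mul0r.
    rewrite big_ord_recr /= mulrA IH ?(ltnW nN)// /rt mulrC divfK//.
    by apply: F0; apply: s_1; apply: xs => //; exact: ltnW.
  by rewrite T// /x divff ?gt_eqF// mul1r.
Qed.

(** The roots on the discs of radius [m w] agree by [sqrt_unique] and glue to one continuous root.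
    It is differentiable because G(v) - G(w) = (F(v) - F(w)) / (G(v) + G(w)). *)
Lemma holo_sqrt F : holo F -> (forall w, normc w < 1 -> F w != 0) ->
  exists2 G, holo G & forall w, normc w < 1 -> G w ^+ 2 = F w.
Proof.
move=> Fh F0; pose g0 := sqrtc (F 0).
have g0E : g0 ^+ 2 = F 0 by exact: sqr_sqrtc.
have F00 : F 0 != 0 by apply: F0; rewrite normc0.
have ex s : exists G, 0 < s -> s < 1 -> [/\ G 0 = g0, forall w, normc w <= s -> ccont G w &
    forall w, normc w <= s -> G w ^+ 2 = F w].
  have [s0|] := ltP 0 s; last by exists id.
  have [s1|] := ltP s 1; last by exists id.
  by have [G hG] := local_sqrt Fh F0 s0 s1 g0E; exists G.
have [H HP] := choice ex.
pose m w := (1 + normc w) / 2.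
have mP w : normc w < 1 -> [/\ 0 < m w, normc w < m w & m w < 1].
  move=> w1; have [h1 h2] := mid_disc w1; split => //.
  exact: le_lt_trans (normc_ge0 _) h1.
pose G w := H (m w) w.
have GE s w : 0 < s -> s < 1 -> normc w <= s -> G w = H s w.
  move=> s0 s1 ws; have w1 : normc w < 1 by exact: le_lt_trans s1.
  have [m0 wm m1] := mP _ w1; have [a1 a2 a3] := HP _ m0 m1; have [b1 b2 b3] := HP _ s0 s1.
  apply: (@sqrt_unique F (H (m w)) (H s)) => //; first by rewrite a1 b1.
  move=> t /andP[t0 t1]; have tw : normc (t%:C * w) <= normc w.
    by rewrite normcM normcR ger0_norm// ler_piMl ?normc_ge0.
  have tm := le_trans tw (ltW wm); have ts := le_trans tw ws.
  by split; [exact: a2|exact: b2|apply: F0; exact: le_lt_trans w1|exact: a3|exact: b3].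
have G2 w : normc w < 1 -> G w ^+ 2 = F w.
  by move=> w1; have [m0 wm m1] := mP _ w1; have [_ _ a3] := HP _ m0 m1; apply: a3; exact: ltW.
have Gc w : normc w < 1 -> ccont G w.
  move=> w1; have [m0 wm m1] := mP _ w1; have [_ a2 _] := HP _ m0 m1.
  rewrite /ccont (GE _ _ m0 m1 (ltW wm)); apply: ctends_ext (a2 _ (ltW wm)).
  exists (m w - normc w); first by rewrite subr_gt0.
  move=> v vw; apply/esym/GE => //; have := ler_normcB v w; move: vw; clear; lra.
exists G => // w w1.
have Gw0 : G w != 0 by have := F0 _ w1; rewrite -G2//; apply: contraNneq => ->; rewrite expr0n.
have GG0 : G w + G w != 0 by rewrite -mulr2n mulrn_eq0.
have [p [pc Fp]] := Fh _ w1.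
have Gcw := Gc _ w1.
have sumc : ctends (cnear w) (fun v => G v + G w) (G w + G w).
  by apply: ctendsD => //; exact: ctends_cst.
exists (fun v => if (normc v < 1) && (G v + G w != 0) then p v / (G v + G w) else (G v - G w) / (v - w)); split.
  rewrite /ccont w1 GG0 /=; apply: ctends_ext (ctends_div GG0 pc sumc).
  have [d d0 dP] := sumc _ (etrans (normc_gt0 _) GG0).
  exists (Num.min d (1 - normc w)); first by rewrite lt_min d0 subr_gt0.
  move=> v; rewrite lt_min => /andP[vd vw].
  have v1 : normc v < 1 by have := ler_normcB v w; move: vw; clear; lra.
  rewrite v1 /=; case: eqVneq => // e; have := dP _ vd; rewrite e sub0r normcN ltxx//.
move=> v; case: ifPn => [/andP[v1 n]|].
  rewrite mulrAC -Fp; apply: (mulIf n); rewrite divfK//.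
  by rewrite -subr_sqr !G2.
move=> h; rewrite divfK// subr_eq0; apply: contraNneq h => ->.
by rewrite w1 GG0.
Qed.
End holomorphic_sqrt.

(** * Radial limits (Fatou's theorem) *)

Section summable_steps.
Variable R : realType.
Local Notation C := R[i].

(** Both [s] and [s + x] are nondecreasing and bounded above, and [x] is their difference. *)
Lemma cvg_of_summable_steps (x : nat -> R) (B : R) :
  (forall N, \sum_(n < N) `|x n.+1 - x n| <= B) -> exists l : R, x n @[n --> \oo] --> l.
Proof.
move=> hB; pose s n : R := \sum_(k < n) `|x k.+1 - x k|.
have sS n : s n.+1 = s n + `|x n.+1 - x n| by rewrite /s big_ord_recr.
have xs n : x n - x 0%N <= s n.
  elim: n => [|n IH]; first by rewrite subrr /s big_ord0.
  by rewrite sS; have := ler_norm (x n.+1 - x n); move: IH; clear; lra.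
have c1 : cvgn s.
  apply: nondecreasing_is_cvgn; first by apply/nondecreasing_seqP => n; rewrite sS lerDl.
  by exists B => _ [n _ <-]; exact: hB.
have c2 : cvgn (fun n => s n + x n).
  apply: nondecreasing_is_cvgn.
    apply/nondecreasing_seqP => n; rewrite sS.
    by have := ler_norm (- (x n.+1 - x n)); rewrite normrN; clear; lra.
  exists (B + (B + x 0%N)) => _ [n _ <-].
  by have := hB n; have := xs n; rewrite -/(s n); clear; lra.
move/cvg_ex: c1 => [l1 h1]; move/cvg_ex: c2 => [l2 h2].
exists (l2 - l1); rewrite (_ : x = (fun n => s n + x n - s n)); first exact: cvgB.
by apply/funext => n; rewrite addrC addKr.
Qed.

Lemma ctends_of_summable_steps (z : nat -> C) (B : R) :
  (forall N, \sum_(n < N) normc (z n.+1 - z n) <= B) -> exists l, ctends \oo z l.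
Proof.
move=> hB.
have [a ha] : exists l : R, complex.Re (z n) @[n --> \oo] --> l.
  apply: (@cvg_of_summable_steps _ B) => N; apply: le_trans (hB N); apply: ler_sum => i _.
  by rewrite -ReB ler_Re_normc.
have [b hb] : exists l : R, complex.Im (z n) @[n --> \oo] --> l.
  apply: (@cvg_of_summable_steps _ B) => N; apply: le_trans (hB N); apply: ler_sum => i _.
  by rewrite -ImB ler_Im_normc.
by exists (a +i* b); exact: ctends_ReIm.
Qed.
End summable_steps.

(** * Square means over circles and convergence along a sequence of radii *)

Section square_means.
Variable R : realType.
Local Notation C := R[i].
Local Notation pi := (@pi R).
Local Notation mu := (@lebesgue_measure R).
Variables (f : C -> C) (M : R).
Hypothesis fh : holo f.
Hypothesis fM : forall w, normc w < 1 -> normc (f w) <= M.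

Let pi2_gt0 : 0 < 2 * pi. Proof. by rewrite mulr_gt0// pi_gt0. Qed.

Lemma cdiff_conjconj (g : C -> C) z : cdiff g (conjc z) -> cdiff (fun w => conjc (g (conjc w))) z.
Proof.
move=> [q [qc gq]]; exists (fun w => conjc (q (conjc w))); split.
  move=> e /qc[d d0 dP]; exists d => // w wz; rewrite -rmorphB normc_conj; apply: dP.
  by rewrite -rmorphB normc_conj.
by move=> w; rewrite -rmorphB gq rmorphM rmorphB /= !conjcK.
Qed.

(* cross r s depends on r * s only, by Goursat in logarithmic coordinates; hence sqmean is mid-convex
   and bounded, thus monotone, and f is L^2-Cauchy along suitable radii. *)
Definition cross r s := cint 0 (2 * pi) (fun t => f (pt r t) * conjc (f (pt s t))).
Definition sqmean x := rint 0 (2 * pi) (fun t => normc (f (pt (expR (- (x / 2))) t)) ^+ 2).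

Lemma cross_invariant r s r' s' : 0 < r < 1 -> 0 < s < 1 -> 0 < r' < 1 -> 0 < s' < 1 ->
  r * s = r' * s' -> cross r s = cross r' s'.
Proof.
move=> r1 s1 r'1 s'1 e.
(* For [u * v = m] the reflection of w to conj(m / w) takes [pt u t] to [pt v t]. Hence [cross u v]
   is the integral of [h] over the circle of radius [u], and [h] is analytic between two such
   circles. *)
pose m := r * s; pose h w := f w * conjc (f (conjc (m%:C / w))).
have m0 : 0 < m by case/andP: r1 => r0 _; case/andP: s1 => s0 _; exact: mulr_gt0.
have hE u v : 0 < u < 1 -> 0 < v < 1 -> u * v = m -> cross u v = circ h u.
  move=> /andP[u0 _] /andP[v0 _] uv; apply: eq_cint => t _; rewrite /h; congr (_ * conjc (f _)).
  have u0' : u%:C != 0 :> C by rewrite -normc_eq0 normcR normr_eq0 gt_eqF.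
  have n : (cos t +i* sin t : C) != 0 by rewrite -normc_eq0 normc_cis oner_eq0.
  have E : m%:C / pt u t = v%:C * conjc (cos t +i* sin t).
    have -> : m%:C = u%:C * v%:C :> C by rewrite -uv rmorphM.
    apply: (mulIf n); rewrite /pt -[RHS]mulrA [conjc _ * _]mulrC mulcJ normc_cis expr1n mulr1.
    by field; rewrite u0' n.
  by rewrite E /pt rmorphM /= conjcK conjc_real.
have main u v u' v' : 0 < u < 1 -> 0 < v < 1 -> 0 < u' < 1 -> 0 < v' < 1 -> u * v = m -> u' * v' = m ->
    u <= u' -> cross u v = cross u' v'.
  move=> u1 v1 u'1 v'1 uv uv' uu; rewrite (hE u v)// (hE u' v')//.
  case/andP: (u1) => u0 ul1; case/andP: (u'1) => u'0 u'l1; case/andP: v1 => v0 vl1.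
  apply: circ_const => // w /andP[w1 w2].
  have w0 : 0 < normc w by exact: lt_le_trans w1.
  have wn : w != 0 by rewrite -normc_gt0.
  apply: cdiffM; first by apply: fh; exact: le_lt_trans u'l1.
  apply: (@cdiff_comp _ (fun v => conjc (f (conjc v))) (fun w => m%:C / w)).
    by apply: cdiff_div => //; [exact: cdiff_cst|exact: cdiff_id].
  apply: cdiff_conjconj; apply: fh; rewrite normc_conj normc_div normcR gtr0_norm//.
  rewrite ltr_pdivrMr// mul1r -uv; apply: lt_le_trans w1.
  by rewrite gtr_pMr.
have e' : r' * s' = m by [].
have [rr|rr] := leP r r'; first exact: main.
by apply/esym; apply: main => //; exact: ltW.
Qed.

Lemma expN_01 (x : R) : 0 < x -> 0 < expR (- x) < 1.
Proof. by move=> x0; rewrite expR_gt0 expR_lt1 oppr_lt0. Qed.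

Lemma cbm_f r : 0 < r < 1 -> cbm 0 (2 * pi) (fun t => f (pt r t)).
Proof.
move=> /andP[r0 r1]; apply: cbm_circ; first exact: ltW.
exact: holo_le.
Qed.

Lemma cross_sqmean x y : 0 < x -> 0 < y ->
  complex.Re (cross (expR (- x)) (expR (- y))) = sqmean (x + y).
Proof.
move=> x0 y0; have h0 : 0 < (x + y) / 2 by rewrite divr_gt0// addr_gt0.
rewrite (cross_invariant (expN_01 x0) (expN_01 y0) (expN_01 h0) (expN_01 h0)); last first.
  by rewrite -!expRD; congr expR; field.
rewrite /cross /sqmean /=; apply: eq_rint => t _.
by rewrite mulcJ.
Qed.

Lemma sqmean_dist x y : 0 < x -> 0 < y ->
  rint 0 (2 * pi) (fun t => normc (f (pt (expR (- x)) t) - f (pt (expR (- y)) t)) ^+ 2) =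
  sqmean (2 * x) + sqmean (2 * y) - 2 * sqmean (x + y).
Proof.
move=> x0 y0; have fx := cbm_f (expN_01 x0); have fy := cbm_f (expN_01 y0).
rewrite -(cross_sqmean x0 y0) /cross /=.
have sE z : sqmean (2 * z) = rint 0 (2 * pi) (fun t => normc (f (pt (expR (- z)) t)) ^+ 2).
  by rewrite /sqmean; apply: eq_rint => t _; congr (normc (f (pt (expR (- _)) t)) ^+ 2); field.
rewrite !sE; have [c1 _] := cbmM fx (cbm_conj fy).
rewrite -rintD; [|exact: cbm_norm2..].
rewrite -rintZ// -rintB; last 2 first.
- by apply: rbmD; exact: cbm_norm2.
- by apply: rbmM => //; exact: rbm_cst.
apply: eq_rint => t _; rewrite !normc_sqr.
by case: (f _) => a b; case: (f _) => c d; rewrite /conjc /= ; ring.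
Qed.

Lemma sqmean_bound x : 0 < x -> 0 <= sqmean x <= M ^+ 2 * (2 * pi).
Proof.
move=> x0; have x2 : 0 < x / 2 by rewrite divr_gt0.
have /andP[e0 e1] := expN_01 x2.
rewrite rint_ge0/=; last by move=> t _; rewrite sqr_ge0.
rewrite -[X in _ * X]subr0 -rint_cst ?(ltW pi2_gt0)//; apply: le_rint.
- by apply: cbm_norm2; apply: cbm_f; rewrite e0.
- exact: rbm_cst.
- by move=> t _; rewrite lerXn2r ?nnegrE ?normc_ge0// ?fM ?normc_pt ?(ltW e0)// (le_trans (normc_ge0 (f 0)))// fM// normc0.
Qed.

Let arith1 (a b c d : R) : 2 * b <= a + c -> d <= b - a -> d <= c - b.
Proof. by lra. Qed.
Let arith2 (n d a b c : R) : n <= b - a -> d <= c - b -> n + d <= c - a.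
Proof. by lra. Qed.
Let arith3 (n a b c : R) : n <= b - a -> b <= c -> 0 <= a -> n <= c.
Proof. by lra. Qed.

Let arith4 (x y : R) : 0 < x -> y <= x / 4 -> 2 * y < x.
Proof. by lra. Qed.

(** The variable is minus twice the logarithm of the radius. By mid-convexity, which is
    [sqmean_dist] being nonnegative, one increase by [d] repeats at every step of an arithmetic
    progression, against boundedness. *)
Lemma sqmean_noninc x y : 0 < x -> x < y -> sqmean y <= sqmean x.
Proof.
move=> x0 xy; rewrite leNgt; apply/negP => lt.
pose d := sqmean y - sqmean x; have d0 : 0 < d by rewrite subr_gt0.
pose p n := x + n%:R * (y - x).
have yx0 : 0 < y - x by rewrite subr_gt0.
have p0 n : 0 < p n by rewrite ltr_pwDl// mulr_ge0// ltW.
have cvx n : 2 * sqmean (p n.+1) <= sqmean (p n) + sqmean (p n.+2).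
  have h k : 0 < p k / 2 by rewrite divr_gt0.
  rewrite -subr_ge0; have := sqmean_dist (h n) (h n.+2).
  have -> : p n / 2 + p n.+2 / 2 = p n.+1 by rewrite /p -!natr1; field.
  have two k : 2 * (p k / 2) = p k by field.
  by rewrite !two => <-; apply: rint_ge0 => t _; rewrite sqr_ge0.
have inc n : d <= sqmean (p n.+1) - sqmean (p n).
  elim: n => [|n IH].
    by rewrite /p mul0r addr0 mul1r [x + _]addrC subrK.
  exact: arith1 (cvx n) IH.
have big n : n%:R * d <= sqmean (p n) - sqmean (p 0%N).
  elim: n => [|n IH]; first by rewrite mul0r subrr.
  by rewrite -natr1 mulrDl mul1r; exact: arith2 IH (inc n).
have B n : n%:R * d <= M ^+ 2 * (2 * pi).
  have /andP[_ h1] := sqmean_bound (p0 n); have /andP[h2 _] := sqmean_bound (p0 0%N).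
  exact: arith3 (big n) h1 h2.
have := B (Num.truncn (M ^+ 2 * (2 * pi) / d)).+1.
by rewrite leNgt -ltr_pdivrMr// truncnS_gt.
Qed.

(** If [sqmean (2 * a n)] is within 4^-n of the supremum [L], monotonicity puts
    [sqmean (a n.+1 + a n)] within 4^-n of [L] as well, and the expression in [sqmean_dist] is at
    most 2 L - 2 (L - 4^-n). *)
Lemma radii_exist : exists a : nat -> R, [/\ forall n, 0 < a n, forall n, a n <= n.+1%:R^-1 &
  forall n, rint 0 (2 * pi) (fun t => normc (f (pt (expR (- a n.+1)) t) - f (pt (expR (- a n)) t)) ^+ 2) <= 2 * 4^-1 ^+ n].
Proof.
pose S := [set sqmean x | x in [set x | 0 < x]].
have hS : has_sup S.
  split; first by exists (sqmean 1); exists 1 => //=.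
  by exists (M ^+ 2 * (2 * pi)) => _ [x /= x0 <-]; have /andP[] := sqmean_bound x0.
pose L := sup S.
have le_L x : 0 < x -> sqmean x <= L by move=> x0; apply: ub_le_sup; [case: hS|exists x].
have ex n : exists a, [/\ 0 < a, a <= n.+1%:R^-1 & L - 4^-1 ^+ n < sqmean (2 * a)].
  have e0 : 0 < 4^-1 ^+ n :> R by rewrite exprn_gt0// invr_gt0.
  have [_ [x /= x0 <-] h] := sup_adherent e0 hS.
  have n0 : 0 < n.+1%:R^-1 :> R by rewrite invr_gt0 ltr0n.
  exists (Num.min (x / 4) n.+1%:R^-1); split.
  - by rewrite lt_min n0 andbT divr_gt0.
  - by rewrite ge_min lexx orbT.
  - apply: (lt_le_trans h); apply: sqmean_noninc.
      by rewrite mulr_gt0// lt_min n0 andbT divr_gt0.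
    have : Num.min (x / 4) n.+1%:R^-1 <= x / 4 by rewrite ge_min lexx.
    exact: arith4.
have [a aP] := choice ex.
exists a; split => [n|n|n]; [by case: (aP n)|by case: (aP n)|].
have [a0 _ aL] := aP n; have [b0 _ bL] := aP n.+1.
rewrite sqmean_dist//.
have h1 := le_L _ (mulr_gt0 (ltr0Sn R 1) a0); have h2 := le_L _ (mulr_gt0 (ltr0Sn R 1) b0).
have h3 : L - 4^-1 ^+ n <= sqmean (a n.+1 + a n).
  have e0 : 4^-1 ^+ n.+1 <= 4^-1 ^+ n :> R.
    by rewrite exprS ler_piMl ?exprn_ge0 ?invr_ge0// invf_le1// ler1n.
  have [ab|ba] := leP (a n.+1) (a n).
    have [e|ne] := eqVneq (a n.+1) (a n).
      by rewrite e (_ : a n + a n = 2 * a n) ?ltW// mulr_natl mulr2n.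
    apply: (le_trans (ltW aL)); apply: sqmean_noninc; first by rewrite addr_gt0.
    by rewrite (_ : 2 * a n = a n + a n) ?ltrD2r ?lt_neqAle ?ne// mulr_natl mulr2n.
  apply: (@le_trans _ _ (sqmean (2 * a n.+1))); first by apply: ltW; apply: le_lt_trans bL; rewrite lerB.
  apply: sqmean_noninc; first by rewrite addr_gt0.
  by rewrite (_ : 2 * a n.+1 = a n.+1 + a n.+1) ?ltrD2l// mulr_natl mulr2n.
move: (sqmean (2 * a n.+1)) (sqmean (2 * a n)) (sqmean (a n.+1 + a n)) (4^-1 ^+ n) h1 h2 h3 => u v w e h1 h2 h3.
clear -h1 h2 h3; lra.
Qed.

Lemma ae_radial_sequence : exists a : nat -> R, [/\ forall n, 0 < a n, a n @[n --> \oo] --> 0 &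
  {ae mu, forall t, 0 <= t <= 2 * pi -> exists l, ctends \oo (fun n => f (pt (expR (- a n)) t)) l}].
Proof.
have [a [a0 an aI]] := radii_exist.
exists a; split => //.
  apply: (@squeeze_cvgr _ _ _ _ (cst 0) (fun n => n.+1%:R^-1)).
  - by apply: nearW => n; rewrite (ltW (a0 n))/=.
  - exact: cvg_cst.
  - exact: cvg_harmonic.
pose F n t := f (pt (expR (- a n)) t).
pose d n t := normc (F n.+1 t - F n t).
have Fm n : cbm 0 (2 * pi) (F n) by exact: cbm_f (expN_01 (a0 n)).
have dm n : rbm 0 (2 * pi) (d n) by apply: cbm_norm; exact: cbmB.
have dI n : rint 0 (2 * pi) (d n) <= (pi + 1) * 2^-1 ^+ n.
  pose p : R := 2 ^+ n; have p0 : 0 < p by rewrite exprn_gt0.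
  have pV : 2^-1 ^+ n = p^-1 by rewrite exprVn.
  have pV2 : 4^-1 ^+ n = (p * p)^-1 :> R by rewrite exprVn /p -exprMn -natrM.
  have := aI n; rewrite pV2 => H; rewrite pV.
  have d2m : rbm 0 (2 * pi) (fun t => normc (F n.+1 t - F n t) ^+ 2) by apply: cbm_norm2; exact: cbmB.
  (* The arithmetic-geometric mean inequality with weight [p = 2 ^+ n] turns the bound 2 / p^2 for
     the integral of the square into the bound pi / p + 1 / p for that of the modulus. *)
  apply: (@le_trans _ _ (rint 0 (2 * pi) (fun t => p^-1 / 2 + p / 2 * normc (F n.+1 t - F n t) ^+ 2))).
    apply: le_rint => //.
      apply: rbmD; first exact: (rbm_cst _ _ (p^-1 / 2)).
      by apply: rbmM => //; exact: (rbm_cst _ _ (p / 2)).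
    move=> t _; rewrite /d; move: (normc _) => x.
    rewrite -subr_ge0 (_ : _ - _ = p / 2 * (x - p^-1) ^+ 2); last by field; rewrite gt_eqF.
    by rewrite mulr_ge0 ?sqr_ge0// divr_ge0// ltW.
  rewrite (@rintD _ _ _ (cst (p^-1 / 2))); [|exact: rbm_cst|by apply: rbmM => //; exact: (rbm_cst _ _ (p / 2))].
  rewrite rint_cst ?(ltW pi2_gt0)// rintZ// subr0.
  have H2 : p / 2 * rint 0 (2 * pi) (fun t => normc (F n.+1 t - F n t) ^+ 2) <= p / 2 * (2 * (p * p)^-1).
    by rewrite ler_wpM2l// divr_ge0// ltW.
  apply: (le_trans (lerD (lexx _) H2)).
  by rewrite le_eqVlt; apply/orP; left; apply/eqP; field; rewrite gt_eqF.
pose D : set R := `[0, 2 * pi]%classic.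
have m01 : measurable D by exact: measurable_itv.
have md n : measurable_fun D (fun t => (d n t)%:E).
  by apply/measurable_EFinP; case: (dm n).
have d0 n t : (0 <= (d n t)%:E)%E by rewrite lee_fin normc_ge0.
have intS : (\int[mu]_(t in D) (\sum_(n <oo) (d n t)%:E) < +oo)%E.
  rewrite integral_nneseries//.
  apply: (@le_lt_trans _ _ (2 * (pi + 1))%:E); last exact: ltry.
  apply: lime_le.
    apply: is_cvg_nneseries => n _ _; apply: integral_ge0 => t _; exact: d0.
  apply: nearW => N; rewrite (eq_bigr (fun n => (rint 0 (2 * pi) (d n))%:E)); last first.
    by move=> n _; rewrite /rint /Rintegral fineK//; apply: integrable_fin_num => //; exact: rbm_integrable.
  rewrite sumEFin lee_fin.
  apply: (@le_trans _ _ (\sum_(0 <= n < N) (pi + 1) * 2^-1 ^+ n)); first by apply: ler_sum => n _; exact: dI.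
  have geo : \sum_(0 <= n < N) 2^-1 ^+ n = 2 - 2 * 2^-1 ^+ N :> R.
    elim: N => [|N IH]; first by rewrite big_geq// expr0 mulr1 subrr.
    by rewrite big_nat_recr//= IH exprS; field.
  rewrite -mulr_sumr geo [leRHS]mulrC; apply: ler_wpM2l; first by rewrite addr_ge0 ?pi_ge0.
  by rewrite gerBl mulr_ge0// exprn_ge0// invr_ge0.
have Sm : measurable_fun D (fun t => \sum_(n <oo) (d n t)%:E)%E.
  exact: ge0_emeasurable_sum.
have Si : mu.-integrable D (fun t => \sum_(n <oo) (d n t)%:E)%E.
  apply/integrableP; split => //; apply: le_lt_trans intS.
  by apply: ge0_le_integral => //; try exact: measurableT_comp; move=> t _; rewrite ?gee0_abs ?nneseries_ge0.
have Sae : {ae mu, forall t, D t -> (\sum_(n <oo) (d n t)%:E)%E \is a fin_num}.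
  by apply: integrable_ae Si; exact: measurable_itv.
move: Sae.
apply: (@filterS _ _ (ae_filter_ringOfSetsType mu)) => t ht tt.
have {}ht : (\sum_(n <oo) (d n t)%:E)%E \is a fin_num by apply: ht; rewrite /D /= in_itv.
apply: (@ctends_of_summable_steps _ _ (fine (\sum_(n <oo) (d n t)%:E)%E)) => N.
rewrite -lee_fin fineK// -sumEFin.
have := @nneseries_lim_ge R (fun n => (d n t)%:E) xpredT 0%N N.
by rewrite big_mkord; apply => *; exact: d0.
Qed.
End square_means.

(** * Boundary densities and the Poisson representation *)

Section fatou.
Variable R : realType.
Local Notation C := R[i].
Local Notation pi := (@pi R).
Local Notation mu := (@lebesgue_measure R).

Let pi2_gt0 : 0 < 2 * pi. Proof. by rewrite mulr_gt0// pi_gt0. Qed.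

Lemma poisson_le (r t : R) (z : C) : normc z < r -> poisson r t z <= r ^+ 2 / (r - normc z) ^+ 2.
Proof.
move=> zr; have r0 : 0 < r by exact: le_lt_trans (normc_ge0 _) zr.
have d0 : 0 < r - normc z by rewrite subr_gt0.
apply: ler_pM.
- by rewrite subr_ge0 lerXn2r ?nnegrE ?normc_ge0 ?(ltW zr) ?(ltW r0).
- by rewrite invr_ge0 sqr_ge0.
- by rewrite gerBl sqr_ge0.
- rewrite lef_pV2 ?posrE ?exprn_gt0 ?normc_gt0 ?ptB_neq0//.
  by rewrite lerXn2r ?nnegrE ?normc_ge0 ?(ltW d0)// ptBgt// ltW.
Qed.

Lemma fatou_density (f : C -> C) (M : R) : holo f -> (forall w, normc w < 1 -> normc (f w) <= M) ->
  exists a : nat -> R, exists phi : R -> C, [/\ a n @[n --> \oo] --> 0, forall n, 0 < a n,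
    cbm 0 (2 * pi) phi,
    {ae mu, forall t, 0 <= t <= 2 * pi -> ctends \oo (fun n => f (pt (expR (- a n)) t)) (phi t)} &
    forall z, normc z < 1 -> cint 0 (2 * pi) (fun t => phi t * (poisson 1 t z)%:C) = (2 * pi)%:C * f z].
Proof.
move=> fh fM; have [a [a0 ac ae_l]] := ae_radial_sequence fh fM.
have r01 n := expN_01 (a0 n).
have pt1 n t : normc (pt (expR (- a n)) t) < 1 by have /andP[h1 h2] := r01 n; rewrite normc_pt// ltW.
pose Fr n t := complex.Re (f (pt (expR (- a n)) t)); pose Fi n t := complex.Im (f (pt (expR (- a n)) t)).
(* Upper limits of the real and imaginary parts give a function that is measurable on the whole
   interval and equals the limit wherever the latter exists. *)
pose phi t : C := limn_sup (Fr ^~ t) +i* limn_sup (Fi ^~ t).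
have Fm n := cbm_f fh (r01 n).
have Frb n t : `|Fr n t| <= M by rewrite (le_trans (ler_Re_normc _))// fM.
have Fib n t : `|Fi n t| <= M by rewrite (le_trans (ler_Im_normc _))// fM.
have bnd (u : nat -> R) : (forall n, `|u n| <= M) -> has_ubound (range u) /\ has_lbound (range u).
  move=> uM; split; [exists M|exists (- M)] => _ [n _ <-]; have := uM n; rewrite ler_norml => /andP[]//.
have phic t l : ctends \oo (fun n => f (pt (expR (- a n)) t)) l -> phi t = l.
  move=> h; apply: complex_ext => /=.
    exact: (cvg_lim (@Rhausdorff R) (cvg_sups (ctends_Re h))).
  exact: (cvg_lim (@Rhausdorff R) (cvg_sups (ctends_Im h))).
have sup_bound (u : nat -> R) : (forall n, `|u n| <= M) -> `|limn_sup u| <= M.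
  move=> uM; have [ub lb] := bnd _ uM.
  have bf : bounded_fun u by exists M; split; [exact: num_real|move=> x Mx n _; exact: le_trans (uM n) (ltW Mx)].
  have c1 : cvgn (sups u).
    exact: nonincreasing_is_cvgn (nonincreasing_sups (bounded_fun_has_ubound bf)) (bounded_fun_has_lbound_sups bf).
  rewrite ler_norml; apply/andP; split.
    apply: limr_ge => //; apply: nearW => n; apply: (@le_trans _ _ (u n)).
      by have := uM n; rewrite ler_norml => /andP[].
    by apply: ub_le_sup; [exact: has_ubound_sdrop|exists n => //=].
  apply: limr_le => //; apply: nearW => n; apply: sup_le_ub; first by exists (u n); exists n => /=.
  by move=> _ [k _ <-]; have := uM k; rewrite ler_norml => /andP[].
have pm : cbm 0 (2 * pi) phi.
  split; split.
  - apply: measurable_fun_limn_sup; [by move=> t _; have [] := bnd _ (Frb ^~ t)|by move=> t _; have [] := bnd _ (Frb ^~ t)|].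
    by move=> n; case: (Fm n) => -[].
  - by exists M => t _; apply: sup_bound => n; exact: Frb.
  - apply: measurable_fun_limn_sup; [by move=> t _; have [] := bnd _ (Fib ^~ t)|by move=> t _; have [] := bnd _ (Fib ^~ t)|].
    by move=> n; case: (Fm n) => _ [].
  - by exists M => t _; apply: sup_bound => n; exact: Fib.
have ae_phi : {ae mu, forall t, 0 <= t <= 2 * pi -> ctends \oo (fun n => f (pt (expR (- a n)) t)) (phi t)}.
  by apply: (@filterS _ _ (ae_filter_ringOfSetsType mu) _ _ _ ae_l) => t h /h[l hl]; rewrite (phic _ _ hl).
exists a, phi; split => // z z1.
have ec : expR (- a n) @[n --> \oo] --> (1 : R).
  rewrite -[X in _ --> X](expR0 R) -[X in expR X]oppr0.
  by apply: continuous_cvg; [exact: continuous_expR|exact: cvgN].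
(* From the index [K] on, the radii exceed [s], midway between [normc z] and 1; for them the Poisson
   kernels at [z] are bounded uniformly. *)
have [zs s1] := mid_disc z1; set s := _ / 2 in zs s1.
have /cvgrPdist_lt /(_ (1 - s)) := ec; rewrite subr_gt0 => /(_ s1) [K _ hK].
have sr n : s < expR (- a (n + K)%N).
  have /= := hK (n + K)%N (leq_addl _ _); have /andP[_ h] := r01 (n + K)%N.
  by rewrite ger0_norm ?subr_ge0 ?(ltW h)// ltrD2l ltrN2.
have zr n : normc z < expR (- a (n + K)%N) by exact: lt_trans (sr n).
have cs : (fun n => expR (- a (n + K)%N)) n @[n --> \oo] --> (1 : R).
  by have := ec; rewrite -(cvg_shiftn K).
have M0 : 0 <= M by rewrite (le_trans (normc_ge0 (f z)))// fM.
have s0 : 0 < s - normc z by rewrite subr_gt0.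
apply: (@ctends_unique _ _ \oo _ (fun n => cint 0 (2 * pi) (fun t => f (pt (expR (- a (n + K)%N)) t) * (poisson (expR (- a (n + K)%N)) t z)%:C))); last first.
  apply: (@ctends_ext _ _ \oo _ (cst ((2 * pi)%:C * f z))); last exact: ctends_cst.
  apply: nearW => n; rewrite poisson_formula//.
  by apply: holo_le => //; case/andP: (r01 (n + K)%N).
apply: (@cint_dct _ _ _ (fun n t => f (pt (expR (- a (n + K)%N)) t) * (poisson (expR (- a (n + K)%N)) t z)%:C) _ (M * (1 / (s - normc z) ^+ 2))).
- by move=> n; apply: cbmM; [exact: Fm|exact: cbm_poisson].
- move=> n t _; rewrite normcM; apply: ler_pM; rewrite ?normc_ge0 ?fM//.
  rewrite normcR ger0_norm ?poisson_ge0//; apply: (le_trans (poisson_le t (zr n))).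
  have /andP[e0 e1] := r01 (n + K)%N.
  apply: ler_pM; rewrite ?sqr_ge0 ?invr_ge0 ?sqr_ge0//; first by rewrite expr_le1 ?(ltW e0) ?(ltW e1).
  have s' : s - normc z <= expR (- a (n + K)%N) - normc z by rewrite lerB// ltW.
  rewrite lef_pV2 ?posrE ?exprn_gt0//; last by exact: lt_le_trans s'.
  by rewrite lerXn2r ?nnegrE ?(ltW s0)// (le_trans (ltW s0)).
- by apply: cbmM => //; exact: cbm_poisson.
- apply: (@filterS _ _ (ae_filter_ringOfSetsType mu) _ _ _ ae_phi) => t h tt; apply: ctendsM.
    move=> e /(h tt)[N _ hN]; exists N => // n /= Nn; apply: hN => /=; exact: leq_trans (leq_addr _ _).
  have pc : ctends \oo (fun n => pt (expR (- a (n + K)%N)) t) (pt 1 t).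
    by apply: ctends_pt => //; exact: cvg_cst.
  have rc : ctends \oo (fun n => (expR (- a (n + K)%N) ^+ 2 - normc z ^+ 2)%:C) ((1 ^+ 2 - normc z ^+ 2)%:C).
    apply: ctends_ReIm => /=; last exact: cvg_cst.
    by apply: cvgB; [rewrite !expr2; exact: cvgM|exact: cvg_cst].
  have nz : pt 1 t - z != 0 by exact: ptB_neq0.
  have nc : (pt 1 t - z) * conjc (pt 1 t - z) != 0 by rewrite mulf_neq0// conjc_eq0.
  have dc : ctends \oo (fun n => (pt (expR (- a (n + K)%N)) t - z) * conjc (pt (expR (- a (n + K)%N)) t - z)) ((pt 1 t - z) * conjc (pt 1 t - z)).
    have d : ctends \oo (fun n => pt (expR (- a (n + K)%N)) t - z) (pt 1 t - z).
      by apply: ctendsB => //; exact: ctends_cst.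
    by apply: ctendsM => //; exact: ctends_conj.
  have E (r : R) : (poisson r t z)%:C = (r ^+ 2 - normc z ^+ 2)%:C / ((pt r t - z) * conjc (pt r t - z)).
    by rewrite /poisson rmorphM /= fmorphV mulcJ.
  rewrite E; apply: ctends_ext (ctends_div nc rc dc); apply: nearW => n; by rewrite E.
Qed.

Lemma rint_poisson1 (z : C) : normc z < 1 -> rint 0 (2 * pi) (fun t => poisson 1 t z) = 2 * pi.
Proof.
move=> z1; have := poisson_formula z1 (fun w _ => cdiff_cst 1 w).
rewrite mulr1 => /(congr1 (@complex.Re R)) /= H; rewrite -[RHS]H; apply: eq_rint => t _.
by rewrite ?cReM /= !(mul1r, mul0r, subr0).
Qed.

Lemma rbm_poisson1 (z : C) : normc z < 1 -> rbm 0 (2 * pi) (fun t => poisson 1 t z).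
Proof. by move=> z1; have [] := cbm_poisson z1. Qed.

Lemma poisson_le_bound (f : C -> C) (phi : R -> C) (M : R) : 0 <= M -> cbm 0 (2 * pi) phi ->
  (forall z, normc z < 1 -> cint 0 (2 * pi) (fun t => phi t * (poisson 1 t z)%:C) = (2 * pi)%:C * f z) ->
  {ae mu, forall t, 0 <= t <= 2 * pi -> normc (phi t) <= M} ->
  forall z, normc z < 1 -> normc (f z) <= M.
Proof.
move=> M0 pm fE aeM z z1.
have pP := cbmM pm (cbm_poisson z1).
rewrite -(ler_pM2l pi2_gt0); have := congr1 (@normc _) (fE z z1).
rewrite normcM normcR (gtr0_norm pi2_gt0) => <-.
apply: (le_trans (normc_cint_le pP)).
have -> : 2 * pi * M = rint 0 (2 * pi) (fun t => M * poisson 1 t z).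
  by rewrite rintZ; [rewrite rint_poisson1// mulrC|exact: rbm_poisson1].
rewrite /rint /Rintegral; apply: fine_le.
- by apply: integrable_fin_num => //; apply: rbm_integrable; exact: cbm_norm.
- by apply: integrable_fin_num => //; apply: rbm_integrable; apply: rbmM; [exact: rbm_cst|exact: rbm_poisson1].
- apply: ae_ge0_le_integral => //.
  + by move=> t _; rewrite lee_fin normc_ge0.
  + by apply/measurable_EFinP; case: (cbm_norm pP).
  + by move=> t _; rewrite lee_fin mulr_ge0// poisson_ge0.
  + by apply/measurable_EFinP; case: (rbmM (rbm_cst 0 (2 * pi) M) (rbm_poisson1 z1)).
  apply: (@filterS _ _ (ae_filter_ringOfSetsType mu) _ _ _ aeM) => t h; rewrite /= in_itv/= => /h ht.
  by rewrite lee_fin normcM normcR ger0_norm ?poisson_ge0// ler_wpM2r// poisson_ge0.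
Qed.
End fatou.

(** * Radial limits at Lebesgue points *)

Section radial_limits.
Variable R : realType.
Local Notation C := R[i].
Local Notation pi := (@pi R).
Local Notation mu := (@lebesgue_measure R).

Let pi2_gt0 : 0 < 2 * pi. Proof. by rewrite mulr_gt0// pi_gt0. Qed.

Lemma one_sub_cos (x : R) : 1 - cos x = 2 * sin (x / 2) ^+ 2.
Proof.
have -> : cos x = cos (x / 2 + x / 2) by congr cos; field.
rewrite cosD; have := cos2Dsin2 (x / 2); move: (cos _) (sin _) => c s h.
by rewrite -[1 in LHS]h; ring.
Qed.

Lemma one_sub_cos_near : exists2 d : R, 0 < d & forall x, `|x| < d -> x ^+ 2 / 4 <= 1 - cos x.
Proof.
have e0 : 0 < (1 / 4 : R) by [].
have [d d0 dP] := real_frechet (is_derive_sin (0 : R)) e0.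
exists d => // x xd; rewrite one_sub_cos.
have x2 : `|x / 2| < d.
  by rewrite normrM [`|2^-1|]ger0_norm// (le_lt_trans _ xd)// ler_piMr// invf_le1 ?ler1n.
have := dP _ x2; rewrite addr0 sin0 cos0 subr0 mul1r; set y := x / 2; set s := sin y.
have -> : x ^+ 2 / 4 = y ^+ 2 by rewrite /y; field.
rewrite -[X in X <= _ -> _]ger0_norm// => h.
have h2 : (s - y) ^+ 2 <= (y / 4) ^+ 2.
  rewrite -[(s - y) ^+ 2]real_normK ?num_real// -[(y / 4) ^+ 2]real_normK ?num_real//.
  rewrite lerXn2r ?nnegrE//; rewrite ger0_norm// in h; apply: (le_trans h).
  by rewrite normrM [`|4^-1|]ger0_norm// mulrC mul1r.
have : 0 <= (s - 2 * y) ^+ 2 by exact: sqr_ge0.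
have : 0 <= (4 * s - 3 * y) ^+ 2 by exact: sqr_ge0.
move: h2; rewrite !sqrrB ?exprMn; clear; nra.
Qed.

Lemma one_sub_cos_gt0 (x : R) : 0 < x -> x < 2 * pi -> 0 < 1 - cos x.
Proof.
move=> x0 x2; rewrite one_sub_cos mulr_gt0// exprn_gt0// sin_gt0_pi// divr_gt0//=.
by rewrite ltr_pdivrMr// mulrC.
Qed.

Lemma one_sub_cos_far (th eta : R) : 0 < th < 2 * pi -> 0 < eta ->
  exists2 m, 0 < m & forall t, 0 <= t <= 2 * pi -> eta <= `|t - th| -> m <= 1 - cos (t - th).
Proof.
move=> /andP[th0 th2] eta0.
have cc a b : {within `[a, b], continuous (fun t => 1 - cos (t - th))}.
  apply: continuous_subspaceT => t; apply: cvgB; first exact: cvg_cst.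
  apply: continuous_comp; last exact: continuous_cos.
  by apply: cvgB; [exact: cvg_id|exact: cvg_cst].
have [m1 m10 h1] : exists2 m, 0 < m & forall t, 0 <= t -> t <= th - eta -> m <= 1 - cos (t - th).
  have [ab|ba] := leP 0 (th - eta); last first.
    by exists 1 => // t t0 tt; have := lt_le_trans ba (le_trans t0 tt); rewrite ltxx.
  have [c] := EVT_min ab (cc 0 (th - eta)); rewrite in_itv/= => /andP[c0 c1] hc.
  exists (1 - cos (c - th)); last by move=> t t0 tt; apply: hc; rewrite in_itv/= t0.
  by rewrite -cosN opprB; apply: one_sub_cos_gt0; [rewrite subr_gt0; lra|lra].
have [m2 m20 h2] : exists2 m, 0 < m & forall t, th + eta <= t -> t <= 2 * pi -> m <= 1 - cos (t - th).
  have [ab|ba] := leP (th + eta) (2 * pi); last first.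
    by exists 1 => // t t0 tt; have := lt_le_trans ba (le_trans t0 tt); rewrite ltxx.
  have [c] := EVT_min ab (cc (th + eta) (2 * pi)); rewrite in_itv/= => /andP[c0 c1] hc.
  exists (1 - cos (c - th)); last by move=> t t0 tt; apply: hc; rewrite in_itv/= t0.
  by apply: one_sub_cos_gt0; [rewrite subr_gt0; lra|lra].
exists (Num.min m1 m2); first by rewrite lt_min m10.
move=> t /andP[t0 t2]; rewrite ler_normr => /orP[h|h].
  by rewrite ge_min h2 ?orbT//; lra.
by rewrite ge_min h1//; lra.
Qed.

Lemma ptB_norm2 (t r th : R) :
  normc (pt 1 t - pt r th) ^+ 2 = (1 - r) ^+ 2 + 2 * r * (1 - cos (t - th)).
Proof.
rewrite !ptE normc_sqr /= !mul1r cosB.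
have := cos2Dsin2 t; have := cos2Dsin2 th.
move: (cos t) (sin t) (cos th) (sin th) => c s c' s' h h'.
have -> : (c - r * c') ^+ 2 + (s - r * s') ^+ 2 = (c ^+ 2 + s ^+ 2) + r ^+ 2 * (c' ^+ 2 + s' ^+ 2) - 2 * r * (c * c' + s * s') by ring.
by rewrite h h'; ring.
Qed.

(** [th] is a Lebesgue point of [psi]; the mean is normalized by [rho], half the length of the
    interval. *)
Definition lebesgue_cond (psi : R -> R) (th : R) := forall e, 0 < e ->
  exists2 eta, 0 < eta & forall rho, 0 < rho -> rho <= eta ->
    rint (th - rho) (th + rho) (fun t => `|psi t - psi th|) <= e * rho.

Let dyadic (h eta : R) : 0 < h -> h <= eta / 2 -> exists J : nat, eta / 2 < 2 ^+ J * h <= eta.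
Proof.
move=> h0 he; have ex : exists J : nat, eta / 2 < 2 ^+ J * h.
  exists (Num.truncn (eta / 2 / h)).+1; rewrite -ltr_pdivrMr//.
  apply: (lt_le_trans (truncnS_gt _)); rewrite -natrX ler_nat ltnW// ltn_expl//.
case: (ex_minnP ex) => -[|J] hJ minJ; first by move: hJ; rewrite expr0 mul1r ltNge he.
have nJ : 2 ^+ J * h <= eta / 2.
  by rewrite leNgt; apply/negP => H; have := minJ _ H; rewrite ltnn.
by exists J.+1; rewrite hJ/= exprS -mulrA; move: nJ; move: (2 ^+ J * h) => x; lra.
Qed.

(** The Poisson kernel is an approximate identity. With [h = 1 - r] it is at most 2 / h everywhere,
    and at most 8 h / rho^2 at distances from [rho] to [eta]. On dyadic rings the Lebesgue condition
    makes the contributions a geometric series; the rest tends to 0 with [h]. *)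
Lemma poisson_radial_limit (psi : R -> R) (th : R) : rbm 0 (2 * pi) psi -> 0 < th < 2 * pi ->
  lebesgue_cond psi th -> forall e, 0 < e -> exists2 d, 0 < d & forall r, 1 - d < r -> r < 1 ->
  `|rint 0 (2 * pi) (fun t => psi t * poisson 1 t (pt r th)) - 2 * pi * psi th| <= e.
Proof.
move=> pm th02 Lc e e0; case/andP: (th02) => th0 th2.
have [_ [B0 hB0]] := pm.
pose g t := `|psi t - psi th|.
pose B := B0 + B0.
have gB t : 0 <= t <= 2 * pi -> g t <= B.
  move=> tt; rewrite (le_trans (ler_normB _ _))// lerD// hB0// (ltW th0) (ltW th2)//.
have B00 : 0 <= B by apply: le_trans (gB 0 _); rewrite ?normr_ge0 ?lexx ?(ltW pi2_gt0).
have gm : rbm 0 (2 * pi) g by apply: rbm_norm; apply: rbmB => //; exact: rbm_cst.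
pose e1 := e / 100; have e10 : 0 < e1 by rewrite divr_gt0.
have [eta0 eta00 Leta] := Lc _ e10.
have [d0 d00 near_cos] := one_sub_cos_near.
pose eta := Num.min (Num.min eta0 (d0 / 2)) (Num.min (th / 2) ((2 * pi - th) / 2)).
have eta_gt0 : 0 < eta by rewrite !lt_min eta00 !divr_gt0// subr_gt0.
have eta_le : [/\ eta <= eta0, eta < d0, eta < th & eta < 2 * pi - th].
  have k1 : eta <= eta0 by rewrite !ge_min lexx.
  have k2 : eta <= d0 / 2 by rewrite !ge_min lexx orbT.
  have k3 : eta <= th / 2 by rewrite !ge_min lexx !orbT.
  have k4 : eta <= (2 * pi - th) / 2 by rewrite !ge_min lexx !orbT.
  split=> //; [move: k2 d00|move: k3 th0|move: k4 th2]; move: (eta) (2 * pi) => u v; lra.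
case: eta_le => eta_1 eta_2 eta_3 eta_4.
have eta2 : 0 < eta / 2 by rewrite divr_gt0.
have [m m0 far_cos] := one_sub_cos_far th02 eta2.
pose d := Num.min (Num.min (1 / 2) (eta / 2)) (e1 / (4 * (B + 1) * (2 * pi) / m)).
have D0 : 0 < 4 * (B + 1) * (2 * pi) / m.
  by rewrite divr_gt0// mulr_gt0// mulr_gt0// ltr_wpDl.
exists d; first by rewrite !lt_min eta2 divr_gt0// divr_gt0.
move=> r rd r1; pose h := 1 - r.
have h0 : 0 < h by rewrite subr_gt0.
have hd : h < d by rewrite /h ltrBlDr addrC -ltrBlDr.
have [h2 [heta hfar]] : h < 1 / 2 /\ h < eta / 2 /\ h < e1 / (4 * (B + 1) * (2 * pi) / m).
  by move: hd; rewrite !lt_min => /andP[/andP[? ?] ?].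
have rh : r = 1 - h by rewrite /h; ring.
have r12 : 1 / 2 < r by rewrite rh; move: h2; lra.
have r0 : 0 < r by apply: lt_trans r12.
have z1 : normc (pt r th) < 1 by rewrite normc_pt// ltW.
pose K t := poisson 1 t (pt r th).
have K0 t : 0 <= K t by exact: poisson_ge0.
have Km : rbm 0 (2 * pi) K by exact: rbm_poisson1.
have KE t : K t = (1 - r ^+ 2) / (h ^+ 2 + 2 * r * (1 - cos (t - th))).
  by rewrite /K /poisson ptB_norm2 normc_pt ?(ltW r0)// expr1n.
have num : 0 <= 1 - r ^+ 2 <= 2 * h.
  have -> : 1 - r ^+ 2 = h * (2 - h) by rewrite rh; ring.
  by rewrite mulr_ge0 ?(ltW h0)//= ?subr_ge0 1?mulrC ?ler_wpM2r ?(ltW h0)// ?gerBl ?(ltW h0)//; move: h2; lra.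
case/andP: num => num0 num1.
have Kbound t q : 0 < q -> q <= h ^+ 2 + 2 * r * (1 - cos (t - th)) -> K t <= 2 * h / q.
  by move=> q0 hq; rewrite KE; apply: ler_pM => //; rewrite ?invr_ge0 ?(le_trans (ltW q0))// lef_pV2 ?posrE// (lt_le_trans q0).
have cos0 t : 0 <= 1 - cos (t - th) by rewrite subr_ge0 cos_le1.
have K1 t : K t <= 2 / h.
  have -> : 2 / h = 2 * h / h ^+ 2 by field; rewrite gt_eqF.
  by apply: Kbound; rewrite ?exprn_gt0// lerDl !mulr_ge0// ltW.
have K2 t rho : 0 < rho -> rho <= `|t - th| -> `|t - th| <= eta -> K t <= 8 * h / rho ^+ 2.
  move=> rho0 rt te; have -> : 8 * h / rho ^+ 2 = 2 * h / (rho ^+ 2 / 4) by field; rewrite gt_eqF.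
  apply: Kbound; first by rewrite divr_gt0// exprn_gt0.
  have c := near_cos _ (le_lt_trans te eta_2).
  have q : rho ^+ 2 <= (t - th) ^+ 2 by rewrite -[X in _ <= X]real_normK ?num_real// lerXn2r ?nnegrE// ltW.
  have w : 1 - cos (t - th) <= 2 * r * (1 - cos (t - th)).
    by rewrite ler_peMl// mulrC -ler_pdivrMr// ltW.
  have := sqr_ge0 h; move: c q w; move: (cos _) (h ^+ 2) (rho ^+ 2) ((t - th) ^+ 2) => c a b c' h1 h3 h4 h5.
  by move: (2 * r * (1 - c)) h4 => z; move: h1 h3 h5; lra.
have K3 t : 0 <= t <= 2 * pi -> eta / 2 <= `|t - th| -> K t <= 2 * h / m.
  move=> tt te; apply: Kbound => //; have c := far_cos _ tt te.
  have w : 1 - cos (t - th) <= 2 * r * (1 - cos (t - th)).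
    by rewrite ler_peMl// mulrC -ler_pdivrMr// ltW.
  by apply: (le_trans c); apply: (le_trans w); rewrite lerDr sqr_ge0.
have gKm : rbm 0 (2 * pi) (fun t => g t * K t) by exact: rbmM.
have main : rint 0 (2 * pi) (fun t => g t * K t) <= e.
  have [J /andP[J1 J2]] := dyadic h0 (ltW heta).
  pose rho j := 2 ^+ j * h.
  have rho0 j : 0 < rho j by rewrite mulr_gt0// exprn_gt0.
  have rhoS j : rho j.+1 = 2 * rho j by rewrite /rho exprS mulrA.
  have rhoJ j : (j <= J)%N -> rho j <= eta.
    by move=> jJ; apply: le_trans J2; rewrite ler_wpM2r ?(ltW h0)// ler_weXn2l// ler1n.
  have inD j : (j <= J)%N -> 0 <= th - rho j /\ th + rho j <= 2 * pi.
    move=> /rhoJ h1; split; first by rewrite subr_ge0 (le_trans h1)// ltW.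
    by rewrite -lerBrDl (le_trans h1)// ltW.
  (* The innermost interval contributes [2 * e1], and the ring from [rho j] to [rho j.+1] at most
     [16 * e1 * 2^-1 ^+ j], which is 32 e1 (2^-j - 2^-(j+1)): the sum telescopes to at most
     [34 * e1]. With the two far parts the total is [36 * e1 <= e]. *)
  have A j : (j <= J)%N -> rint (th - rho j) (th + rho j) (fun t => g t * K t) <= e1 * (34 - 32 * 2^-1 ^+ j).
    elim: j => [|j IH] jJ.
      have [i1 i2] := inD _ jJ.
      have gs := rbm_sub i1 i2 gm; have gKs := rbm_sub i1 i2 gKm.
      apply: (@le_trans _ _ (rint (th - rho 0%N) (th + rho 0%N) (fun t => 2 / h * g t))).
        apply: le_rint => //; first by apply: rbmM => //; exact: (rbm_cst _ _ (2 / h)).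
        by move=> t _; rewrite mulrC ler_wpM2r ?normr_ge0 ?K1.
      rewrite rintZ// expr0 mulr1.
      have L := Leta _ (rho0 0%N) (le_trans (rhoJ _ jJ) eta_1).
      have hh : 0 <= 2 / h by rewrite divr_ge0// ltW.
      apply: (le_trans (ler_wpM2l hh L)).
      by rewrite le_eqVlt; apply/orP; left; apply/eqP; rewrite /rho; field; rewrite gt_eqF.
    have [i1 i2] := inD _ jJ; have [i3 i4] := inD _ (ltnW jJ).
    have gs := rbm_sub i1 i2 gm; have gKs := rbm_sub i1 i2 gKm.
    have rr : rho j <= rho j.+1 by rewrite rhoS ler_peMl ?ltW// ltr1n.
    have a1 : th - rho j.+1 <= th - rho j by rewrite lerB.
    have a2 : th - rho j <= th + rho j by rewrite lerD2l ge0_cp// ltW.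
    have a3 : th + rho j <= th + rho j.+1 by rewrite lerD2l.
    rewrite (rint_split a1 (le_trans a2 a3) gKs).
    rewrite (rint_split a2 a3 (rbm_sub a1 (lexx _) gKs)).
    have L := Leta _ (rho0 j.+1) (le_trans (rhoJ _ jJ) eta_1).
    rewrite (rint_split a1 (le_trans a2 a3) gs) in L.
    rewrite (rint_split a2 a3 (rbm_sub a1 (lexx _) gs)) in L.
    have mid0 : 0 <= rint (th - rho j) (th + rho j) g by apply: rint_ge0 => t _; exact: normr_ge0.
    pose k := 8 * h / rho j ^+ 2.
    have k0 : 0 <= k by rewrite divr_ge0 ?sqr_ge0// mulr_ge0// ltW.
    have side a b : th - rho j.+1 <= a -> b <= th + rho j.+1 -> (forall t, a <= t <= b -> rho j <= `|t - th| /\ `|t - th| <= rho j.+1) ->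
        rint a b (fun t => g t * K t) <= k * rint a b g.
      move=> ha hb hab; rewrite -rintZ; last exact: rbm_sub gs.
      apply: le_rint.
      - exact: rbm_sub gKs.
      - by apply: rbmM; [exact: (rbm_cst _ _ k)|exact: rbm_sub gs].
      - move=> t /hab[t1 t2]; rewrite mulrC ler_wpM2r ?normr_ge0// K2// (le_trans t2)// rhoJ//.
    have s1 : rint (th - rho j.+1) (th - rho j) (fun t => g t * K t) <= k * rint (th - rho j.+1) (th - rho j) g.
      apply: side => //; first exact: le_trans a3.
      move=> t /andP[t1 t2]; have t3 : t - th <= - rho j by rewrite lerBlDl.
      rewrite ler0_norm; last by rewrite (le_trans t3)// oppr_le0 ltW.
      by rewrite lerNr t3 opprB lerBlDl -lerBlDr.
    have s2 : rint (th + rho j) (th + rho j.+1) (fun t => g t * K t) <= k * rint (th + rho j) (th + rho j.+1) g.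
      apply: side => //; first exact: le_trans a2.
      move=> t /andP[t1 t2]; have t3 : rho j <= t - th by rewrite lerBrDl.
      by rewrite ger0_norm ?t3 ?lerBlDl// (le_trans _ t3)// ltW.
    have kL : k * (e1 * rho j.+1) = 16 * e1 * 2^-1 ^+ j.
      rewrite /k rhoS /rho exprVn; field; rewrite ?gt_eqF ?expf_neq0//.
    have kk : k * (rint (th - rho j.+1) (th - rho j) g + rint (th + rho j) (th + rho j.+1) g) <= 16 * e1 * 2^-1 ^+ j.
      by rewrite -kL ler_wpM2l//; apply: le_trans L; rewrite lerD2l lerDr.
    have {}IH := IH (ltnW jJ).
    rewrite mulrDr in kk; apply: (le_trans (lerD s1 (lerD IH s2))).
    rewrite exprS; move: (2^-1 ^+ j) kk => x; move: (k * _) (k * _) => u v; lra.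
  have [i1 i2] := inD _ (leqnn J).
  have b1 : th - rho J <= th + rho J by rewrite lerD2l ge0_cp// ltW.
  have AJ := A _ (leqnn J).
  have AJ2 : rint (th - rho J) (th + rho J) (fun t => g t * K t) <= 34 * e1.
    apply: (le_trans AJ); rewrite mulrC ler_wpM2r ?(ltW e10)// gerBl mulr_ge0// exprn_ge0// invr_ge0//.
  have farI a b : 0 <= a -> a <= b -> b <= 2 * pi -> (forall t, a <= t <= b -> eta / 2 <= `|t - th|) ->
      rint a b (fun t => g t * K t) <= e1.
    move=> a0 ab b2 hab.
    apply: (@le_trans _ _ (rint a b (cst (B * (2 * h / m))))).
      apply: le_rint; [exact: rbm_sub gKm|exact: rbm_cst|].
      move=> t tt; have t02 : 0 <= t <= 2 * pi by case/andP: tt => t1 t2; rewrite (le_trans a0)//= (le_trans t2).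
      by apply: ler_pM; rewrite ?normr_ge0 ?gB ?K3 ?hab.
    rewrite rint_cst//; apply: (@le_trans _ _ (B * (2 * h / m) * (2 * pi))).
      apply: ler_wpM2l; first by rewrite mulr_ge0// divr_ge0 ?(ltW m0)// mulr_ge0// ltW.
      by rewrite (le_trans _ b2)// gerBl.
    have := hfar; rewrite ltr_pdivlMr// => H; apply: le_trans (ltW H).
    have -> : B * (2 * h / m) * (2 * pi) = h * (2 * B * (2 * pi) / m) by field; rewrite gt_eqF.
    rewrite ler_wpM2l ?(ltW h0)// ler_wpM2r ?invr_ge0 ?(ltW m0)// ler_wpM2r ?(ltW pi2_gt0)//.
    by move: B00; clear; lra.
  rewrite (rint_split i1 (le_trans b1 i2) gKm) (rint_split b1 i2 (rbm_sub i1 (lexx _) gKm)).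
  have f1 : rint 0 (th - rho J) (fun t => g t * K t) <= e1.
    apply: farI => //; first by rewrite (le_trans b1).
    move=> t /andP[t1 t2]; rewrite distrC ger0_norm ?subr_ge0 ?(le_trans t2) ?gerBl ?(ltW (rho0 J))//.
    by apply: (le_trans (ltW J1)); rewrite lerBrDr addrC -lerBrDr.
  have f2 : rint (th + rho J) (2 * pi) (fun t => g t * K t) <= e1.
    apply: farI => //; first by rewrite (le_trans i1).
    move=> t /andP[t1 t2]; rewrite ger0_norm ?subr_ge0 ?(le_trans _ t1) ?lerDl ?(ltW (rho0 J))//.
    by apply: (le_trans (ltW J1)); rewrite lerBrDr addrC.
  apply: (le_trans (lerD f1 (lerD AJ2 f2))); rewrite /e1; move: e0; clear; lra.
have -> : rint 0 (2 * pi) (fun t => psi t * poisson 1 t (pt r th)) - 2 * pi * psi th =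
    rint 0 (2 * pi) (fun t => (psi t - psi th) * K t).
  have E1 : 2 * pi * psi th = rint 0 (2 * pi) (fun t => psi th * K t).
    by rewrite rintZ// rint_poisson1// mulrC.
  rewrite E1 -rintB; [|exact: rbmM|by apply: rbmM => //; exact: (rbm_cst _ _ (psi th))].
  by apply: eq_rint => t _; rewrite mulrBl.
have fm : rbm 0 (2 * pi) (fun t => (psi t - psi th) * K t).
  by apply: rbmM => //; apply: rbmB => //; exact: rbm_cst.
apply: le_trans main; rewrite /rint; apply: (le_trans (le_normr_Rintegral _ (rbm_integrable fm))) => //.
by rewrite le_eqVlt; apply/orP; left; apply/eqP; apply: eq_Rintegral => t _; rewrite normrM (ger0_norm (K0 t)).
Qed.

Lemma ae_lebesgue_cond (psi : R -> R) : rbm 0 (2 * pi) psi ->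
  {ae mu, forall th, 0 < th < 2 * pi -> lebesgue_cond psi th}.
Proof.
move=> pm; pose D : set R := `[0, 2 * pi]%classic.
have pi_ := rbm_integrable pm.
have lI : locally_integrable setT (psi \_ D).
  by apply: integrable_locally_restrict; [exact: measurable_itv|exact: pi_].
have := lebesgue_differentiation lI.
apply: (@filterS _ _ (ae_filter_ringOfSetsType mu)) => th + /andP[th0 th2] e e0.
rewrite /lebesgue_pt => /fine_cvgP[finD cv].
(* The closed interval of half-length [rho] is enclosed in the open ball of radius [2 * rho], whose
   measure [4 * rho] turns a mean of at most [e / 4] into an integral of at most [e * rho]. *)
have e4 : 0 < e / 4 by rewrite divr_gt0.
move/cvgrPdist_lt : cv => /(_ _ e4).
move=> nearD; have := filterI finD nearD => -[d /= d0 dP].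
pose eta := Num.min (d / 4) (Num.min (th / 4) ((2 * pi - th) / 4)).
have eta0 : 0 < eta by rewrite !lt_min !divr_gt0// subr_gt0.
exists eta => // rho rho0 re.
have [k1 k2 k3] : [/\ 2 * rho < d, 2 * rho < th & 2 * rho < 2 * pi - th].
  move: re; rewrite !le_min => /andP[k1 /andP[k2 k3]].
  split; [move: k1 d0|move: k2 th0|move: k3 th2]; move: rho0; move: (2 * pi) => u; lra.
have s0 : 0 < 2 * rho by rewrite mulr_gt0.
have : ball (0 : R) d (2 * rho) by rewrite /ball /= sub0r normrN gtr0_norm.
move=> /dP /(_ s0)[fin1]; rewrite sub0r normrN; set Y := davg _ _ _ in fin1 * => H1.
pose G t := `|(psi \_ D) t - (psi \_ D) th|.
have inD t : 0 <= t <= 2 * pi -> (psi \_ D) t = psi t.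
  by move=> tt; rewrite patchE ifT// inE /D /= in_itv.
have muB : mu (ball th (2 * rho)) = (4 * rho)%:E.
  rewrite lebesgue_measure_ball ?ltW//; congr _%:E; rewrite -mulr_natr; ring.
pose X := (\int[mu]_(t in ball th (2 * rho)) (G t)%:E)%E.
have XY : X = ((4 * rho)%:E * Y)%E.
  rewrite /Y /davg /iavg muB inver gt_eqF ?mulr_gt0// muleA -EFinM divff ?gt_eqF ?mulr_gt0// mul1e.
  by [].
have le1 : ((rint (th - rho) (th + rho) (fun t => `|psi t - psi th|))%:E <= X)%E.
  have sub t : th - rho <= t <= th + rho -> 0 <= t <= 2 * pi.
    by move=> /andP[t1 t2]; apply/andP; split; [move: t1 k2|move: t2 k3]; move: rho0; move: (2 * pi) => u; lra.
  have gm : rbm (th - rho) (th + rho) (fun t => `|psi t - psi th|).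
    apply: (@rbm_sub _ 0 (2 * pi)).
    - by move: k2 rho0; lra.
    - by move: k3 rho0; move: (2 * pi) => u; lra.
    - by apply: rbm_norm; apply: rbmB => //; exact: rbm_cst.
  rewrite /rint /Rintegral fineK; last by apply: integrable_fin_num => //; exact: rbm_integrable.
  apply: (@le_trans _ _ (\int[mu]_(t in `[(th - rho)%R, (th + rho)%R]) (G t)%:E)%E).
    rewrite le_eqVlt; apply/orP; left; apply/eqP; apply: eq_integral => t; rewrite inE/= in_itv/= => /sub tt.
    by rewrite /G !inD// (ltW th0) (ltW th2).
  apply: ge0_subset_integral => //.
  - by apply: measurable_ball.
  - apply/measurable_EFinP; apply: measurableT_comp => //; apply: measurable_funB; last exact: measurable_cst.
    by case: lI => lI1 _ _; exact: measurable_funS lI1.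
  - by move=> t _; rewrite lee_fin normr_ge0.
  - move=> t /=; rewrite in_itv/= => /andP[t1 t2]; rewrite /ball /= ltr_norml; move: rho0 => r0.
    by apply/andP; split; lra.
rewrite -lee_fin; apply: (le_trans le1); rewrite XY -(fineK fin1) -EFinM lee_fin.
have := le_lt_trans (ler_norm _) H1; move: (fine _) => y hy.
apply: (@le_trans _ _ (4 * rho * (e / 4))); first by rewrite ler_wpM2l ?mulr_ge0 ?(ltW rho0)// ltW.
by rewrite le_eqVlt; apply/orP; left; apply/eqP; field.
Qed.

(** [fatou_density] yields limits along one sequence of radii only, but its density represents [f]
    as a Poisson integral, and Poisson integrals have full radial limits at the Lebesgue points of
    their density. *)
Theorem fatou_radial (f : C -> C) (M : R) : holo f -> (forall w, normc w < 1 -> normc (f w) <= M) ->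
  exists phi : R -> C, [/\ cbm 0 (2 * pi) phi,
    {ae mu, forall t, 0 < t < 2 * pi -> ctends ((1 : R)^'-) (fun r => f (pt r t)) (phi t)} &
    forall z, normc z < 1 -> cint 0 (2 * pi) (fun t => phi t * (poisson 1 t z)%:C) = (2 * pi)%:C * f z].
Proof.
move=> fh fM; have [a [phi [_ _ pm _ fE]]] := fatou_density fh fM.
exists phi; split => //; have [pr pim] := pm.
have pi2C : (2 * pi)%:C != 0 :> C by exact: pi2C_neq0.
have lim (psi : R -> R) (g : C -> R) th : (forall z, normc z < 1 -> rint 0 (2 * pi) (fun t => psi t * poisson 1 t z) = 2 * pi * g z) ->
    rbm 0 (2 * pi) psi -> 0 < th < 2 * pi -> lebesgue_cond psi th -> g (pt r th) @[r --> (1 : R)^'-] --> psi th.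
  move=> gE psm th02 Lc; apply/cvgrPdist_le => e e0.
  have e2 : 0 < 2 * pi * e by rewrite mulr_gt0.
  have [d d0 dP] := poisson_radial_limit psm th02 Lc e2.
  near=> r.
  have r1 : r < 1 by near: r; exact: nbhs_left_lt.
  have rd : 1 - d < r by near: r; apply: nbhs_left_gt; rewrite gtrBl.
  have r0 : 0 < r by near: r; apply: nbhs_left_gt.
  have := dP r rd r1; rewrite gE; last by rewrite normc_pt// ltW.
  by rewrite -mulrBr normrM (gtr0_norm pi2_gt0) ler_pM2l// distrC.
have gR z : normc z < 1 -> rint 0 (2 * pi) (fun t => complex.Re (phi t) * poisson 1 t z) = 2 * pi * complex.Re (f z).
  move=> z1; have := congr1 (@complex.Re R) (fE z z1); rewrite cReM /= mul0r subr0 => <-.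
  by apply: eq_rint => t _; rewrite cReM /= mulr0 subr0.
have gI z : normc z < 1 -> rint 0 (2 * pi) (fun t => complex.Im (phi t) * poisson 1 t z) = 2 * pi * complex.Im (f z).
  move=> z1; have := congr1 (@complex.Im R) (fE z z1); rewrite cImM /= mul0r addr0 => <-.
  by apply: eq_rint => t _; rewrite cImM /= mulr0 add0r.
apply: (@filterS2 _ _ (ae_filter_ringOfSetsType mu) _ _ _ _ (ae_lebesgue_cond pr) (ae_lebesgue_cond pim)) => th h1 h2 th02.
apply: ctends_ReIm.
  exact: (lim (fun t => complex.Re (phi t)) (fun z => complex.Re (f z)) th gR pr th02 (h1 th02)).
exact: (lim (fun t => complex.Im (phi t)) (fun z => complex.Im (f z)) th gI pim th02 (h2 th02)).
Unshelve. all: by end_near. Qed.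
End radial_limits.

(** * Blaschke products *)

Section blaschke.
Variable R : realType.
Local Notation C := R[i].
Local Notation D := (disc R).
Implicit Types (zs : nat -> option D) (w z : C).

Lemma disc_lt1 (a : D) : normc (val a) < 1. Proof. exact: (valP a). Qed.

Definition bfac zs w n : C := oapp (fun a : D => bf (val a) w) 1 (zs n).
Definition bprod zs N w : C := \prod_(n < N) bfac zs w n.
Definition ppterm zs w n : R := oapp (fun a : D => pp (val a) w) 0 (zs n).
Definition ppsum zs N w : R := \sum_(n < N) ppterm zs w n.
Definition defect zs n : R := oapp (fun a : D => 1 - normc (val a)) 0 (zs n).
Definition summable_zeros zs := exists K : R, forall N, \sum_(n < N) defect zs n <= K.

Lemma defect_ge0 zs n : 0 <= defect zs n.
Proof. by rewrite /defect; case: (zs n) => [a|]//=; rewrite subr_ge0 ltW ?disc_lt1. Qed.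

Lemma ppterm_ge0 zs w n : normc w < 1 -> 0 <= ppterm zs w n.
Proof. by move=> w1; rewrite /ppterm; case: (zs n) => [a|]//=; rewrite ltW// pp_gt0 ?disc_lt1. Qed.

Lemma ppsum_ge0 zs N w : normc w < 1 -> 0 <= ppsum zs N w.
Proof. by move=> w1; apply: sumr_ge0 => n _; exact: ppterm_ge0. Qed.

Lemma bfac_sqr zs w n : normc w < 1 -> normc (bfac zs w n) ^+ 2 = 1 - ppterm zs w n.
Proof.
move=> w1; rewrite /bfac /ppterm; case: (zs n) => [a|] /=; last by rewrite normc1 expr1n subr0.
by rewrite normc_bf psh_pp ?disc_lt1.
Qed.

Lemma bfac_le1 zs w n : normc w < 1 -> normc (bfac zs w n) <= 1.
Proof.
move=> w1; rewrite -(@expr_le1 _ 2)// ?normc_ge0// bfac_sqr// gerBl.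
exact: ppterm_ge0.
Qed.

Lemma bprod_le1 zs N w : normc w < 1 -> normc (bprod zs N w) <= 1.
Proof.
move=> w1; rewrite normc_prod; apply: prodr_ile1 => n _; rewrite normc_ge0/=.
exact: bfac_le1.
Qed.

Lemma holo_bfac zs n : holo (fun w => bfac zs w n).
Proof.
move=> w w1; rewrite /bfac; case: (zs n) => [a|] /=; last exact: cdiff_cst.
by apply: cdiff_bf => //; exact: disc_lt1.
Qed.

Lemma bprodS zs N w : bprod zs N.+1 w = bprod zs N w * bfac zs w N.
Proof. by rewrite /bprod big_ord_recr. Qed.

Lemma ppsumS zs N w : ppsum zs N.+1 w = ppsum zs N w + ppterm zs w N.
Proof. by rewrite /ppsum big_ord_recr. Qed.

Lemma holo_bprod zs N : holo (bprod zs N).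
Proof.
move=> w w1; elim: N => [|N IH].
  by apply: (cdiff_near _ (cdiff_cst 1 w)); apply: filterE => v; rewrite /bprod big_ord0.
apply: (cdiff_near _ (cdiffM IH (holo_bfac zs N w1))).
by apply: filterE => v; rewrite bprodS.
Qed.

Lemma bprod_upper zs N w : normc w < 1 -> normc (bprod zs N w) ^+ 2 <= expR (- ppsum zs N w).
Proof.
move=> w1; elim: N => [|N IH].
  by rewrite /bprod /ppsum !big_ord0 normc1 expr1n oppr0 expR0.
rewrite bprodS ppsumS normcM exprMn opprD expRD; apply: ler_pM; rewrite ?sqr_ge0//.
by rewrite bfac_sqr// addrC -[X in _ + X]opprK; apply: le_trans (expR_ge1Dx _); rewrite opprK addrC.
Qed.

Lemma expR_lower (d x : R) : 0 < d -> d <= x -> x <= 1 -> expR (- ((1 - x) / d)) <= x.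
Proof.
move=> d0 dx x1; have x0 : 0 < x by exact: lt_le_trans dx.
apply: (@le_trans _ _ (expR (- ((1 - x) / x)))).
  by rewrite ler_expR lerN2 ler_wpM2l ?subr_ge0// lef_pV2.
rewrite expRN -[leRHS]invrK lef_pV2 ?posrE ?expR_gt0 ?invr_gt0//.
apply: le_trans (expR_ge1Dx _); rewrite mulrBl divff ?gt_eqF// mul1r.
by rewrite addrCA subrr addr0.
Qed.

(** Once every factor has squared modulus 1 - pp >= d^2, the inequality 1 - x <= exp(-x) can be
    reversed at the price of the factor d^-2 in the exponent. *)
Lemma bprod_lower zs N w d : normc w < 1 -> 0 < d ->
  (forall n a, zs n = Some a -> d <= psh (val a) w) ->
  expR (- (ppsum zs N w / d ^+ 2)) <= normc (bprod zs N w) ^+ 2.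
Proof.
move=> w1 d0 hd; elim: N => [|N IH].
  by rewrite /bprod /ppsum !big_ord0 normc1 expr1n mul0r oppr0 expR0.
rewrite bprodS ppsumS normcM exprMn mulrDl opprD expRD; apply: ler_pM; rewrite ?expR_ge0//.
rewrite bfac_sqr//; have := hd N; rewrite /ppterm; case: (zs N) => [a|] /= h; last first.
  by rewrite mul0r oppr0 expR0 addr0.
have := expR_lower (exprn_gt0 2 d0) (x := 1 - pp (val a) w).
rewrite opprB addrCA subrr addr0; apply.
  by rewrite -psh_pp ?disc_lt1// lerXn2r ?nnegrE ?(ltW d0) ?psh_ge0// h.
by rewrite gerBl ltW// pp_gt0 ?disc_lt1.
Qed.

(** For nonzero [a] the normalization of the factor gives 1 - bf a w = (1 - |a|) (1 + conj(a) w /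
    |a|) / (1 - conj(a) w); this is why the Blaschke condition makes the product converge. *)
Lemma one_sub_bf (a w : C) : normc a < 1 -> normc w < 1 ->
  normc (1 - bf a w) <= (1 - normc a) * (2 / (1 - normc w)).
Proof.
move=> a1 w1; have d0 : 0 < 1 - normc w by rewrite subr_gt0.
rewrite /bf; case: eqVneq => [->|a0].
  rewrite normc0 subr0 mul1r; apply: (le_trans (le_normcD _ _)); rewrite normcN normc1.
  apply: (@le_trans _ _ 2); first by rewrite -[X in _ <= X]/(1 + 1) lerD2l ltW.
  by rewrite ler_pdivlMr// ler_piMr// gerBl normc_ge0.
have na : (normc a)%:C != 0 :> C by rewrite -normc_eq0 normcR normr_eq0 normc_eq0.
have n := conjM_neq0 a1 w1.
have -> : 1 - conjc a / `|a| * ((a - w) / (1 - conjc a * w)) =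
    (1 - normc a)%:C * (1 + conjc a * w / (normc a)%:C) / (1 - conjc a * w).
  rewrite -[`|a|]/((normc a)%:C) rmorphB /= -[(1%:C)]/(1 : C).
  have e : conjc a * a = (normc a)%:C ^+ 2 by rewrite mulrC mulcJ rmorphXn.
  have -> : 1 - conjc a / (normc a)%:C * ((a - w) / (1 - conjc a * w)) =
     ((1 - conjc a * w) * (normc a)%:C - (conjc a * a - conjc a * w)) / ((normc a)%:C * (1 - conjc a * w)).
    by field; rewrite na n.
  by rewrite e; field; rewrite na n.
rewrite normc_div normcM normcR ger0_norm; last by rewrite subr_ge0 ltW.
rewrite -mulrA ler_wpM2l ?subr_ge0 ?(ltW a1)//.
have aw : normc (conjc a * w) <= normc w.
  by rewrite normcM normc_conj ler_piMl ?normc_ge0// ltW.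
apply: ler_pM; rewrite ?normc_ge0 ?invr_ge0 ?normc_ge0//.
  apply: (le_trans (le_normcD _ _)); rewrite normc1 -[X in _ <= X]/(1 + 1) lerD2l.
  rewrite normc_div normcR ger0_norm ?normc_ge0// normcM normc_conj mulrAC divff ?mul1r ?ltW//.
  by rewrite normc_eq0.
rewrite lef_pV2 ?posrE ?normc_gt0//.
by apply: le_trans (ler_normcB _ _); rewrite normc1 lerB.
Qed.

Lemma one_sub_bfac zs w n : normc w < 1 ->
  normc (1 - bfac zs w n) <= defect zs n * (2 / (1 - normc w)).
Proof.
move=> w1; rewrite /bfac /defect; case: (zs n) => [a|] /=; last by rewrite subrr normc0 mul0r.
by apply: one_sub_bf => //; exact: disc_lt1.
Qed.

Lemma sum_one_sub_bfac zs w K : normc w < 1 -> (forall N, \sum_(n < N) defect zs n <= K) ->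
  forall N, \sum_(n < N) normc (1 - bfac zs w n) <= K * (2 / (1 - normc w)).
Proof.
move=> w1 hK N; apply: (@le_trans _ _ ((\sum_(n < N) defect zs n) * (2 / (1 - normc w)))).
  by rewrite mulr_suml; apply: ler_sum => n _; exact: one_sub_bfac.
by rewrite ler_wpM2r// divr_ge0// subr_ge0 ltW.
Qed.

Lemma bprod_cvg zs w : summable_zeros zs -> normc w < 1 -> exists l, ctends \oo (bprod zs ^~ w) l.
Proof.
move=> [K hK] w1; apply: (@ctends_of_summable_steps _ _ (K * (2 / (1 - normc w)))) => N.
apply: le_trans (sum_one_sub_bfac w1 hK N); apply: ler_sum => n _.
rewrite bprodS -{2}[bprod zs n w]mulr1 -mulrBr normcM normcB ler_piMl ?normc_ge0//.
exact: bprod_le1.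
Qed.

Lemma blaschke_exists zs : summable_zeros zs -> exists B, [/\ holo B,
  forall w, normc w < 1 -> normc (B w) <= 1 &
  forall w, normc w < 1 -> ctends \oo (bprod zs ^~ w) (B w)].
Proof.
move=> sz; have ex w : exists l, normc w < 1 -> ctends \oo (bprod zs ^~ w) l.
  by have [/(bprod_cvg sz)[l]|] := pselect (normc w < 1); [exists l|exists 0].
have [B BP] := choice ex; exists B; split => //.
  apply: (@holo_lim _ (bprod zs) _ 1) => //; first by move=> n; exact: holo_bprod.
  by move=> n w; exact: bprod_le1.
by move=> w w1; apply: (ctends_le (BP _ w1)); apply: nearW => n; exact: bprod_le1.
Qed.

Lemma ppsum_mono zs w m n : normc w < 1 -> (m <= n)%N -> ppsum zs m w <= ppsum zs n w.
Proof.
move=> w1 mn; rewrite -(subnKC mn); elim: (n - m)%N => [|k IH]; first by rewrite addn0.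
by rewrite addnS ppsumS (le_trans IH)// lerDl ppterm_ge0.
Qed.

Lemma blaschke_upper zs w l N : normc w < 1 -> ctends \oo (bprod zs ^~ w) l ->
  normc l ^+ 2 <= expR (- ppsum zs N w).
Proof.
move=> w1 h; rewrite -normcX; apply: (ctends_le (ctendsX 2 h)).
exists N => // n /= Nn; rewrite normcX; apply: (le_trans (bprod_upper _ _ w1)).
by rewrite ler_expR lerN2 ppsum_mono.
Qed.

Lemma blaschke_lower zs w l d A : normc w < 1 -> 0 < d -> ctends \oo (bprod zs ^~ w) l ->
  (forall n a, zs n = Some a -> d <= psh (val a) w) -> (forall N, ppsum zs N w <= A) ->
  expR (- (A / d ^+ 2)) <= normc l ^+ 2.
Proof.
move=> w1 d0 h hd hA; rewrite -normcX; apply: (ctends_ge (ctendsX 2 h)).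
apply: nearW => n; rewrite normcX; apply: le_trans (bprod_lower _ w1 d0 hd).
by rewrite ler_expR lerN2 ler_wpM2r ?invr_ge0 ?sqr_ge0.
Qed.

(** A substitute for the triangle inequality of the hyperbolic metric. It comes from (1 - |b|^2) (1
    - conj(a) c) = (1 - conj(a) b) (1 - conj(b) c) - (conj(b) - conj(a)) (b - c), where the first
    product dominates the second in modulus. *)
Lemma pp_chain (a b c : C) : normc a < 1 -> normc b < 1 -> normc c < 1 ->
  pp a b * pp b c <= 4 * pp a c.
Proof.
move=> a1 b1 c1.
have x0 : 0 < normc (1 - conjc a * b) by rewrite normc_gt0 conjM_neq0.
have y0 : 0 < normc (1 - conjc b * c) by rewrite normc_gt0 conjM_neq0.
have z0 : 0 < normc (1 - conjc a * c) by rewrite normc_gt0 conjM_neq0.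
have A0 : 0 < 1 - normc a ^+ 2 by rewrite subr_gt0 sqr_lt1 ?normc_ge0.
have B0 : 0 < 1 - normc b ^+ 2 by rewrite subr_gt0 sqr_lt1 ?normc_ge0.
have C0 : 0 < 1 - normc c ^+ 2 by rewrite subr_gt0 sqr_lt1 ?normc_ge0.
have le1 (u v : C) : normc u < 1 -> normc v < 1 -> normc (u - v) <= normc (1 - conjc u * v).
  move=> u1 v1; rewrite -(@ler_pXn2r _ 2)// ?nnegrE ?normc_ge0// -subr_ge0 norm_identity.
  by rewrite mulr_ge0// subr_ge0 ltW// sqr_lt1 ?normc_ge0.
have key : (1 - normc b ^+ 2) * normc (1 - conjc a * c) <= 2 * (normc (1 - conjc a * b) * normc (1 - conjc b * c)).
  have -> : (1 - normc b ^+ 2) * normc (1 - conjc a * c) = normc ((1 - conjc a * b) * (1 - conjc b * c) - (conjc b - conjc a) * (b - c)).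
    have -> : (1 - conjc a * b) * (1 - conjc b * c) - (conjc b - conjc a) * (b - c) = (1 - b * conjc b) * (1 - conjc a * c) by ring.
    have e : 1 - b * conjc b = (1 - normc b ^+ 2)%:C by rewrite mulcJ rmorphB.
    by rewrite e normcM normcR ger0_norm// ltW.
  apply: (le_trans (le_normcD _ _)); rewrite normcN !normcM mulr_natl mulr2n lerD2l.
  rewrite -rmorphB normc_conj; apply: ler_pM; rewrite ?normc_ge0 ?le1//.
  by rewrite normcB le1.
move: key x0 y0 z0 A0 B0 C0; rewrite /pp.
move: (normc (1 - conjc a * b)) (normc (1 - conjc b * c)) (normc (1 - conjc a * c)) => x y v.
move: (1 - normc a ^+ 2) (1 - normc b ^+ 2) (1 - normc c ^+ 2) => p q r key x0 y0 v0 p0 q0 r0.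
have -> : p * q / x ^+ 2 * (q * r / y ^+ 2) = p * r * (q / (x * y)) ^+ 2 by field; rewrite !gt_eqF.
have -> : 4 * (p * r / v ^+ 2) = p * r * (2 / v) ^+ 2 by field; rewrite gt_eqF.
rewrite ler_pM2l ?mulr_gt0// lerXn2r ?nnegrE ?divr_ge0 ?mulr_ge0 ?(ltW q0) ?(ltW x0) ?(ltW y0) ?(ltW v0)//.
by rewrite ler_pdivrMr ?mulr_gt0// mulrAC ler_pdivlMr.
Qed.

Lemma summable_of_ppsum zs z K : normc z < 1 -> (forall N, ppsum zs N z <= K) -> summable_zeros zs.
Proof.
move=> z1 hK; exists (4 / (1 - normc z ^+ 2) * K) => N.
have d0 : 0 < 1 - normc z ^+ 2 by rewrite subr_gt0 sqr_lt1 ?normc_ge0.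
apply: (@le_trans _ _ (4 / (1 - normc z ^+ 2) * ppsum zs N z)); last first.
  by rewrite ler_wpM2l// divr_ge0// ltW.
rewrite mulr_sumr; apply: ler_sum => n _; rewrite /defect /ppterm; case: (zs n) => [a|] /=; last by rewrite mulr0.
have a1 := disc_lt1 a; set b := val a in a1 *.
have n0 : normc (0 : C) < 1 by rewrite normc0.
have h := pp_chain a1 z1 n0.
have d2 : normc (1 - conjc b * z) <= 2.
  apply: (le_trans (le_normcD _ _)); rewrite normcN normc1 -[X in _ <= X]/(1 + 1) lerD2l.
  by rewrite normcM normc_conj mulr_ile1 ?normc_ge0// ltW.
have d3 : 0 < normc (1 - conjc b * z) by rewrite normc_gt0 conjM_neq0.
have h2 : (1 - normc b) * (1 - normc z ^+ 2) / 4 <= pp b z.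
  rewrite /pp; apply: ler_pM.
  - by rewrite mulr_ge0 ?subr_ge0 ?(ltW a1) ?(ltW d0)// -subr_ge0 ltW.
  - by [].
  - by rewrite ler_pM2r// lerD2l lerN2 expr2 ler_piMr ?normc_ge0 ?(ltW a1).
  - rewrite lef_pV2 ?posrE ?exprn_gt0//.
    by apply: (@le_trans _ _ (2 ^+ 2)); [rewrite lerXn2r ?nnegrE ?(ltW d3)|rewrite -natrX].
change (1 - normc b <= 4 / (1 - normc z ^+ 2) * pp b z).
rewrite mulrAC ler_pdivlMr//.
by move: h2; move: ((1 - normc b) * (1 - normc z ^+ 2)) (pp b z) => x y; lra.
Qed.

Lemma bounded_sums_tail (t : nat -> R) B : (forall N, \sum_(n < N) t n <= B) ->
  forall e : R, 0 < e -> exists K, forall m, \sum_(n < m) t (K + n)%N <= e.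
Proof.
move=> hB e e0; pose s N := \sum_(n < N) t n.
have hs : has_sup (range s) by split; [exists (s 0%N); exists 0%N|exists B => _ [n _ <-]; exact: hB].
have [_ [K _ <-] hK] := sup_adherent e0 hs; exists K => m.
have E : s (K + m)%N = s K + \sum_(n < m) t (K + n)%N.
  by rewrite /s big_split_ord.
have : s (K + m)%N <= sup (range s) by apply: ub_le_sup; [case: hs|exists (K + m)%N].
by rewrite E; move: hK; move: (s K) (\sum_(n < m) _) (sup _) => x y u; lra.
Qed.

Lemma defect_tail zs : summable_zeros zs -> forall e : R, 0 < e ->
  exists K, forall m, \sum_(n < m) defect zs (K + n)%N <= e.
Proof. by move=> [B hB]; exact: bounded_sums_tail hB. Qed.

Lemma prod_near1 (c : nat -> C) m : (forall n, normc (c n) <= 1) ->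
  normc (\prod_(n < m) c n - 1) <= \sum_(n < m) normc (1 - c n).
Proof.
move=> c1; elim: m => [|m IH]; first by rewrite !big_ord0 subrr normc0.
rewrite !big_ord_recr /=.
have -> : \prod_(i < m) c i * c m - 1 = (\prod_(i < m) c i - 1) + \prod_(i < m) c i * (c m - 1) by ring.
apply: (le_trans (le_normcD _ _)); rewrite lerD// normcM normcB ler_piMl ?normc_ge0//.
by rewrite normc_prod; apply: prodr_ile1 => n _; rewrite normc_ge0 c1.
Qed.

(** The zero divided out has at least half the supremum of the defects 1 - |c|. This replaces an
    enumeration of the zeros with multiplicities: a zero that survived every step would bound the
    defects of all removed zeros from below. *)
Lemma greedy_step (f : C -> C) : exists q : option D * (C -> C),
  holo f -> (forall w, normc w < 1 -> normc (f w) <= 1) ->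
  [/\ holo q.2, forall w, normc w < 1 -> normc (q.2 w) <= 1,
      forall w, normc w < 1 -> f w = oapp (fun a : D => bf (val a) w) 1 q.1 * q.2 w &
      forall c, normc c < 1 -> f c = 0 -> exists2 a : D, q.1 = Some a & 1 - normc c <= 2 * (1 - normc (val a))].
Proof.
have [[fh f1]|nf] := pselect (holo f /\ forall w, normc w < 1 -> normc (f w) <= 1); last first.
  by exists (None, f) => fh f1; exfalso; apply: nf.
have [[c [c1 fc]]|nz] := pselect (exists c, normc c < 1 /\ f c = 0); last first.
  exists (None, f) => _ _; split => //= [w _|c c1 fc]; first by rewrite mul1r.
  by exfalso; apply: nz; exists c.
pose S := [set x : R | exists c, [/\ normc c < 1, f c = 0 & x = 1 - normc c]].
have hS : has_sup S.
  split; first by exists (1 - normc c); exists c.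
  by exists 1 => _ [d [_ _ ->]]; rewrite gerBl normc_ge0.
have s0 : 0 < sup S.
  apply: (@lt_le_trans _ _ (1 - normc c)); first by rewrite subr_gt0.
  by apply: ub_le_sup; [case: hS|exists c].
have s2 : 0 < sup S / 2 by rewrite divr_gt0.
have [_ [a [a1 fa ->]] ha] := sup_adherent s2 hS.
have [g [gh g1 gE]] := schwarz_div fh a1 fa f1.
exists (Some (Sub a a1), g) => _ _; split => // d d1 fd.
exists (Sub a a1) => //; change (1 - normc d <= 2 * (1 - normc a)).
have : 1 - normc d <= sup S by apply: ub_le_sup; [case: hS|exists d].
by move: ha; move: (sup S) => s; lra.
Qed.

Theorem blaschke_decomposition (f : C -> C) (z0 : C) : holo f ->
  (forall w, normc w < 1 -> normc (f w) <= 1) -> normc z0 < 1 -> f z0 != 0 ->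
  exists zs B F, [/\ summable_zeros zs, forall w, normc w < 1 -> ctends \oo (bprod zs ^~ w) (B w),
    holo F /\ (forall w, normc w < 1 -> normc (F w) <= 1),
    forall w, normc w < 1 -> F w != 0 & forall w, normc w < 1 -> f w = B w * F w].
Proof.
move=> fh f1 z01 fz0; have [st stP] := choice greedy_step.
pose fix u n : C -> C := if n is n'.+1 then (st (u n')).2 else f.
pose zs n := (st (u n)).1.
have uP n : holo (u n) /\ forall w, normc w < 1 -> normc (u n w) <= 1.
  by elim: n => [//|n [h1 h2]]; have [] := stP _ h1 h2.
have uS n w : normc w < 1 -> u n w = bfac zs w n * u n.+1 w.
  by move=> w1; have [h1 h2] := uP n; have [_ _ h _] := stP _ h1 h2; exact: h.
have uz n c : normc c < 1 -> u n c = 0 -> 1 - normc c <= 2 * defect zs n.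
  move=> c1 uc; have [h1 h2] := uP n; have [_ _ _ h] := stP _ h1 h2.
  by have [a za h3] := h c c1 uc; rewrite /defect /zs za.
have fu N w : normc w < 1 -> f w = bprod zs N w * u N w.
  move=> w1; elim: N => [|N IH]; first by rewrite /bprod big_ord0 mul1r.
  by rewrite IH bprodS uS// mulrA.
have nz2 : 0 < normc (f z0) ^+ 2 by rewrite exprn_gt0// normc_gt0.
(* The partial products dominate [f] in modulus, so [bprod_upper] bounds [ppsum] at the single point
   [z0], where [f] does not vanish. *)
have sz : summable_zeros zs.
  apply: (@summable_of_ppsum _ z0 (- ln (normc (f z0) ^+ 2))) => // N.
  rewrite lerNr -ler_expR lnK ?posrE//; apply: le_trans (bprod_upper _ _ z01).
  rewrite lerXn2r ?nnegrE ?normc_ge0// (fu N)// normcM ler_piMr ?normc_ge0//.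
  by have [_ ->] := uP N.
have [B [Bh B1 BP]] := blaschke_exists sz.
have ucvg w : normc w < 1 -> exists l, ctends \oo (u ^~ w) l.
  move=> w1; have d0 : 0 < 1 - normc w by rewrite subr_gt0.
  have e0 : 0 < (1 - normc w) / 4 by rewrite divr_gt0.
  have [K hK] := defect_tail sz e0.
  (* Past the index [K] the partial products [T m] keep modulus at least 1 / 2, so that
     [u (K + m) w], the quotient of [u K w] by [T m], converges even where [bprod] tends to 0. *)
  pose c n := bfac zs w (K + n)%N; pose T m := \prod_(n < m) c n.
  have tail m : \sum_(n < m) normc (1 - c n) <= 2^-1.
    apply: (@le_trans _ _ ((\sum_(n < m) defect zs (K + n)%N) * (2 / (1 - normc w)))).
      by rewrite mulr_suml; apply: ler_sum => n _; exact: one_sub_bfac.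
    apply: (@le_trans _ _ ((1 - normc w) / 4 * (2 / (1 - normc w)))).
      by rewrite ler_wpM2r// divr_ge0// ltW.
    by rewrite le_eqVlt; apply/orP; left; apply/eqP; field; rewrite gt_eqF.
  have c1 n : normc (c n) <= 1 by exact: bfac_le1.
  have T1 m : normc (T m) <= 1 by rewrite normc_prod; apply: prodr_ile1 => n _; rewrite normc_ge0 c1.
  have T2 m : 2^-1 <= normc (T m).
    have := le_trans (prod_near1 m c1) (tail m); have := ler_normcB 1 (1 - T m).
    by rewrite subKr normc1 [normc (1 - _)]normcB -/(T m); move: (normc _) (normc _) => x y; lra.
  have [l hl] : exists l, ctends \oo T l.
    apply: (@ctends_of_summable_steps _ _ 2^-1) => N; apply: le_trans (tail N); apply: ler_sum => n _.
    by rewrite /T big_ord_recr /= -{2}[\prod_(i < n) _]mulr1 -mulrBr normcM normcB ler_piMl ?normc_ge0// T1.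
  have l0 : l != 0.
    rewrite -normc_gt0; apply: (@lt_le_trans _ _ 2^-1); first by rewrite invr_gt0.
    by apply: (ctends_ge hl); apply: nearW => n; exact: T2.
  have uK m : u K w = T m * u (K + m)%N w.
    elim: m => [|m IH]; first by rewrite /T big_ord0 mul1r addn0.
    by rewrite IH uS// /T big_ord_recr /= mulrA addnS.
  exists (u K w / l) => e e0'.
  have := ctends_div l0 (ctends_cst (u K w)) hl => /(_ _ _ e e0')[N _ hN].
  exists (K + N)%N => // n /= Nn; have Kn : (K <= n)%N by exact: leq_trans (leq_addr _ _) Nn.
  have := hN (n - K)%N; rewrite /= leq_subRL// => /(_ Nn).
  have Tn : T (n - K)%N != 0 by rewrite -normc_gt0 (lt_le_trans _ (T2 _))// invr_gt0.
  by rewrite (uK (n - K)%N) subnKC// mulrAC divff// mul1r.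
have ex w : exists l, normc w < 1 -> ctends \oo (u ^~ w) l.
  by have [/ucvg[l]|] := pselect (normc w < 1); [exists l|exists 0].
have [F FP] := choice ex.
have F1 w : normc w < 1 -> normc (F w) <= 1.
  by move=> w1; apply: (ctends_le (FP _ w1)); apply: nearW => n; have [_ ->] := uP n.
have Fh : holo F.
  apply: (@holo_lim _ u _ 1) => //; first by move=> n; case: (uP n).
  by move=> n w w1; have [_ ->] := uP n.
exists zs, B, F; split => //.
  move=> a a1; apply/eqP => Fa.
  (* The moduli of [u n a] are nondecreasing in [n], so a zero of the limit is a zero of every
     [u n], and [uz] then contradicts the summability of the defects. *)
  have u0 n : u n a = 0.
    apply/eqP; rewrite -normc_eq0 eq_le normc_ge0 andbT.
    have : normc (u n a) <= normc (F a).
      apply: (ctends_ge (FP _ a1)); exists n => // m /= nm.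
      rewrite -(subnKC nm); elim: (m - n)%N => [|k IH]; first by rewrite addn0.
      by rewrite addnS (le_trans IH)// uS// normcM ler_piMl ?normc_ge0// bfac_le1.
    by rewrite Fa normc0.
  have da : 0 < 1 - normc a by rewrite subr_gt0.
  have [K hK] := sz.
  pose N := (Num.truncn (2 * K / (1 - normc a))).+1.
  have : 2 * K / (1 - normc a) < N%:R by exact: truncnS_gt.
  rewrite ltr_pdivrMr// => H.
  have : N%:R * (1 - normc a) <= 2 * \sum_(n < N) defect zs n.
    rewrite mulr_sumr mulr_natl -[N in _ *+ N]card_ord -sumr_const.
    by apply: ler_sum => n _; apply: uz.
  by have := hK N; move: H; move: (N%:R * _) (\sum_(n < N) _) => x y; lra.
move=> w w1; apply: (@ctends_unique _ _ \oo _ (fun n => bprod zs n w * u n w)).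
  by apply: ctends_ext (ctends_cst (f w)); apply: nearW => n; rewrite (fu n).
by apply: ctendsM; [exact: BP|exact: FP].
Qed.
End blaschke.

(** * The algebra of bounded analytic functions *)

Section bridge.
Variable R : realType.
Local Notation C := R[i].
Local Notation D := (disc R).
Implicit Types (w z : C).

Lemma derivable_cdiff (F : C -> C) z : derivable (F : C^o -> C^o) z 1 <-> cdiff F z.
Proof.
rewrite cdiffP /derivable; split => [/cvg_ex[l]|[l hl]].
  move=> /(ctends_cvg _ _) hl; exists l => e e0.
  have : (0 : C^o)^' (fun h : C => normc (h^-1 * (F (h * 1 + z) - F z) - l) < e) by exact: hl.
  rewrite /dnbhs /within /= -cnear_nbhs => -[d d0 hd]; exists d => // w wz.
  have [->|nwz] := eqVneq w z; first by rewrite !subrr mulr0 subrr normc0 mulr0.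
  have n0 : w - z != 0 by rewrite subr_eq0.
  have := hd (w - z); rewrite subr0 => /(_ wz n0); rewrite mulr1 subrK => /ltW h.
  rewrite -[F w - F z](mulVKf n0) [l * _]mulrC -mulrBr normcM mulrC ler_wpM2r ?normc_ge0//.
apply/cvg_ex; exists l; apply/(ctends_cvg _ _) => e e0.
have e2 : 0 < e / 2 by rewrite divr_gt0.
have [d d0 hd] := hl _ e2.
rewrite /dnbhs /within /= -cnear_nbhs; exists d => // h; rewrite subr0 => hd' h0.
have := hd (h + z); rewrite addrK => /(_ hd') H.
have nh : 0 < normc h by rewrite normc_gt0.
change (normc (h^-1 * (F (h * 1 + z) - F z) - l) < e).
rewrite mulr1 -(ltr_pM2l nh) -normcM mulrBr mulVKf// [h * l]mulrC.
apply: (le_lt_trans H); rewrite mulrC ltr_pM2l//; lra.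
Qed.

Lemma ext_in (f : D -> C) w (w1 : normc w < 1) : ext f w = f (Sub w w1).
Proof. by rewrite /ext insubT. Qed.

Lemma ext_out (f : D -> C) w : ~~ (normc w < 1) -> ext f w = 0.
Proof. by move=> w1; rewrite /ext insubN. Qed.

Lemma holo_ext (f : Hinf R) : holo (ext f).
Proof.
move=> w w1; have /asboolP[af _] : hfun f \in Hinf_pred R by exact: (valP f).
by apply/derivable_cdiff; have := af (Sub w w1).
Qed.

Lemma Hinf_bounded (f : Hinf R) : exists2 M, 0 <= M & forall w, normc (ext f w) <= M.
Proof.
have /asboolP[_ [M hM]] : hfun f \in Hinf_pred R by exact: (valP f).
exists (Num.max M 0); first by rewrite le_max lexx orbT.
move=> w; rewrite le_max; case: (boolP (normc w < 1)) => w1; first by rewrite ext_in hM.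
by rewrite ext_out// normc0 lexx orbT.
Qed.

Lemma mk_Hinf (F : C -> C) M : holo F -> (forall w, normc w < 1 -> normc (F w) <= M) ->
  exists f : Hinf R, forall w, normc w < 1 -> ext f w = F w.
Proof.
move=> Fh FM; pose g (z : D) := F (val z).
have gE w : normc w < 1 -> ext g w = F w by move=> w1; rewrite ext_in /g SubK.
have gP : g \in Hinf_pred R.
  apply/asboolP; split; last by exists M => z; apply: FM; exact: disc_lt1.
  move=> z; apply/derivable_cdiff; apply: (@cdiff_near _ F); last by apply: Fh; exact: disc_lt1.
  by rewrite cnear_nbhs; apply: filterS (near_disc z) => w /gE ->.
by exists (MkHinf gP).
Qed.

Lemma Hinf_eq (f g : Hinf R) : (forall w, normc w < 1 -> ext f w = ext g w) -> f = g.
Proof.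
move=> h; apply: val_inj; apply/funext => z.
by have := h (val z) (disc_lt1 z); rewrite !ext_val.
Qed.

Lemma ext_add (f g : Hinf R) w : ext (f + g) w = ext f w + ext g w.
Proof.
case: (boolP (normc w < 1)) => w1; first by rewrite !(ext_in _ w1).
by rewrite !ext_out// addr0.
Qed.

Lemma ext_opp (f : Hinf R) w : ext (- f) w = - ext f w.
Proof.
case: (boolP (normc w < 1)) => w1; first by rewrite !(ext_in _ w1).
by rewrite !ext_out// oppr0.
Qed.

Lemma ext_sub (f g : Hinf R) w : ext (f - g) w = ext f w - ext g w.
Proof. by rewrite ext_add ext_opp. Qed.

Lemma ext_mul (f g : Hinf R) w : ext (f * g) w = ext f w * ext g w.
Proof.
case: (boolP (normc w < 1)) => w1; first by rewrite !(ext_in _ w1).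
by rewrite !ext_out// mulr0.
Qed.

Lemma ext_scale (a : C) (f : Hinf R) w : ext (a *: f) w = a * ext f w.
Proof.
case: (boolP (normc w < 1)) => w1; first by rewrite !(ext_in _ w1).
by rewrite !ext_out// mulr0.
Qed.

Lemma ext_one w : normc w < 1 -> ext (1 : Hinf R) w = 1.
Proof. by move=> w1; rewrite ext_in. Qed.

Lemma ext_zero w : ext (0 : Hinf R) w = 0.
Proof.
case: (boolP (normc w < 1)) => w1; first by rewrite !(ext_in _ w1).
by rewrite !ext_out.
Qed.

Lemma Hnorm_ge (f : Hinf R) w : normc w < 1 -> normc (ext f w) <= Hnorm f.
Proof.
move=> w1; have [M _ hM] := Hinf_bounded f; rewrite ext_in; apply: ub_le_sup.
  by exists M => _ [z _ <-]; rewrite -ext_val.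
by exists (Sub w w1).
Qed.

Lemma Hnorm_ge0 (f : Hinf R) : 0 <= Hnorm f.
Proof.
have n0 : normc (0 : C) < 1 by rewrite normc0.
by apply: le_trans (Hnorm_ge f n0); exact: normc_ge0.
Qed.

Lemma Hnorm_le (f : Hinf R) M : (forall w, normc w < 1 -> normc (ext f w) <= M) -> Hnorm f <= M.
Proof.
move=> h; apply: ge_sup; first by exists (normc (f point)); exists point.
by move=> _ [z _ <-]; rewrite -ext_val; apply: h; exact: disc_lt1.
Qed.

Lemma Hinf_inv (f : Hinf R) d : 0 < d -> (forall w, normc w < 1 -> d <= normc (ext f w)) ->
  exists g : Hinf R, f * g = 1 /\ forall w, normc w < 1 -> ext g w = (ext f w)^-1.
Proof.
move=> d0 fd; have nz w : normc w < 1 -> ext f w != 0.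
  by move=> w1; rewrite -normc_gt0; apply: lt_le_trans (fd _ w1).
have [||g gE] := @mk_Hinf (fun w => (ext f w)^-1) d^-1.
- by move=> w w1; apply: cdiffV; [exact: nz|exact: holo_ext].
- by move=> w w1; rewrite -[_^-1]mul1r normc_div normc1 mul1r lef_pV2 ?posrE ?fd// (lt_le_trans d0)// fd.
exists g; split => //; apply: Hinf_eq => w w1.
by rewrite ext_mul gE// divff ?nz// ext_one.
Qed.

Lemma char_scale (x : spectrum R) (a : C) f : x (a *: f) = a * x f.
Proof. exact: linearZ. Qed.

Lemma char_cst (x : spectrum R) (a : C) : x (a *: 1) = a.
Proof. by rewrite char_scale rmorph1 mulr1. Qed.

(** Otherwise [f - x f *: 1] is bounded away from 0 on the disc, hence invertible, although [x]
    annihilates it. This is how estimates on the disc reach all characters. *)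
Lemma char_le (x : spectrum R) f : normc (x f) <= Hnorm f.
Proof.
rewrite leNgt; apply/negP => h.
have d0 : 0 < normc (x f) - Hnorm f by rewrite subr_gt0.
have [w w1|g [fg _]] := @Hinf_inv (f - x f *: 1) _ d0.
  rewrite ext_sub ext_scale ext_one// mulr1 normcB.
  by apply: le_trans (ler_normcB _ _); rewrite lerB// Hnorm_ge.
have : x ((f - x f *: 1) * g) = 1 by rewrite fg rmorph1.
rewrite rmorphM rmorphB /= char_cst subrr mul0r => /eqP.
by rewrite eq_sym oner_eq0.
Qed.
End bridge.

(** * Boundary values *)

Section boundary_values.
Variable R : realType.
Local Notation C := R[i].
Local Notation D := (disc R).
Local Notation mu := (@lebesgue_measure R).
Local Notation arc := (@arc_measure R).
Implicit Types (w z : C) (f g : Hinf R).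

Let pi2_gt0 : 0 < 2 * pi :> R. Proof. by rewrite mulr_gt0// pi_gt0. Qed.

Let leftF : Filter ((1 : R)^'-). Proof. exact: filter_filter. Qed.

Definition radial (F : C -> C) (t : R) (l : C) := ctends ((1 : R)^'-) (fun r => F (pt r t)) l.

Lemma arc_ae (P : R -> Prop) :
  {ae arc, forall t, P t} <-> {ae mu, forall t, 0 <= t < 2 * pi -> P t}.
Proof.
have mI : measurable (`[0, 2 * pi[%classic : set (measurableTypeR R)) by exact: measurable_itv.
have inI t : (`[0, 2 * pi[%classic : set R) t = (0 <= t < 2 * pi) by rewrite /= in_itv.
split => [[N [mN N0 PN]]|[N [mN N0 PN]]].
  exists (N `&` `[0, 2 * pi[%classic); split; [exact: measurableI|exact: N0|].
  move=> t /= /not_implyP[tI nP]; split; last by rewrite /= in_itv.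
  by apply: PN.
exists (N `|` ~` `[0, 2 * pi[%classic); split.
- by apply: measurableU => //; exact: measurableC.
- apply/eqP; rewrite -measure_le0 /arc_measure /mrestr.
  pose I := `[0, 2 * pi[%classic : set R.
  change (mu ((N `|` ~` I) `&` I) <= 0)%E.
  rewrite setIUl setICl setU0 -N0; apply: le_measure; rewrite ?inE//; first exact: measurableI.
- move=> t /= nP; have [tI|] := pselect (0 <= t < 2 * pi); last by move=> h; right; rewrite /= in_itv.
  by left; apply: PN => /= /(_ tI).
Qed.

Lemma arc_ae1 (P Q : R -> Prop) : (forall t, P t -> Q t) -> {ae arc, forall t, P t} -> {ae arc, forall t, Q t}.
Proof. by move=> PQ; exact: (@filterS _ _ (ae_filter_ringOfSetsType arc)). Qed.

Lemma arc_ae2 (P Q S : R -> Prop) : (forall t, P t -> Q t -> S t) ->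
  {ae arc, forall t, P t} -> {ae arc, forall t, Q t} -> {ae arc, forall t, S t}.
Proof. by move=> PQ; exact: (@filterS2 _ _ (ae_filter_ringOfSetsType arc)). Qed.

Lemma arc_aeT (P : R -> Prop) : (forall t, P t) -> {ae arc, forall t, P t}.
Proof. by move=> PT; apply: (@filterE _ _ (ae_filter_ringOfSetsType arc)). Qed.

Lemma arc_of_open (P : R -> Prop) : {ae mu, forall t, 0 < t < 2 * pi -> P t} -> {ae arc, forall t, P t}.
Proof.
move=> h; apply/arc_ae.
have h0 : {ae mu, forall t, t != 0}.
  exists [set 0]; split; [exact: measurable_set1|exact: lebesgue_measure_set1|].
  by move=> t /= /negP; rewrite negbK => /eqP.
apply: (@filterS2 _ _ (ae_filter_ringOfSetsType mu) _ _ _ _ h h0) => t Pt t0 /andP[t1 t2].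
by apply: Pt; rewrite t2 lt_neqAle eq_sym t0 t1.
Qed.

Lemma mu_of_arc (P : R -> Prop) : {ae arc, forall t, P t} -> {ae mu, forall t, 0 < t < 2 * pi -> P t}.
Proof.
move=> /arc_ae h; apply: (@filterS _ _ (ae_filter_ringOfSetsType mu) _ _ _ h) => t Pt /andP[t1 t2].
by apply: Pt; rewrite t2 ltW.
Qed.

Lemma mu_closed (P : R -> Prop) : {ae mu, forall t, 0 < t < 2 * pi -> P t} ->
  {ae mu, forall t, 0 <= t <= 2 * pi -> P t}.
Proof.
move=> h.
have hc (c : R) : {ae mu, forall t, t != c}.
  exists [set c]; split; [exact: measurable_set1|exact: lebesgue_measure_set1|].
  by move=> t /= /negP; rewrite negbK => /eqP.
apply: (@filterS3 _ _ (ae_filter_ringOfSetsType mu) _ _ _ _ _ h (hc 0) (hc (2 * pi))).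
move=> t Pt t0 t1 /andP[t2 t3]; apply: Pt.
by rewrite lt_neqAle eq_sym t0 t2 lt_neqAle t1 t3.
Qed.

Lemma near_radius : \forall r \near (1 : R)^'-, 0 < r < 1.
Proof.
near=> r; apply/andP; split; near: r; first exact: nbhs_left_gt.
exact: nbhs_left_lt.
Unshelve. all: by end_near. Qed.

Lemma pt_lt1 (r t : R) : 0 < r < 1 -> normc (pt r t) < 1.
Proof. by move=> /andP[r0 r1]; rewrite normc_pt// ltW. Qed.

Lemma radial_unique (F : C -> C) t l m : radial F t l -> radial F t m -> l = m.
Proof. exact: (@ctends_unique _ _ ((1 : R)^'-)). Qed.

Lemma radial_ext (F G : C -> C) t l : (forall w, normc w < 1 -> F w = G w) -> radial F t l -> radial G t l.
Proof.
move=> FG; apply: ctends_ext; apply: filterS near_radius => r hr.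
by apply: FG; exact: pt_lt1.
Qed.

Lemma radial_le (F : C -> C) t l M : (forall w, normc w < 1 -> normc (F w) <= M) -> radial F t l -> normc l <= M.
Proof.
move=> FM h; apply: (ctends_le h); apply: filterS near_radius => r hr.
by apply: FM; exact: pt_lt1.
Qed.

Lemma boundary_limit f t l : radial (ext f) t l -> boundary f t = l.
Proof.
move=> h; have hc := (@ctends_cvg _ _ _ leftF _ _).1 h.
apply: (@radial_unique (ext f) t) => //.
by apply/(ctends_cvg _ _); have := cvgP _ hc; rewrite /boundary.
Qed.

Lemma boundary_radial f : {ae arc, forall t, radial (ext f) t (boundary f t)}.
Proof.
have [M _ fM] := Hinf_bounded f.
have [phi [_ h _]] := @fatou_radial _ (ext f) M (holo_ext f) (fun w _ => fM w).
apply: arc_of_open; apply: (@filterS _ _ (ae_filter_ringOfSetsType mu) _ _ _ h) => t ht /ht ht'.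
by rewrite (boundary_limit ht').
Qed.

Lemma boundary_le f M : (forall w, normc w < 1 -> normc (ext f w) <= M) ->
  {ae arc, forall t, normc (boundary f t) <= M}.
Proof. by move=> fM; apply: arc_ae1 (boundary_radial f) => t; exact: radial_le. Qed.

Lemma boundary_add f g : {ae arc, forall t, boundary (f + g) t = boundary f t + boundary g t}.
Proof.
apply: arc_ae2 (boundary_radial f) (boundary_radial g) => t hf hg.
apply: boundary_limit; apply: (@radial_ext (fun w => ext f w + ext g w)); last exact: ctendsD.
by move=> w _; rewrite ext_add.
Qed.

Lemma boundary_mul f g : {ae arc, forall t, boundary (f * g) t = boundary f t * boundary g t}.
Proof.
apply: arc_ae2 (boundary_radial f) (boundary_radial g) => t hf hg.
apply: boundary_limit; apply: (@radial_ext (fun w => ext f w * ext g w)); last exact: ctendsM.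
by move=> w _; rewrite ext_mul.
Qed.

Lemma boundary_scale (a : C) f : {ae arc, forall t, boundary (a *: f) t = a * boundary f t}.
Proof.
apply: arc_ae1 (boundary_radial f) => t hf.
apply: boundary_limit; apply: (@radial_ext (fun w => a * ext f w)); last by apply: ctendsM => //; exact: ctends_cst.
by move=> w _; rewrite ext_scale.
Qed.

Lemma boundary_one t : boundary (1 : Hinf R) t = 1.
Proof.
apply: boundary_limit; apply: (@radial_ext (cst 1)); last exact: ctends_cst.
by move=> w w1; rewrite ext_one.
Qed.

(** The Poisson kernel is nonnegative with total mass [2 * pi] and reproduces [f] from its radial
    limits. *)
Theorem boundary_max f M : 0 <= M -> {ae arc, forall t, normc (boundary f t) <= M} ->
  forall w, normc w < 1 -> normc (ext f w) <= M.
Proof.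
move=> M0 h w w1; have [M' _ fM] := Hinf_bounded f.
have [phi [pm hr rep]] := @fatou_radial _ (ext f) M' (holo_ext f) (fun w _ => fM w).
apply: (poisson_le_bound M0 pm rep) => //; apply: mu_closed.
apply: (@filterS2 _ _ (ae_filter_ringOfSetsType mu) _ _ _ _ hr (mu_of_arc h)) => t h1 h2 t02.
by rewrite -(boundary_limit (h1 t02)) h2.
Qed.

Lemma Linf_normP (F : R -> C) (e : R) : 0 <= e ->
  (Linf_norm F <= e%:E)%E <-> {ae arc, forall t, normc (F t) <= e}.
Proof.
move=> e0; rewrite /Linf_norm unlock.
have mT : (0 < arc [set: R])%E.
  rewrite -[arc _]/(mu (setT `&` `[0, 2 * pi[%classic)) setTI lebesgue_measure_itv /= lte_fin pi2_gt0.
  by rewrite -EFinD lte_fin subr0.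
rewrite mT; split.
  by move=> /ess_supP; apply: arc_ae1 => t /=; rewrite lee_fin ger0_norm// normc_ge0.
by move=> h; apply/ess_supP; apply: arc_ae1 h => t /=; rewrite lee_fin ger0_norm// normc_ge0.
Qed.

(** Dominated convergence for the constant sequence [h], which converges to [k] almost
    everywhere. *)
Lemma rint_ae_eq a b (h k : R -> R) : rbm a b h -> rbm a b k ->
  {ae mu, forall t, a <= t <= b -> h t = k t} -> rint a b h = rint a b k.
Proof.
move=> hm km hk; have [mh [M hM]] := hm.
apply: (@cvg_unique _ (@norm_hausdorff _ R) (rint a b h @[_ --> \oo])); first exact: cvg_cst.
apply: (@rint_dct _ a b (fun=> h) k M) => //.
apply: (@filterS _ _ (ae_filter_ringOfSetsType mu) _ _ _ hk) => t E tab.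
by rewrite -E//; exact: cvg_cst.
Qed.

Lemma ppterm_radial (zs : nat -> option D) n t :
  ppterm zs (pt r t) n @[r --> (1 : R)^'-] --> (0 : R).
Proof.
rewrite /ppterm; case: (zs n) => [a|] /=; last exact: cvg_cst.
have a1 := disc_lt1 a; set b := val a in a1 *.
have b0 : 0 < 1 - normc b by rewrite subr_gt0.
have k0 : 0 <= (1 - normc b ^+ 2) / (1 - normc b) ^+ 2.
  by rewrite divr_ge0 ?sqr_ge0// subr_ge0 ltW// sqr_lt1 ?normc_ge0.
apply: (@squeeze_cvgr _ _ _ _ (fun=> 0) (fun r => (1 - normc b ^+ 2) / (1 - normc b) ^+ 2 * (1 - r ^+ 2))).
- apply: filterS near_radius => r hr; rewrite ltW ?pp_gt0 ?pt_lt1//=.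
  have /andP[r0 r1] := hr; have r2 : 0 <= 1 - r ^+ 2 by rewrite subr_ge0 ltW// sqr_lt1// ltW.
  rewrite /pp normc_pt ?(ltW r0)// [leRHS]mulrAC; apply: ler_wpM2l.
    by rewrite mulr_ge0// subr_ge0 ltW// sqr_lt1 ?normc_ge0.
  have h : 1 - normc b <= normc (1 - conjc b * pt r t).
    apply: le_trans (ler_normcB _ _); rewrite normc1 lerB// normcM normc_conj ler_piMr ?normc_ge0//.
    by rewrite ltW// pt_lt1.
  by rewrite lef_pV2 ?posrE ?exprn_gt0// ?(lt_le_trans b0 h)// lerXn2r ?nnegrE ?normc_ge0// ltW.
- exact: cvg_cst.
- rewrite -[X in _ --> X](mulr0 ((1 - normc b ^+ 2) / (1 - normc b) ^+ 2)).
  apply: cvgM; first exact: cvg_cst.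
  rewrite -[X in _ --> X](subrr 1); apply: cvgB; first exact: cvg_cst.
  rewrite -[X in _ --> X](expr1n R 2); apply: (@cvg_at_left_filter _ _ (fun r : R => r ^+ 2)).
  exact: exprn_continuous.
Qed.

Lemma bprod_ge zs N w : normc w < 1 -> 1 - ppsum zs N w <= normc (bprod zs N w).
Proof.
move=> w1; elim: N => [|N IH]; first by rewrite /bprod /ppsum !big_ord0 subr0 normc1.
rewrite bprodS ppsumS normcM.
have := bfac_sqr zs N w1; have := bfac_le1 zs N w1; have := bprod_le1 zs N w1.
have := ppsum_ge0 zs N w1; have := ppterm_ge0 zs N w1.
move: IH (normc_ge0 (bfac zs w N)) (normc_ge0 (bprod zs N w)).
move: (normc (bfac zs w N)) (normc (bprod zs N w)) (ppsum zs N w) (ppterm zs w N) => x y s p.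
by nra.
Qed.

Lemma ppsum_radial (zs : nat -> option D) N t :
  ppsum zs N (pt r t) @[r --> (1 : R)^'-] --> (0 : R).
Proof.
elim: N => [|N IH].
  by under eq_cvg do rewrite /ppsum big_ord0; exact: cvg_cst.
under eq_cvg do rewrite ppsumS.
by have := cvgD IH (ppterm_radial zs N t); rewrite addr0; apply.
Qed.

Lemma bprod_radial zs N t : normc (bprod zs N (pt r t)) @[r --> (1 : R)^'-] --> (1 : R).
Proof.
apply: (@squeeze_cvgr _ _ _ _ (fun r => 1 - ppsum zs N (pt r t)) (fun=> 1)).
- apply: filterS near_radius => r hr; have r1 := pt_lt1 t hr.
  by rewrite bprod_ge// bprod_le1.
- rewrite -[X in _ --> X](subr0 1); apply: cvgB; first exact: cvg_cst.
  exact: ppsum_radial.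
- exact: cvg_cst.
Qed.

Theorem blaschke_radial_norm zs (B : C -> C) : summable_zeros zs -> holo B ->
  (forall w, normc w < 1 -> ctends \oo (bprod zs ^~ w) (B w)) ->
  {ae arc, forall t, forall l, radial B t l -> normc l = 1}.
Proof.
move=> sz Bh BP.
have n0 : normc (0 : C) < 1 by rewrite normc0.
have B1 w : normc w < 1 -> normc (B w) <= 1.
  by move=> w1; apply: (ctends_le (BP _ w1)); apply: nearW => n; exact: bprod_le1.
have [phi [pm hr rep]] := fatou_radial Bh B1.
have key (e : R) : 0 < e -> 2 * pi * (1 - 2 * e) <= rint 0 (2 * pi) (fun t => normc (phi t)).
  move=> e0; have [K hK] := defect_tail sz e0.
  pose ys n := zs (K + n)%N.
  have sy : summable_zeros ys by exists e => N; exact: hK.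
  have [T [Th T1 TP]] := blaschke_exists sy.
  have [psi [sm hs rep2]] := fatou_radial Th T1.
  have BT w : normc w < 1 -> B w = bprod zs K w * T w.
    move=> w1; apply: (@ctends_unique _ _ \oo _ (fun n => bprod zs (K + n)%N w)).
      move=> d d0; have [m _ hm] := BP w w1 d d0; exists m => // n /= mn.
      by apply: hm; exact: leq_trans mn (leq_addl _ _).
    apply: (@ctends_ext _ _ \oo _ (fun n => bprod zs K w * bprod ys n w)).
      by apply: nearW => n; rewrite /bprod big_split_ord.
    by apply: ctendsM; [exact: ctends_cst|exact: TP].
  have E : {ae mu, forall t, 0 <= t <= 2 * pi -> normc (psi t) = normc (phi t)}.
    apply: mu_closed; apply: (@filterS2 _ _ (ae_filter_ringOfSetsType mu) _ _ _ _ hr hs) => t h1 h2 t02.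
    have c1 := @ctends_norm _ _ _ leftF _ _ (h1 t02); have c2 := @ctends_norm _ _ _ leftF _ _ (h2 t02).
    apply: (@cvg_unique _ (@norm_hausdorff _ R) (normc (B (pt r t)) @[r --> (1 : R)^'-])) => //.
    rewrite -[normc (psi t)]mul1r.
    have c3 := cvgM (bprod_radial zs K t) c2.
    move=> A /c3 hA; apply: (@filterS2 _ _ leftF _ _ _ _ near_radius hA) => r hr' /=.
    by rewrite BT ?pt_lt1// normcM.
  rewrite -(rint_ae_eq (cbm_norm sm) (cbm_norm pm) E).
  have := rep2 0 n0; rewrite (@eq_cint _ _ _ _ psi); last first.
    move=> t _; rewrite /poisson subr0 normc0 normc_pt// expr0n subr0 expr1n invr1 mulr1 mulr1//.
  move=> rep0; apply: le_trans (normc_cint_le sm).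
  rewrite rep0 normcM normcR ger0_norm ?(ltW pi2_gt0)// ler_pM2l//.
  have : normc (T 0 - 1) <= 2 * e.
    apply: (@ctends_le _ _ \oo _ (fun n => bprod ys n 0 - 1)).
      by apply: ctendsB; [exact: TP|exact: ctends_cst].
    apply: nearW => n; apply: (le_trans (@prod_near1 _ (bfac ys 0) n _)).
      by move=> m; exact: bfac_le1.
    apply: (@le_trans _ _ ((\sum_(m < n) defect ys m) * 2)).
      rewrite mulr_suml; apply: ler_sum => m _.
      by apply: (le_trans (one_sub_bfac ys m n0)); rewrite normc0 subr0 invr1 mulr1.
    by rewrite mulrC ler_pM2l//; exact: hK.
  have := ler_normcB 1 (1 - T 0); rewrite subKr normc1 [normc (1 - _)]normcB.
  by move: (normc (T 0)) (normc (T 0 - 1)) => x y; lra.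
have phi1 : {ae mu, forall t, 0 <= t <= 2 * pi -> normc (phi t) <= 1}.
  apply: mu_closed; apply: (@filterS _ _ (ae_filter_ringOfSetsType mu) _ _ _ hr) => t h1 t02.
  exact: radial_le B1 (h1 t02).
have dm : rbm 0 (2 * pi) (fun t => 1 - normc (phi t)) by apply: rbmB; [exact: rbm_cst|exact: cbm_norm].
have dn := rbm_norm dm.
have E0 : rint 0 (2 * pi) (fun t => `|1 - normc (phi t)|) = 0.
  have E1 : rint 0 (2 * pi) (fun t => `|1 - normc (phi t)|) = rint 0 (2 * pi) (fun t => 1 - normc (phi t)).
    apply: rint_ae_eq => //; apply: (@filterS _ _ (ae_filter_ringOfSetsType mu) _ _ _ phi1) => t h t02.
    by rewrite ger0_norm// subr_ge0 h.
  apply/eqP; rewrite eq_le; apply/andP; split; last by apply: rint_ge0.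
  rewrite E1 rintB ?rint_cst ?(ltW pi2_gt0)//; [|exact: rbm_cst|exact: cbm_norm].
  rewrite subr0 mul1r subr_le0; apply/ler_addgt0Pr => e e0.
  have e1 : 0 < e / (2 * (2 * pi)) by rewrite divr_gt0// mulr_gt0.
  rewrite -lerBlDr; apply: le_trans (key _ e1); rewrite le_eqVlt; apply/orP; left; apply/eqP.
  by move: pi2_gt0; move: (2 * pi) => x x0; field; rewrite gt_eqF.
have := rint_eq0_ae dn (fun t _ => normr_ge0 _) E0 => H.
apply: arc_of_open; apply: (@filterS2 _ _ (ae_filter_ringOfSetsType mu) _ _ _ _ hr H) => t h1 h2 t02 l hl.
have E := h1 t02; have -> := radial_unique hl E.
have /andP[t1 t2] := t02.
by have := h2 _; rewrite (ltW t1) (ltW t2) => /(_ isT)/eqP; rewrite normr_eq0 subr_eq0 => /eqP <-.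
Qed.

Lemma radius_lt1 (n : nat) : 0 <= 1 - n.+2%:R^-1 :> R /\ 1 - n.+2%:R^-1 < 1 :> R.
Proof. by rewrite subr_ge0 invf_le1// ler1n gtrBl invr_gt0. Qed.

Lemma rcont_circle f r t : 0 <= r < 1 -> rcont (fun s => ext f (pt r s)) t.
Proof.
move=> /andP[r0 r1]; apply: rcont_pt; apply: cdiff_cont; apply: holo_ext.
by rewrite normc_pt.
Qed.

Lemma measurable_osc f r s e : 0 <= r < 1 -> 0 <= s < 1 ->
  measurable ([set t | normc (ext f (pt r t) - ext f (pt s t)) <= e] : set (measurableTypeR R)).
Proof.
move=> hr hs; pose c t := normc (ext f (pt r t) - ext f (pt s t)).
have cc : continuous c.
  by move=> t; apply: ctends_norm; apply: ctendsB; exact: rcont_circle.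
have := continuous_measurable_fun cc measurableT (measurable_itv `]-oo, e]).
rewrite setTI; congr (measurable _); apply/seteqP; split => t /=; rewrite /preimage/= in_itv//=.
Qed.

Definition radial_domain f : set R := [set t | exists l, radial (ext f) t l].

(** An enumeration of the rationals; an index that codes no rational gives 0. *)
Let ratio (n : nat) : R := oapp (fun q : rat => ratr q) 0 (unpickle n).

Let ratio_dense (a b : R) : a < b -> exists n, a < ratio n < b.
Proof.
move=> ab; have [q] := rat_in_itvoo ab; rewrite in_itv/= => hq.
by exists (pickle q); rewrite /ratio pickleK.
Qed.

Let osc_set f (k n p q : nat) : set R :=
  [set t | (1 - n.+2%:R^-1 < ratio p < 1) -> (1 - n.+2%:R^-1 < ratio q < 1) ->
     normc (ext f (pt (ratio p) t) - ext f (pt (ratio q) t)) <= k.+1%:R^-1].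

(** Cauchy's criterion restricted to rational radii, which suffices because [ext f] is continuous
    inside the disc. It exhibits the domain as a countable combination of closed sets. *)
Lemma radial_domainE f : radial_domain f =
  \bigcap_k \bigcup_n \bigcap_p \bigcap_q osc_set f k n p q.
Proof.
apply/seteqP; split => t.
  move=> [l hl] k _; have e0 : 0 < k.+1%:R^-1 / 2 :> R by rewrite divr_gt0.
  have [d d0 hd] := hl _ e0.
  have [n hn] : exists n : nat, n.+2%:R^-1 < d :> R.
    exists (Num.truncn d^-1); rewrite invf_plt ?posrE//.
    by apply: (lt_trans (truncnS_gt _)); rewrite ltr_nat.
  exists n => // p _ q _ /andP[p1 p2] /andP[q1 q2].
  have near x : 1 - n.+2%:R^-1 < x -> x < 1 -> normc (ext f (pt x t) - l) < k.+1%:R^-1 / 2.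
    move=> x1 x2; apply: hd => //=; rewrite ger0_norm ?subr_ge0 ?(ltW x2)//.
    by rewrite ltrBlDr -ltrBlDl (le_lt_trans _ x1)// lerB// ltW.
  apply: (le_trans (normc_triangle _ _ l)); have := near _ p1 p2; have := near _ q1 q2.
  rewrite [normc (l - _)]normcB; move: (normc _) (normc _) (k.+1%:R^-1) => x y z; lra.
move=> h.
have close (e : R) : 0 < e -> exists2 d : R, 0 < d <= 1 & forall r s, 1 - d < r < 1 -> 1 - d < s < 1 ->
    normc (ext f (pt r t) - ext f (pt s t)) <= e.
  move=> e0; have e3 : 0 < e / 3 by rewrite divr_gt0.
  pose k := Num.truncn (e / 3)^-1.
  have hk : k.+1%:R^-1 <= e / 3.
    by rewrite -[leRHS]invrK lef_pV2 ?posrE ?invr_gt0// ltW// truncnS_gt.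
  have [n _ hn] := h k I; have [rn0 rn1] := radius_lt1 n.
  exists n.+2%:R^-1; first by rewrite invr_gt0 ltr0n/= invf_le1// ler1n.
  have appr r : 1 - n.+2%:R^-1 < r < 1 -> exists2 p, 1 - n.+2%:R^-1 < ratio p < 1 &
      normc (ext f (pt r t) - ext f (pt (ratio p) t)) <= e / 3.
    move=> /andP[r1 r2]; have r0 : 0 <= r by exact: le_trans (ltW r1).
    have : ctends (nbhs r) (fun x => ext f (pt x t)) (ext f (pt r t)).
      apply: (@ctends_comp _ _ _ _ (fun x => pt x t) (ext f)).
        by apply: ctends_pt; [exact: cvg_id|exact: cvg_cst].
      by apply: cdiff_cont; apply: holo_ext; rewrite normc_pt.
    move=> /(_ _ e3)[d /= d0 hd].
    have ab : Num.max (1 - n.+2%:R^-1) (r - d) < r by rewrite gt_max r1 gtrBl d0.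
    have [p /andP[]] := ratio_dense ab; rewrite gt_max => /andP[p1 p2] p3.
    exists p; first by rewrite p1 (lt_trans p3).
    by rewrite normcB ltW//; apply: hd; rewrite /= gtr0_norm ?subr_gt0// ltrBlDr -ltrBlDl.
  move=> r s hr hs; have [p hp rp] := appr r hr; have [q hq sq] := appr s hs.
  have hpq := le_trans (hn p I q I hp hq) hk.
  apply: (le_trans (normc_triangle _ _ (ext f (pt (ratio p) t)))).
  have : normc (ext f (pt (ratio p) t) - ext f (pt s t)) <= e / 3 + e / 3.
    apply: (le_trans (normc_triangle _ _ (ext f (pt (ratio q) t)))).
    by rewrite lerD// normcB.
  move: rp; move: (normc _) (normc _) => x y; lra.
have cv (g : C -> R) : (forall z w, `|g z - g w| <= normc (z - w)) ->
    cvg (g (ext f (pt r t)) @[r --> (1 : R)^'-]).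
  move=> gl; apply: cauchy_cvg; apply: cauchy_exP => e e0.
  have e2 : 0 < e / 2 by rewrite divr_gt0.
  have [d /andP[d0 d1] hd] := close _ e2.
  have m1 : 1 - d < 1 - d / 2 < 1.
    by rewrite gtrBl divr_gt0// andbT ltrD2l ltrN2 ltr_pdivrMr// mulr_natr mulr2n ltrDl.
  exists (g (ext f (pt (1 - d / 2) t))).
  change (\forall r \near (1 : R)^'-, ball (g (ext f (pt (1 - d / 2) t))) e (g (ext f (pt r t)))).
  near=> r; rewrite /ball /=; apply: (le_lt_trans (gl _ _)); apply: (@le_lt_trans _ _ (e / 2)).
    apply: hd => //; apply/andP; split; near: r.
      by apply: nbhs_left_gt; rewrite gtrBl.
    exact: nbhs_left_lt.
  by rewrite ltr_pdivrMr// mulr_natr mulr2n ltrDl.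
have hR z w : `|complex.Re z - complex.Re w| <= normc (z - w) by rewrite -ReB ler_Re_normc.
have hI z w : `|complex.Im z - complex.Im w| <= normc (z - w) by rewrite -ImB ler_Im_normc.
have /cvg_ex[a ha] := cv _ hR; have /cvg_ex[b hb] := cv _ hI.
by exists (a +i* b); apply: ctends_ReIm.
Unshelve. all: try end_near.
Qed.

Lemma measurable_radial_domain f : measurable (radial_domain f : set (measurableTypeR R)).
Proof.
rewrite radial_domainE; apply: bigcapT_measurable => k; apply: bigcupT_measurable => n.
apply: bigcapT_measurable => p; apply: bigcapT_measurable => q; rewrite /osc_set.
have [n0 n1] := radius_lt1 n.
have [/andP[p1 p2]|np] := boolP (1 - n.+2%:R^-1 < ratio p < 1); last first.
  by rewrite (_ : [set _ | _] = setT)//; apply/seteqP; split.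
have [/andP[q1 q2]|nq] := boolP (1 - n.+2%:R^-1 < ratio q < 1); last first.
  by rewrite (_ : [set _ | _] = setT)//; apply/seteqP; split.
have := @measurable_osc f (ratio p) (ratio q) k.+1%:R^-1.
rewrite p2 q2 (le_trans n0 (ltW p1)) (le_trans n0 (ltW q1)) => /(_ isT isT).
by congr (measurable _); apply/seteqP; split => t /=; [move=> h _ _|apply].
Qed.

(** For [g] the real or the imaginary part. On the domain of the radial limit the function is a
    limit of continuous ones; outside, [lim] returns the same default value for every [t]. *)
Lemma measurable_boundary_part (g : C -> R) f : (forall z w, `|g z - g w| <= normc (z - w)) ->
  (forall t l, radial (ext f) t l -> g (ext f (pt r t)) @[r --> (1 : R)^'-] --> g l) ->
  measurable_fun setT (fun t : measurableTypeR R => g (boundary f t)).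
Proof.
move=> gl glim; have mD := measurable_radial_domain f.
rewrite -(setUv (radial_domain f)); apply/measurable_funU => //; first exact: measurableC.
split.
  apply: (@measurable_fun_cvg _ _ _ _ (fun n t => g (ext f (pt (1 - n.+2%:R^-1) t)))).
    move=> n; apply: (@measurable_funS _ _ _ _ setT) => //.
    apply: continuous_measurable_fun => t; have [n0 n1] := radius_lt1 n.
    apply/cvgrPdist_lt => e e0.
    have := @rcont_circle f (1 - n.+2%:R^-1) t; rewrite n0 n1 => /(_ isT _ e0).
    by apply: filterS => s; rewrite normcB; apply: le_lt_trans.
  move=> t [l hl]; rewrite (boundary_limit hl).
  apply: ((cvg_at_leftP _ _ _).1 (glim t l hl)); split => [n|]; first by case: (radius_lt1 n).
  rewrite -[X in _ --> X](subr0 1); apply: cvgB; first exact: cvg_cst.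
  by have := @cvg_harmonic R; rewrite -cvg_shiftS.
apply: (@eq_measurable_fun _ _ _ _ _ (cst (g (point : C^o)))); last exact: measurable_cst.
move=> t; rewrite inE => nt; have E : boundary f t = (point : C^o).
  rewrite /boundary dvgP// => /cvg_ex[l hl].
  by apply: nt; exists l; apply/(@ctends_cvg _ _ _ leftF).
by rewrite E.
Qed.

Lemma boundary_Linf f : Linf (boundary f).
Proof.
split.
- apply: measurable_boundary_part => [z w|t l hl]; last exact: ctends_Re.
  by rewrite -ReB ler_Re_normc.
- apply: measurable_boundary_part => [z w|t l hl]; last exact: ctends_Im.
  by rewrite -ImB ler_Im_normc.
have [M M0 fM] := Hinf_bounded f.
apply: (@le_lt_trans _ _ M%:E); last exact: ltry.
by apply/Linf_normP => //; apply: boundary_le => w _; exact: fM.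
Qed.
End boundary_values.

(** * Thick sets *)

Section thick_sets.
Variable R : realType.
Local Notation C := R[i].
Implicit Types (f : C -> C) (S : set C) (a w z : C).

(** The involutive automorphism of the disc that exchanges [a] and 0. *)
Definition mob a w : C := (a - w) / (1 - conjc a * w).

Lemma normc_mob a w : normc (mob a w) = psh a w. Proof. by []. Qed.

Lemma mob_lt1 a w : normc a < 1 -> normc w < 1 -> normc (mob a w) < 1.
Proof. by move=> a1 w1; rewrite normc_mob psh_lt1. Qed.

Lemma one_sub_norm_neq0 a : normc a < 1 -> 1 - conjc a * a != 0.
Proof. by move=> a1; apply: conjM_neq0. Qed.

Lemma mobK a w : normc a < 1 -> normc w < 1 -> mob a (mob a w) = w.
Proof.
move=> a1 w1; have n1 := conjM_neq0 a1 w1; have n2 := one_sub_norm_neq0 a1.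
rewrite /mob.
have -> : a - (a - w) / (1 - conjc a * w) = w * (1 - conjc a * a) / (1 - conjc a * w).
  by field.
have -> : 1 - conjc a * ((a - w) / (1 - conjc a * w)) = (1 - conjc a * a) / (1 - conjc a * w).
  by field.
by field; rewrite n1 n2.
Qed.

Lemma mob0 a : mob a 0 = a.
Proof. by rewrite /mob mulr0 !subr0 divr1. Qed.

Lemma cdiff_mob a w : normc a < 1 -> normc w < 1 -> cdiff (mob a) w.
Proof.
move=> a1 w1; apply: cdiff_div; first exact: conjM_neq0.
  by apply: cdiffB; [exact: cdiff_cst|exact: cdiff_id].
apply: cdiffB; first exact: cdiff_cst.
by apply: cdiffM; [exact: cdiff_cst|exact: cdiff_id].
Qed.

Lemma pp_mob a w : normc a < 1 -> normc w < 1 -> pp a (mob a w) = 1 - normc w ^+ 2.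
Proof.
move=> a1 w1; have m1 := mob_lt1 a1 w1.
by rewrite -{2}(mobK a1 w1) normc_mob psh_pp// subKr.
Qed.

Let arith1 (x p : R) : 0 <= x -> p < 2 -> x ^+ 2 * (1 - p / 2) <= 1 - p -> 0 < p -> p / 4 <= 1 - x.
Proof.
move=> x0 p2 h p0; have a0 : 0 < 1 - p / 2 by lra.
have h1 : x ^+ 2 <= 1 - p / 2 by rewrite -(ler_pM2r a0); apply: (le_trans h); nra.
have h2 : x <= 1 - p / 4 by rewrite -(@ler_pXn2r _ 2)// ?nnegrE; [apply: (le_trans h1); nra|lra].
lra.
Qed.

Let arith2 (q p s : R) : 0 < p -> 0 <= q -> p / 4 <= 1 - q -> 0 <= s ->
  2 * q / (1 - q) * s <= 8 / p * s.
Proof.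
move=> p0 q0 h s0; rewrite ler_wpM2r//.
have d0 : 0 < 1 - q by apply: lt_le_trans h; rewrite divr_gt0.
by rewrite ler_pdivrMr// mulrAC ler_pdivlMr//; nra.
Qed.

(** The map of l to [mob w (r%:C * l)] carries the unit disc to the hyperbolic disc
    [p / 2 < pp w v]. The inequality is applied to s - c f with c f(w) = |f(w)|: its real part at
    the centre is the gap s - |f(w)|, so a value of nearly maximal modulus forces [f] to be almost
    constant. *)
Lemma borel_caratheodory_local f w (s p : R) : holo f -> normc w < 1 -> 0 < p ->
  (forall v, normc v < 1 -> p / 2 <= pp w v -> normc (f v) <= s) ->
  forall v, normc v < 1 -> p <= pp w v -> normc (f v - f w) <= 8 / p * (s - normc (f w)).
Proof.
move=> fh w1 p0 fs v v1 pv.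
have p1 : p <= 1 by apply: le_trans (pp_le1 w1 v1).
pose r := Num.sqrt (1 - p / 2).
have h0 : 0 < 1 - p / 2 by rewrite subr_gt0 ltr_pdivrMr//; lra.
have r0 : 0 < r by rewrite sqrtr_gt0.
have r2 : r ^+ 2 = 1 - p / 2 by rewrite sqr_sqrtr// ltW.
have r1 : r < 1 by rewrite -(@expr_lt1 _ 2)// ?(ltW r0)// r2 gtrBl divr_gt0.
have [c c1 cf] := phase (f w).
pose u l := r%:C * l; have u1 l : normc l < 1 -> normc (u l) < 1.
  by move=> l1; rewrite normcM normcR gtr0_norm// mulr_ilt1 ?normc_ge0// ltW.
pose F l := f (mob w (u l)).
have Fh : holo F.
  move=> l l1; apply: (@cdiff_comp _ f (fun l => mob w (u l))).
    apply: (@cdiff_comp _ (mob w) u); last by apply: cdiff_mob => //; exact: u1.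
    by apply: cdiffM; [exact: cdiff_cst|exact: cdiff_id].
  by apply: fh; apply: mob_lt1 => //; exact: u1.
have FS l : normc l < 1 -> normc (F l) <= s.
  move=> l1; apply: fs; first by apply: mob_lt1 => //; exact: u1.
  rewrite pp_mob ?u1// normcM normcR gtr0_norm// exprMn r2.
  have : normc l ^+ 2 <= 1 by rewrite ltW// sqr_lt1 ?normc_ge0.
  by move: (sqr_ge0 (normc l)); move: (normc l ^+ 2) => x; clear - h0; nra.
pose h l := s%:C - c * F l.
have hh : holo h.
  move=> l l1; apply: cdiffB; first exact: cdiff_cst.
  by apply: cdiffM; [exact: cdiff_cst|exact: Fh].
have hRe l : normc l < 1 -> 0 <= complex.Re (h l).
  move=> l1; rewrite /h ReB /= subr_ge0; apply: (le_trans (Re_le_normc _)).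
  by rewrite normcM c1 mul1r FS.
have n0 : normc (0 : C) < 1 by rewrite normc0.
have F0 : F 0 = f w by rewrite /F /u mulr0 mob0.
have h0E : complex.Re (h 0) = s - normc (f w) by rewrite /h F0 cf ReB.
have rC : r%:C != 0 :> C by rewrite -normc_eq0 normcR normr_eq0 gt_eqF.
pose l := mob w v / r%:C.
have nl : normc l ^+ 2 * (1 - p / 2) <= 1 - p.
  rewrite normc_div normcR gtr0_norm// expr_div_n r2 divfK ?gt_eqF//.
  by rewrite normc_mob psh_pp// lerD2l lerN2.
have q4 := arith1 (normc_ge0 l) (le_lt_trans p1 (ltr1n _ 2)) nl p0.
have l1 : normc l < 1 by rewrite -subr_gt0 (lt_le_trans _ q4)// divr_gt0.
have Fl : F l = f v by rewrite /F /u mulrCA divff// mulr1 mobK.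
have := borel_caratheodory hh hRe n0 l1; rewrite h0E.
have -> : psh 0 l = normc l by rewrite /psh conjc0 mul0r subr0 divr1 sub0r normcN.
have -> : h l - h 0 = c * (f w - f v) by rewrite /h Fl F0; ring.
rewrite normcM c1 mul1r normcB => H; apply: (le_trans H); apply: arith2 => //.
  exact: normc_ge0.
by rewrite subr_ge0 -F0 FS.
Qed.

(* {w | p <= pp z w} is a hyperbolic disc centred at z whose radius is large when p is small. *)
Definition thick S := forall p : R, 0 < p ->
  exists2 z, normc z < 1 & forall w, normc w < 1 -> p <= pp z w -> S w.

Lemma thick_sub S S' : (forall w, normc w < 1 -> S w -> S' w) -> thick S -> thick S'.
Proof.
by move=> h tS p p0; have [z z1 hz] := tS p p0; exists z => // w w1 pw; apply: h => //; exact: hz.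
Qed.

Lemma pp_diag z : normc z < 1 -> pp z z = 1.
Proof.
move=> z1; have := psh_pp z1 z1; rewrite /psh subrr mul0r normc0 expr0n /= => /eqP.
by rewrite eq_sym subr_eq0 => /eqP <-.
Qed.

Lemma thick_nonempty S : thick S -> exists2 z, normc z < 1 & S z.
Proof. by move=> /(_ 1 ltr01)[z z1 h]; exists z => //; apply: h => //; rewrite pp_diag. Qed.

Let arith3 (x y p q : R) : 0 < p -> 0 < q -> p <= x -> q <= y -> p * q <= x * y.
Proof. by move=> p0 q0 h h'; apply: ler_pM => //; exact: ltW. Qed.

(* The infimum of the s such that S /\ {|f| <= s} is thick is almost attained at some point of
   every large disc, and there the Borel-Caratheodory inequality makes f almost constant. *)
Theorem thick_osc S f (e q : R) : holo f -> (forall w, normc w < 1 -> normc (f w) <= 1) ->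
  0 < e -> 0 < q -> thick S ->
  thick [set z | S z /\ forall v, normc v < 1 -> q <= pp z v -> normc (f v - f z) <= e].
Proof.
move=> fh f1 e0 q0 tS p p0.
pose p' := Num.min p 1; pose q' := Num.min q 1.
have p'0 : 0 < p' by rewrite lt_min p0 ltr01.
have q'0 : 0 < q' by rewrite lt_min q0 ltr01.
have p'1 : p' <= 1 by rewrite ge_min lexx orbT.
have q'1 : q' <= 1 by rewrite ge_min lexx orbT.
(* By [pp_chain], [p <= pp w v] and [q <= pp v u] imply [p2 <= pp w u]; controlling [f] on this
   larger disc around [w] controls its oscillation around every such [v]. *)
pose p2 := p' * q' / 4; have p20 : 0 < p2 by rewrite divr_gt0// mulr_gt0.
have p2p : p2 <= p' by rewrite ler_pdivrMr// ler_pM2l// (le_trans q'1)// ler1n.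
pose A := [set s : R | thick (S `&` [set w | normc (f w) <= s])].
have A1 : A 1 by apply: thick_sub tS => w w1 Sw; split => //; exact: f1.
have hA : has_inf A.
  split; first by exists 1.
  by exists 0 => s /thick_nonempty[w w1 [_ /= h]]; apply: le_trans (normc_ge0 _) h.
(* Chosen so that [8 / p2 * (2 * eta) = e / 2]. *)
pose eta := e * p2 / 32; have eta0 : 0 < eta by rewrite divr_gt0// mulr_gt0.
have [s As sA] := inf_adherent eta0 hA.
have nA : ~ A (inf A - eta).
  move=> h; have : inf A <= inf A - eta by apply: ge_inf => //; case: hA.
  by rewrite lerBrDl gerDr leNgt eta0.
(* Since the level [inf A - eta] gives no thick set, every disc of one fixed radius contains a point
   [w] where [S] fails or |f| exceeds that level. Deep inside a large disc of the set for the level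
   [s], the first alternative is excluded. *)
have [p0' [p0'0 hw]] : exists p0', 0 < p0' /\ forall z, normc z < 1 -> exists w,
    [/\ normc w < 1, p0' <= pp z w & S w -> inf A - eta < normc (f w)].
  apply: contrapT => nh; apply: nA => d d0; apply: contrapT => nz; apply: nh.
  exists d; split => // z z1; apply: contrapT => nw; apply: nz; exists z => // w w1 dw.
  apply: contrapT => nSw; apply: nw; exists w; split => // Sw; rewrite ltNge; apply/negP => h.
  by apply: nSw.
have pT0 : 0 < p0' * (p2 / 2) / 4 by rewrite divr_gt0// mulr_gt0// divr_gt0.
have [z0 z01 hz0] := As _ pT0.
have [w [w1 pw fw]] := hw _ z01.
have inT v : normc v < 1 -> p2 / 2 <= pp w v -> S v /\ normc (f v) <= s.
  move=> v1 h; apply: hz0 => //; rewrite ler_pdivrMr// [leRHS]mulrC.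
  apply: le_trans (pp_chain z01 w1 v1); apply: arith3 => //; exact: divr_gt0.
have Sw : S w.
  apply: (inT w w1 _).1; rewrite pp_diag// ler_pdivrMr// mul1r.
  by apply: le_trans (le_trans p2p p'1) _; rewrite ler1n.
have osc v : normc v < 1 -> p2 <= pp w v -> normc (f v - f w) <= e / 2.
  move=> v1 pv; have fs u : normc u < 1 -> p2 / 2 <= pp w u -> normc (f u) <= s.
    by move=> u1 pu; have [] := inT u u1 pu.
  apply: (le_trans (borel_caratheodory_local fh w1 p20 fs v1 pv)).
  have : s - normc (f w) <= 2 * eta by have := fw Sw; move: sA; clear; lra.
  rewrite -(ler_pM2l (_ : 0 < 8 / p2)); last by rewrite divr_gt0.
  move=> /le_trans; apply; rewrite /eta le_eqVlt; apply/orP; left; apply/eqP.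
  by field; rewrite gt_eqF.
have pdiv v : normc v < 1 -> p <= pp w v -> p' <= pp w v.
  by move=> v1; apply: le_trans; rewrite ge_min lexx.
exists w => // v v1 pv; split.
  apply: (inT v v1 _).1; apply: le_trans (pdiv v v1 pv); apply: le_trans p2p.
  by rewrite ler_pdivrMr// ler_pMr// ler1n.
move=> u u1 pu; apply: (le_trans (normc_triangle _ _ (f w))).
have h1 : normc (f u - f w) <= e / 2.
  apply: osc => //; rewrite ler_pdivrMr// [leRHS]mulrC; apply: le_trans (pp_chain w1 v1 u1).
  apply: arith3 => //; first exact: pdiv.
  by apply: le_trans pu; rewrite ge_min lexx.
have h2 : normc (f v - f w) <= e / 2 by apply: osc => //; apply: le_trans p2p (pdiv v v1 pv).
by rewrite [normc (f w - _)]normcB; move: h1 h2; move: (normc _) (normc _) => x y; clear; lra.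
Qed.
End thick_sets.

(** * Characters obtained as limits along thick sets *)

Lemma mk_char (R : realType) (y : Hinf R -> R[i]) :
  (forall f g, y (f - g) = y f - y g) -> y 1 = 1 -> (forall f g, y (f * g) = y f * y g) ->
  (forall a f, y (a *: f) = a * y f) -> exists x : spectrum R, forall f, x f = y f.
Proof.
move=> yB y1 yM yZ.
pose m1 := GRing.isZmodMorphism.Build _ _ y yB.
pose m2 := GRing.isMonoidMorphism.Build _ _ y (conj y1 yM).
pose m3 := GRing.isScalable.Build _ _ _ _ y yZ.
pose x : spectrum R := HB.pack y m1 m2 m3.
by exists x.
Qed.

Section ultralimits.
Variable R : realType.
Local Notation C := R[i].
Variables (U : set_system C) (UU : UltraFilter U).

Let UP : ProperFilter U. Proof. exact: ultra_proper. Qed.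
Let UF : Filter U. Proof. exact: filter_filter. Qed.

Lemma ultra_real_limit (g : C -> R) M : (forall w, `|g w| <= M) ->
  exists l : R, forall e, 0 < e -> U [set w | `|g w - l| < e].
Proof.
move=> gM; pose A := [set x : R | U [set w | x <= g w]].
have hA : has_sup A.
  split.
    by exists (- M); apply: filterE => w; have := gM w; rewrite ler_norml => /andP[].
  exists M => x Ax; have [w /= xw] := filter_ex Ax; apply: (le_trans xw).
  by have := gM w; rewrite ler_norml => /andP[].
exists (sup A) => e e0.
have [x Ax xe] := sup_adherent e0 hA.
have nA : ~ A (sup A + e / 2).
  move=> h; have : sup A + e / 2 <= sup A by apply: ub_le_sup => //; case: hA.
  by rewrite gerDl leNgt divr_gt0.
have [//|h] := in_ultra_setVsetC [set w | sup A + e / 2 <= g w] UU.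
apply: filterS2 Ax h => w /= xg /negP; rewrite -ltNge => gx.
by rewrite ltr_norml; move: xe xg gx; move: (sup A) (g w) => s t; clear - e0 => h1 h2 h3; apply/andP; split; lra.
Qed.

Lemma ultra_limit (g : C -> C) M : (forall w, normc (g w) <= M) -> exists l, ctends U g l.
Proof.
move=> gM.
have [a ha] := @ultra_real_limit (fun w => complex.Re (g w)) M (fun w => le_trans (ler_Re_normc _) (gM w)).
have [b hb] := @ultra_real_limit (fun w => complex.Im (g w)) M (fun w => le_trans (ler_Im_normc _) (gM w)).
exists (a +i* b) => e e0; have e2 : 0 < e / 2 by rewrite divr_gt0.
apply: filterS2 (ha _ e2) (hb _ e2) => w /= h1 h2.
apply: (le_lt_trans (normc_le_ReIm _)); rewrite ReB ImB /=.
by move: h1 h2; move: (`|_|) (`|_|) => x y; lra.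
Qed.

Lemma ultra_char : U [set w | normc w < 1] ->
  exists x : spectrum R, forall f : Hinf R, ctends U (ext f) (x f).
Proof.
move=> UD; have ex (f : Hinf R) : exists l, ctends U (ext f) l.
  by have [M _ fM] := Hinf_bounded f; exact: ultra_limit fM.
have [y yP] := choice ex.
have yE (f : Hinf R) l : ctends U (ext f) l -> y f = l by move=> h; exact: ctends_unique (yP f) h.
have [||||x xP] := @mk_char _ y.
- move=> f g; apply: yE; apply: (@ctends_ext _ _ _ _ (fun w => ext f w - ext g w)); last exact: ctendsB.
  by apply: filterE => w; rewrite ext_sub.
- apply: yE; apply: (@ctends_ext _ _ _ _ (cst 1)); last exact: ctends_cst.
  by apply: filterS UD => w w1; rewrite ext_one.
- move=> f g; apply: yE; apply: (@ctends_ext _ _ _ _ (fun w => ext f w * ext g w)); last exact: ctendsM.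
  by apply: filterE => w; rewrite ext_mul.
- move=> a f; apply: yE; apply: (@ctends_ext _ _ _ _ (fun w => a * ext f w)).
    by apply: filterE => w; rewrite ext_scale.
  by apply: ctendsM => //; exact: ctends_cst.
by exists x => f; rewrite xP.
Qed.
End ultralimits.

Section thick_points.
Variable R : realType.
Local Notation C := R[i].
Implicit Types (S : set C) (f : Hinf R).

Definition steady f (n : nat) : set C := [set z | forall v, normc v < 1 ->
  n.+1%:R^-1 <= pp z v -> normc (ext f v - ext f z) <= n.+1%:R^-1].

Lemma thick_steady S f n : thick S -> thick (S `&` steady f n).
Proof.
move=> tS; have [M M0 fM] := Hinf_bounded f.
have M1 : 0 < M + 1 by rewrite ltr_wpDl.
have c0 : normc (M + 1)%:C^-1 = (M + 1)^-1 :> R.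
  by rewrite -[_^-1]mul1r normc_div normc1 mul1r normcR gtr0_norm.
have gh : holo (fun w => (M + 1)%:C^-1 * ext f w).
  by move=> w w1; apply: cdiffM; [exact: cdiff_cst|exact: holo_ext].
have g1 w : normc w < 1 -> normc ((M + 1)%:C^-1 * ext f w) <= 1.
  move=> _; rewrite normcM c0 mulrC ler_pdivrMr// mul1r.
  by apply: (le_trans (fM w)); rewrite lerDl.
have e0 : 0 < n.+1%:R^-1 / (M + 1) by rewrite divr_gt0.
have q0 : 0 < n.+1%:R^-1 :> R by rewrite invr_gt0.
have h := thick_osc gh g1 e0 q0 tS.
apply: thick_sub h => w w1 [Sw h]; split => // v v1 pv.
have := h v v1 pv; rewrite -mulrBr normcM c0 mulrC ler_pM2r// invr_gt0//.
Qed.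

(** Restricting to the steady points of one more function keeps a set thick, so finitely many
    steadiness conditions can always be met inside [S]. An ultrafilter collects all of them, and
    limits along it are multiplicative. *)
Theorem thick_char S : thick S -> exists (U : set_system C) (x : spectrum R),
  [/\ UltraFilter U, U (S `&` [set w | normc w < 1]), forall f n, U (steady f n) &
    forall f, ctends U (ext f) (x f)].
Proof.
move=> tS.
pose deep (l : seq (Hinf R * nat)) := [set z | S z /\ forall t, t \in l -> steady t.1 t.2 z].
have td l : thick (deep l).
  elim: l => [|t l IH]; first by apply: thick_sub tS => w _ Sw; split.
  apply: thick_sub (thick_steady t.1 t.2 IH) => w _ [[Sw h] ht]; split => // t'.
  by rewrite inE => /orP[/eqP ->|/h].
pose F := [set A | exists l, deep l `&` [set w | normc w < 1] `<=` A].
have FF : ProperFilter F.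
  split.
    move=> [l h]; have [w w1 dw] := thick_nonempty (td l).
    by apply: (h w); split.
  split.
  - by exists [::].
  - move=> A B [l hl] [m hm]; exists (l ++ m) => w [[Sw h] w1].
    split; [apply: hl|apply: hm]; split => //; split => // t tl; apply: h;
      by rewrite mem_cat tl ?orbT.
  - by move=> A B AB [l hl]; exists l => w /hl /AB.
have [U [UU FU]] := ultraFilterLemma FF.
have US : U (S `&` [set w | normc w < 1]) by apply: FU; exists [::] => w [[]].
have UP : ProperFilter U by exact: ultra_proper.
have UD : U [set w | normc w < 1] by apply: filterS US => w [].
have [x xP] := ultra_char UU UD.
exists U, x; split => // f n; apply: FU; exists [:: (f, n)] => w [[_ h] _].
by apply: (h (f, n)); rewrite inE.
Qed.
End thick_points.

(** * Alternating colourings of dyadic strips *)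

Section alternation.
Variable R : realType.
Implicit Types (F g : nat -> R) (L : seq nat) (b : bool).

Fixpoint altsum F L : R := if L is n :: L' then F n - altsum F L' else 0.

Fixpoint colsum b F L : R := if L is n :: L' then (if b then 0 else F n) + colsum (~~ b) F L' else 0.

Lemma colsum_total b F L : colsum b F L + colsum (~~ b) F L = \sum_(n <- L) F n.
Proof.
elim: L b => [|n L IH] b /=; first by rewrite big_nil addr0.
by rewrite big_cons -(IH b) negbK; case: b => /=; ring.
Qed.

Lemma colsum_alt F L : colsum false F L - colsum true F L = altsum F L.
Proof. by elim: L => [|n L IH] /=; [rewrite subr0|rewrite -IH; ring]. Qed.

Lemma colsum_index b F L : uniq L -> \sum_(n <- L | odd (index n L) == b) F n = colsum b F L.
Proof.
elim: L b => [|n L IH] b /=; first by rewrite big_nil.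
move=> /andP[nL uL]; rewrite big_cons /= eqxx /= -(IH _ uL).
have -> : \sum_(j <- L | odd (if n == j then 0 else (index j L).+1) == b) F j =
    \sum_(j <- L | odd (index j L) == ~~ b) F j.
  rewrite big_seq_cond [RHS]big_seq_cond; apply: eq_bigl => j.
  have [jL|//] := boolP (j \in L); case: (eqVneq n j) => [nj|_] /=; first by rewrite nj jL in nL.
  by case: b; case: (odd _).
by case: b; rewrite ?add0r.
Qed.

Variables (y : nat -> R) (w : R -> R) (v M : R).
Hypothesis w0 : forall x, 0 <= w x <= M.
Hypothesis winc : forall x x', x <= x' -> x' <= v -> w x <= w x'.
Hypothesis wdec : forall x x', v <= x -> x <= x' -> w x' <= w x.

(* The lower bound w (y n) - M, and not just 0, is what the induction needs on the increasing part. *)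
Lemma altsum_unimodal n L : sorted (fun m k => y m <= y k) (n :: L) ->
  w (y n) - M <= altsum (w \o y) (n :: L) <= M /\
  (v <= y n -> 0 <= altsum (w \o y) (n :: L) <= w (y n)).
Proof.
elim: L n => [|m L IH] n.
  move=> _ /=; rewrite subr0; have /andP[h1 h2] := w0 (y n); rewrite h1 h2 lexx.
  by rewrite gerBl (le_trans h1 h2).
rewrite /= => /andP[nm sL]; have [] := IH m sL; rewrite /=.
move: (w (y m) - altsum _ L) => A hA hA'.
have /andP[n0 nM] := w0 (y n); have /andP[m0 mM] := w0 (y m).
split; last first.
  move=> vn; have /andP[A0 A1] := hA' (le_trans vn nm); have := wdec vn nm.
  by move: A0 A1; clear; move=> h1 h2 h3; apply/andP; split; lra.
have [vm|mv] := leP v (y m).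
  have /andP[A0 A1] := hA' vm.
  by move: A0 A1 n0 nM m0 mM; clear; move=> *; apply/andP; split; lra.
have := winc nm (ltW mv); have /andP[] := hA.
by move: n0 nM m0 mM; clear; move=> *; apply/andP; split; lra.
Qed.

Lemma colsum_unimodal b L : sorted (fun m k => y m <= y k) L -> 0 <= M ->
  \sum_(n <- L) w (y n) <= 2 * colsum b (w \o y) L + M.
Proof.
move=> sL M0; have h := colsum_total b (w \o y) L; have a := colsum_alt (w \o y) L.
have : `|altsum (w \o y) L| <= M.
  case: L sL {h a} => [|n L] sL; first by rewrite normr0.
  have [/andP[h1 h2] _] := altsum_unimodal sL; have /andP[h3 _] := w0 (y n).
  by rewrite ler_norml h2 andbT (le_trans _ h1)// -[leLHS]add0r lerD2r.
rewrite -a; move: h; rewrite /= => <-; rewrite ler_norml => /andP[].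
by case: b => /=; move: (colsum true _ _) (colsum false _ _) => p q; lra.
Qed.
End alternation.

(** * A colouring that balances the half-plane kernel at every point *)

Section colouring.
Variable R : realType.
Variables (T : pred nat) (s y : nat -> R) (K : R).
Hypothesis s01 : forall n, T n -> 0 < s n <= 1.
Hypothesis sK : forall N, \sum_(n < N | T n) s n <= K.

Let width (j : nat) : R := 2 ^- j.

Let width0 j : 0 < width j. Proof. by rewrite invr_gt0 exprn_gt0. Qed.

Let widthS j : width j = 2 * width j.+1.
Proof. by rewrite /width exprS invfM mulrA divff ?mul1r// pnatr_eq0. Qed.

Let strip_exists n : exists j, T n -> width j.+1 < s n <= width j.
Proof.
have [Tn|] := boolP (T n); last by exists 0%N.
have /andP[s0 s1] := s01 Tn.
have ex : exists j, width j.+1 < s n.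
  exists (Num.truncn (s n)^-1); rewrite /width invf_plt ?posrE ?exprn_gt0//.
  apply: (lt_le_trans (truncnS_gt _)); rewrite -natrX ler_nat; exact: ltnW (ltn_expl _ _).
case: (ex_minnP ex) => j hj jmin; exists j => _; rewrite hj /=.
case: j hj jmin => [|j] hj jmin; first by rewrite /width expr0 invr1.
by rewrite leNgt; apply/negP => /jmin; rewrite ltnn.
Qed.

(** [sg] and [h] are the heights of two points and |x - v| their horizontal distance; up to
    constants this is [pp] in the half-plane. *)
Let kernel (h v : R) (sg : R) (x : R) := sg * h / (sg + h + `|x - v|) ^+ 2.

Let kernel_max (h v sg x : R) : 0 < h -> 0 < sg -> 0 <= kernel h v sg x <= sg * h / (sg + h) ^+ 2.
Proof.
move=> h0 g0; have n0 := normr_ge0 (x - v); have gh0 := addr_gt0 g0 h0.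
have d0 : 0 < sg + h + `|x - v| by rewrite ltr_wpDr.
rewrite /kernel divr_ge0 ?sqr_ge0 ?mulr_ge0 ?(ltW g0) ?(ltW h0)//=.
rewrite ler_pM2l ?mulr_gt0// lef_pV2 ?posrE ?exprn_gt0//.
by rewrite lerXn2r ?nnegrE ?(ltW gh0) ?(ltW d0)// lerDl.
Qed.

Let kernel_dist (h v sg x x' : R) : 0 < h -> 0 < sg -> `|x - v| <= `|x' - v| ->
  kernel h v sg x' <= kernel h v sg x.
Proof.
move=> h0 g0 le; have gh0 := addr_gt0 g0 h0.
have d0 z : 0 < sg + h + `|z| by rewrite ltr_wpDr.
rewrite /kernel ler_pM2l ?mulr_gt0// lef_pV2 ?posrE ?exprn_gt0//.
by apply: lerXn2r; rewrite ?nnegrE ?lerD2l// ltW.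
Qed.

(** Replacing a height by the width of its dyadic strip costs bounded factors. After that the kernel
    depends, within one strip, on the horizontal position alone and is unimodal in it. *)
Let kernel_strip (h v x sg t : R) : 0 < h -> 0 < sg -> sg / 2 < t <= sg ->
  kernel h v t x <= 4 * kernel h v sg x /\ kernel h v sg x <= 2 * kernel h v t x.
Proof.
move=> h0 g0 /andP[t1 t2]; have n0 := normr_ge0 (x - v).
have t0 : 0 < t by apply: lt_trans t1; rewrite divr_gt0.
rewrite /kernel; move: (`|x - v|) n0 => d d0.
have a0 : 0 < sg + h + d by lra.
have b0 : 0 < t + h + d by lra.
rewrite !mulrA; split.
  rewrite ler_pdivrMr ?exprn_gt0// mulrAC ler_pdivlMr ?exprn_gt0//.
  have ab : (sg + h + d) ^+ 2 <= 4 * (t + h + d) ^+ 2.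
    have -> : 4 * (t + h + d) ^+ 2 = (2 * (t + h + d)) ^+ 2 by ring.
    by rewrite lerXn2r ?nnegrE; lra.
  apply: (@le_trans _ _ (t * h * (4 * (t + h + d) ^+ 2))); first by rewrite ler_wpM2l// mulr_ge0// ltW.
  have -> : 4 * sg * h * (t + h + d) ^+ 2 = sg * h * (4 * (t + h + d) ^+ 2) by ring.
  by rewrite ler_wpM2r ?ler_pM2r// mulr_ge0// sqr_ge0.
rewrite ler_pdivrMr ?exprn_gt0// mulrAC ler_pdivlMr ?exprn_gt0//.
have ab : (t + h + d) ^+ 2 <= (sg + h + d) ^+ 2 by rewrite lerXn2r ?nnegrE; lra.
apply: (@le_trans _ _ (sg * h * (sg + h + d) ^+ 2)); first by rewrite ler_wpM2l// mulr_ge0// ltW.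
by rewrite ler_wpM2r ?sqr_ge0// ler_wpM2r ?(ltW h0)//; lra.
Qed.

(** The maxima decay geometrically for widths far above and far below [h]; each one is dominated by
    an increment of 2 h / (width + h), and these increments telescope. *)
Let strip_max_sum (h : R) J : 0 < h -> \sum_(j < J) width j * h / (width j + h) ^+ 2 <= 2.
Proof.
move=> h0; have -> : 2 = 2 * 1 :> R by rewrite mulr1.
suff : \sum_(j < J) width j * h / (width j + h) ^+ 2 <= 2 * (h / (width J + h)).
  move=> H; apply: (le_trans H); rewrite ler_pM2l// ler_pdivrMr ?addr_gt0// mul1r.
  by rewrite lerDr ltW.
elim: J => [|J IH]; first by rewrite big_ord0 mulr_ge0// divr_ge0 ?addr_ge0 ?(ltW h0)// ltW.
rewrite big_ord_recr /=; move: IH; move: (\sum_(j < J) _) => S.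
rewrite (widthS J); move: (width J.+1) (width0 J.+1) => a a0 IH.
have d1 : 0 < 2 * a + h by rewrite addr_gt0// mulr_gt0.
have d2 : 0 < a + h by rewrite addr_gt0.
suff : 2 * a * h / (2 * a + h) ^+ 2 <= 2 * (h / (a + h)) - 2 * (h / (2 * a + h)).
  by move: IH; move: (2 * (h / (2 * a + h))) (2 * (h / (a + h))) (_ / _ ^+ 2) => p q r; lra.
have -> : 2 * (h / (a + h)) - 2 * (h / (2 * a + h)) = 2 * a * h / ((a + h) * (2 * a + h)).
  by field; rewrite !gt_eqF.
rewrite ler_pM2l ?mulr_gt0// lef_pV2 ?posrE ?mulr_gt0// expr2 ler_pM2r//; lra.
Qed.

(* Inside each dyadic strip the indices sorted by y are coloured alternately; the kernel being
   unimodal in y, the two colours receive the same sum up to its maximum over the strip, and these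
   maxima have a bounded sum. *)
Theorem balanced_colouring : exists c : nat -> bool, forall (h v : R) N, 0 < h ->
  exists N', forall b, \sum_(n < N | T n) s n * h / (s n + h + `|y n - v|) ^+ 2 <=
    16 * (\sum_(n < N' | T n && (c n == b)) s n * h / (s n + h + `|y n - v|) ^+ 2) + 8.
Proof.
have [strip stripP] := choice strip_exists.
(* Heights in one strip are bounded below, so summability makes each strip finite and its indices
   can be sorted by [y]. *)
have fin j : exists N, forall n, T n -> strip n = j -> (n < N)%N.
  have sK' N : \sum_(n < N) (if T n then s n else 0) <= K by rewrite -big_mkcond.
  have [N hN] := @bounded_sums_tail _ (fun n => if T n then s n else 0) K sK' _ (width0 j.+1).
  exists N => n Tn nj; rewrite ltnNge; apply/negP => Nn.
  have := hN (n - N).+1; rewrite big_ord_recr /= subnKC// Tn leNgt => /negP; apply.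
  have /andP[h1 _] := stripP n Tn; rewrite nj in h1; apply: (lt_le_trans h1).
  rewrite lerDr; apply: sumr_ge0 => i _; case: ifP => // Ti.
  by have /andP[/ltW] := s01 Ti.
have [bd bdP] := choice fin.
pose L j := sort (fun m k => y m <= y k) [seq n <- iota 0 (bd j) | T n && (strip n == j)].
have ytot : total (fun m k : nat => y m <= y k) by move=> m k; exact: le_total.
have sL j : sorted (fun m k => y m <= y k) (L j) by exact: sort_sorted.
have uL j : uniq (L j) by rewrite sort_uniq filter_uniq// iota_uniq.
have inL j n : (n \in L j) = T n && (strip n == j).
  rewrite mem_sort mem_filter mem_iota add0n /=; have [Tn|//] := boolP (T n).
  by case: eqP => //= nj; rewrite (bdP j).
have pL j N' : (bd j <= N')%N -> perm_eq (L j) [seq n <- iota 0 N' | T n && (strip n == j)].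
  move=> bN; apply: uniq_perm => //; first by rewrite filter_uniq// iota_uniq.
  move=> n; rewrite inL mem_filter mem_iota add0n /=; have [Tn|//] := boolP (T n).
  by case: eqP => //= nj; rewrite (leq_trans (bdP j n Tn nj)).
exists (fun n => odd (index n (L (strip n)))) => h v N h0.
pose J := (\max_(n < N) strip n).+1.
(* Alternation compares the two colours over whole strips; [N'] takes in all the indices of every
   strip met by the first [N] ones. *)
pose N' := maxn N (\max_(j < J) bd j).
have bdN' j : (j < J)%N -> (bd j <= N')%N.
  by move=> jJ; rewrite leq_max; apply/orP; right; exact: (leq_bigmax (Ordinal jJ)).
exists N' => b; set c := fun n => odd (index n (L (strip n))).
pose k n := kernel h v (width (strip n)) (y n).
pose q n := kernel h v (s n) (y n).
have qk n : T n -> q n <= 4 * k n /\ k n <= 2 * q n.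
  move=> Tn; apply: kernel_strip => //; have := stripP n Tn.
  by rewrite (widthS (strip n)) mulrAC divff ?mul1r// pnatr_eq0.
have q0 n : T n -> 0 <= q n.
  by move=> Tn; have /andP[t0 _] := s01 Tn; have /andP[] := kernel_max v (y n) h0 t0.
have k0 n : 0 <= k n by have /andP[] := kernel_max v (y n) h0 (width0 (strip n)).
change (\sum_(n < N | T n) q n <= 16 * (\sum_(n < N' | T n && (c n == b)) q n) + 8).
have split_strips (P : pred nat) : \sum_(0 <= n < N' | (T n && P n) && (strip n < J)%N) k n =
    \sum_(j < J) \sum_(n <- L j | P n) k n.
  have E (j : 'I_J) : \sum_(n <- L j | P n) k n = \sum_(0 <= n < N' | T n && P n && (strip n == j)) k n.
    rewrite (perm_big _ (pL j N' (bdN' _ (ltn_ord j)))) /= big_filter_cond /index_iota subn0.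
    by apply: eq_bigl => n; rewrite -!andbA; congr (_ && _); rewrite andbC.
  rewrite (eq_bigr _ (fun j _ => E j)).
  rewrite big_mkcond /=; under [RHS]eq_bigr do rewrite big_mkcond /=.
  rewrite exchange_big /=; apply: eq_bigr => n _.
  case: (T n && P n) => /=; last by rewrite big1.
  case: ltnP => nJ.
    rewrite (bigD1 (Ordinal nJ)) //= eqxx big1 ?addr0// => j jn.
    by case: eqP => // nj; case/negP: jn; apply/eqP/val_inj.
  by rewrite big1// => j _; case: eqP => // nj; move: (ltn_ord j); rewrite -nj ltnNge nJ.
have per_strip (j : 'I_J) : \sum_(n <- L j) k n <=
    2 * (\sum_(n <- L j | c n == b) k n) + width j * h / (width j + h) ^+ 2.
  have kj n : n \in L j -> k n = kernel h v (width j) (y n).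
    by rewrite inL => /andP[_ /eqP nj]; rewrite /k nj.
  have -> : \sum_(n <- L j) k n = \sum_(n <- L j) kernel h v (width j) (y n).
    by rewrite big_seq [RHS]big_seq; apply: eq_bigr => n /kj.
  have -> : \sum_(n <- L j | c n == b) k n = colsum b (kernel h v (width j) \o y) (L j).
    rewrite -colsum_index// big_seq_cond [RHS]big_seq_cond; apply: eq_big => n.
      have [|//] := boolP (n \in L j); rewrite inL /= => /andP[_ /eqP nj].
      by rewrite /c nj.
    by move=> /andP[/kj].
  apply: (@colsum_unimodal _ y (kernel h v (width j)) v) => //.
  - by move=> x; exact: kernel_max.
  - move=> x x' xx' x'v; apply: kernel_dist => //.
    by rewrite !ler0_norm ?subr_le0 ?(le_trans xx')// lerN2 lerD2r.
  - move=> x x' vx xx'; apply: kernel_dist => //.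
    by rewrite !ger0_norm ?subr_ge0 ?(le_trans vx)// lerD2r.
  - by rewrite divr_ge0 ?sqr_ge0// mulr_ge0// ltW.
have step1 : \sum_(n < N | T n) q n <= 4 * \sum_(j < J) \sum_(n <- L j) k n.
  have -> : \sum_(j < J) \sum_(n <- L j) k n = \sum_(0 <= n < N' | (T n && predT n) && (strip n < J)%N) k n.
    by rewrite split_strips.
  rewrite (@big_cat_nat _ _ _ N 0 N') //=; last exact: leq_maxl.
  apply: (@le_trans _ _ (4 * \sum_(n < N | T n) k n)).
    by rewrite mulr_sumr; apply: ler_sum => n /qk[].
  rewrite ler_pM2l// big_mkord [X in _ <= X + _](eq_bigl (fun n : 'I_N => T n)); last first.
    by move=> n; rewrite ltnS (leq_bigmax n) !andbT.
  by rewrite lerDl; apply: sumr_ge0.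
have step2 : \sum_(j < J) \sum_(n <- L j) k n <=
    2 * (\sum_(n < N' | T n && (c n == b)) 2 * q n) + 2.
  apply: (@le_trans _ _ (\sum_(j < J) (2 * (\sum_(n <- L j | c n == b) k n) + width j * h / (width j + h) ^+ 2))).
    by apply: ler_sum => j _; exact: per_strip.
  rewrite big_split /= lerD ?strip_max_sum// -mulr_sumr ler_pM2l// -(split_strips (fun n => c n == b)).
  rewrite big_mkord [leRHS](bigID (fun n : 'I_N' => (strip n < J)%N)) /=.
  rewrite -[leLHS]addr0 lerD//.
    by apply: ler_sum => n /andP[/andP[/qk[]]].
  by apply: sumr_ge0 => n /andP[/andP[Tn _] _]; rewrite mulr_ge0// q0.
(* 16 = 4 * 2 * 2: passage to strip widths, two colours, passage back. 8 = 4 * 2, where 2 comes from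
   [strip_max_sum]. *)
apply: (le_trans step1); rewrite -mulr_sumr in step2.
by move: step2; move: (\sum_(j < J) _) (\sum_(n < N' | _) _) => A B; lra.
Qed.
End colouring.

(** * Splitting the zeros of a Blaschke product *)

Section kernel_comparison.
Variable R : realType.
Local Notation C := R[i].
Implicit Types (a z : C).

(* Replaces pp in the sector |Im a| <= Re a; it depends on a only through its height and Im a. *)
Definition rker a z : R := (1 - normc a) * (1 - normc z) /
  ((1 - normc a) + (1 - normc z) + `|complex.Im a - complex.Im z|) ^+ 2.

Lemma normcB_le_conjM a z : normc a < 1 -> normc z < 1 -> normc (a - z) <= normc (1 - conjc a * z).
Proof.
move=> a1 z1; rewrite -(@ler_pXn2r _ 2)// ?nnegrE ?normc_ge0// -subr_ge0 norm_identity.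
by rewrite mulr_ge0// subr_ge0 ltW// sqr_lt1 ?normc_ge0.
Qed.

Lemma conjM_ge_defect a z : normc a < 1 -> normc z < 1 -> 1 - normc a <= normc (1 - conjc a * z).
Proof.
move=> a1 z1; apply: le_trans (ler_normcB _ _); rewrite normc1 lerB// normcM normc_conj.
by rewrite ler_piMr ?normc_ge0// ltW.
Qed.

Let arith1 (x s h d n : R) : 0 < s -> 0 < h -> 0 <= d -> s <= n -> h <= n -> d <= n ->
  0 <= x <= 4 -> x * (s * h) / n ^+ 2 <= 36 * (s * h / (s + h + d) ^+ 2).
Proof.
move=> s0 h0 d0 sn hn dn /andP[x0 x4].
have n0 : 0 < n by exact: lt_le_trans sn.
have t0 : 0 < s + h + d by lra.
have -> : 36 * (s * h / (s + h + d) ^+ 2) = 4 * (s * h) * (3 / (s + h + d)) ^+ 2.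
  by field; rewrite gt_eqF.
apply: ler_pM.
- by rewrite mulr_ge0// mulr_ge0// ltW.
- by rewrite invr_ge0 sqr_ge0.
- by rewrite ler_wpM2r// mulr_ge0// ltW.
- rewrite -exprVn lerXn2r ?nnegrE ?invr_ge0 ?divr_ge0 ?(ltW n0) ?(ltW t0)//.
  by rewrite -[n^-1]mul1r ler_pdivrMr// mulrAC ler_pdivlMr//; lra.
Qed.

(** Each of the two heights and the difference of the imaginary parts is at most |1 - conj(a) z|,
    hence so is a third of their sum; 36 = 4 * 9. *)
Lemma pp_le_rker a z : normc a < 1 -> normc z < 1 -> pp a z <= 36 * rker a z.
Proof.
move=> a1 z1; have s0 : 0 < 1 - normc a by rewrite subr_gt0.
have h0 : 0 < 1 - normc z by rewrite subr_gt0.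
have -> : pp a z = (1 + normc a) * (1 + normc z) * ((1 - normc a) * (1 - normc z)) / normc (1 - conjc a * z) ^+ 2.
  by rewrite /pp; congr (_ / _); ring.
apply: arith1 => //.
- exact: conjM_ge_defect.
- by rewrite normc_conjM_sym conjM_ge_defect.
- by apply: le_trans (normcB_le_conjM a1 z1); rewrite -ImB ler_Im_normc.
- move: (normc_ge0 a) (normc_ge0 z) a1 z1; move: (normc a) (normc z) => x y x0 y0 x1 y1.
  rewrite mulr_ge0 ?addr_ge0//=; have -> : 4 = 2 * 2 :> R by ring.
  by apply: ler_pM; lra.
Qed.

(** For a = x + iy in the sector, of modulus [A] at least 1 / 2, the real part [x] is at least 1 /
    3. Hence (x - u) (x + u) = (A^2 - Z^2) - (y^2 - v^2) bounds the distance of the real parts by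
    the heights and the imaginary parts. *)
Let arith2 (x y u v A Z : R) : 0 <= A -> A < 1 -> 0 <= Z -> Z < 1 -> 2^-1 <= A ->
  A ^+ 2 = x ^+ 2 + y ^+ 2 -> Z ^+ 2 = u ^+ 2 + v ^+ 2 -> `|y| <= x -> 0 <= u ->
  `|x - u| <= 6 * ((1 - A) + (1 - Z) + `|y - v|).
Proof.
move=> A0 A1 Z0 Z1 hA eA eZ yx u0.
have x0 : 0 <= x by apply: le_trans yx.
have y2 : y ^+ 2 <= x ^+ 2 by rewrite -[y ^+ 2]real_normK ?num_real// lerXn2r ?nnegrE.
have x3 : 3^-1 <= x.
  rewrite -(@ler_pXn2r _ 2)// ?nnegrE ?invr_ge0//.
  have : 2^-1 ^+ 2 <= A ^+ 2 by rewrite lerXn2r ?nnegrE ?invr_ge0.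
  by rewrite eA; move: y2; move: (x ^+ 2) (y ^+ 2) => p q; lra.
have D : `|(x - u) * (x + u)| <= 2 * ((1 - A) + (1 - Z) + `|y - v|).
  have -> : (x - u) * (x + u) = (A - Z) * (A + Z) - (y - v) * (y + v).
    have -> : (A - Z) * (A + Z) = A ^+ 2 - Z ^+ 2 by ring.
    by rewrite eA eZ; ring.
  apply: (le_trans (ler_normB _ _)); rewrite !normrM mulrDr lerD//.
    rewrite mulrC; apply: ler_pM => //; first by rewrite ger0_norm; lra.
    by rewrite ler_norml; apply/andP; split; lra.
  rewrite mulrC ler_wpM2r//; apply: (le_trans (ler_normD _ _)).
  have y1 : `|y| <= 1.
    rewrite -(@ler_pXn2r _ 2)// ?nnegrE// real_normK ?num_real// expr1n.
    have : A ^+ 2 <= 1 by rewrite expr_le1// ltW.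
    by move: (sqr_ge0 x); rewrite eA; lra.
  have v1 : `|v| <= 1.
    rewrite -(@ler_pXn2r _ 2)// ?nnegrE// real_normK ?num_real// expr1n.
    have : Z ^+ 2 <= 1 by rewrite expr_le1// ltW.
    by move: (sqr_ge0 u); rewrite eZ; lra.
  lra.
have n0 := normr_ge0 (x - u).
move: D; rewrite normrM [`|x + u|]ger0_norm ?addr_ge0// => D.
have : `|x - u| * 3^-1 <= `|x - u| * (x + u) by rewrite ler_wpM2l//; lra.
by move: D; move: (`|x - u| * (x + u)) (`|x - u|) (`|y - v|) => p q r; lra.
Qed.

Lemma rker_le_pp a z : normc a < 1 -> normc z < 1 -> 2^-1 <= normc a ->
  `|complex.Im a| <= complex.Re a -> 0 <= complex.Re z -> rker a z <= 81 * pp a z.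
Proof.
move=> a1 z1 a2 sec uz; have s0 : 0 < 1 - normc a by rewrite subr_gt0.
have h0 : 0 < 1 - normc z by rewrite subr_gt0.
have h6 := arith2 (normc_ge0 a) a1 (normc_ge0 z) z1 a2 (normc_sqr a) (normc_sqr z) sec uz.
set d := `|complex.Im a - complex.Im z| in h6 *.
have d0 : 0 <= d by exact: normr_ge0.
have n0 : 0 < normc (1 - conjc a * z) by rewrite normc_gt0 conjM_neq0.
have n9 : normc (1 - conjc a * z) <= 9 * ((1 - normc a) + (1 - normc z) + d).
  have -> : 1 - conjc a * z = (1 - normc a ^+ 2)%:C + conjc a * (a - z).
    by rewrite rmorphB /= -mulcJ; ring.
  apply: (le_trans (le_normcD _ _)); rewrite normcR normcM normc_conj.
  have e1 : `|1 - normc a ^+ 2| <= 2 * (1 - normc a).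
    rewrite ger0_norm ?subr_ge0 ?ltW ?sqr_lt1 ?normc_ge0//.
    by move: (normc_ge0 a) a1; move: (normc a) => x; clear; nra.
  have e2 : normc a * normc (a - z) <= normc (a - z) by rewrite ler_piMl ?normc_ge0// ltW.
  have e3 := normc_le_ReIm (a - z); rewrite ReB ImB -/d in e3.
  move: e1 e2 e3 h6 s0 h0 d0; move: (normc a * normc (a - z)) (normc (a - z)) => p q.
  move: (`|_ - complex.Re z|) (`|1 - _|) (1 - normc a) (1 - normc z) d => x1 x2 x3 x4 x5; clear; lra.
have t0 : 0 < (1 - normc a) + (1 - normc z) + d by lra.
rewrite /rker /pp -/d.
have -> : 81 * ((1 - normc a ^+ 2) * (1 - normc z ^+ 2) / normc (1 - conjc a * z) ^+ 2) =
   ((1 - normc a ^+ 2) * (1 - normc z ^+ 2)) * (9 / normc (1 - conjc a * z)) ^+ 2.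
  by field; rewrite gt_eqF.
apply: ler_pM.
- by rewrite mulr_ge0 ?(ltW s0) ?(ltW h0).
- by rewrite invr_ge0 sqr_ge0.
- apply: ler_pM; rewrite ?(ltW s0) ?(ltW h0)// lerD2l lerN2 expr2 ler_piMr ?normc_ge0// ltW//.
- rewrite -exprVn lerXn2r ?nnegrE ?invr_ge0 ?divr_ge0 ?(ltW n0) ?(ltW t0)//.
  by rewrite -[_^-1]mul1r ler_pdivrMr// mulrAC ler_pdivlMr// mul1r.
Qed.

Lemma conjM_norm2 a z : normc (1 - conjc a * z) ^+ 2 =
  1 - 2 * (complex.Re a * complex.Re z + complex.Im a * complex.Im z) +
  (complex.Re a ^+ 2 + complex.Im a ^+ 2) * (complex.Re z ^+ 2 + complex.Im z ^+ 2).
Proof.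
rewrite normc_sqr; case: a => x y; case: z => u v.
by rewrite !(ReB, ImB, cReM, cImM) /conjc /=; ring.
Qed.

(** In the half-plane opposite to the sector |1 - conj(a) z|^2 is at least 1 / 2, so that a zero is
    felt there only with the weight of its defect. *)
Lemma pp_far a z : normc a < 1 -> normc z < 1 -> `|complex.Im a| <= complex.Re a ->
  complex.Re z < 0 -> pp a z <= 4 * (1 - normc a).
Proof.
move=> a1 z1 sec uz.
have key : 2^-1 <= normc (1 - conjc a * z) ^+ 2.
  rewrite conjM_norm2; case: a z sec uz {a1 z1} => x y [u v] /= yx u0.
 have y2 : y ^+ 2 <= x ^+ 2.
    by rewrite -[y ^+ 2]real_normK ?num_real// lerXn2r ?nnegrE ?(le_trans _ yx).
  have x0 : 0 <= x by apply: le_trans yx.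
  have xu : x * u <= 0 by rewrite mulr_ge0_le0// ltW.
  have yv2 : 2 * (y * v) ^+ 2 <= (x ^+ 2 + y ^+ 2) * (u ^+ 2 + v ^+ 2).
    have -> : 2 * (y * v) ^+ 2 = (y ^+ 2 + y ^+ 2) * v ^+ 2 by ring.
    by apply: ler_pM; rewrite ?addr_ge0 ?sqr_ge0 ?lerD2r ?lerDr ?sqr_ge0.
  have := sqr_ge0 (y * v - 2^-1); move: xu yv2; move: (x * u) (y * v) (_ * (u ^+ 2 + _)) => p q t.
  by clear; rewrite sqrrB; move: (q ^+ 2) => qq; lra.
have n0 : 0 < normc (1 - conjc a * z) ^+ 2 by apply: lt_le_trans key; rewrite invr_gt0.
rewrite /pp ler_pdivrMr//.
have s0 : 0 <= 1 - normc a by rewrite subr_ge0 ltW.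
apply: (@le_trans _ _ (2 * (1 - normc a) * 1)).
  apply: ler_pM.
  - by rewrite subr_ge0 ltW// sqr_lt1 ?normc_ge0.
  - by rewrite subr_ge0 ltW// sqr_lt1 ?normc_ge0.
  - by move: (normc_ge0 a) a1; move: (normc a) => x; clear; nra.
  - by rewrite gerBl sqr_ge0.
move: key s0; move: (normc (1 - _) ^+ 2) (1 - normc a) => p q; clear; nra.
Qed.

Lemma pp_rotate (c a z : C) : normc c = 1 -> pp (c * a) (c * z) = pp a z.
Proof.
move=> c1; rewrite /pp !normcM c1 !mul1r rmorphM /= mulrACA.
have -> : conjc c * c = 1 by rewrite mulrC mulcJ c1 expr1n.
by rewrite mul1r.
Qed.
End kernel_comparison.

(** * Sectors, and halves of a zero set that both stay unbounded *)

Section zero_sets.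
Variable R : realType.
Local Notation C := R[i].
Local Notation D := (disc R).
Implicit Types (zs : nat -> option D) (P Q : pred nat) (z w : C).

Definition subzeros zs P n : option D := if P n then zs n else None.

Lemma ppsum_subzeros zs P N w :
  ppsum (subzeros zs P) N w = \sum_(n < N | P n) ppterm zs w n.
Proof.
rewrite [RHS]big_mkcond; apply: eq_bigr => n _; rewrite /ppterm /subzeros.
by case: (P n).
Qed.

Lemma ppsum_subzeros_sub zs P Q N w : normc w < 1 -> (forall n, P n -> Q n) ->
  ppsum (subzeros zs P) N w <= ppsum (subzeros zs Q) N w.
Proof.
move=> w1 PQ; apply: ler_sum => n _; rewrite /ppterm /subzeros.
have := ppterm_ge0 zs n w1; rewrite /ppterm; case: ifP => [/PQ ->//|_].
by case: ifP.
Qed.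

Lemma bprod_subzeros zs P N w :
  bprod zs N w = bprod (subzeros zs P) N w * bprod (subzeros zs (predC P)) N w.
Proof.
rewrite /bprod -big_split; apply: eq_bigr => n _; rewrite /bfac /subzeros /=.
by case: (P n); rewrite ?mulr1 ?mul1r.
Qed.

Lemma summable_subzeros zs P : summable_zeros zs -> summable_zeros (subzeros zs P).
Proof.
move=> [K hK]; exists K => N; apply: le_trans (hK N); apply: ler_sum => n _.
have := defect_ge0 zs n; rewrite /defect /subzeros; case: ifP => //.
Qed.

(** A quarter-plane about the ray through conj(c). Four rotations cover the plane, and the zeros of
    modulus below 1 / 2, for which [rker] is not comparable with [pp], are left out. *)
Definition sector (c : C) zs n : bool := if zs n is Some a then
  (2^-1 <= normc (val a)) && (`|complex.Im (c * val a)| <= complex.Re (c * val a)) else false.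

Lemma sector_colouring (c : C) zs : normc c = 1 -> summable_zeros zs ->
  exists (col : nat -> bool) (A B : R), 0 < B /\ forall z N, normc z < 1 -> exists N', forall b,
    ppsum (subzeros zs (sector c zs)) N z <=
      B * ppsum (subzeros zs (fun n => sector c zs n && (col n == b))) N' z + A.
Proof.
move=> c1 [K hK].
have K0 : 0 <= K by have := hK 0%N; rewrite big_ord0.
pose s n := defect zs n.
pose y n := oapp (fun a : D => complex.Im (c * val a)) 0 (zs n).
have s01 n : sector c zs n -> 0 < s n <= 1.
  rewrite /sector /s /defect; case: (zs n) => [a|//] _ /=.
  by rewrite subr_gt0 disc_lt1 gerBl normc_ge0.
have sK N : \sum_(n < N | sector c zs n) s n <= K.
  apply: le_trans (hK N); rewrite [leRHS](bigID (fun n : 'I_N => sector c zs n)) /= lerDl.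
  by apply: sumr_ge0 => n _; exact: defect_ge0.
have [col hcol] := balanced_colouring y s01 sK.
(* [36 * (16 * 81)]: comparison with [rker], colouring, comparison back. 288 = 36 * 8 is the error
   of the colouring, and [4 * K] bounds the whole sum when [z] lies in the opposite half-plane. *)
exists col, (288 + 4 * K), (36 * (16 * 81)); split => [|z N z1]; first by rewrite !mulr_gt0.
have cz1 : normc (c * z) < 1 by rewrite normcM c1 mul1r.
have ca1 (a : D) : normc (c * val a) < 1 by rewrite normcM c1 mul1r disc_lt1.
have [uz|uz] := ltP (complex.Re (c * z)) 0.
  exists 0%N => b; rewrite [ppsum _ 0 z]/ppsum big_ord0 mulr0 add0r ppsum_subzeros; apply: (@le_trans _ _ (4 * K)); last by rewrite lerDr.
  apply: (@le_trans _ _ (4 * \sum_(n < N | sector c zs n) s n)); last by rewrite ler_pM2l.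
  rewrite mulr_sumr; apply: ler_sum => n; rewrite /sector /ppterm /s /defect.
  case: (zs n) => [a|//] /= /andP[_ sec]; rewrite -(pp_rotate _ _ c1).
  by have := pp_far (ca1 a) cz1 sec uz; rewrite normcM c1 mul1r.
have h0 : 0 < 1 - normc z by rewrite subr_gt0.
have [N' hN'] := hcol _ (complex.Im (c * z)) N h0; exists N' => b.
have := hN' b; set q := fun n => s n * (1 - normc z) / (s n + (1 - normc z) + `|y n - complex.Im (c * z)|) ^+ 2.
move=> hb.
have qE n a : zs n = Some a -> q n = rker (c * val a) (c * z).
  by move=> za; rewrite /q /s /y /defect za /= /rker !normcM c1 !mul1r.
rewrite !ppsum_subzeros.
have h1 : \sum_(n < N | sector c zs n) ppterm zs z n <= 36 * \sum_(n < N | sector c zs n) q n.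
  rewrite mulr_sumr; apply: ler_sum => n; rewrite /sector /ppterm.
  case za : (zs n) => [a|//] /= /andP[_ sec]; rewrite (qE n a za) -(pp_rotate _ _ c1).
  exact: (pp_le_rker (ca1 a) cz1).
have h2 : \sum_(n < N' | sector c zs n && (col n == b)) q n <=
    81 * \sum_(n < N' | sector c zs n && (col n == b)) ppterm zs z n.
  rewrite mulr_sumr; apply: ler_sum => n /andP[]; rewrite /sector /ppterm.
  case za : (zs n) => [a|//] /= /andP[a2 sec] _; rewrite (qE n a za) -(pp_rotate _ _ c1).
  by apply: rker_le_pp => //; rewrite normcM c1 mul1r.
move: h1 h2 hb K0.
move: (\sum_(n < N | _) ppterm _ _ _) (\sum_(n < N | _) q n) => p1 q1.
move: (\sum_(n < N' | _) ppterm _ _ _) (\sum_(n < N' | _) q n) => p2 q2.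
rewrite -/(q _); clear; lra.
Qed.

Lemma sectors_cover (a : C) : exists2 c : C, c \in [:: 1; -1; 'i; - 'i] & normc c = 1 /\
  `|complex.Im (c * a)| <= complex.Re (c * a).
Proof.
have ni : normc ('i : C) = 1 by rewrite /normc /= expr0n add0r expr1n sqrtr1.
case: a => x y; have iE : 'i * (x +i* y) = (- y) +i* x.
  by apply: complex_ext; rewrite ?cReM ?cImM /=; ring.
have [h|h] := leP `|y| `|x|.
  have [x0|x0] := leP 0 x.
    exists 1; rewrite ?inE ?eqxx//; split; first exact: normc1.
    by rewrite mul1r /= -[leRHS](ger0_norm x0).
  exists (-1); rewrite ?inE ?eqxx ?orbT//; split; first by rewrite normcN normc1.
  by rewrite mulN1r /= normrN -[leRHS](ltr0_norm x0).
have [y0|y0] := leP 0 y.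
  exists (- 'i); rewrite ?inE ?eqxx ?orbT//; split; first by rewrite normcN.
  by rewrite mulNr iE /= opprK normrN (le_trans (ltW h))// ger0_norm.
exists 'i; rewrite ?inE ?eqxx ?orbT//; split => //.
by rewrite iE /= (le_trans (ltW h))// ltr0_norm.
Qed.

Definition unbounded_along (U : set_system C) zs := forall K, U [set z | exists N, K <= ppsum zs N z].

Section ultra.
Variables (U : set_system C) (UU : UltraFilter U).
Hypothesis UD : U [set w | normc w < 1].

Let UP : ProperFilter U. Proof. exact: ultra_proper. Qed.
Let UF : Filter U. Proof. exact: filter_filter. Qed.

Lemma not_unbounded zs : ~ unbounded_along U zs -> exists K, U [set z | forall N, ppsum zs N z <= K].
Proof.
move=> /existsNP[K nK]; exists K.
have [//|h] := in_ultra_setVsetC [set z | exists N, K <= ppsum zs N z] UU.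
by apply: filterS h => z /= nz N; rewrite leNgt; apply/negP => /ltW h; apply: nz; exists N.
Qed.

Lemma unbounded_sub zs P Q : (forall n, P n -> Q n) ->
  unbounded_along U (subzeros zs P) -> unbounded_along U (subzeros zs Q).
Proof.
move=> PQ h K; apply: filterS2 (h K) UD => z /= [N hN] z1; exists N; apply: (le_trans hN).
exact: ppsum_subzeros_sub.
Qed.

(** A zero of modulus below 1 / 2 contributes at most twice its defect, so these zeros stay bounded
    together. If all four sectors were bounded along [U], so would be the whole sum. *)
Lemma unbounded_sector zs : summable_zeros zs -> unbounded_along U zs ->
  exists2 c : C, normc c = 1 & unbounded_along U (subzeros zs (sector c zs)).
Proof.
move=> [K hK] hu; apply: contrapT => no.
have bd (c : C) : normc c = 1 -> exists K, U [set z | forall N, ppsum (subzeros zs (sector c zs)) N z <= K].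
  by move=> c1; apply: not_unbounded => h; apply: no; exists c.
have ni : normc ('i : C) = 1 by rewrite /normc /= expr0n add0r expr1n sqrtr1.
have [K1 U1] := bd 1 (normc1 _).
have [K2 U2] := bd (-1) (etrans (normcN _) (normc1 _)).
have [K3 U3] := bd 'i ni.
have [K4 U4] := bd (- 'i) (etrans (normcN _) ni).
pose B := K1 + K2 + K3 + K4 + 2 * K + 1.
have : U set0; last exact: filter_not_empty.
apply: filterS2 (filterI (filterI U1 U2) (filterI U3 U4)) (filterI (hu B) UD).
move=> z /= [[h1 h2] [h3 h4]] [[N hN] z1]; have := hN; rewrite leNgt => /negP; apply.
apply: (@le_lt_trans _ _ (K1 + K2 + K3 + K4 + 2 * K)); last by rewrite ltrDl.
apply: (@le_trans _ _ (ppsum (subzeros zs (sector 1 zs)) N z + ppsum (subzeros zs (sector (-1) zs)) N z +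
   ppsum (subzeros zs (sector 'i zs)) N z + ppsum (subzeros zs (sector (- 'i) zs)) N z + 2 * \sum_(n < N) defect zs n)); last first.
  by rewrite !lerD// ler_pM2l.
rewrite /ppsum mulr_sumr -!big_split /=; apply: ler_sum => n _.
have t0 c : 0 <= ppterm (subzeros zs (sector c zs)) z n by exact: ppterm_ge0.
have d0 := defect_ge0 zs n.
have [[a za]|za] : (exists a, zs n = Some a) \/ zs n = None by case: (zs n) => [a|]; [left; exists a|right].
2: by rewrite {1}/ppterm za /= !addr_ge0// mulr_ge0.
have [a2|a2] := leP 2^-1 (normc (val a)).
  have [c cin [c1 sec]] := sectors_cover (val a).
  have E : ppterm zs z n = ppterm (subzeros zs (sector c zs)) z n.
    by rewrite /ppterm /subzeros /sector za a2 sec.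
  rewrite E; move: cin; rewrite !inE => /or4P[] /eqP ->;
  move: (t0 1) (t0 (-1)) (t0 'i) (t0 (- 'i)) d0; clear;
  move: (ppterm _ _ _) (ppterm _ _ _) (ppterm _ _ _) (ppterm _ _ _) (defect _ _) => *; lra.
have : ppterm zs z n <= 2 * defect zs n.
  rewrite /ppterm /defect za /=; apply: (le_trans (pp_le1 (disc_lt1 a) z1)).
  by move: a2; move: (normc _) => x; lra.
move: (t0 1) (t0 (-1)) (t0 'i) (t0 (- 'i)); clear.
move: (ppterm zs _ _) (ppterm _ _ _) (ppterm _ _ _) (ppterm _ _ _) (ppterm _ _ _) (2 * _) => *; lra.
Qed.

(** The colouring and its constants are the same for all [z], so both colours inherit unboundedness
    along [U]; the zeros outside the sector join the second half. *)
Theorem unbounded_split zs : summable_zeros zs -> unbounded_along U zs -> exists P : pred nat,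
  unbounded_along U (subzeros zs P) /\ unbounded_along U (subzeros zs (predC P)).
Proof.
move=> sz hu; have [c c1 hc] := unbounded_sector sz hu.
have [col [A [B [B0 hA]]]] := sector_colouring c1 sz.
have hb b : unbounded_along U (subzeros zs (fun n => sector c zs n && (col n == b))).
  move=> K; apply: filterS2 (hc (B * K + A)) UD => z /= [N hN] z1.
  have [N' hN'] := hA z N z1; exists N'; have := le_trans hN (hN' b).
  by rewrite lerD2r ler_pM2l.
exists (fun n => sector c zs n && (col n == true)); split => //.
apply: unbounded_sub (hb false) => n /= /andP[-> /eqP ->].
by [].
Qed.
End ultra.
End zero_sets.

(** * Trivial Gleason parts *)

Section large_values.
Variable R : realType.
Local Notation C := R[i].
Local Notation D := (disc R).
Implicit Types (zs : nat -> option D) (a z w : C).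

Lemma psh_small_dist (a w : C) (d : R) : normc a < 1 -> normc w < 1 -> 0 < d <= 2^-1 ->
  psh a w < d -> normc (a - w) <= 4 * d * (1 - normc w).
Proof.
move=> a1 w1 /andP[d0 d2]; have n0 : 0 < normc (1 - conjc a * w) by rewrite normc_gt0 conjM_neq0.
rewrite /psh normc_div ltr_pdivrMr// => h.
have n1 : normc (1 - conjc a * w) <= 2 * (1 - normc w) + normc (a - w).
  have -> : 1 - conjc a * w = (1 - normc w ^+ 2)%:C + conjc (w - a) * w.
    by rewrite rmorphB /= -mulcJ rmorphB /=; ring.
  apply: (le_trans (le_normcD _ _)); rewrite normcR normcM normc_conj normcB lerD//.
    rewrite ger0_norm ?subr_ge0 ?ltW ?sqr_lt1 ?normc_ge0//.
    by move: (normc_ge0 w) w1; move: (normc w) => x; clear; nra.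
  by rewrite ler_piMr ?normc_ge0// ltW.
move: h n1 (normc_ge0 (a - w)); have : 0 < 1 - normc w by rewrite subr_gt0.
move: (normc (a - w)) (normc (1 - _)) (1 - normc w) => x n s s0 h n1 x0.
have : x <= d * (2 * s + x) by apply: (le_trans (ltW h)); rewrite ler_wpM2l// ltW.
nra.
Qed.

Lemma sum_inj_le (N m : nat) (F : nat -> R) (h : 'I_m -> nat) : (forall n, 0 <= F n) ->
  (forall j, (h j < N)%N) -> injective h -> \sum_(j < m) F (h j) <= \sum_(n < N) F n.
Proof.
move=> F0 hN hi; pose g j : 'I_N := Ordinal (hN j).
have gi : injective g by move=> j k /(congr1 val)/hi.
have -> : \sum_(j < m) F (h j) = \sum_(n in [set g j | j : 'I_m]%SET) F n.
  by rewrite big_imset//= => j k _ _ /gi.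
rewrite [leRHS](bigID (fun n => n \in [set g j | j : 'I_m]%SET)) /= lerDl.
by apply: sumr_ge0.
Qed.

(** Pigeonhole among [M.+1] points [w j] of a segment starting at [z]. A zero close to one of them
    is close to no other, and each such zero adds at least 9 / 64 to [ppsum] at [z]. Bounded sums
    thus leave one [w j] away from all zeros, where [blaschke_lower] applies. *)
Lemma blaschke_large_nearby (K : R) : exists2 e : R, 0 < e & forall zs z, normc z < 1 ->
  (forall N, ppsum zs N z <= K) -> exists w, [/\ normc w < 1, 3 / 4 <= pp z w &
    forall l, ctends \oo (bprod zs ^~ w) l -> e <= normc l ^+ 2].
Proof.
(* [M] makes [M.+1 * (9 / 64)] exceed [K]. The spacing [tau] keeps the points within half the
   distance from [z] to the circle. With [d = tau / 32], two points near the same zero would be at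
   distance at most 12 d (1 - |z|), less than the spacing tau (1 - |z|). *)
pose M := Num.truncn (64 * K / 9); pose tau : R := (2 * M.+1%:R)^-1; pose d := tau / 32.
have tau0 : 0 < tau by rewrite invr_gt0 mulr_gt0.
have tau1 : tau <= 2^-1 by rewrite lef_pV2 ?posrE ?mulr_gt0// ler_pMr// ler1n.
have d0 : 0 < d by rewrite divr_gt0.
have d2 : d <= 2^-1 by rewrite /d; lra.
exists (expR (- (16 * K / 3 / d ^+ 2))); first exact: expR_gt0.
move=> zs z z1 hK; have h0 : 0 < 1 - normc z by rewrite subr_gt0.
pose w (j : nat) : C := z + (j%:R * tau * (1 - normc z))%:C.
have jt (j : 'I_M.+1) : j%:R * tau <= 2^-1.
  rewrite /tau ler_pdivrMr ?mulr_gt0// mulrA mulVf ?pnatr_eq0// mul1r ler_nat ltnW//.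
have dist (j : 'I_M.+1) : normc (z - w j) <= 2^-1 * (1 - normc z).
  rewrite /w opprD addrA subrr add0r normcN normcR ger0_norm; last first.
    by rewrite mulr_ge0 ?(ltW h0)// mulr_ge0// ltW.
  by rewrite ler_pM2r.
have w1 (j : 'I_M.+1) : normc (w j) < 1.
  have := dist j; rewrite normcB => h; have := ler_normcB (w j) z.
  by move: h h0; move: (normc _) (normc _) (normc _) => x y v; lra.
have wz (j : 'I_M.+1) : 3 / 4 <= pp z (w j).
  have p2 : psh z (w j) <= 2^-1.
    rewrite /psh normc_div ler_pdivrMr ?normc_gt0 ?conjM_neq0//.
    by apply: (le_trans (dist j)); rewrite ler_pM2l ?invr_gt0// conjM_ge_defect.
  have : psh z (w j) ^+ 2 <= 2^-1 ^+ 2 by rewrite lerXn2r ?nnegrE ?psh_ge0 ?invr_ge0.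
  by rewrite psh_pp//; move: (pp z (w j)) => x; lra.
have [[j hj]|nj] := pselect (exists j : 'I_M.+1, forall n (a : D), zs n = Some a -> d <= psh (val a) (w j)).
  exists (w j); split => // l hl; apply: (blaschke_lower (w1 j) d0 hl hj) => N.
  apply: (@le_trans _ _ (16 / 3 * ppsum zs N z)); last by have := hK N; lra.
  rewrite /ppsum mulr_sumr; apply: ler_sum => n _; rewrite /ppterm.
  case: (zs n) => [a|] /=; last by rewrite mulr0.
  have := pp_chain (disc_lt1 a) (w1 j) z1; rewrite (pp_sym (w j) z).
  have := wz j; have := pp_gt0 (disc_lt1 a) (w1 j).
  by move: (pp _ (w j)) (pp z _) (pp _ z) => x y v; clear; nra.
have bad (j : 'I_M.+1) : exists n, exists2 a : D, zs n = Some a & psh (val a) (w j) < d.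
  apply: contrapT => nb; apply: nj; exists j => n a za; rewrite leNgt; apply/negP => h.
  by apply: nb; exists n, a.
have [m hm] := choice bad; exfalso.
have near (j : 'I_M.+1) (a : D) : psh (val a : C) (w j) < d -> normc (val a - w j) <= 6 * d * (1 - normc z).
  move=> h; have := @psh_small_dist (val a) (w j) d (disc_lt1 a) (w1 j); rewrite d0 d2 => /(_ isT h).
  have : 1 - normc (w j) <= 3 / 2 * (1 - normc z).
    have := dist j; have := ler_normcB z (w j); move: (normc _) (normc _) (normc _) => x y v; lra.
  move: (1 - normc (w j)) (1 - normc z) (normc _) => x y v h1 h2; apply: (le_trans h2).
  by rewrite -[6](_ : 4 * (3 / 2) = 6); [nra|lra].
have mi : injective m.
  move=> j k jk; apply/val_inj/eqP; apply: contrapT => /negP njk.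
  have [a za ha] := hm j; have [b zb hb] := hm k.
  have ab : a = b by move: za; rewrite jk zb => -[].
  rewrite -ab in hb; have n1 := near _ _ ha; have n2 := near _ _ hb.
  have := normc_triangle (w j) (w k) (val a).
  have -> : w j - w k = ((j%:R - k%:R) * (tau * (1 - normc z)))%:C.
    by rewrite /w opprD addrACA subrr add0r -rmorphB /=; congr (_%:C); ring.
  rewrite normcR normrM [`|tau * _|]gtr0_norm ?mulr_gt0//.
  have : 1 <= `|j%:R - k%:R : R|.
    by rewrite -[j%:R]/((j : int)%:~R) -[k%:R]/((k : int)%:~R) -rmorphB /= -intr_norm (ler_int _ 1) -gtz0_ge1 normr_gt0 subr_eq0.
  move: n1 n2; rewrite [normc (w j - _)]normcB /d; move: (`|_|) (normc (val a - w j)) (normc (val a - w k)) => x u v n1 n2 x1.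
  have t1 : 0 < tau * (1 - normc z) by rewrite mulr_gt0.
  have : tau * (1 - normc z) <= x * (tau * (1 - normc z)) by rewrite ler_peMl// ltW.
  move: n1 n2 t1; have -> : 6 * (tau / 32) * (1 - normc z) = 6 / 32 * (tau * (1 - normc z)) by ring.
  by move: (x * (tau * (1 - normc z))) (tau * (1 - normc z)) => p q; lra.
have big (j : 'I_M.+1) : 9 / 64 <= ppterm zs z (m j).
  have [a za ha] := hm j; rewrite /ppterm za /=.
  have : psh (val a) (w j) ^+ 2 <= 2^-1 ^+ 2.
    by rewrite lerXn2r ?nnegrE ?psh_ge0 ?invr_ge0// (le_trans (ltW ha)).
  have a1 := disc_lt1 a; rewrite psh_pp//.
  have := pp_chain a1 (w1 j) z1; rewrite (pp_sym (w j) z); have := wz j.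
  by move: (pp _ (w j)) (pp z _) (pp _ z) => x y v; clear; nra.
pose N := (\max_j m j).+1.
have mN j : (m j < N)%N by rewrite ltnS; exact: (leq_bigmax j).
have t0 n : 0 <= ppterm zs z n by exact: ppterm_ge0.
have := le_trans (sum_inj_le t0 mN mi) (hK N).
have : M.+1%:R * (9 / 64) <= \sum_(j < M.+1) ppterm zs z (m j).
  have -> : M.+1%:R * (9 / 64) = \sum_(j < M.+1) (9 / 64 : R) by rewrite sumr_const card_ord mulr_natl.
  by apply: ler_sum.
have : 64 * K / 9 < M.+1%:R by exact: truncnS_gt.
move: (\sum_(j < _) _) (M.+1%:R) => x y; lra.
Qed.
End large_values.

(** * Factorization of functions vanishing at a steady point *)

Section factorization.
Variable R : realType.
Local Notation C := R[i].
Implicit Types (f g : Hinf R) (x y m : spectrum R).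

Lemma Hinf_blaschke (zs : nat -> option (disc R)) : summable_zeros zs ->
  exists B : Hinf R, Hnorm B <= 1 /\ forall w, normc w < 1 -> ctends \oo (bprod zs ^~ w) (ext B w).
Proof.
move=> sz; have [B [Bh B1 BP]] := blaschke_exists sz.
have [b bE] := mk_Hinf Bh B1; exists b; split.
  by apply: Hnorm_le => w w1; rewrite bE// B1.
by move=> w w1; rewrite bE//; exact: BP.
Qed.

Lemma Hnorm_mul f g : Hnorm f <= 1 -> Hnorm g <= 1 -> Hnorm (f * g) <= 1.
Proof.
move=> f1 g1; apply: Hnorm_le => w w1; rewrite ext_mul normcM mulr_ile1 ?normc_ge0//.
  exact: le_trans (Hnorm_ge f w1) f1.
exact: le_trans (Hnorm_ge g w1) g1.
Qed.

Section steady_point.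
Variables (U : set_system C) (UU : UltraFilter U) (x : spectrum R).
Hypothesis UD : U [set w | normc w < 1].
Hypothesis Ust : forall f n, U (steady f n).
Hypothesis Ux : forall f : Hinf R, ctends U (ext f) (x f).

Let UP : ProperFilter U. Proof. exact: ultra_proper. Qed.
Let UF : Filter U. Proof. exact: filter_filter. Qed.

Lemma vanishing_blaschke (zs : nat -> option (disc R)) (B : Hinf R) :
  (forall w, normc w < 1 -> ctends \oo (bprod zs ^~ w) (ext B w)) ->
  unbounded_along U zs -> x B = 0.
Proof.
move=> BP hu; apply/eqP; rewrite -normc_eq0; apply/eqP; apply: contrapT => n0.
have p0 : 0 < normc (x B) ^+ 2 by rewrite exprn_gt0// lt_neqAle eq_sym normc_ge0 andbT; apply/eqP.
have : normc (x B ^+ 2) <= normc (x B) ^+ 2 / 2.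
  apply: (@ctends_le _ _ U _ (fun w => ext B w ^+ 2)); first by apply: ctendsX; exact: Ux.
  apply: filterS2 (hu (- ln (normc (x B) ^+ 2 / 2))) UD => w /= [N hN] w1; rewrite normcX.
  apply: (le_trans (blaschke_upper N w1 (BP w w1))).
  by rewrite -[leRHS]lnK ?posrE ?divr_gt0// ler_expR lerNl.
by rewrite normcX ler_pdivlMr// ger_pMr// -subr_le0 addrK; lra.
Qed.

(** Steadiness carries the smallness of [B] along [U] to all points at bounded hyperbolic distance,
    among them the one where bounded sums would force [B] to be large. *)
Lemma unbounded_of_vanishing (zs : nat -> option (disc R)) (B : Hinf R) :
  (forall w, normc w < 1 -> ctends \oo (bprod zs ^~ w) (ext B w)) ->
  x B = 0 -> unbounded_along U zs.
Proof.
move=> BP xB; apply: contrapT => /(not_unbounded UU)[K hK].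
have [e e0 he] := blaschke_large_nearby K.
(* At the nearby point [w] the modulus of [B] is at most [2 * d], and 4 d^2 <= e / 2 because
   [d <= e / 4] and [d <= 2^-1]. *)
pose n := (Num.truncn (4 / e)).+1; pose d : R := n.+1%:R^-1.
have d0 : 0 < d by rewrite invr_gt0.
have de : d <= e / 4.
  rewrite -[leRHS]invrK invf_div lef_pV2 ?posrE ?divr_gt0//.
  by apply: (le_trans (ltW (truncnS_gt _))); rewrite ler_nat.
have d2 : d <= 2^-1 by rewrite lef_pV2 ?posrE// ler_nat.
have := Ux B d0; rewrite xB => U0.
have : U set0; last exact: filter_not_empty.
apply: filterS2 (filterI (Ust B n) U0) (filterI hK UD) => z /= [st z0] [zK z1].
have [w [w1 pw hw]] := he zs z z1 zK.
have := hw _ (BP w w1).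
have hs : normc (ext B w - ext B z) <= d.
  by apply: st => //; apply: le_trans pw; apply: (le_trans d2); lra.
have : normc (ext B w) <= 2 * d.
  rewrite -[ext B w](subrK (ext B z)); apply: (le_trans (le_normcD _ _)).
  by move: z0 hs; rewrite subr0; move: (normc _) (normc _) => p q; lra.
move: (normc_ge0 (ext B w)); move: (normc (ext B w)) => p p0 pd.
have : p ^+ 2 <= (2 * d) ^+ 2 by rewrite lerXn2r ?nnegrE// mulr_ge0// ltW.
by move: d0 de d2 e0; nra.
Qed.

Theorem char_factor f : Hnorm f <= 1 -> x f = 0 -> exists f1 f2,
  [/\ f = f1 * f2, Hnorm f1 <= 1, Hnorm f2 <= 1, x f1 = 0 & x f2 = 0].
Proof.
move=> f1 xf.
have [[z0 [z01 fz0]]|nz] := pselect (exists z0, normc z0 < 1 /\ ext f z0 != 0); last first.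
  have n0 : Hnorm (0 : Hinf R) <= 1 by apply: Hnorm_le => w _; rewrite ext_zero normc0.
  exists 0, 0; rewrite rmorph0; split => //; rewrite mulr0; apply: Hinf_eq => w w1.
  by rewrite ext_zero; apply/eqP; apply: contrapT => /negP h; apply: nz; exists w.
have fb w : normc w < 1 -> normc (ext f w) <= 1 by move=> w1; exact: le_trans (Hnorm_ge f w1) f1.
have [zs [B0 [F [sz B0P [Fh F1] Fnz fE]]]] := blaschke_decomposition (holo_ext f) fb z01 fz0.
have [B [B1 BP]] := Hinf_blaschke sz; have [H HE] := mk_Hinf Fh F1.
have H1 : Hnorm H <= 1 by apply: Hnorm_le => w w1; rewrite HE// F1.
have fBH : f = B * H.
  apply: Hinf_eq => w w1; rewrite ext_mul HE// fE//; congr (_ * _).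
  exact: (@ctends_unique _ _ \oo _ (fun N => bprod zs N w) _ _ (B0P w w1) (BP w w1)).
have /eqP := xf; rewrite fBH rmorphM mulf_eq0 => /orP[]/eqP h0; last first.
  have [G Gh GE] := holo_sqrt Fh Fnz.
  have G1 w : normc w < 1 -> normc (G w) <= 1.
    by move=> w1; rewrite -(@expr_le1 _ 2)// ?normc_ge0// -normcX GE// F1.
  have [g gE] := mk_Hinf Gh G1.
  have g1 : Hnorm g <= 1 by apply: Hnorm_le => w w1; rewrite gE// G1.
  have HG : H = g * g by apply: Hinf_eq => w w1; rewrite ext_mul gE// HE// -GE// expr2.
  have xg : x g = 0 by have /eqP := h0; rewrite HG rmorphM mulf_eq0 orbb => /eqP.
  by exists (B * g), g; split; rewrite ?rmorphM /= ?xg ?mulr0// ?HG ?mulrA//; exact: Hnorm_mul.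
have [P [u1 u2]] := unbounded_split UU UD sz (unbounded_of_vanishing BP h0).
have [b1 [b11 b1P]] := Hinf_blaschke (summable_subzeros P sz).
have [b2 [b21 b2P]] := Hinf_blaschke (summable_subzeros (predC P) sz).
exists b1, (b2 * H); split => //.
- rewrite mulrA; congr (_ * _); apply: Hinf_eq => w w1; rewrite ext_mul.
  apply: (@ctends_unique _ _ \oo _ (fun N => bprod zs N w)); first exact: BP.
  apply: (@ctends_ext _ _ \oo _ (fun N => bprod (subzeros zs P) N w * bprod (subzeros zs (predC P)) N w)).
    by apply: nearW => N; rewrite -bprod_subzeros.
  by apply: ctendsM; [exact: b1P|exact: b2P].
- exact: Hnorm_mul.
- exact: vanishing_blaschke b1P u1.
- by rewrite rmorphM /= (vanishing_blaschke b2P u2) mul0r.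
Qed.
End steady_point.

(** Composing [f] with the disc automorphism that sends its value at [y] to 0 exchanges the roles of
    [x] and [y]. The factor [t < 1] keeps this value inside the disc even if [y f] has modulus 1. *)
Lemma rho_le x y : (rho x y <= rho y x)%E.
Proof.
apply: ge_ereal_sup => _ [f [f1 xf] <-].
have yf1 : normc (y f) <= 1 by exact: le_trans (char_le y f) f1.
apply/lee_addgt0Pr => e e0; pose t := 1 - Num.min e 2^-1.
have m0 : 0 < Num.min e 2^-1 by rewrite lt_min e0 invr_gt0 ltr0n.
have m2 : Num.min e 2^-1 <= 2^-1 by rewrite ge_min lexx orbT.
have t0 : 0 < t by rewrite /t; lra.
have t1 : t < 1 by rewrite /t gtrBl.
pose l := t%:C * y f.
have nl : normc l = t * normc (y f) by rewrite normcM normcR gtr0_norm.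
have l1 : normc l < 1 by rewrite nl (le_lt_trans (ler_piMr (ltW t0) yf1)).
have fw w : normc w < 1 -> normc (t%:C * ext f w) < 1.
  move=> w1; rewrite normcM normcR gtr0_norm//.
  by apply: (le_lt_trans (ler_piMr (ltW t0) (le_trans (Hnorm_ge f w1) f1))).
have d0 : 0 < 1 - normc l by rewrite subr_gt0.
have dE w : normc w < 1 -> ext (1 - (conjc l * t%:C) *: f) w = 1 - conjc l * (t%:C * ext f w).
  by move=> w1; rewrite ext_sub ext_one// ext_scale mulrA.
have [|i [fi iE]] := @Hinf_inv _ (1 - (conjc l * t%:C) *: f) _ d0.
  by move=> w w1; rewrite dE//; apply: conjM_ge_defect => //; exact: fw.
pose g := (t%:C *: f - l *: 1) * i.
have g1 : Hnorm g <= 1.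
  apply: Hnorm_le => w w1; rewrite ext_mul ext_sub !ext_scale ext_one// mulr1 iE// dE//.
  by rewrite normcM normcB -normcM; apply: ltW; apply: psh_lt1 => //; exact: fw.
have yg : y g = 0 by rewrite rmorphM rmorphB /= !char_scale rmorph1 mulr1 subrr mul0r.
have xi : x i = 1.
  have : x ((1 - (conjc l * t%:C) *: f) * i) = 1 by rewrite fi rmorph1.
  by rewrite rmorphM rmorphB /= char_scale xf mulr0 rmorph1 subr0 mul1r.
have xg : normc (x g) = t * normc (y f).
  by rewrite rmorphM rmorphB /= !char_scale rmorph1 xf mulr0 sub0r mulr1 xi mulr1 normcN.
have h : ((t * normc (y f))%:E <= rho y x)%E by apply: ereal_sup_ubound; exists g => //; rewrite xg.
apply: (@le_trans _ _ ((t * normc (y f))%:E + e%:E)%E); last by rewrite leeD2r.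
rewrite -EFinD lee_fin /t.
have : Num.min e 2^-1 * normc (y f) <= e.
  by rewrite (le_trans (ler_piMr (ltW m0) yf1))// ge_min lexx.
by move: (Num.min e _) (normc _) => p q; lra.
Qed.

Lemma spectrum_eq x y : (forall f, x f = y f) -> x = y.
Proof.
case: x => x cx; case: y => y cy /= h.
have e : x = y by apply/funext.
subst y; congr (GRing.LRMorphism.Pack _).
case: cx => -[a1] [a2] [a3]; case: cy => -[b1] [b2] [b3].
by congr (GRing.LRMorphism.Class _ _ _); congr (_ _); exact: Prop_irrelevance.
Qed.

(** Factorization gives [r <= r * r] for the distance [r] from [x] to [m]. As [r < 1], it vanishes;
    then [m] and [x] agree on the kernel of [x], hence everywhere. *)
Theorem steady_point_trivial (U : set_system C) x : UltraFilter U -> U [set w | normc w < 1] ->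
  (forall f n, U (steady f n)) -> (forall f : Hinf R, ctends U (ext f) (x f)) ->
  gleason_part x = [set x].
Proof.
move=> UU UD Ust Ux; apply/seteqP; split => [m /= mx|_ ->]; last first.
  rewrite /gleason_part /=; apply: (@le_lt_trans _ _ 0%:E); last by rewrite lte_fin.
  by apply: ge_ereal_sup => _ [f [_ xf] <-]; rewrite xf normc0.
have r1 : (rho x m < 1)%E by exact: le_lt_trans (rho_le x m) mx.
have mf f : Hnorm f <= 1 -> x f = 0 -> ((normc (m f))%:E <= rho x m)%E.
  by move=> f1 xf; apply: ereal_sup_ubound; exists f.
have h0 : Hnorm (0 : Hinf R) <= 1 by apply: Hnorm_le => w _; rewrite ext_zero normc0.
have r0 : (0%:E <= rho x m)%E by apply: le_trans (mf 0 h0 (rmorph0 x)); rewrite lee_fin normc_ge0.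
have [r rE] : exists r : R, rho x m = r%:E.
  by move: r0 r1; case: (rho x m) => [r _ _|//|//]; exists r.
rewrite rE lte_fin in r1; rewrite rE lee_fin in r0.
have rr : r <= r * r.
  rewrite -lee_fin -rE; apply: ge_ereal_sup => _ [f [f1 xf] <-].
  have [g [h [-> g1 h1 xg xh]]] := char_factor UU UD Ust Ux f1 xf.
  rewrite rmorphM /= normcM lee_fin; apply: ler_pM; rewrite ?normc_ge0//.
    by rewrite -lee_fin -rE mf.
  by rewrite -lee_fin -rE mf.
have r00 : r = 0 by apply: le_anti; rewrite r0 andbT; move: r1 r0 rr; nra.
apply: spectrum_eq => g.
have n0 : 0 < Hnorm g + Hnorm g + 1 by rewrite ltr_wpDl// addr_ge0// Hnorm_ge0.
pose c : C := ((Hnorm g + Hnorm g + 1)^-1)%:C.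
have c0 : c != 0 by rewrite -normc_gt0 normcR gtr0_norm ?invr_gt0.
have := mf (c *: (g - x g *: 1)).
rewrite rE r00 !char_scale !rmorphB /= !char_cst subrr mulr0 => /(_ _ erefl).
rewrite lee_fin normcM => H; have {}H : normc c * normc (m g - x g) <= 0.
  apply: H; apply: Hnorm_le => w w1; rewrite ext_scale normcM normcR gtr0_norm ?invr_gt0//.
  rewrite mulrC ler_pdivrMr// mul1r ext_sub ext_scale ext_one// mulr1.
  apply: (le_trans (le_normcD _ _)); rewrite normcN -[leLHS]addr0; apply: lerD => //.
  by rewrite lerD ?Hnorm_ge ?char_le.
apply/eqP; rewrite -subr_eq0 -normc_eq0 eq_le normc_ge0 andbT.
by rewrite -(pmulr_rle0 _ (_ : 0 < normc c))// normc_gt0.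
Qed.

Theorem typeG_not_thick (s : seq (Hinf R)) (c : R) : (forall b, b \in s -> typeG b) -> c < 1 ->
  ~ thick [set w | normc (ext (\prod_(b <- s) b) w) <= c].
Proof.
move=> sG c1 /thick_char[U [x [UU US Ust Ux]]].
have UP : ProperFilter U by exact: ultra_proper.
have UF : Filter U by exact: filter_filter.
have UD : U [set w | normc w < 1] by apply: filterS US => w [].
have triv := steady_point_trivial UU UD Ust Ux.
have : normc (x (\prod_(b <- s) b)) <= c.
  by apply: (ctends_le (Ux _)); apply: filterS US => w [].
move=> /le_lt_trans/(_ c1); apply/negP; rewrite -leNgt.
elim: s sG {US} => [|b s IH] sG; first by rewrite big_nil rmorph1 normc1.
rewrite big_cons rmorphM normcM /=.
have h : 1 <= normc (x (\prod_(j <- s) j)) by apply: IH => j js; apply: sG; rewrite inE js orbT.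
apply: (le_trans h); rewrite ler_peMl ?normc_ge0// leNgt; apply/negP => xb.
(* [x] lies in the nontrivial part of some [y]. By symmetry [y] lies in the part of [x], which is
   trivial, so [y = x] and the part of [y] is trivial too. *)
have [_ /(_ x xb)[y /= yn xy]] := sG b (mem_head _ _).
apply: yn; have : gleason_part x y by exact: le_lt_trans (rho_le y x) xy.
by rewrite triv /= => ->.
Qed.
End factorization.

(** * The Douglas algebra generated by type G products *)

Section blaschke_products.
Variable R : realType.
Local Notation C := R[i].
Implicit Types (zs : nat -> option (disc R)) (b f g h u : Hinf R).

Lemma blaschke_conditionP zs : blaschke_condition zs <-> summable_zeros zs.
Proof.
have E N : series (fun n => oapp (fun a => 1 - normc (val a)) 0 (zs n)) N = \sum_(n < N) defect zs n.
  by rewrite /series /= big_mkord.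
have ndecr : nondecreasing_seq (series (fun n => oapp (fun a : disc R => 1 - normc (val a)) 0 (zs n))).
  by apply: nondecreasing_series => n _ _; exact: (defect_ge0 zs n).
rewrite /blaschke_condition; split => [cv|[K hK]].
  by eexists => N; rewrite -E; exact: (nondecreasing_cvgn_le ndecr cv N).
by apply: nondecreasing_is_cvgn => //; exists K => _ [N _ <-]; rewrite E.
Qed.

Lemma blaschke_with_rootsP zs b : blaschke_with_roots zs b <-> summable_zeros zs /\
  exists2 c : C, normc c = 1 & forall w, normc w < 1 ->
    ctends \oo (fun N => c * bprod zs N w) (ext b w).
Proof.
rewrite /blaschke_with_roots; split => -[/blaschke_conditionP sz [c c1 h]]; split => //; exists c => //.
  move=> w w1; rewrite (ext_in _ w1).
  by apply/(@ctends_cvg _ _ \oo _); exact: (h (Sub w w1)).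
by move=> z; have /(@ctends_cvg _ _ \oo _) := h _ (disc_lt1 z); rewrite ext_val.
Qed.

Lemma unimodular_neq0 (c : C) : normc c = 1 -> c != 0.
Proof. by move=> c1; rewrite -normc_gt0 c1. Qed.

Lemma blaschke_boundary zs b : blaschke_with_roots zs b ->
  {ae @arc_measure R, forall t, normc (boundary b t) = 1}.
Proof.
move=> /blaschke_with_rootsP[sz [c c1 h]]; have c0 := unimodular_neq0 c1.
have Bh : holo (fun w => c^-1 * ext b w).
  by move=> w w1; apply: cdiffM; [exact: cdiff_cst|exact: holo_ext].
have BP w : normc w < 1 -> ctends \oo (bprod zs ^~ w) (c^-1 * ext b w).
  move=> w1; apply: (@ctends_ext _ _ \oo _ (fun N => c^-1 * (c * bprod zs N w))).
    by apply: nearW => N; rewrite mulKf.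
  by apply: ctendsM; [exact: ctends_cst|exact: h].
apply: arc_ae2 (blaschke_radial_norm sz Bh BP) (boundary_radial b) => t H hb.
have : normc (c^-1 * boundary b t) = 1.
  by apply: H; apply: ctendsM; [exact: ctends_cst|exact: hb].
by rewrite normcM -[c^-1]mul1r normc_div normc1 c1 divr1 mul1r.
Qed.

Lemma prod_boundary (s : seq (Hinf R)) : (forall b, b \in s -> typeG b) ->
  {ae @arc_measure R, forall t, normc (boundary (\prod_(b <- s) b) t) = 1}.
Proof.
elim: s => [|b s IH] sG.
  by apply: arc_aeT => t; rewrite big_nil boundary_one normc1.
have [[zs bz _] _] := sG b (mem_head _ _).
have := IH (fun j js => sG j (mem_behead (s := b :: s) js)).
move=> /(arc_ae2 _ (blaschke_boundary bz)) H.
have := arc_ae2 _ (H (fun t => normc (boundary b t) = 1 /\ normc (boundary (\prod_(j <- s) j) t) = 1) (fun t a c => conj a c)) (boundary_mul b (\prod_(j <- s) j)).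
by apply => t [h1 h2] h3; rewrite big_cons h3 normcM h1 h2 mulr1.
Qed.
End blaschke_products.

(** * Quotients by products of type G *)

Section approximation.
Variable R : realType.
Local Notation C := R[i].
Local Notation arc := (@arc_measure R).
Implicit Types (phi psi : R -> C) (h u : Hinf R) (s : seq (Hinf R)).

(** On the circle the conjugate of a product of type G functions is its inverse, so these are the
    uniform limits of quotients of H^oo functions by such products. *)
Definition quotient_closure : set (R -> C) := [set phi | Linf phi /\ forall e : R, 0 < e ->
  exists h s, (forall b, b \in s -> typeG b) /\
    {ae arc, forall t, normc (phi t - boundary h t * conjc (boundary (\prod_(b <- s) b) t)) <= e}].

Lemma Linf_bound phi : Linf phi -> exists2 M, 0 <= M & {ae arc, forall t, normc (phi t) <= M}.
Proof.
move=> [_ _]; have [|/negP n0] := boolP (0%:E <= Linf_norm phi)%E.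
  case E : (Linf_norm phi) => [M| |] //; rewrite lee_fin => M0 _.
  by exists M => //; apply/Linf_normP => //; rewrite E.
move=> _; exists 0 => //; apply/Linf_normP => //.
by have := le_total (Linf_norm phi) 0%:E => /orP[|/n0].
Qed.

Lemma Linf_intro phi M : 0 <= M ->
  measurable_fun setT (fun t : measurableTypeR R => complex.Re (phi t)) ->
  measurable_fun setT (fun t : measurableTypeR R => complex.Im (phi t)) ->
  {ae arc, forall t, normc (phi t) <= M} -> Linf phi.
Proof.
move=> M0 mr mi h; split => //; apply: (@le_lt_trans _ _ M%:E); last exact: ltry.
exact/Linf_normP.
Qed.

Lemma Linf_add phi psi : Linf phi -> Linf psi -> Linf (fun t => phi t + psi t).
Proof.
move=> Lf Lg; have [M M0 hM] := Linf_bound Lf; have [N N0 hN] := Linf_bound Lg.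
have [fr fi _] := Lf; have [gr gi _] := Lg.
apply: (@Linf_intro _ (M + N)); first exact: addr_ge0.
- by under eq_fun do rewrite ReD; exact: measurable_funD.
- by under eq_fun do rewrite ImD; exact: measurable_funD.
- by apply: arc_ae2 hM hN => t h1 h2; apply: (le_trans (le_normcD _ _)); exact: lerD.
Qed.

Lemma Linf_mul phi psi : Linf phi -> Linf psi -> Linf (fun t => phi t * psi t).
Proof.
move=> Lf Lg; have [M M0 hM] := Linf_bound Lf; have [N N0 hN] := Linf_bound Lg.
have [fr fi _] := Lf; have [gr gi _] := Lg.
apply: (@Linf_intro _ (M * N)); first exact: mulr_ge0.
- by under eq_fun do rewrite cReM; apply: measurable_funB; exact: measurable_funM.
- by under eq_fun do rewrite cImM; apply: measurable_funD; exact: measurable_funM.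
- by apply: arc_ae2 hM hN => t h1 h2; rewrite normcM ler_pM ?normc_ge0.
Qed.

Lemma Linf_cst (c : C) : Linf (fun=> c).
Proof.
apply: (@Linf_intro _ (normc c)); [exact: normc_ge0|exact: measurable_cst|exact: measurable_cst|].
exact: arc_aeT.
Qed.

Lemma Linf_conj phi : Linf phi -> Linf (fun t => conjc (phi t)).
Proof.
move=> Lf; have [M M0 hM] := Linf_bound Lf; have [fr fi _] := Lf.
apply: (@Linf_intro _ M) => //.
- by have -> : (fun t => complex.Re (conjc (phi t))) = (fun t => complex.Re (phi t));
    [apply/funext => t; case: (phi t)|exact: fr].
- have -> : (fun t => complex.Im (conjc (phi t))) = (fun t => - complex.Im (phi t)).
    by apply/funext => t; case: (phi t).
  exact: measurable_funN.
- by apply: arc_ae1 hM => t; rewrite normc_conj.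
Qed.

Lemma arc_and (P Q : R -> Prop) : {ae arc, forall t, P t} -> {ae arc, forall t, Q t} ->
  {ae arc, forall t, P t /\ Q t}.
Proof. exact: arc_ae2. Qed.

Lemma quotient_linear (a : C) phi psi : quotient_closure phi -> quotient_closure psi ->
  quotient_closure (fun t => a * phi t + psi t).
Proof.
move=> [Lf hf] [Lg hg]; split; first by apply: Linf_add => //; apply: Linf_mul => //; exact: Linf_cst.
move=> e e0; have a0 : 0 < normc a + 1 by rewrite ltr_wpDl ?normc_ge0.
have e1 : 0 < e / 2 / (normc a + 1) by rewrite divr_gt0// divr_gt0.
have e2 : 0 < e / 2 by rewrite divr_gt0.
have [h1 [s1 [G1 A1]]] := hf _ e1; have [h2 [s2 [G2 A2]]] := hg _ e2.
set b1 := \prod_(b <- s1) b in A1; set b2 := \prod_(b <- s2) b in A2.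
(* The common denominator is [b1 * b2]; the extra factors have modulus 1 on the circle, so the
   errors do not grow. *)
exists ((a *: h1) * b2 + h2 * b1), (s1 ++ s2); split.
  by move=> b; rewrite mem_cat => /orP[/G1|/G2].
rewrite big_cat /= -/b1 -/b2.
have X1 := arc_and A1 A2.
have X2 := arc_and (prod_boundary G1) (prod_boundary G2); rewrite -/b1 -/b2 in X2.
have X3 := arc_and (boundary_add ((a *: h1) * b2) (h2 * b1)) (boundary_mul (a *: h1) b2).
have X4 := arc_and (boundary_mul h2 b1) (boundary_scale a h1).
have := arc_and (arc_and (arc_and X1 X2) (arc_and X3 X4)) (boundary_mul b1 b2).
apply: arc_ae1 => t [[[[f1 f2] [n1 n2]] [[-> ->] [-> ->]]] ->].
have m1 : boundary b1 t * conjc (boundary b1 t) = 1 by rewrite mulcJ n1 expr1n.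
have m2 : boundary b2 t * conjc (boundary b2 t) = 1 by rewrite mulcJ n2 expr1n.
have -> : a * phi t + psi t - (a * boundary h1 t * boundary b2 t + boundary h2 t * boundary b1 t) *
     conjc (boundary b1 t * boundary b2 t) =
  a * (phi t - boundary h1 t * conjc (boundary b1 t) * (boundary b2 t * conjc (boundary b2 t))) +
  (psi t - boundary h2 t * conjc (boundary b2 t) * (boundary b1 t * conjc (boundary b1 t))).
  by rewrite rmorphM /=; ring.
rewrite m1 m2 !mulr1; apply: (le_trans (le_normcD _ _)); rewrite normcM.
move: f1 f2 (normc_ge0 a); move: (normc _) (normc (phi t - _)) (normc (psi t - _)) a0 => x y z x0 hy hz x0'.
have : x * y <= e / 2.
  apply: (@le_trans _ _ ((x + 1) * (e / 2 / (x + 1)))).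
    by apply: (le_trans (ler_wpM2l x0' hy)); rewrite ler_wpM2r ?lerDl// divr_ge0 ?(ltW x0)// divr_ge0// ltW.
  by rewrite mulrC divfK// gt_eqF.
move: hz; clear; lra.
Qed.

Lemma quotient_mul phi psi : quotient_closure phi -> quotient_closure psi ->
  quotient_closure (fun t => phi t * psi t).
Proof.
move=> [Lf hf] [Lg hg]; split; first exact: Linf_mul.
have [M M0 hM] := Linf_bound Lf; have [N N0 hN] := Linf_bound Lg.
(* With both errors at most [d <= 1], the product is off by at most
   [M * d + d * (N + d) <= d * (M + N + 1)]. *)
move=> e e0; pose d := Num.min 1 (e / (M + N + 1)).
have MN : 0 < M + N + 1 by rewrite ltr_wpDl ?addr_ge0.
have d0 : 0 < d by rewrite lt_min ltr01 divr_gt0.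
have d1 : d <= 1 by rewrite ge_min lexx.
have de : d * (M + N + 1) <= e by rewrite -ler_pdivlMr// ge_min lexx orbT.
have [h1 [s1 [G1 A1]]] := hf _ d0; have [h2 [s2 [G2 A2]]] := hg _ d0.
set b1 := \prod_(b <- s1) b in A1; set b2 := \prod_(b <- s2) b in A2.
exists (h1 * h2), (s1 ++ s2); split.
  by move=> b; rewrite mem_cat => /orP[/G1|/G2].
rewrite big_cat /= -/b1 -/b2.
have := arc_and (arc_and (arc_and A1 A2) (arc_and hM hN)) (arc_and (boundary_mul h1 h2) (boundary_mul b1 b2)).
apply: arc_ae1 => t [[[f1 f2] [fM fN]] [-> ->]].
rewrite rmorphM /= mulrACA; move: f1 f2.
move: (boundary h1 t * _) (boundary h2 t * _) => F G f1 f2.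
have -> : phi t * psi t - F * G = phi t * (psi t - G) + (phi t - F) * G by ring.
apply: (le_trans (le_normcD _ _)); rewrite !normcM.
have gN : normc G <= N + d.
  have -> : G = psi t - (psi t - G) by ring.
  by apply: (le_trans (le_normcD _ _)); rewrite normcN lerD.
move: f1 f2 fM gN (normc_ge0 (phi t)) (normc_ge0 (psi t - G)) (normc_ge0 (phi t - F)) (normc_ge0 G).
move: (normc (phi t)) (normc (psi t - G)) (normc (phi t - F)) (normc G) => x y z v f1 f2 fM gN x0 y0 z0 v0.
apply: le_trans de.
have : x * y <= M * d by apply: ler_pM.
have : z * v <= d * (N + d) by apply: ler_pM.
have : d * d <= d by rewrite ler_piMl// ltW.
move: (x * y) (z * v) => p q; clear; nra.
Qed.

Lemma quotient_boundary h : quotient_closure (boundary h).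
Proof.
split=> [|e e0]; first exact: boundary_Linf.
exists h, [::]; split => //; apply: arc_aeT => t.
by rewrite big_nil boundary_one conjc1 mulr1 subrr normc0 ltW.
Qed.

Theorem quotient_douglas : douglas quotient_closure.
Proof.
split; last by move=> _ [h _ <-]; exact: quotient_boundary.
split; first by move=> phi [].
  split.
  - apply/mem_set; have := quotient_boundary 1.
    by congr quotient_closure; apply/funext => t; rewrite boundary_one.
  - by move=> a phi psi /set_mem hf /set_mem hg; apply/mem_set; exact: quotient_linear.
  - by move=> phi psi /set_mem hf /set_mem hg; apply/mem_set; exact: quotient_mul.
move=> phi Lf h; split => // e e0; have e2 : 0 < e / 2 by rewrite divr_gt0.
have [psi [Lg hg] /(Linf_normP _ (ltW e2)) d1] := h _ e2.
have [g [s [sG d2]]] := hg _ e2; exists g, s; split => //.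
apply: arc_ae2 d1 d2 => t h1 h2; apply: (le_trans (normc_triangle _ _ (psi t))).
by rewrite [leRHS](splitr e) lerD.
Qed.

Lemma E_algebra_sub : @E_algebra R `<=` quotient_closure.
Proof.
apply: bigcap_inf; split; first exact: quotient_douglas.
move=> _ [b bG <-]; split; first exact: (Linf_conj (boundary_Linf b)).
move=> e e0; exists 1, [:: b]; split; first by move=> c; rewrite inE => /eqP ->.
apply: arc_aeT => t; rewrite big_seq1 boundary_one mul1r /conj_boundary subrr normc0 ltW//.
Qed.

(** If the inverse [g] of [u] is close to h / b, multiplication by the unimodular b u shows that b -
    u h is small on the circle; [boundary_max] carries this, and the bound for [h], into the
    disc. *)
Theorem invertible_approx u : inner u -> invertible_in (@E_algebra R) (boundary u) ->
  forall e : R, 0 < e -> exists h s, [/\ forall b, b \in s -> typeG b,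
    forall w, normc w < 1 -> normc (ext (\prod_(b <- s) b) w - ext u w * ext h w) <= e &
    Hnorm h <= 1 + e].
Proof.
move=> iu [_ [g /E_algebra_sub[_ hg] ug]] e e0.
have [h [s [sG hs]]] := hg e e0; exists h, s; set b := \prod_(b <- s) b in hs *.
have X : {ae arc, forall t, normc (boundary b t - boundary u t * boundary h t) <= e}.
  have := arc_and (arc_and hs ug) (arc_and iu (prod_boundary sG)).
  apply: arc_ae1 => t [[h1 h2] [u1 b1]]; rewrite -/b in b1.
  have bb : boundary b t * conjc (boundary b t) = 1 by rewrite mulcJ b1 expr1n.
  have -> : boundary b t - boundary u t * boundary h t = boundary b t * boundary u t *
      (g t - boundary h t * conjc (boundary b t)).
    rewrite mulrBr -mulrA h2 mulr1; congr (_ - _).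
    have -> : boundary b t * boundary u t * (boundary h t * conjc (boundary b t)) =
       boundary u t * boundary h t * (boundary b t * conjc (boundary b t)) by ring.
    by rewrite bb mulr1.
  by rewrite !normcM b1 u1 !mul1r.
split => //.
  move=> w w1; have := @boundary_max _ (b - u * h) e (ltW e0) _ w w1.
  rewrite ext_sub ext_mul; apply.
  have B1 : {ae arc, forall t, boundary (b - u * h) t = boundary b t - boundary (u * h) t}.
    have := arc_and (boundary_add b (-1 *: (u * h))) (boundary_scale (-1) (u * h)).
    apply: arc_ae1 => t [e1 e2].
    by rewrite -scaleN1r e1 e2 mulN1r.
  have := arc_and X (arc_and B1 (boundary_mul u h)).
  by apply: arc_ae1 => t [h1 [-> ->]].
apply: Hnorm_le => w w1; apply: (@boundary_max _ h (1 + e)) => //; first by rewrite addr_ge0// ltW.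
have := arc_and X (arc_and iu (prod_boundary sG)); apply: arc_ae1 => t [h1 [u1 b1]].
rewrite -/b in b1; have -> : normc (boundary h t) = normc (boundary u t * boundary h t) by rewrite normcM u1 mul1r.
have := ler_normcB (boundary u t * boundary h t) (boundary b t).
by move: h1; rewrite [normc (boundary b t - _)]normcB b1; move: (normc _) (normc _) => x y; lra.
Qed.
End approximation.

(** * Factorization into interpolating Blaschke products *)

Section interpolating_factors.
Variable R : realType.
Local Notation C := R[i].
Local Notation D := (disc R).
Implicit Types (zs : nat -> option D) (z w : C) (b u : Hinf R).

Let arith1 (x p : R) : 0 <= x -> x ^+ 2 <= 1 - p -> 0 < p <= 1 -> p / 2 <= 1 - x.
Proof.
move=> x0 h /andP[p0 p1]; have h2 : x <= 1 - p / 2.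
  by rewrite -(@ler_pXn2r _ 2)// ?nnegrE; [apply: (le_trans h); nra|lra].
lra.
Qed.

Let pow_small (x eta : R) n : 0 < x <= 1 -> 0 < eta -> eta <= x ^+ n -> n%:R * (1 - x) <= eta^-1.
Proof.
move=> /andP[x0 x1] e0 h.
have B k : 1 + k%:R * (1 - x) <= (x ^+ k)^-1.
  elim: k => [|k IH]; first by rewrite mul0r addr0 expr0 invr1.
  rewrite exprS invfM ler_pdivlMl//; apply: le_trans IH; rewrite -natr1.
  rewrite -subr_ge0; have -> : 1 + k%:R * (1 - x) - x * (1 + (k%:R + 1) * (1 - x)) = (k%:R + 1) * (1 - x) ^+ 2 by ring.
  by rewrite mulr_ge0 ?sqr_ge0 ?addr_ge0.
apply: (@le_trans _ _ (x ^+ n)^-1); last by rewrite lef_pV2 ?posrE ?exprn_gt0.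
by apply: le_trans (B n); rewrite lerDr.
Qed.

Lemma iterated_root (S : C -> C) k : holo S -> (forall w, normc w < 1 -> S w != 0) ->
  exists2 G : C -> C, holo G & forall w, normc w < 1 -> G w ^+ (2 ^ k) = S w.
Proof.
move=> Sh Snz; elim: k => [|k [G Gh GE]]; first by exists S => // w _; rewrite expn0 expr1.
have Gnz w : normc w < 1 -> G w != 0.
  move=> w1; apply/eqP => G0; have := Snz w w1; rewrite -GE// G0 expr0n.
  by rewrite expn_eq0 /= eqxx.
have [H Hh HE] := holo_sqrt Gh Gnz; exists H => // w w1.
by rewrite expnS exprM HE// GE.
Qed.

(* Harnack's inequality for a 2^k-th root that is close to 1 at a point of every hyperbolic disc. *)
Lemma zero_free_lower (S : C -> C) (p eta : R) : holo S -> (forall w, normc w < 1 -> S w != 0) ->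
  (forall w, normc w < 1 -> normc (S w) <= 1) -> 0 < p -> 0 < eta ->
  (forall z, normc z < 1 -> exists2 v, normc v < 1 & p <= pp z v /\ eta <= normc (S v)) ->
  exists2 d, 0 < d & forall w, normc w < 1 -> d <= normc (S w).
Proof.
move=> Sh Snz S1 p0 eta0 near.
(* Where |S(v)| >= eta, a root of order at least 16 / (p eta) satisfies 1 - |G(v)| <= p / 16. The
   Borel-Caratheodory inequality with constant 4 / p then lets [G] vary by at most 1 / 4 between [v]
   and [z]. *)
pose k := Num.truncn (16 / p / eta).
have [G Gh GE] := iterated_root k Sh Snz.
have k0 : (0 < 2 ^ k)%N by rewrite expn_gt0.
have G1 w : normc w < 1 -> normc (G w) <= 1.
  by move=> w1; rewrite -(@expr_le1 _ (2 ^ k)%N)// ?normc_ge0// -normcX GE// S1.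
exists (2^-1 ^+ (2 ^ k)); first by rewrite exprn_gt0// invr_gt0.
move=> z z1; have [v v1 [pv ev]] := near z z1.
rewrite -GE// normcX lerXn2r ?nnegrE ?normc_ge0 ?invr_ge0//.
have p1 : p <= 1 by exact: le_trans (pp_le1 z1 v1).
have Gv0 : 0 < normc (G v).
  rewrite normc_gt0; apply/eqP => G0; have := Snz v v1; rewrite -GE// G0 expr0n.
  by rewrite expn_eq0 /= eqxx.
have Gv : 1 - normc (G v) <= p / 16.
  have := @pow_small (normc (G v)) eta (2 ^ k)%N; rewrite Gv0 G1// => /(_ isT eta0).
  rewrite -normcX GE// => /(_ ev) h.
  have nk : 16 / p / eta <= (2 ^ k)%:R.
    by apply: (le_trans (ltW (truncnS_gt _))); rewrite ler_nat ltn_expl.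
  have N0 : 0 < (2 ^ k)%:R :> R by rewrite ltr0n.
  rewrite -(ler_pM2l N0); apply: (le_trans h).
  apply: (@le_trans _ _ (16 / p / eta * (p / 16))); last by rewrite ler_wpM2r// divr_ge0// ltW.
  by rewrite le_eqVlt; apply/orP; left; apply/eqP; field; rewrite !gt_eqF.
have [c c1 cG] := phase (G v).
have hh : holo (fun w => 1 - c * G w).
  move=> w w1; apply: cdiffB; first exact: cdiff_cst.
  by apply: cdiffM; [exact: cdiff_cst|exact: Gh].
have hRe w : normc w < 1 -> 0 <= complex.Re (1 - c * G w).
  move=> w1; rewrite ReB /= subr_ge0; apply: (le_trans (Re_le_normc _)).
  by rewrite normcM c1 mul1r G1.
have := borel_caratheodory hh hRe v1 z1; rewrite ReB cG /=.
have -> : 1 - c * G z - (1 - (normc (G v))%:C) = c * (G v - G z) by rewrite -cG; ring.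
rewrite normcM c1 mul1r => H.
have q2 : p / 2 <= 1 - psh v z.
  apply: arith1; [exact: psh_ge0| |by rewrite p0].
  by rewrite psh_pp// lerD2l lerN2 pp_sym.
have d0 : 0 < 1 - psh v z by apply: lt_le_trans q2; rewrite divr_gt0.
have H2 : 2 * psh v z / (1 - psh v z) <= 4 / p.
  rewrite ler_pdivrMr// mulrAC ler_pdivlMr//.
  by move: (psh_ge0 v z) q2 p1 p0; move: (psh v z) => q; nra.
have H3 : normc (G v - G z) <= 4^-1.
  apply: (le_trans H); apply: (@le_trans _ _ (4 / p * (p / 16))).
    apply: ler_pM => //; last by rewrite subr_ge0 G1.
    by rewrite divr_ge0 ?mulr_ge0 ?psh_ge0// ltW.
  by rewrite le_eqVlt; apply/orP; left; apply/eqP; field; rewrite gt_eqF.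
have := ler_normcB (G v) (G v - G z); rewrite subKr.
by move: Gv H3; move: (normc _) (normc _) (normc _) => x y t; lra.
Qed.

(** The function [1 - conjc (S 0) * S w] has nonnegative real part and vanishes at 0, so the
    Borel-Caratheodory inequality from the point 0 makes it vanish identically. *)
Lemma unimodular_constant (S : C -> C) : holo S -> (forall w, normc w < 1 -> normc (S w) = 1) ->
  forall w, normc w < 1 -> S w = S 0.
Proof.
move=> Sh S1 w w1; have n0 : normc (0 : C) < 1 by rewrite normc0.
have S0 := S1 0 n0.
have hh : holo (fun w => 1 - conjc (S 0) * S w).
  move=> v v1; apply: cdiffB; first exact: cdiff_cst.
  by apply: cdiffM; [exact: cdiff_cst|exact: Sh].
have hRe v : normc v < 1 -> 0 <= complex.Re (1 - conjc (S 0) * S v).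
  move=> v1; rewrite ReB /= subr_ge0; apply: (le_trans (Re_le_normc _)).
  by rewrite normcM normc_conj S0 mul1r S1.
have cS : conjc (S 0) * S 0 = 1 by rewrite mulrC mulcJ S0 expr1n.
have := borel_caratheodory hh hRe n0 w1; rewrite cS subrr subr0 /= mulr0 => H.
have : 1 - conjc (S 0) * S w = 0.
  by apply/eqP; rewrite -normc_eq0 eq_le H normc_ge0.
move=> /eqP; rewrite subr_eq0 => /eqP E.
have : S 0 * (conjc (S 0) * S w) = S 0 by rewrite -E mulr1.
by rewrite mulrA mulcJ S0 expr1n mul1r.
Qed.

Section greedy_colouring.
Variables (conflict : nat -> nat -> bool) (M : nat).
Hypothesis few : forall n, (\sum_(k < n) conflict k n <= M)%N.

Let free (l : seq nat) (n : nat) : nat :=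
  find (fun j => all (fun k => ~~ (conflict k n && (nth 0%N l k == j))) (iota 0 n)) (iota 0 M.+1).

Let Fixpoint colours (n : nat) : seq nat := if n is n'.+1 then rcons (colours n') (free (colours n') n') else [::].

(** At most [M] colours are forbidden by earlier indices, so the first free one among [M.+1] exists;
    [colours n] records the choices for the first [n] indices. *)
Lemma greedy_colouring : exists c : nat -> nat, (forall n, (c n <= M)%N) /\
  forall k n, (k < n)%N -> conflict k n -> c k != c n.
Proof.
have sz n : size (colours n) = n by elim: n => //= n IH; rewrite size_rcons IH.
have pre k n : (k < n)%N -> nth 0%N (colours n) k = free (colours k) k.
  elim: n => // n IH; rewrite ltnS leq_eqVlt => /orP[/eqP ->|kn].
    by rewrite /= nth_rcons sz ltnn eqxx.
  by rewrite /= nth_rcons sz kn IH.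
pose c n := free (colours n) n; exists c.
have ex n : has (fun j => all (fun k => ~~ (conflict k n && (nth 0%N (colours n) k == j))) (iota 0 n)) (iota 0 M.+1).
  apply: contrapT => /negP; rewrite -all_predC => /allP h.
  have bad (j : 'I_M.+1) : exists k : 'I_n, conflict k n && (nth 0%N (colours n) k == j).
    have := h j; rewrite mem_iota /= add0n => /(_ (ltn_ord j)); rewrite -has_predC => /hasP[k].
    by rewrite mem_iota /= add0n negbK => kn hk; exists (Ordinal kn).
  have [f hf] := choice bad.
  have fi : injective f.
    move=> i j fij; apply: ord_inj; have /andP[_ /eqP ei] := hf i; have /andP[_ /eqP ej] := hf j.
    by rewrite -ei -ej fij.
  have : (M.+1 <= \sum_(k < n) conflict k n)%N.
    rewrite (bigID (fun k => k \in [set f j | j : 'I_M.+1]%SET)) /=; apply: leq_trans (leq_addr _ _).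
    rewrite big_imset /=; last by move=> i j _ _ /fi.
    rewrite -{1}[M.+1]card_ord -sum1_card; apply: leq_sum => j _.
    by have /andP[-> _] := hf j.
  by rewrite leqNgt ltnS few.
have cM n : (c n < M.+1)%N by rewrite /c /free -[X in (_ < X)%N](size_iota 0) -has_find; exact: ex.
split => [n|k n kn cf]; first by rewrite -ltnS.
have := nth_find 0%N (ex n); rewrite -/(free (colours n) n) nth_iota; last exact: cM.
rewrite add0n => /allP/(_ k); rewrite mem_iota /= add0n => /(_ kn).
by rewrite cf pre//=.
Qed.
End greedy_colouring.

(** At a zero, every other factor has modulus at least 1 / 2, and [bprod_lower] with [d = 1 / 2]
    bounds the square of the product from below by exp(- 4 A). *)
Lemma separated_interpolating zs b (A : R) : blaschke_with_roots zs b ->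
  (forall z N, normc z < 1 -> ppsum zs N z <= A) ->
  (forall k n a a', k != n -> zs k = Some a -> zs n = Some a' -> 2^-1 <= psh (val a') (val a)) ->
  interpolating b.
Proof.
move=> bz hA sep; exists zs => //; have [sz _] := (blaschke_with_rootsP zs b).1 bz.
apply: (@lt_le_trans _ _ (expR (- (2 * A)))%:E); first by rewrite lte_fin expR_gt0.
apply: le_ereal_inf_tmp => _ [k [a [za ->]]]; rewrite lee_fin.
pose ys := subzeros zs (fun n => n != k); have a1 := disc_lt1 a.
have E N : \prod_(n < N | n != k :> nat) oapp (pseudohyp a) 1 (zs n) = normc (bprod ys N (val a)).
  rewrite /bprod normc_prod big_mkcond; apply: eq_bigr => n _.
  rewrite /bfac /ys /subzeros; case: ifP => _; last by rewrite normc1.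
  by case: (zs n) => [a'|] /=; [rewrite normc_bf psh_sym /psh /pseudohyp !normc_div normc_conjM_sym|rewrite normc1].
have sy : summable_zeros ys by exact: summable_subzeros.
have [l hl] := bprod_cvg sy a1.
rewrite (_ : (fun N => _) = (fun N => normc (bprod ys N (val a)))); last by apply/funext => N; exact: E.
apply: limr_ge; first by apply/cvg_ex; exists (normc l); exact: (@ctends_norm _ _ \oo _ _ _ hl).
apply: nearW => N.
have low := @bprod_lower _ ys N (val a) 2^-1 a1 (_ : 0 < 2^-1).
have : expR (- (ppsum ys N (val a) / 2^-1 ^+ 2)) <= normc (bprod ys N (val a)) ^+ 2.
  apply: low => // n a' ya; move: ya; rewrite /ys /subzeros; case: ifP => // nk ya.
  by apply: (sep k n a a') => //; rewrite eq_sym.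
have : expR (- (2 * A)) ^+ 2 <= expR (- (ppsum ys N (val a) / 2^-1 ^+ 2)).
  rewrite -expRM_natl ler_expR exprVn invrK.
  have : ppsum ys N (val a) <= A.
    apply: le_trans (hA _ N a1); apply: ler_sum => n _; rewrite /ppterm /ys /subzeros.
    by case: ifP => // _; have := ppterm_ge0 zs n a1.
  by move: (ppsum _ _ _) => p; lra.
move=> h1 h2; have := le_trans h1 h2.
by rewrite ler_pXn2r// ?nnegrE ?normc_ge0// expR_ge0.
Qed.

Lemma bprod_classes zs (c : nat -> nat) M N w : (forall n, (c n <= M)%N) ->
  bprod zs N w = \prod_(i < M.+1) bprod (subzeros zs (fun n => c n == i)) N w.
Proof.
move=> cM; rewrite /bprod exchange_big /=; apply: eq_bigr => n _.
have cn : (c n < M.+1)%N by rewrite ltnS.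
rewrite (bigD1 (Ordinal cn))//= {2}/bfac /subzeros /= eqxx big1 ?mulr1// => i ni.
rewrite /bfac; case: eqP => // ci; case/negP: ni; apply/eqP/val_inj; by rewrite /= ci.
Qed.

Lemma ctends_big_prod (m : nat) (F : 'I_m -> nat -> C) (l : 'I_m -> C) :
  (forall i, ctends \oo (F i) (l i)) -> ctends \oo (fun N => \prod_(i < m) F i N) (\prod_(i < m) l i).
Proof.
elim: m F l => [|m IH] F l h.
  apply: (@ctends_ext _ _ \oo _ (cst 1)); first by apply: nearW => N; rewrite big_ord0.
  by rewrite big_ord0; exact: ctends_cst.
rewrite big_ord_recr /=.
apply: (@ctends_ext _ _ \oo _ (fun N => (\prod_(i < m) F (widen_ord (leqnSn m) i) N) * F ord_max N)).
  by apply: nearW => N; rewrite big_ord_recr.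
by apply: ctendsM => //; apply: IH => i; exact: h.
Qed.

Theorem interpolating_factorization zs u (A : R) : blaschke_with_roots zs u ->
  (forall z N, normc z < 1 -> ppsum zs N z <= A) ->
  exists s : seq (Hinf R), (forall b, b \in s -> interpolating b /\ Hnorm b <= 1) /\ u = \prod_(b <- s) b.
Proof.
move=> uz hA; have [sz [c c1 hu]] := (blaschke_with_rootsP zs u).1 uz.
(* Zeros conflict when their pseudohyperbolic distance is at most 1 / 2, in particular when they
   coincide. Each conflict adds at least 3 / 4 to [ppsum] at the later zero, whence the bound
   [M]. *)
pose conflict k n : bool := if zs k is Some a then if zs n is Some a' then 3 / 4 <= pp (val a) (val a') else false else false.
pose M := Num.truncn (4 / 3 * A).
have few n : (\sum_(k < n) conflict k n <= M)%N.
  have A0 : 0 <= A by have := hA 0 0%N; rewrite /ppsum big_ord0; apply; rewrite normc0.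
  rewrite -(@ler_nat R) natr_sum.
  case zn : (zs n) => [a'|]; last first.
    rewrite big1 ?ler0n// => k _; rewrite /conflict zn; by case: (zs k).
  have h : (\sum_(k < n) conflict k n)%N%:R <= 4 / 3 * A.
    rewrite natr_sum; apply: (@le_trans _ _ (4 / 3 * ppsum zs n (val a'))); last first.
      by rewrite ler_pM2l ?divr_gt0//; apply: hA; exact: disc_lt1.
    rewrite /ppsum mulr_sumr; apply: ler_sum => k _; rewrite /conflict /ppterm zn.
    case: (zs k) => [a|] /=; last by rewrite mulr0.
    have p0 := pp_gt0 (disc_lt1 a) (disc_lt1 a').
    case: (boolP (3 / 4 <= pp (val a) (val a'))) => h /=; last by rewrite mulr_ge0// ltW.
    by move: h; move: (pp _ _) => p; lra.
  by rewrite -natr_sum ler_nat truncn_ge_nat// mulr_ge0.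
have [col [colM colP]] := greedy_colouring few.
pose ys i := subzeros zs (fun n => col n == i).
have cls i : exists b : Hinf R, Hnorm b <= 1 /\ forall w, normc w < 1 -> ctends \oo (bprod (ys i) ^~ w) (ext b w).
  by apply: Hinf_blaschke; exact: summable_subzeros.
have [B BP] := choice cls.
(* The unimodular constant of [u] is attached to the class of colour 0. *)
pose k i : C := if i == 0%N then c else 1.
have k1 i : normc (k i) = 1 by rewrite /k; case: ifP => // _; exact: normc1.
pose F i := k i *: B i.
exists [seq F i | i <- iota 0 M.+1]; split.
  move=> _ /mapP[i _ ->]; split; last first.
    apply: Hnorm_le => w w1; rewrite ext_scale normcM k1 mul1r.
    by have [h _] := BP i; exact: le_trans (Hnorm_ge _ w1) h.
  apply: (@separated_interpolating (ys i) _ A).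
  - apply/blaschke_with_rootsP; split; first exact: summable_subzeros.
    exists (k i) => // w w1; rewrite ext_scale; apply: ctendsM; first exact: ctends_cst.
    by have [_ h] := BP i; exact: h.
  - move=> z N z1; apply: le_trans (hA z N z1); apply: ler_sum => n _; rewrite /ppterm /ys /subzeros.
    by case: ifP => // _; have := ppterm_ge0 zs n z1.
  - have half (a a' : D) : ~~ (3 / 4 <= pp (val a) (val a')) -> 2^-1 <= psh (val a) (val a').
      rewrite -ltNge => h; rewrite -(@ler_pXn2r _ 2)// ?nnegrE ?psh_ge0 ?invr_ge0// psh_pp ?disc_lt1//.
      by move: h; move: (pp _ _) => p; lra.
    move=> m n a a' mn; rewrite /ys /subzeros.
    case: eqP => // cm zm; case: eqP => // cn zn.
    have nc : ~~ conflict m n && ~~ conflict n m.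
      move: mn; rewrite neq_ltn => /orP[mn|nm].
        have nc : ~~ conflict m n by apply/negP => /(colP _ _ mn); rewrite cm cn eqxx.
        by rewrite nc; move: nc; rewrite /conflict zm zn pp_sym.
      have nc : ~~ conflict n m by apply/negP => /(colP _ _ nm); rewrite cm cn eqxx.
      by rewrite nc andbT; move: nc; rewrite /conflict zm zn pp_sym.
    by move: nc => /andP[_]; rewrite /conflict zm zn => /half.
rewrite big_map -[iota 0 M.+1]/(index_iota 0 M.+1) big_mkord.
apply: Hinf_eq => w w1; apply: (@ctends_unique _ _ \oo _ (fun N => c * bprod zs N w)); first exact: hu.
apply: (@ctends_ext _ _ \oo _ (fun N => \prod_(i < M.+1) (k i * bprod (ys i) N w))).
  apply: nearW => N; rewrite big_split /= (bprod_classes _ _ _ colM); congr (_ * _).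
  by rewrite big_ord_recl big1 ?mulr1.
have -> : ext (\prod_(i < M.+1) F i) w = \prod_(i < M.+1) ext (F i) w.
  by apply: (big_morph (fun f : Hinf R => ext f w)) => [f g|]; rewrite ?ext_mul ?ext_one.
apply: ctends_big_prod => i; rewrite ext_scale; apply: ctendsM; first exact: ctends_cst.
by have [_ h] := BP i; exact: h.
Qed.
End interpolating_factors.

(** * From invertibility to a uniform bound on the zeros *)

Section main.
Variable R : realType.
Local Notation C := R[i].
Implicit Types (u b h : Hinf R) (s : seq (Hinf R)).

Lemma norm_prod_lt1 (x : spectrum R) s : normc (x (\prod_(b <- s) b)) < 1 ->
  exists2 b, b \in s & normc (x b) < 1.
Proof.
elim: s => [|b s IH]; first by rewrite big_nil rmorph1 normc1 ltxx.
rewrite big_cons rmorphM normcM /= => h.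
have [xb|xb] := ltP (normc (x b)) 1; first by exists b => //; exact: mem_head.
have [|c cs xc] := IH; last by exists c => //; rewrite inE cs orbT.
by apply: le_lt_trans h; rewrite ler_peMl ?normc_ge0.
Qed.

Lemma prod_norm_le (x : spectrum R) s b : (forall j, j \in s -> Hnorm j <= 1) -> b \in s ->
  normc (x (\prod_(j <- s) j)) <= normc (x b).
Proof.
move=> s1 bs; rewrite (big_rem b bs) rmorphM normcM /= ler_piMr ?normc_ge0//.
apply: (le_trans (char_le _ _)); elim: (rem b s) (mem_rem (x := b) (s := s)) => [|j t IH] h.
  by rewrite big_nil; apply: Hnorm_le => w w1; rewrite ext_one// normc1.
rewrite big_cons; apply: Hnorm_mul; first by apply: s1; apply: h; exact: mem_head.
by apply: IH => i it; apply: h; rewrite inE it orbT.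
Qed.

Lemma invertible_lower u : inner u -> invertible_in (@E_algebra R) (boundary u) ->
  exists p eta : R, [/\ 0 < p, 0 < eta & forall z, normc z < 1 ->
    exists2 v, normc v < 1 & p <= pp z v /\ eta <= normc (ext u v)].
Proof.
move=> iu inv; have [|h [s [sG bh _]]] := invertible_approx iu inv (e := 4^-1); first by rewrite invr_gt0.
have [p [p0 hp]] : exists p : R, 0 < p /\ forall z, normc z < 1 -> exists v,
    [/\ normc v < 1, p <= pp z v & 2^-1 < normc (ext (\prod_(b <- s) b) v)].
  apply: contrapT => no; apply: (@typeG_not_thick _ s 2^-1 sG); first by rewrite invf_lt1// ltr1n.
  move=> p p0; apply: contrapT => nz; apply: no; exists p; split => // z z1.
  apply: contrapT => nv; apply: nz; exists z => // w w1 pw /=; rewrite leNgt; apply/negP => bw.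
  by apply: nv; exists w.
have h0 : 0 < Hnorm h + 1 by rewrite ltr_wpDl// Hnorm_ge0.
(* Where |b| > 1 / 2, the estimate |b - u h| <= 1 / 4 leaves |u h| at least 1 / 4; the [+ 1] keeps
   the denominator positive. *)
exists p, (4^-1 / (Hnorm h + 1)); split => //; first by rewrite divr_gt0// invr_gt0.
move=> z z1; have [v [v1 pv bv]] := hp z z1; exists v => //; split => //.
rewrite ler_pdivrMr//.
apply: (@le_trans _ _ (normc (ext u v) * normc (ext h v))); last first.
  by rewrite ler_wpM2l ?normc_ge0// (le_trans (Hnorm_ge h v1))// lerDl.
have := bh v v1; have := ler_normcB (ext (\prod_(b <- s) b) v) (ext (\prod_(b <- s) b) v - ext u v * ext h v).
rewrite subKr normcM; move: bv; move: (normc (ext _ v)) (normc (_ - _)) (normc _ * normc _) => x y t; lra.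
Qed.

Lemma inner_norm_le u : inner u -> forall w, normc w < 1 -> normc (ext u w) <= 1.
Proof. by move=> iu; apply: boundary_max => //; apply: arc_ae1 iu => t ->. Qed.

Lemma invertible_blaschke u : inner u -> invertible_in (@E_algebra R) (boundary u) ->
  exists zs A, blaschke_with_roots zs u /\ forall z N, normc z < 1 -> ppsum zs N z <= A.
Proof.
move=> iu inv; have [p [eta [p0 eta0 near]]] := invertible_lower iu inv.
have u1 := inner_norm_le iu; have n0 : normc (0 : C) < 1 by rewrite normc0.
have [z0 z01 [_ ez0]] := near 0 n0.
have uz0 : ext u z0 != 0 by rewrite -normc_gt0 (lt_le_trans eta0).
have [zs [B0 [S [sz B0P [Sh S1] Snz uE]]]] := blaschke_decomposition (holo_ext u) u1 z01 uz0.
have B01 w : normc w < 1 -> normc (B0 w) <= 1.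
  by move=> w1; apply: (ctends_le (B0P _ w1)); apply: nearW => n; exact: bprod_le1.
have [d d0 Sd] : exists2 d, 0 < d & forall w, normc w < 1 -> d <= normc (S w).
  apply: (@zero_free_lower _ S p eta) => // z z1; have [v v1 [pv ev]] := near z z1.
  exists v => //; split => //; apply: (le_trans ev); rewrite uE// normcM.
  by rewrite ler_piMl ?normc_ge0// B01.
have [H HE] := mk_Hinf Sh S1; have [B [B1 BP]] := Hinf_blaschke sz.
have [G [HG GE]] : exists g : Hinf R, H * g = 1 /\ forall w, normc w < 1 -> ext g w = (ext H w)^-1.
  by apply: (Hinf_inv d0) => w w1; rewrite HE// Sd.
have BE w : normc w < 1 -> B0 w = ext B w.
  move=> w1; exact: (@ctends_unique _ _ \oo _ (fun N => bprod zs N w) _ _ (B0P w w1) (BP w w1)).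
have uBH : u = B * H by apply: Hinf_eq => w w1; rewrite ext_mul HE// -BE// uE.
have bz : blaschke_with_roots zs B.
  apply/blaschke_with_rootsP; split => //; exists 1; first exact: normc1.
  move=> w w1; apply: (@ctends_ext _ _ \oo _ (fun N => bprod zs N w)); last exact: BP.
  by apply: nearW => N; rewrite mul1r.
(* [G] inverts the zero-free factor. The boundary values of [u] and of the Blaschke product [B] are
   unimodular, hence so are those of [G], and the maximum principle applies. *)
have G1 w : normc w < 1 -> normc (ext G w) <= 1.
  apply: boundary_max => //.
  have X := arc_and (boundary_mul B H) (boundary_mul H G); rewrite -uBH HG in X.
  apply: arc_ae1 (arc_and X (arc_and iu (blaschke_boundary bz))) => t [[eu eG] [nu nB]].
  rewrite eu normcM nB mul1r in nu; rewrite boundary_one in eG.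
  by have := congr1 (@normc R) eG; rewrite normc1 normcM nu mul1r => <-.
have Su w : normc w < 1 -> normc (S w) = 1.
  move=> w1; apply: le_anti; rewrite S1//=.
  have := G1 w w1; rewrite GE// HE// -[_^-1]mul1r normc_div normc1 mul1r invf_le1//.
  by rewrite normc_gt0 Snz.
have Sc := unimodular_constant Sh Su.
have ub : blaschke_with_roots zs u.
  apply/blaschke_with_rootsP; split => //; exists (S 0); first exact: Su.
  move=> w w1; rewrite uE// mulrC Sc//; apply: ctendsM; first exact: ctends_cst.
  exact: B0P.
(* [blaschke_upper] bounds the sum at the nearby point [v] where |u| >= eta, and [pp_chain]
   transfers the bound to [z] with the factor 4 / p. *)
exists zs, (4 / p * (- ln (eta ^+ 2))); split => // z N z1.
have [v v1 [pv ev]] := near z z1.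
have hv : ppsum zs N v <= - ln (eta ^+ 2).
  rewrite lerNr -ler_expR lnK ?posrE ?exprn_gt0//.
  apply: (@le_trans _ _ (normc (B0 v) ^+ 2)); last exact: (blaschke_upper N v1 (B0P v v1)).
  rewrite lerXn2r ?nnegrE ?normc_ge0 ?(ltW eta0)// (le_trans ev)// uE// normcM.
  by rewrite ler_piMr ?normc_ge0// S1.
apply: (@le_trans _ _ (4 / p * ppsum zs N v)); last by rewrite ler_pM2l ?divr_gt0.
rewrite /ppsum mulr_sumr; apply: ler_sum => n _; rewrite /ppterm.
case: (zs n) => [a|] /=; last by rewrite mulr0.
rewrite mulrAC ler_pdivlMr//; have := pp_chain (disc_lt1 a) z1 v1; have := pp_gt0 (disc_lt1 a) z1.
move: pv; move: (pp _ z) (pp z v) (pp _ v) => x y t h1 h2 h3.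
by apply: le_trans h3; rewrite ler_wpM2l// ltW.
Qed.
End main.

Theorem theorem7 (R : realType) (u : Hinf R) :
  inner u -> invertible_in (@E_algebra R) (boundary u) ->
  exists s : seq (Hinf R),
    (forall b, b \in s -> typeG b) /\ u = \prod_(b <- s) b.
Proof.
move=> iu inv; have [zs [A [uz hA]]] := invertible_blaschke iu inv.
have [s [sI us]] := interpolating_factorization uz hA.
exists s; split => // b bs; split; first by have [] := sI b bs.
move=> x /= xb.
have xu : normc (x u) < 1.
  by apply: le_lt_trans xb; rewrite us; apply: prod_norm_le => // j /sI[].
(* Then the approximating product has |x| at most |x(u)| (1 + e) + e <= |x(u)| + 2 e < 1. *)
pose e := (1 - normc (x u)) / 4; have e0 : 0 < e by rewrite divr_gt0// subr_gt0.
have [h [t [tG bh h1]]] := invertible_approx iu inv e0.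
have xt : normc (x (\prod_(j <- t) j)) < 1.
  have H : Hnorm (\prod_(j <- t) j - u * h) <= e.
    by apply: Hnorm_le => w w1; rewrite ext_sub ext_mul; exact: bh.
  have := le_trans (char_le x _) H; rewrite rmorphB rmorphM /=.
  have := ler_normcB (x (\prod_(j <- t) j)) (x u * x h).
  have : normc (x u * x h) <= normc (x u) * (1 + e).
    by rewrite normcM ler_wpM2l ?normc_ge0// (le_trans (char_le x h)).
  move: xu (normc_ge0 (x u)) e0; rewrite /e.
  move: (normc (x u)) (normc (x u * x h)) (normc (x (\prod_(j <- t) j))) (normc (_ - _)) => p q r v.
  by nra.
have [j jt xj] := norm_prod_lt1 xt.
by have [_] := tG j jt; apply.
Qed.
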